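(* Under the network model and the mean-field assumption described in the context, the network average age of information $\bar\Delta$ is given by $$\bar{\Delta} \;=\; \frac{1}{\xi} \;+\; \int_{0}^{1} \frac{F(dt)}{p\,t} \;-\; 1 \;\approx\; \frac{1}{\xi} \;+\; \int_{0}^{1} \frac{f(t)\,dt}{p\,t} \;-\; 1 ,$$ where $F$ is the cumulative distribution function of the conditional transmission success probability $\mu_0^\Phi$ of the typical link, given by the fixed-point equation recalled in the context, and $f$ is the Beta-type approximation of the corresponding probability density function, given by the recursion recalled in the context. (The integral may be unbounded under certain settings of the network parameters, due to the singularity at the origin.)
   Context: Parameters: spatial density $\lambda$; link distance $r$; path-loss exponent $\alpha$, and $\delta=2/\alpha$; transmit power $P_{\mathrm{tx}}$, noise power $\sigma^2$, $\rho=P_{\mathrm{tx}}/\sigma^2$; decoding threshold $\theta$; packet arrival probability $\xi\in(0,1]$; channel access probability $p\in(0,1)$. Spatial model. Transmitters form a homogeneous Poisson point process $\tilde\Phi=\{X_i\}$ in $\mathbb{R}^2$ of density $\lambda$; transmitter $X_i$ has a dedicated receiver $y_i$ at distance $r$ in a uniformly random direction; $\bar\Phi=\{y_i\}$, $\Phi=\tilde\Phi\cup\bar\Phi$. The topology is static. $\mathbb{E}^0$ denotes expectation under the Palm distribution, under which there is a typical link (index $0$) with receiver $y_0$ at the origin and transmitter $X_0$ at distance $r$; the other transmitters $X_j$, $j\neq0$, form a homogeneous Poisson process of density $\lambda$. Protocol. Time is slotted. At the beginning of each slot, each transmitter independently receives a new packet with probability $\xi$; the packet is stored in a unit-size buffer,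 replacing any undelivered older packet. In each slot, each transmitter with a non-empty buffer independently transmits with probability $p$. A transmission succeeds if the received SINR exceeds $\theta$; then the packet is delivered by the end of the same slot and removed from the buffer. Otherwise it stays in the buffer and is retransmitted in the next available slot unless replaced. With $\zeta_{j,t}\in\{0,1\}$ the indicator that the buffer of node $j$ is non-empty in slot $t$, $\nu_{j,t}\in\{0,1\}$ the channel-access indicator ($\mathbb{P}(\nu_{j,t}=1)=p$), and $H_{j0}$ fading coefficients that are i.i.d. exponential with mean $1$ over space and time, $$\mathrm{SINR}_{0,t}=\frac{P_{\mathrm{tx}}H_{00}r^{-\alpha}}{\sum_{j\neq0}P_{\mathrm{tx}}H_{j0}\zeta_{j,t}\nu_{j,t}\|X_j\|^{-\alpha}+\sigma^2},\qquad \mu_{0}^\Phi=\lim_{t\to\infty}\mathbb{P}(\mathrm{SINR}_{0,t}>\theta\mid\Phi),$$ and $\mu_j^\Phi$ is defined analogously for link $j$. Mean-field assumption. Each node experiences independent interferers over time, and hence the queues evolve independently of each other. Thus: conditioned on $\Phi$, transmissions over link $j$ succeed i.i.d. over time with probability $\mu_j^\Phi$; in steady state the nodes are active independently of one another; and $\{\mu_j^\Phi\}_{j\neq 0}$ are treated as i.i.d. across transmitters, independent of the locations, with the same distribution as $\mu_0^\Phi$. Age of information. $\Delta_0(t+1)=\Delta_0(t)+1$ if no packet is delivered on the typical link in slot $t$, and $\Delta_0(t+1)=t-G_0(t)+1$ otherwise, where $G_0(t)$ is the generation time of the packet delivered in slot $t$. The network average age of information (the spatial average over all links of their time-average age, equal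 by Campbell's theorem to the Palm expectation) is $$\bar\Delta=\mathbb{E}^0\Big[\limsup_{T\to\infty}\frac1T\sum_{t=1}^T\Delta_0(t)\Big].$$ Fixed-point equation for $F(u)=\mathbb{P}(\mu_0^\Phi<u)$ (with $\mathrm{i}=\sqrt{-1}$): $$F(u)=\frac12-\int_0^\infty \mathrm{Im}\Big\{u^{-\mathrm{i}\omega}\exp\Big(-\frac{\mathrm{i}\omega\theta r^\alpha}{\rho}-\lambda\pi r^2\theta^\delta\sum_{k=1}^\infty\binom{\mathrm{i}\omega}{k}\int_0^\infty\frac{(-1)^{k+1}dv}{(1+v^{\alpha/2})^k}\int_0^1\frac{(p\xi)^k\,F(dt)}{[\xi+(1-\xi)pt]^k}\Big)\Big\}\frac{d\omega}{\pi\omega}.$$ Approximate density $f$. The density of $\mu_0^\Phi$ is approximated by $$f(u)=\lim_{n\to\infty}f_n(u),\qquad f_n(u)=\frac{u^{\frac{\kappa_n(\beta_n+1)-1}{1-\kappa_n}}(1-u)^{\beta_n-1}}{B\big(\kappa_n\beta_n/(1-\kappa_n),\,\beta_n\big)},\qquad u\in(0,1),\ n\ge1,$$ where $B(\cdot,\cdot)$ is the Beta function and $$\kappa_n=c_n^{(1)},\qquad \beta_n=\frac{(1-\kappa_n)\big[\kappa_n-c_n^{(2)}\big]}{c_n^{(2)}-\kappa_n^2},\qquad c_n^{(m)}=\exp\Big(-\frac{m\theta r^\alpha}{\rho}-\lambda\pi r^2\theta^\delta\sum_{k=1}^m\binom{m}{k}\eta_{n-1}^{(k)}\Big),$$ with,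 for $n\ge1$, $$\eta_n^{(k)}=\int_0^\infty\frac{(-1)^{k+1}dv}{(1+v^{\alpha/2})^k}\int_0^1\frac{(p\xi)^k f_n(t)\,dt}{[\xi+(1-\xi)pt]^k},$$ and the initial value $$\eta_0^{(k)}=\binom{\delta-1}{k-1}\frac{2\pi\,\xi^kp^k}{\alpha\sin(\pi\delta)}.$$ *)

(* Defs.v *)
From HB Require Import structures.
From mathcomp Require Import all_boot all_order all_algebra.
From mathcomp Require Import all_classical all_reals all_analysis.
From mathcomp.real_closed Require Import complex.

Set Implicit Arguments.
Unset Strict Implicit.
Unset Printing Implicit Defensive.

Import Order.TTheory GRing.Theory Num.Theory.
Import numFieldNormedType.Exports.
Local Open Scope classical_set_scope.
Local Open Scope ring_scope.

Definition mutually_independent d (T : measurableType d) (R : realType)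
    (P : set T -> \bar R) (I : Type) (D : set I) (E : I -> set (set T)) : Prop :=
  forall (m : nat) (i : 'I_m -> I) (A : 'I_m -> set T),
    injective i -> (forall k, D (i k)) -> (forall k, E (i k) (A k)) ->
    P (\bigcap_k A k) = (\prod_(k < m) P (A k))%E.

Definition sigma_of d (T : measurableType d) d' (U : measurableType d')
    (Y : T -> U) : set (set T) :=
  preimage_set_system setT Y measurable.

Definition sigma_of_seq d (T : measurableType d) d' (U : measurableType d')
    (Y : nat -> T -> U) : set (set T) :=
  <<s \bigcup_j sigma_of (Y j) >>.

(* Library norms on a product are sup norms, so the Euclidean one is spelled
   out. *)
Notation plane R := (measurableTypeR R * measurableTypeR R)%type.

Definition euclidean_norm (R : realType) (x : plane R) : R :=
  Num.sqrt ((x.1 : R) ^+ 2 + (x.2 : R) ^+ 2).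

Definition area (R : realType) : set (plane R) -> \bar R :=
  (@lebesgue_measure R \x @lebesgue_measure R)%E.

Definition number_of_points (R : realType) (T : Type) (Y : nat -> T -> plane R)
    (A : set (plane R)) (e : T) : \bar R :=
  (\sum_(0 <= j <oo) (\1_A (Y j e) : R)%:E)%E.

(* The library's [poisson_pmf] is 1 at rate 0, hence unusable for null sets. *)
Definition poisson_mass (R : realType) (rate : R) (n : nat) : R :=
  expR (- rate) * rate ^+ n / n`!%:R.

(* [Y] enumerates a homogeneous Poisson point process of density [lam]: counts
   in disjoint sets of finite area are independent Poisson variables. *)
Definition poisson_point_process d (T : measurableType d) (R : realType)
    (P : set T -> \bar R) (lam : R) (Y : nat -> T -> plane R) : Prop :=
  forall (m : nat) (A : 'I_m -> set (plane R)) (n : 'I_m -> nat),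
    (forall k, measurable (A k)) -> (forall k, (area (A k) < +oo)%E) ->
    trivIset setT A ->
    P (\bigcap_k [set e | number_of_points Y (A k) e = ((n k)%:R : R)%:E]) =
    (\prod_(k < m) (poisson_mass (lam * fine (area (A k))) (n k))%:E)%E.

Record params (R : realType) := Params {
  density : R;
  link_dist : R;
  pathloss : R;
  tx_power : R;
  noise : R;
  threshold : R;
  arrival : R;
  access : R }.

(* [2 < pathloss] is what makes the interference finite and the integrals over
   the plane convergent. *)
Definition admissible (R : realType) (N : params R) : Prop :=
  [/\ [/\ 0 < density N, 0 < link_dist N & 2 < pathloss N],
      [/\ 0 < tx_power N, 0 < noise N & 0 < threshold N],
      0 < arrival N <= 1 & 0 < access N < 1].

Definition delta (R : realType) (N : params R) : R := 2 / pathloss N.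
Definition rho (R : realType) (N : params R) : R := tx_power N / noise N.

(** A link: sample-path dynamics driven by the sequences [b] (arrivals),
   [a] (channel accesses) and [s] (outcomes of transmission attempts). *)

(* Generation time of the packet in the buffer during slot [t], after the
   possible arrival at the beginning of that slot; slots start at 0. *)
Fixpoint buffer (b a s : nat -> bool) (t : nat) : option nat :=
  match t with
  | 0 => if b 0%N then Some 0%N else None
  | t'.+1 => if b t'.+1 then Some t'.+1
             else if a t' && s t' then None else buffer b a s t'
  end.

Definition nonempty (b a s : nat -> bool) (t : nat) : bool :=
  isSome (buffer b a s t).

(* Generation time of the packet delivered in slot [t], if any. *)
Definition delivered (b a s : nat -> bool) (t : nat) : option nat :=
  if a t && s t then buffer b a s t else None.

Fixpoint age (b a s : nat -> bool) (age0 : nat) (t : nat) : nat :=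
  match t with
  | 0 => age0
  | t'.+1 => if delivered b a s t' is Some g then (t' - g + 1)%N
             else (age b a s age0 t' + 1)%N
  end.

(** The network.  [E] carries the (static) environment, distributed under the
   Palm probability; the protocol runs on [W], whose law given the environment
   is a probability kernel.  Link 0 is the typical link. *)

Record network (R : realType) de (E : measurableType de)
    dw (W : measurableType dw) := Network {
  tx : nat -> {mfun E >-> plane R};
  angle : nat -> {mfun E >-> R};
  mu : nat -> {mfun E >-> R};               (* conditional success probability *)
  arr : nat -> nat -> {mfun W >-> bool};    (* link, slot *)
  acc : nat -> nat -> {mfun W >-> bool};
  suc : nat -> nat -> {mfun W >-> bool};
  fad : nat -> nat -> {mfun W >-> R} }.     (* from transmitter j to receiver 0 *)

Section network.
Context (R : realType) de (E : measurableType de) dw (W : measurableType dw).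
Variables (N : params R) (P0 : probability E R) (Q : R.-pker E ~> W).
Variable (net : network R E W).

Definition receiver (j : nat) (e : E) : plane R :=
  (((tx net j e).1 : R) + link_dist N * cos (angle net j e),
   ((tx net j e).2 : R) + link_dist N * sin (angle net j e)).

Definition zeta (j t : nat) (w : W) : bool :=
  nonempty ((arr net j)^~ w) ((acc net j)^~ w) ((suc net j)^~ w) t.

Definition interference (e : E) (t : nat) (w : W) : \bar R :=
  (\sum_(1 <= j <oo)
    (tx_power N * fad net j t w * (zeta j t w)%:R * (acc net j t w)%:R
     * euclidean_norm (tx net j e) `^ (- pathloss N))%:E)%E.

Definition SINR (e : E) (t : nat) (w : W) : \bar R :=
  ((tx_power N * fad net 0 t w * link_dist N `^ (- pathloss N))%:E
   / (interference e t w + (noise N)%:E))%E.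

Definition typical_age (age0 t : nat) (w : W) : nat :=
  age ((arr net 0)^~ w) ((acc net 0)^~ w) ((suc net 0)^~ w) age0 t.

Definition average_age (age0 : nat) : \bar R :=
  (\int[P0]_e \int[Q e]_w
     limn_esup (fun T : nat =>
       (T.+1%:R^-1 * \sum_(1 <= t < T.+2) (typical_age age0 t w)%:R : R)%:E))%E.

Inductive env_index := Points | Angle of nat | Mark of nat.

Definition env_events (i : env_index) : set (set E) :=
  match i with
  | Points => sigma_of_seq (fun j => tx net j.+1)
  | Angle j => sigma_of (angle net j)
  | Mark j => sigma_of (mu net j)
  end.

Definition palm_model : Prop :=
  [/\ poisson_point_process P0 (density N) (fun j => tx net j.+1),
      (forall j (A : set R), measurable A ->
         P0 (angle net j @^-1` A) =
         (\int[lebesgue_measure]_(x in A) (uniform_pdf 0 (2 * pi) x)%:E)%E),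
      (forall e, receiver 0 e = (0, 0)) &
      mutually_independent P0 [set i | if i is Mark _ then False else True]
        env_events].

Inductive run_index :=
  Arr of nat & nat | Acc of nat & nat | Suc of nat & nat | Fad of nat & nat.

Definition run_events (i : run_index) : set (set W) :=
  match i with
  | Arr j t => sigma_of (arr net j t)
  | Acc j t => sigma_of (acc net j t)
  | Suc j t => sigma_of (suc net j t)
  | Fad j t => sigma_of (fad net j t)
  end.

Definition protocol : Prop :=
  forall e,
  [/\ (forall j t, Q e [set w | arr net j t w] = (arrival N)%:E),
      (forall j t, Q e [set w | acc net j t w] = (access N)%:E),
      (forall j t (A : set R), measurable A ->
         Q e (fad net j t @^-1` A) = exponential_prob 1 A) &
      mutually_independent (Q e) [set i | if i is Suc _ _ then False else True]
        run_events].

(* The typical link's attempts [suc net 0] are only tied to its SINR through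
   [mu net 0], so the last clause leaves their joint law with the fading
   free. *)
Definition mean_field : Prop :=
  [/\ {ae P0, forall e,
        Q e [set w | ((threshold N)%:E < SINR e t w)%E] @[t --> \oo]
          --> (mu net 0 e)%:E},
      (forall j (A : set R), measurable A ->
         P0 (mu net j @^-1` A) = P0 (mu net 0 @^-1` A)),
      mutually_independent P0 [set i | if i is Mark 0 then False else True]
        env_events,
      (forall e j t, Q e [set w | suc net j t w] = (mu net j e)%:E) &
      (forall e,
         mutually_independent (Q e)
           [set i | if i is Fad _ _ then False else True] run_events /\
         mutually_independent (Q e)
           [set i | if i is Suc 0 _ then False else True] run_events)].

(* The measure F(dt) attached to [F] is [law_mu]. *)
Definition F (u : R) : R := fine (P0 [set e | mu net 0 e < u]).

Definition law_mu : probability R R :=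
  distribution P0 (mu net 0).

End network.

Definition cexp (R : realType) (z : R[i]) : R[i] :=
  Complex (expR (complex.Re z) * cos (complex.Im z))
          (expR (complex.Re z) * sin (complex.Im z)).

(* Meaningful for u > 0. *)
Definition cpow (R : realType) (u : R) (z : R[i]) : R[i] :=
  cexp (z * Complex (ln u) 0).

(* The sum starts at k = 1. *)
Definition cseries (R : realType) (u : nat -> R[i]) : R[i] :=
  Complex (limn (fun n => \sum_(1 <= k < n) complex.Re (u k)))
          (limn (fun n => \sum_(1 <= k < n) complex.Im (u k))).

Definition gbinom (K : fieldType) (z : K) (k : nat) : K :=
  (\prod_(i < k) (z - i%:R)) / k`!%:R.

Section formulas.
Context (R : realType).
Variable N : params R.

Definition noise_term : R :=
  threshold N * link_dist N `^ pathloss N / rho N.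

Definition spatial_const : R :=
  density N * pi * link_dist N ^+ 2 * threshold N `^ delta N.

Definition activity (k : nat) (t : R) : R :=
  (access N * arrival N) ^+ k
  / (arrival N + (1 - arrival N) * access N * t) ^+ k.

(* [J] stands for the inner integral over t. *)
Definition outer_integral (k : nat) (J : R) : R :=
  \int[@lebesgue_measure R]_(v in `[0, +oo[)
    ((-1) ^+ k.+1 / (1 + v `^ (pathloss N / 2)) ^+ k * J).

Definition fixed_point_rhs (nu : probability R R)
    (u : R) : R :=
  2^-1 - \int[@lebesgue_measure R]_(x in `]0, +oo[)
    (complex.Im (cpow u (Complex 0 (- x)) *
         cexp (- (Complex 0 (x * noise_term))
               - Complex spatial_const 0 *
                 cseries (fun k =>
                   gbinom (Complex 0 x) k *
                   Complex (outer_integral k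
                     (\int[nu]_(t in `[0, 1]) activity k t)) 0)))
     / (pi * x)).

(* The library's [beta_fun] only has natural-number arguments. *)
Definition Beta (a b : R) : R :=
  \int[@lebesgue_measure R]_(x in `]0, 1[)
    (x `^ (a - 1) * (1 - x) `^ (b - 1)).

Definition c_of (eta : nat -> R) (m : nat) : R :=
  expR (- (m%:R * noise_term)
        - spatial_const * \sum_(1 <= k < m.+1) 'C(m, k)%:R * eta k).

Definition beta_of (eta : nat -> R) : R :=
  let kappa := c_of eta 1 in let c2 := c_of eta 2 in
  (1 - kappa) * (kappa - c2) / (c2 - kappa ^+ 2).

Definition f_of (eta : nat -> R) (u : R) : R :=
  let kappa := c_of eta 1 in let beta := beta_of eta in
  u `^ ((kappa * (beta + 1) - 1) / (1 - kappa)) * (1 - u) `^ (beta - 1)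
  / Beta (kappa * beta / (1 - kappa)) beta.

Fixpoint eta (n : nat) : nat -> R :=
  match n with
  | 0 => fun k => gbinom (delta N - 1) k.-1 *
           (2 * pi * arrival N ^+ k * access N ^+ k
            / (pathloss N * sin (pi * delta N)))
  | n'.+1 => fun k => outer_integral k
      (\int[@lebesgue_measure R]_(t in `]0, 1[)
         (activity k t * f_of (eta n') t))
  end.

(* Meaningful for n >= 1. *)
Definition f_seq (n : nat) : R -> R := f_of (eta n.-1).

End formulas.

(* Main.v *)
Require Import Defs.
From HB Require Import structures.
From mathcomp Require Import all_boot all_order all_algebra.
From mathcomp Require Import all_classical all_reals all_analysis.
From mathcomp Require Import measurable_realfun.
From mathcomp Require Import ring lra.
From mathcomp.real_closed Require Import complex.

Set Implicit Arguments.
Unset Strict Implicit.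
Unset Printing Implicit Defensive.

Import Order.TTheory GRing.Theory Num.Theory.
Import numFieldNormedType.Exports.
Local Open Scope classical_set_scope.
Local Open Scope ring_scope.

(** Along one link the age obeys a random recursion driven by arrivals and
    deliveries; summing it expresses the time average through bounded-in-L2
    martingales, so a strong law (Borel-Cantelli along squares) gives
    1/xi + 1/(p mu) - 1 for a link of success probability mu, and integrating
    over the environment gives the first formula.

    For the law of mu_0, averaging the fading turns the success probability
    into exp(-noise) times the product over interferers of
    1 - a(mu_j) h(X_j), with h = s / (1 + s) for the normalised path gain s and
    a(mu_j) the steady-state probability that interferer j transmits.  Hence
    ln mu_0 is a shot-noise sum over a marked Poisson process: the mark is
    integrated out, the generating functional of the Poisson process gives the
    characteristic function of ln mu_0, polar coordinates reduce the integral
    over the plane to one over the half-line, and the binomial series of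
    (1 - a h)^(i w) gives the series of the fixed-point equation.  The
    characteristic function decays like exp(-c w^delta), so Gil-Pelaez
    inversion yields the distribution function. *)

(** * Independence *)

(** The joint law of the attempts of link 0 and the fading is left unspecified, so two independent
    families are used: one without fading for the age of link 0, one without [Suc 0] for its SINR;
    they meet only through [mu net 0]. Every other mark has the law of mu_0, so the characteristic
    function of ln mu_0 is expressed through that very law, whence a fixed-point equation. Three
    facts carry the analysis. The total gain has finite mean: this makes mu_0 positive and ln mu_0
    integrable, and it allows the limits over slots and over interferers to be exchanged, since
    occupancies converge geometrically, uniformly in the link. The duty cycle is at most
    [access N < 1]: logarithms are then Lipschitz in the gain, and the binomial series converges
    uniformly with an error proportional to the gain, hence integrable. The decay of the
    characteristic function makes the inversion integral absolutely convergent and excludes atoms,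
    so no half-jump corrects the value of F at u. A link with mu = 0 fits the first formula because
    its average age is +oo and so is the inverse of 0. *)

Section pi_lambda.
Context d (T : measurableType d) (R : realType) (P : probability T R).
Local Open Scope ereal_scope.

(** For a fixed [B], the events satisfying the product formula with [B] form a Dynkin system; it
    contains the pi-system [G], hence the sigma-algebra generated by [G]. *)
Lemma indep_generated (G : set (set T)) (B : set T) :
  setI_closed G -> G `<=` measurable -> measurable B ->
  (forall A, G A -> P (A `&` B) = P A * P B) ->
  forall A, <<s G >> A -> P (A `&` B) = P A * P B.
Proof.
move=> GI Gm mB GB A; rewrite -(setI_closed_g_dynkin_g_sigma_algebra GI).
have finP (X : set T) : measurable X -> P X \is a fin_num.
  by move=> ?; exact: fin_num_measure.
suff : <<d G >> `<=` [set X | measurable X /\ P (X `&` B) = P X * P B].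
  by move=> /[apply] -[].
apply: smallest_sub; last by move=> X GX; split; [exact: Gm|exact: GB].
split.
- by split => //; rewrite setTI probability_setT mul1e.
- move=> X [mX XB]; split; first exact: measurableC.
  rewrite setIC -setDE measureD//; last by rewrite -ge0_fin_numE// finP.
  rewrite (setIC B) [X in _ - X]XB probability_setC// muleBl ?mul1e// ?fin_num_adde_defr//.
  exact: finP.
- move=> X tX XP; have mX k : measurable (X k) by have [] := XP k.
  split; first exact: bigcupT_measurable.
  rewrite setI_bigcupl measure_bigcup//=; last 2 first.
  + by move=> k _; exact: measurableI.
  + exact: trivIset_setIr.
  rewrite measure_bigcup//= muleC -[P B]fineK ?finP// -nneseriesZl//.
  by apply: eq_eseriesr => k _; rewrite fineK ?finP// muleC; have [] := XP k.
Qed.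

(** The one-sided extension is nested: each event of [G] is extended against [H], and the result is
    then extended on the side of [G]. *)
Lemma indep_generated2 (G H : set (set T)) :
  setI_closed G -> G `<=` measurable -> setI_closed H -> H `<=` measurable ->
  (forall A B, G A -> H B -> P (A `&` B) = P A * P B) ->
  forall A B, <<s G >> A -> <<s H >> B -> P (A `&` B) = P A * P B.
Proof.
move=> GI Gm HI Hm GH A B GA HB.
have mB : measurable B.
  by apply: HB; split => //; exact: sigma_algebra_measurable.
apply: (indep_generated GI Gm mB _ GA) => X GX.
rewrite setIC muleC; apply: (indep_generated HI Hm (Gm _ GX) _ HB) => Y HY.
by rewrite setIC muleC; exact: GH.
Qed.

Section groups.
Context (I : Type) (D : set I) (F : I -> set (set T)).
Hypothesis indF : mutually_independent P D F.
Hypothesis FI : forall i, D i -> setI_closed (F i).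
Hypothesis FT : forall i, D i -> F i setT.
Hypothesis Fm : forall i, D i -> F i `<=` measurable.

(** A classical decidable equality on the arbitrary index type gives a meaning to duplicate-free
    sequences of indices. *)
Let cI := {classic I}.

(** The cylinders of a group of indices form a pi-system that generates the sigma-algebra of the
    group, and on which independence is a finite product formula. *)
Definition cylinder (D1 : set I) (X : set T) : Prop :=
  exists (s : seq cI) (A : cI -> set T),
    [/\ uniq s, (forall i, i \in s -> D1 i), (forall i, i \in s -> F i (A i)) &
        X = \big[setI/setT]_(i <- s) A i].

Lemma indep_seq (s : seq cI) (A : cI -> set T) :
  uniq s -> (forall i, i \in s -> D i) -> (forall i, i \in s -> F i (A i)) ->
  P (\big[setI/setT]_(i <- s) A i) = \prod_(i <- s) P (A i).
Proof.
move=> us sD sF.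
have := indF (m := size s) (i := tnth (in_tuple s)) (A := fun k => A (tnth (in_tuple s) k)).
rewrite !(big_tnth _ _ s) => <-.
- by congr (P _); apply/seteqP; split=> x; rewrite -bigcap_seq/=; [move=> h k _|move=> h k _]; apply: h => //=; rewrite mem_index_enum.
- have /tuple_uniqP := (us : uniq (in_tuple s)); exact.
- by move=> k; apply: sD; exact: mem_tnth.
- by move=> k; apply: sF; exact: mem_tnth.
Qed.

Section two_groups.
Variables (D1 D2 : set I).
Hypothesis (D1D : D1 `<=` D) (D2D : D2 `<=` D) (D12 : D1 `&` D2 = set0).

(** The two index sequences are merged. An index absent from one of them contributes [setT] there,
    and a common index contributes the intersection of its two events. *)
Lemma cylinder_setI (D' : set I) : D' `<=` D -> setI_closed (cylinder D').
Proof.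
move=> D'D X Y [s [A [us sD sF ->]]] [t [B [ut tD tF ->]]].
exists (undup (s ++ t)).
exists (fun i => (if i \in s then A i else setT) `&` (if i \in t then B i else setT)).
have memD i : i \in undup (s ++ t) -> D' i.
  by rewrite mem_undup mem_cat => /orP[]; [exact: sD|exact: tD].
split => //; first exact: undup_uniq.
- move=> i ist; have Di := D'D _ (memD _ ist).
  apply: (FI Di); case: ifPn => // *; try exact: FT; [exact: sF|exact: tF].
- apply/seteqP; split => x.
  + rewrite -!bigcap_seq => -[xA xB] i _ /=; split; case: ifPn => // it.
      exact: xA.
    exact: xB.
  + rewrite -!bigcap_seq => xAB; split => i /= it.
      have /= := xAB i; rewrite mem_undup mem_cat it/= => /(_ isT)[]//.
    have /= := xAB i; rewrite mem_undup mem_cat it orbT/= => /(_ isT)[]//.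
Qed.

Lemma cylinder_measurable (D' : set I) : D' `<=` D ->
  cylinder D' `<=` measurable.
Proof.
move=> D'D X [s [A [us sD sF ->]]]; rewrite big_seq.
by apply: bigsetI_measurable => i si; exact: (Fm (D'D _ (sD _ si)) (sF _ si)).
Qed.

Lemma sub_cylinder (D' : set I) :
  <<s \bigcup_(i in D') F i >> `<=` <<s cylinder D' >>.
Proof.
apply: smallest_sub; first exact: smallest_sigma_algebra.
move=> A [i D'i FA]; apply: sub_sigma_algebra.
exists [:: i], (fun=> A); split => //.
- by move=> j; rewrite inE => /eqP ->.
- by move=> j; rewrite inE => /eqP ->.
- by rewrite big_seq1.
Qed.

(** On cylinders both sides are finite products: since the groups are disjoint, the concatenated
    index sequence is still duplicate-free. The pi-lambda argument extends this to the generated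
    sigma-algebras. *)
Lemma indep_groups (X Y : set T) :
  <<s \bigcup_(i in D1) F i >> X -> <<s \bigcup_(i in D2) F i >> Y ->
  P (X `&` Y) = P X * P Y.
Proof.
move=> /sub_cylinder D1X /sub_cylinder D2Y.
apply: (indep_generated2 (cylinder_setI D1D) (cylinder_measurable D1D)
  (cylinder_setI D2D) (cylinder_measurable D2D) _ D1X D2Y).
move=> _ _ [s [A [us sD sF ->]]] [t [B [ut tD tF ->]]].
have st i : i \in s -> i \in t -> False.
  by move=> /sD Di1 /tD Di2; have : (D1 `&` D2) i by []; rewrite D12.
have tNs i : i \in t -> (i \in s) = false.
  by move=> it; apply/negP => /st; exact.
(* A single family of events serves both sequences, so that independence applies to their
   concatenation. *)
pose C i := if i \in s then A i else B i.
have -> : \big[setI/setT]_(i <- s) A i = \big[setI/setT]_(i <- s) C i.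
  by rewrite !big_seq; apply: eq_bigr => i; rewrite /C => ->.
have -> : \big[setI/setT]_(i <- t) B i = \big[setI/setT]_(i <- t) C i.
  by rewrite !big_seq; apply: eq_bigr => i; rewrite /C => /tNs ->.
rewrite -big_cat/= !indep_seq//=.
- by rewrite big_cat.
- by move=> i it; exact/D2D/tD.
- by move=> i it; rewrite /C tNs//; exact: tF.
- by move=> i it; exact/D1D/sD.
- by move=> i it; rewrite /C it; exact: sF.
- rewrite cat_uniq us ut andbT /=; apply/hasPn => i it /=.
  by apply/negP => /st; exact.
- by move=> i; rewrite mem_cat => /orP[/sD/D1D|/tD/D2D].
- move=> i; rewrite mem_cat /C; case: ifPn => [it _|_ /=]; first exact: sF.
  exact: tF.
Qed.

End two_groups.
End groups.
End pi_lambda.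

Section joint_law.
Context d1 d2 d (U1 : measurableType d1) (U2 : measurableType d2)
  (T : measurableType d) (R : realType) (P : probability T R).
Variables (X : T -> U1) (Y : T -> U2).
Hypothesis mX : measurable_fun setT X.
Hypothesis mY : measurable_fun setT Y.
Hypothesis XY : forall A B, measurable A -> measurable B ->
  P (X @^-1` A `&` Y @^-1` B) = (P (X @^-1` A) * P (Y @^-1` B))%E.

Let X' : {mfun T >-> U1} := HB.pack X (isMeasurableFun.Build _ _ _ _ _ mX).
Let Y' : {mfun T >-> U2} := HB.pack Y (isMeasurableFun.Build _ _ _ _ _ mY).

Let mXY : measurable_fun setT (fun w => (X w, Y w)).
Proof. exact: measurable_fun_pair. Qed.

Let XY' : {mfun T >-> (U1 * U2)%type} :=
  HB.pack (fun w => (X w, Y w)) (isMeasurableFun.Build _ _ _ _ _ mXY).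

(** The product formula on rectangles identifies the joint law with the product of the marginal
    laws; Tonelli's theorem concludes. *)
Lemma indep_integral (f : U1 * U2 -> \bar R) :
  measurable_fun setT f -> (forall z, 0 <= f z)%E ->
  (\int[P]_w f (X w, Y w) = \int[P]_v \int[P]_w f (X v, Y w))%E.
Proof.
move=> mf f0.
have law A : measurable A ->
    (distribution P X' \x distribution P Y')%E A = distribution P XY' A.
  by apply: product_measure_unique => A' B' mA' mB'; rewrite -XY.
transitivity (\int[distribution P XY']_z f z)%E.
  by rewrite ge0_integral_distribution.
rewrite -(eq_measure_integral _ (fun A mA _ => law A mA)).
rewrite fubini_tonelli1// ge0_integral_distribution//; last 2 first.
- exact: measurable_fun_fubini_tonelli_F.
- by move=> x; exact: integral_ge0.
apply: eq_integral => v _; rewrite /fubini_F /= ge0_integral_distribution//=.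
by apply: measurableT_comp.
Qed.

Lemma indep_integral_measurable (f : U1 * U2 -> \bar R) :
  measurable_fun setT f -> (forall z, 0 <= f z)%E ->
  measurable_fun setT (fun v => \int[P]_w f (X v, Y w))%E.
Proof.
move=> mf f0.
have -> : (fun v => \int[P]_w f (X v, Y w))%E =
    fubini_F (distribution P Y') f \o X.
  apply/funext => v; rewrite /fubini_F /= ge0_integral_distribution//=.
  by apply: measurableT_comp.
apply: measurableT_comp mX.
exact: measurable_fun_fubini_tonelli_F.
Qed.

End joint_law.

(** Such functions are integrable under every probability and stable under algebraic operations, so
    linearity of the real-valued integral costs no integrability argument. *)
Definition bounded_measurable d (T : measurableType d) (R : realType)
    (f : T -> R) : Prop :=
  measurable_fun setT f /\ exists M : R, forall x, `|f x| <= M.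

Section bounded_measurable.
Context d (T : measurableType d) (R : realType).
Implicit Types f g : T -> R.

Lemma bmcst (a : R) : bounded_measurable (fun=> a : R) (T := T).
Proof. by split; [exact: measurable_cst|exists `|a|]. Qed.

Lemma bmN f : bounded_measurable f -> bounded_measurable (fun x => - f x).
Proof.
move=> [mf [M fM]]; split; first exact: measurable_funN.
by exists M => x; rewrite normrN.
Qed.

Lemma bmD f g : bounded_measurable f -> bounded_measurable g ->
  bounded_measurable (fun x => f x + g x).
Proof.
move=> [mf [M fM]] [mg [L gL]]; split; first exact: measurable_funD.
by exists (M + L) => x; rewrite (le_trans (ler_normD _ _))// lerD.
Qed.

Lemma bmB f g : bounded_measurable f -> bounded_measurable g ->
  bounded_measurable (fun x => f x - g x).
Proof. by move=> bf bg; apply: bmD => //; exact: bmN. Qed.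

Lemma bmM f g : bounded_measurable f -> bounded_measurable g ->
  bounded_measurable (fun x => f x * g x).
Proof.
move=> [mf [M fM]] [mg [L gL]]; split; first exact: measurable_funM.
by exists (M * L) => x; rewrite normrM ler_pM.
Qed.

Lemma bmZ (a : R) f : bounded_measurable f -> bounded_measurable (fun x => a * f x).
Proof. by move=> bf; apply: bmM => //; exact: bmcst. Qed.

Lemma bmX n f : bounded_measurable f -> bounded_measurable (fun x => f x ^+ n).
Proof.
move=> bf; elim: n => [|n IH]; first by under eq_fun do rewrite expr0; exact: bmcst.
by under eq_fun do rewrite exprS; exact: bmM.
Qed.

Lemma bm_sum n (f : nat -> T -> R) :
  (forall i, (i < n)%N -> bounded_measurable (f i)) ->
  bounded_measurable (fun x => \sum_(i < n) f i x).
Proof.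
elim: n => [|n IH] bf.
  by under eq_fun do rewrite big_ord0; exact: bmcst.
under eq_fun do rewrite big_ord_recr/=; apply: bmD; last exact: bf.
by apply: IH => i /ltnW; exact: bf.
Qed.

Variable P : probability T R.

Lemma bm_integrable f : bounded_measurable f -> P.-integrable setT (EFin \o f).
Proof.
move=> [mf [M fM]]; apply: measurable_bounded_integrable => //.
  exact: le_lt_trans (probability_le1 P measurableT) (ltry _).
by exists M; split; [exact: num_real|move=> L ML x _; exact: le_trans (fM x) (ltW ML)].
Qed.

Lemma bm_EFin f : bounded_measurable f ->
  (\int[P]_x f x)%:E = (\int[P]_x (f x)%:E)%E.
Proof.
move=> bf; rewrite /Rintegral fineK//.
by apply: integrable_fin_num => //; exact: bm_integrable.
Qed.

Lemma bm_intD f g : bounded_measurable f -> bounded_measurable g ->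
  \int[P]_x (f x + g x) = \int[P]_x f x + \int[P]_x g x.
Proof. by move=> bf bg; apply: RintegralD => //; exact: bm_integrable. Qed.

Lemma bm_intB f g : bounded_measurable f -> bounded_measurable g ->
  \int[P]_x (f x - g x) = \int[P]_x f x - \int[P]_x g x.
Proof. by move=> bf bg; apply: RintegralB => //; exact: bm_integrable. Qed.

Lemma bm_intZ (a : R) f : bounded_measurable f ->
  \int[P]_x (a * f x) = a * \int[P]_x f x.
Proof. by move=> bf; apply: RintegralZl => //; exact: bm_integrable. Qed.

Lemma bm_int_cst (a : R) : \int[P]_x a = a.
Proof. by rewrite Rintegral_cst//= probability_setT mulr1. Qed.

Lemma bm_int_le f g : bounded_measurable f -> bounded_measurable g ->
  (forall x, f x <= g x) -> \int[P]_x f x <= \int[P]_x g x.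
Proof. by move=> bf bg fg; apply: le_Rintegral => //; exact: bm_integrable. Qed.

Lemma bm_int_norm f (M : R) : bounded_measurable f -> (forall x, `|f x| <= M) ->
  `|\int[P]_x f x| <= M.
Proof.
move=> bf fM; rewrite ler_norml; apply/andP; split.
- apply: le_trans (bm_int_le (bmcst (- M)) bf _); first by rewrite bm_int_cst.
  by move=> x; have := fM x; rewrite ler_norml => /andP[].
- apply: le_trans (bm_int_le bf (bmcst M) _) _; last by rewrite bm_int_cst.
  by move=> x; have := fM x; rewrite ler_norml => /andP[].
Qed.

End bounded_measurable.

Section indep_bounded.
Context d1 d2 d (U1 : measurableType d1) (U2 : measurableType d2)
  (T : measurableType d) (R : realType) (P : probability T R).
Variables (X : T -> U1) (Y : T -> U2).
Hypothesis mX : measurable_fun setT X.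
Hypothesis mY : measurable_fun setT Y.
Hypothesis XY : forall A B, measurable A -> measurable B ->
  P (X @^-1` A `&` Y @^-1` B) = (P (X @^-1` A) * P (Y @^-1` B))%E.

Lemma bm_comp d' d'' (V : measurableType d') (V' : measurableType d'')
  (f : V' -> R) (Z : V -> V') :
  bounded_measurable f -> measurable_fun setT Z -> bounded_measurable (f \o Z).
Proof.
move=> [mf [M fM]] mZ; split; first exact: measurableT_comp.
by exists M => x /=.
Qed.

(** Adding the bound [M] makes [f] nonnegative, so the Tonelli version applies; under a probability
    the constant then cancels on both sides. *)
Lemma indep_Rintegral (f : U1 * U2 -> R) : bounded_measurable f ->
  bounded_measurable (fun v => \int[P]_w f (X v, Y w)) /\
  \int[P]_w f (X w, Y w) = \int[P]_v \int[P]_w f (X v, Y w).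
Proof.
move=> [mf [M fM]].
have bXY : bounded_measurable (fun w => f (X w, Y w)).
  by apply: (@bm_comp _ _ _ _ f (fun w => (X w, Y w))); [split => //; exists M|exact: measurable_fun_pair].
have bY v : bounded_measurable (fun w => f (X v, Y w)).
  apply: (@bm_comp _ _ _ _ f (fun w => (X v, Y w))); [split => //; exists M|].
    done.
  by apply: measurable_fun_pair => //; exact: measurable_cst.
have mfM : measurable_fun setT (fun z => (f z + M)%:E).
  by apply/measurable_EFinP; apply: measurable_funD.
have f0 z : (0 <= (f z + M)%:E)%E.
  by rewrite lee_fin -lerBlDr sub0r; have := fM z; rewrite ler_norml => /andP[].
have := indep_integral mX mY XY mfM f0.
have Yint v : (\int[P]_w (f (X v, Y w) + M)%:E = (\int[P]_w f (X v, Y w) + M)%:E)%E.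
  by rewrite -bm_EFin ?bm_intD ?bm_int_cst//; [exact: bmcst|apply: bmD => //; exact: bmcst].
under [in RHS]eq_integral do rewrite Yint.
have bmv : bounded_measurable (fun v => \int[P]_w f (X v, Y w)).
  split; last by exists M => v; apply: bm_int_norm.
  have := indep_integral_measurable P mX mY mfM f0.
  under eq_fun do rewrite Yint.
  move=> /measurable_EFinP h.
  have -> : (fun v => \int[P]_w f (X v, Y w)) =
      (fun v => \int[P]_w f (X v, Y w) + M) \- cst M.
    by apply/funext => v /=; rewrite addrK.
  by apply: measurable_funB => //; exact: measurable_cst.
move=> H; split => //; move: H.
rewrite -!bm_EFin; last 2 first.
- by apply: bmD => //; exact: bmcst.
- by apply: bmD => //; exact: bmcst.
move=> [] ; rewrite !bm_intD//; try exact: bmcst.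
by rewrite !bm_int_cst => /addIr.
Qed.

End indep_bounded.

Section sub_algebra.
Context d (T : measurableType d) (R : realType) (P : probability T R).

(** The identity, seen as a map to the same set with a coarser sigma-algebra, plays the role of a
    random variable generating that sigma-algebra. *)
Lemma measurable_sub_id (G : set (set T)) : G `<=` measurable ->
  measurable_fun setT (id : T -> g_sigma_algebraType G).
Proof.
move=> Gm _ A mA; rewrite setTI preimage_id.
by apply: mA; split => //; exact: sigma_algebra_measurable.
Qed.

Lemma bm_sub (G : set (set T)) (f : T -> R) : G `<=` measurable ->
  bounded_measurable (f : g_sigma_algebraType G -> R) -> bounded_measurable f.
Proof. by move=> Gm bf; exact: (bm_comp bf (measurable_sub_id Gm)). Qed.

Context (G1 G2 : set (set T)).
Hypothesis G1m : G1 `<=` measurable.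
Hypothesis G2m : G2 `<=` measurable.
Hypothesis G12 : forall A B, <<s G1 >> A -> <<s G2 >> B ->
  P (A `&` B) = (P A * P B)%E.

Let S1 := g_sigma_algebraType G1.
Let S2 := g_sigma_algebraType G2.

(** Both arguments of [f] live on the same space. With two identity maps as the independent pair,
    what the first group determines is frozen while the second group is integrated out. *)
Lemma indep_sub_Rintegral (f : S1 * S2 -> R) : bounded_measurable f ->
  bounded_measurable (fun v : T => \int[P]_w f (v, w)) /\
  \int[P]_w f (w, w) = \int[P]_v \int[P]_w f (v, w).
Proof.
move=> bf; apply: (indep_Rintegral (X := id : T -> S1) (Y := id : T -> S2) _ _ _ bf).
- exact: measurable_sub_id.
- exact: measurable_sub_id.
- by move=> A B mA mB; exact: G12.
Qed.

Lemma indep_RintegralM (f : S1 -> R) (g : S2 -> R) :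
  bounded_measurable f -> bounded_measurable g ->
  \int[P]_w (f w * g w) = \int[P]_w f w * \int[P]_w g w.
Proof.
move=> bf bg.
have bf1 : bounded_measurable (fun z : S1 * S2 => f z.1).
  by apply: (@bm_comp _ _ _ _ _ f fst).
have bg2 : bounded_measurable (fun z : S1 * S2 => g z.2).
  by apply: (@bm_comp _ _ _ _ _ g snd).
have [_ /= ->] := indep_sub_Rintegral (bmM bf1 bg2).
under eq_Rintegral => v _ do rewrite (bm_intZ P (f v) (bm_sub G2m bg)) mulrC.
by rewrite (bm_intZ P _ (bm_sub G1m bf)) mulrC.
Qed.

End sub_algebra.

(** * Time-average age of a link *)

Section series.
Context {R : realType}.

Lemma nneseries_lty_cvg0 (u : nat -> R) : (forall n, 0 <= u n) ->
  (\sum_(n <oo) (u n)%:E < +oo)%E -> u n @[n --> \oo] --> (0 : R).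
Proof.
move=> u0 ufin; apply: cvg_series_cvg_0; apply: nondecreasing_is_cvgn.
  by apply/nondecreasing_series => n _ _; exact: u0.
exists (fine (\sum_(n <oo) (u n)%:E)) => _ [N _ <-].
rewrite -lee_fin fineK; last first.
  by rewrite ge0_fin_numE// nneseries_ge0// => n _ _; rewrite lee_fin.
rewrite /series/= -sumEFin.
by apply: (@nneseries_lim_ge R (EFin \o u) xpredT 0 N) => n _ _; rewrite lee_fin.
Qed.

Lemma inv_sqr_series (K : R) : 0 <= K ->
  (\sum_(n <oo) (K / n.+1%:R ^+ 2)%:E <= (2 * K)%:E)%E.
Proof.
move=> K0; have u0 n : 0 <= K / n.+1%:R ^+ 2 by rewrite divr_ge0// exprn_ge0.
apply: lime_le; first by apply: is_cvg_nneseries => n _ _; rewrite lee_fin.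
near=> N; rewrite sumEFin lee_fin.
(* The induction needs this stronger bound: [1/(n+1)^2] is at most [2/((n+1)(n+2))], which
   telescopes. *)
suff h : \sum_(0 <= n < N) K / n.+1%:R ^+ 2 <= 2 * K * (1 - N.+1%:R^-1).
  by apply: (le_trans h); rewrite ler_piMr ?mulr_ge0// lerBlDr lerDl invr_ge0.
clear -K0; elim: N => [|N IH]; first by rewrite big_geq// invr1 subrr mulr0.
rewrite big_nat_recr//= (le_trans (lerD IH (lexx _)))//.
have a0 : 0 < N.+1%:R :> R by [].
rewrite -(@natr1 _ N.+1); move: a0 (ler0n R N) ; rewrite -natr1.
set n := (N%:R : R) => a0 n0.
rewrite -subr_ge0.
have -> : 2 * K * (1 - (n + 1 + 1)^-1) - (2 * K * (1 - (n + 1)^-1) + K / (n + 1) ^+ 2)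
  = K * n / ((n + 1) ^+ 2 * (n + 1 + 1)).
  by field; rewrite !gt_eqF//; lra.
by rewrite divr_ge0 ?mulr_ge0//; lra.
Unshelve. all: by end_near.
Qed.

End series.

(** * Strong law along squares from second moments of linear growth *)

Section L2_strong_law.
Context d (T : measurableType d) (R : realType) (P : probability T R).

(** The second moment of [X m / m] is at most [K / m], which is summable along squares. The series
    of the squared ratios thus has finite mean, is almost surely finite, and its terms tend to 0. *)
Lemma L2_cvg_squares (X : nat -> T -> R) (K : R) :
  (forall n, bounded_measurable (X n)) ->
  (forall n, (0 < n)%N -> \int[P]_w (X n w) ^+ 2 <= K * n%:R) ->
  {ae P, forall w, X (n.+1 ^ 2)%N w / (n.+1 ^ 2)%:R @[n --> \oo] --> (0 : R)}.
Proof.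
move=> bX XK.
pose Y n w := (X (n.+1 ^ 2)%N w / (n.+1 ^ 2)%:R) ^+ 2.
have bY n : bounded_measurable (Y n).
  by apply: bmX; apply: bmM => //; exact: bmcst.
have Y0 n w : 0 <= Y n w by rewrite exprn_even_ge0.
have K0 : 0 <= K.
  have := XK 1%N isT; rewrite mulr1; apply: le_trans.
  by apply: Rintegral_ge0 => w _; rewrite exprn_even_ge0.
have mY n : measurable_fun setT (fun w => (Y n w)%:E).
  by apply/measurable_EFinP; case: (bY n).
have EY n : \int[P]_w (Y n w) <= K / n.+1%:R ^+ 2.
  rewrite /Y; under eq_Rintegral do rewrite expr_div_n mulrC.
  rewrite bm_intZ; last by exact: bmX.
  rewrite mulrC ler_pdivrMr ?exprn_gt0 ?ltr0n ?expn_gt0//.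
  have := XK (n.+1 ^ 2)%N; rewrite expn_gt0/= => /(_ isT) /le_trans; apply.
  rewrite natrX le_eqVlt; apply/orP; left; apply/eqP.
  by field.
have int_sum : (\int[P]_w \sum_(n <oo) (Y n w)%:E <= (2 * K)%:E)%E.
  rewrite integral_nneseries//; last by move=> n w _; rewrite lee_fin.
  apply: le_trans (inv_sqr_series K0); apply: lee_nneseries => [n _ _|n _].
    by apply: integral_ge0 => w _; rewrite lee_fin.
  by rewrite -bm_EFin// lee_fin.
have intS : P.-integrable setT (fun w => \sum_(n <oo) (Y n w)%:E)%E.
  apply/integrableP; split.
    by apply: ge0_emeasurable_sum => //; move=> n w _ _; rewrite lee_fin.
  rewrite (eq_integral (fun w => \sum_(n <oo) (Y n w)%:E)%E).
    by rewrite (le_lt_trans int_sum)// ltry.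
  by move=> w _; rewrite gee0_abs// nneseries_ge0// => n _ _; rewrite lee_fin.
have := integrable_ae measurableT intS.
apply: filterS => w /(_ I); rewrite fin_numElt => /andP[_ Sw].
have Yw := nneseries_lty_cvg0 (Y0^~ w) Sw.
apply/cvgr0Pnorm_lt => e e0.
have e2 : 0 < e ^+ 2 by rewrite exprn_gt0.
move/cvgr0Pnorm_lt : Yw => /(_ _ e2); apply: filterS => n.
rewrite /Y ger0_norm// -(@real_normK _ (_ / _)) ?num_real//.
by rewrite ltr_pXn2r// nnegrE// ltW.
Qed.

(** The orthogonality hypothesis kills the cross term in the square of the next partial sum, so the
    second moments of the increments add up. *)
Lemma martingale_L2 (eps Z : nat -> T -> R) (K : R) :
  (forall t, bounded_measurable (eps t)) ->
  (forall t, bounded_measurable (Z t)) ->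
  (forall t w, `|eps t w| <= 1) ->
  (forall t, \int[P]_w (eps t w * (Z t w * \sum_(s < t) (eps s w * Z s w))) = 0) ->
  (forall t, \int[P]_w (Z t w) ^+ 2 <= K) ->
  forall t, \int[P]_w (\sum_(s < t) (eps s w * Z s w)) ^+ 2 <= K * t%:R.
Proof.
move=> be bZ e1 orth ZK; elim=> [|t IH].
  under eq_Rintegral do rewrite big_ord0 expr0n/=.
  by rewrite bm_int_cst mulr0.
set M := fun w => \sum_(s < t) (eps s w * Z s w).
have bM : bounded_measurable M by apply: (@bm_sum _ _ _ t (fun s w => eps s w * Z s w)) => s _; exact: bmM.
have -> : \int[P]_w (\sum_(s < t.+1) (eps s w * Z s w)) ^+ 2 =
  \int[P]_w (M w) ^+ 2 + \int[P]_w (2 * (eps t w * (Z t w * M w))) + \int[P]_w (eps t w * Z t w) ^+ 2.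
  rewrite -bm_intD; [|exact: bmX|by apply: bmZ; do 2 apply: bmM => //].
  rewrite -bm_intD; [|apply: bmD; [exact: bmX|by apply: bmZ; do 2 apply: bmM => //]|by apply: bmX; exact: bmM].
  apply: eq_Rintegral => w _; rewrite big_ord_recr/= -/(M w); ring.
rewrite bm_intZ; last by do 2 apply: bmM => //.
rewrite orth mulr0 addr0 -natr1 mulrDr mulr1 lerD//.
apply: le_trans (ZK t); apply: bm_int_le; [by apply: bmX; exact: bmM|exact: bmX|].
move=> w; rewrite exprMn ler_piMl ?exprn_even_ge0//.
by rewrite -real_normK ?num_real// exprn_ile1.
Qed.

End L2_strong_law.

Section cesaro_interpolation.
Context {R : realType}.

Lemma floor_sqrt (T : nat) : exists n, (n ^ 2 <= T < n.+1 ^ 2)%N.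
Proof.
elim: T => [|T [n /andP[n1 n2]]]; first by exists 0%N.
have [h|h] := ltnP T.+1 (n.+1 ^ 2)%N.
  by exists n; rewrite h andbT (leq_trans n1).
exists n.+1; rewrite h/=; apply: leq_ltn_trans n2 _.
by rewrite ltn_exp2r.
Qed.

(* A nondecreasing sequence is interpolated between consecutive squares. *)
Lemma cvg_squares (u : nat -> R) (D : R) :
  (forall n, 0 <= u n) -> {homo u : m n / (m <= n)%N >-> m <= n} ->
  u (n.+1 ^ 2)%N / (n.+1 ^ 2)%:R @[n --> \oo] --> D ->
  u n / n%:R @[n --> \oo] --> D.
Proof.
move=> u0 nd uD.
pose r (n : nat) : R := (n.+1 ^ 2)%:R / (n.+2 ^ 2)%:R.
have r1 : r n @[n --> \oo] --> (1 : R).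
  have -> : r = fun n => (1 - n.+2%:R^-1) ^+ 2.
    apply/funext => n; rewrite /r !natrX -expr_div_n; congr (_ ^+ 2).
    have n2 : n.+2%:R != 0 :> R by rewrite pnatr_eq0.
    by apply: (mulIf n2); rewrite divfK// mulrBl mul1r mulVf// -[n.+2%:R]natr1 addrK.
  rewrite -[X in _ --> X](expr1n _ 2) -[X in X ^+ 2]subr0.
  apply: (@cvg_comp _ _ _ (fun n => (1 : R) - n.+2%:R^-1) (fun x => x ^+ 2) _ (nbhs ((1 : R) - 0))).
    apply: cvgB; first exact: cvg_cst.
    have := @cvg_harmonic R; rewrite -(cvg_shiftn 1) /harmonic /=.
    by under eq_fun do rewrite addn1.
  exact: exprn_continuous.
have lo : u (n.+1 ^ 2)%N / (n.+2 ^ 2)%:R @[n --> \oo] --> D.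
  rewrite -[D]mulr1; have -> : (fun n => u (n.+1 ^ 2)%N / (n.+2 ^ 2)%:R) =
     (fun n => u (n.+1 ^ 2)%N / (n.+1 ^ 2)%:R) \* r.
    by apply/funext => n /=; rewrite /r mulrA divfK.
  exact: cvgM.
have hi : u (n.+2 ^ 2)%N / (n.+1 ^ 2)%:R @[n --> \oo] --> D.
  rewrite -[D]mulr1 -[X in _ * X]invr1; have -> : (fun n => u (n.+2 ^ 2)%N / (n.+1 ^ 2)%:R) =
     (fun n => u (n.+2 ^ 2)%N / (n.+2 ^ 2)%:R) \* (fun n => (r n)^-1).
    by apply/funext => n /=; rewrite /r invf_div mulrA divfK.
  apply: cvgM; last exact: cvgV.
  move: uD; rewrite -(cvg_shiftn 1).
  by under eq_fun do rewrite addn1.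
apply/cvgrPdist_lt => e e0.
move/cvgrPdist_lt : lo => /(_ _ e0)[N1 _ loN].
move/cvgrPdist_lt : hi => /(_ _ e0)[N2 _ hiN].
exists ((maxn N1 N2).+1 ^ 2)%N => //= T NT.
have [[|n] /andP[nT Tn]] := floor_sqrt T.
  by have := leq_ltn_trans NT Tn; rewrite ltn_exp2r.
have Nn : (maxn N1 N2 <= n)%N.
  have := leq_ltn_trans NT Tn; rewrite ltn_exp2r// ltnS; exact.
have := loN n; rewrite /= (leq_trans (leq_maxl _ _) Nn) => /(_ isT).
have := hiN n; rewrite /= (leq_trans (leq_maxr _ _) Nn) => /(_ isT).
have T0 : (0 < T)%N by rewrite (leq_trans _ nT)// expn_gt0.
have h1 : u (n.+1 ^ 2)%N / (n.+2 ^ 2)%:R <= u T / T%:R.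
  apply: ler_pM => //; [exact: nd|].
  by rewrite lef_pV2 ?posrE ?ltr0n ?expn_gt0// ler_nat ltnW.
have h2 : u T / T%:R <= u (n.+2 ^ 2)%N / (n.+1 ^ 2)%:R.
  apply: ler_pM => //; [exact/nd/ltnW|].
  by rewrite lef_pV2 ?posrE ?ltr0n ?expn_gt0// ler_nat.
rewrite !ltr_distl => /andP[a1 a2] /andP[b1 b2].
apply/andP; split; first by apply: le_lt_trans a1; rewrite lerD2r.
by apply: (lt_le_trans b2); rewrite lerD2r.
Qed.

End cesaro_interpolation.

Lemma contraction_bounded (R : realType) (u : nat -> R) (r C : R) :
  0 <= r < 1 -> 0 <= C -> 0 <= u 0%N ->
  (forall t, u t.+1 <= r * u t + C) -> forall t, u t <= u 0%N + C / (1 - r).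
Proof.
move=> /andP[r0 r1] C0 u0 ur; have r1' : 0 < 1 - r by lra.
elim=> [|t IH]; first by rewrite lerDl divr_ge0// ltW.
apply: (le_trans (ur t)); apply: le_trans (_ : r * (u 0%N + C / (1 - r)) + C <= _).
  by rewrite lerD2r ler_wpM2l.
rewrite -subr_ge0.
have -> : u 0%N + C / (1 - r) - (r * (u 0%N + C / (1 - r)) + C) = (1 - r) * u 0%N.
  by field; lra.
by rewrite mulr_ge0// ltW.
Qed.

(** * Strong law for the age recursion *)

Section age_strong_law.
Context d (W : measurableType d) (R : realType) (P : probability W R).
(** [beta t] indicates an arrival at the beginning of slot [t], and [gamma t] an attempt in that
    slot that succeeds. [G t] is the information available just before this attempt, [K t] the
    information at the end of the slot. *)
Variables (beta gamma : nat -> W -> R) (G K : nat -> set (set W)) (q xi a0 : R).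
Hypotheses (q01 : 0 < q <= 1) (xi01 : 0 < xi <= 1) (a0_ge0 : 0 <= a0).
Hypothesis b01 : forall t w, beta t w = 0 \/ beta t w = 1.
Hypothesis c01 : forall t w, gamma t w = 0 \/ gamma t w = 1.
Hypothesis Gm : forall t, G t `<=` measurable.
Hypothesis Km : forall t, K t `<=` measurable.
Hypothesis bG : forall s t, (s <= t)%N ->
  measurable_fun (setT : set (g_sigma_algebraType (G t))) (beta s).
Hypothesis cG : forall s t, (s < t)%N ->
  measurable_fun (setT : set (g_sigma_algebraType (G t))) (gamma s).
Hypothesis bK : forall s t, (s <= t)%N ->
  measurable_fun (setT : set (g_sigma_algebraType (K t))) (beta s).
Hypothesis cK : forall s t, (s <= t)%N ->
  measurable_fun (setT : set (g_sigma_algebraType (K t))) (gamma s).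
Hypothesis gamma_indep : forall t (Z : g_sigma_algebraType (G t) -> R),
  bounded_measurable Z -> \int[P]_w (gamma t w * Z w) = q * \int[P]_w Z w.
Hypothesis beta_indep : forall t (Z : g_sigma_algebraType (K t) -> R),
  bounded_measurable Z -> \int[P]_w (beta t.+1 w * Z w) = xi * \int[P]_w Z w.

(** Age of the freshest packet generated so far, whether delivered or not. Before any arrival it
    starts from the initial age, so that it then coincides with the age at the receiver. *)
Fixpoint source_age t w := match t with
  | 0 => (1 - beta 0%N w) * a0
  | t'.+1 => (1 - beta t'.+1 w) * (source_age t' w + 1)
  end.

(** The buffer does not occur: with an empty buffer the freshest packet has already been delivered
    and both ages agree, so a fictitious delivery changes nothing. This makes the recursion affine
    in the ages, with coefficients independent of the past. *)
Fixpoint sink_age t w := match t with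
  | 0 => a0
  | t'.+1 => gamma t' w * (source_age t' w + 1) +
             (1 - gamma t' w) * (sink_age t' w + 1)
  end.

Lemma bm01 d' (V : measurableType d') (f : V -> R) :
  measurable_fun setT f -> (forall w, f w = 0 \/ f w = 1) ->
  bounded_measurable f.
Proof.
move=> mf f01; split => //; exists 1 => w.
by case: (f01 w) => ->; rewrite ?normr0// normr1.
Qed.

Lemma source_age_bm (H : set (set W)) t :
  (forall s, (s <= t)%N -> measurable_fun (setT : set (g_sigma_algebraType H)) (beta s)) ->
  bounded_measurable (source_age t : g_sigma_algebraType H -> R).
Proof.
elim: t => [|t IH] mb /=.
  apply: bmM; last exact: bmcst.
  by apply: bmB; [exact: bmcst|apply: bm01 => //; exact: mb].
apply: bmM; first by apply: bmB; [exact: bmcst|apply: bm01 => //; exact: mb].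
by apply: bmD; [apply: IH => s st; by apply: mb; exact: leqW|exact: bmcst].
Qed.

Lemma sink_age_bm (H : set (set W)) t :
  (forall s, (s < t)%N -> measurable_fun (setT : set (g_sigma_algebraType H)) (beta s)) ->
  (forall s, (s < t)%N -> measurable_fun (setT : set (g_sigma_algebraType H)) (gamma s)) ->
  bounded_measurable (sink_age t : g_sigma_algebraType H -> R).
Proof.
elim: t => [|t IH] mb mc /=; first exact: bmcst.
have bc : bounded_measurable (gamma t : g_sigma_algebraType H -> R).
  by apply: bm01 => //; exact: mc.
apply: bmD; apply: bmM => //.
- by apply: bmD; [apply: source_age_bm => s st; exact: mb|exact: bmcst].
- by apply: bmB => //; exact: bmcst.
- by apply: bmD; [apply: IH => s st; [by apply: mb; exact: leqW|by apply: mc; exact: leqW]|exact: bmcst].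
Qed.

Let source_bm t : bounded_measurable (source_age t).
Proof. by apply: (bm_sub (Gm (t := t))); apply: source_age_bm => s; exact: bG. Qed.

Let sink_bm t : bounded_measurable (sink_age t).
Proof.
by apply: (bm_sub (Gm (t := t))); apply: sink_age_bm => s st; [by apply: bG; exact: ltnW|exact: cG].
Qed.

Let b_bm t : bounded_measurable (beta t).
Proof.
by apply: (bm_sub (Gm (t := t))); apply: bm01 => //; exact: bG.
Qed.

Let c_bm t : bounded_measurable (gamma t).
Proof.
by apply: (bm_sub (Gm (t := t.+1))); apply: bm01 => //; exact: cG.
Qed.

Lemma source_age_ge0 t w : 0 <= source_age t w.
Proof.
have h s : 0 <= 1 - beta s w by case: (b01 s w) => ->; lra.
by elim: t => [|t IH] /=; rewrite mulr_ge0// addr_ge0.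
Qed.

Lemma sink_age_ge0 t w : 0 <= sink_age t w.
Proof.
have h s : 0 <= 1 - gamma s w by case: (c01 s w) => ->; lra.
have h' s : 0 <= gamma s w by case: (c01 s w) => ->; lra.
by elim: t => [|t IH] //=; rewrite addr_ge0// mulr_ge0// addr_ge0// source_age_ge0.
Qed.

(** Weighted Young inequality; the weight [e] lets the factor of the square stay as close to 1 as a
    contraction requires. *)
Lemma sqrD1_le (x e : R) : 0 < e -> (x + 1) ^+ 2 <= (1 + e) * x ^+ 2 + (1 + e^-1).
Proof.
move=> e0; rewrite -subr_ge0.
have -> : (1 + e) * x ^+ 2 + (1 + e^-1) - (x + 1) ^+ 2 = e^-1 * (e * x - 1) ^+ 2.
  by field; lra.
by rewrite mulr_ge0 ?sqr_ge0// invr_ge0 ltW.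
Qed.

Lemma square_recurrence (X : nat -> W -> R) (r C : R) : 0 <= r < 1 -> 0 <= C ->
  (forall t, bounded_measurable (X t)) ->
  (forall t, \int[P]_w X t.+1 w ^+ 2 <= r * \int[P]_w (X t w + 1) ^+ 2 + C) ->
  exists L, forall t, \int[P]_w X t w ^+ 2 <= L.
Proof.
move=> /andP[r0 r1] C0 bX XS.
(* With this weight [r * (1 + e) = 1 - (1 - r)^2], which is still less than 1. *)
pose e := 1 - r; have e0 : 0 < e by rewrite /e; lra.
eexists; apply: (@contraction_bounded _ _ (r * (1 + e)) (r * (1 + e^-1) + C)).
- rewrite mulr_ge0//=; last by rewrite /e; lra.
  by rewrite /e -subr_gt0 (_ : _ - _ = (1 - r) ^+ 2) ?exprn_gt0//; ring.
- by rewrite addr_ge0// mulr_ge0// addr_ge0// invr_ge0 ltW.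
- by apply: Rintegral_ge0 => w _; rewrite sqr_ge0.
move=> t; apply: le_trans (XS t) _; rewrite addrA lerD2r -mulrA -mulrDr ler_wpM2l//.
rewrite -bm_intZ; last exact: bmX.
rewrite -[X in _ + X](bm_int_cst P) -bm_intD; [|by apply: bmZ; exact: bmX|exact: bmcst].
apply: bm_int_le.
- by apply: bmX; apply: bmD => //; exact: bmcst.
- by apply: bmD; [apply: bmZ; exact: bmX|exact: bmcst].
- by move=> w; exact: sqrD1_le.
Qed.

(** As [1 - beta] is idempotent, squaring keeps the recursion linear; independence of the next
    arrival from the past replaces this factor by [1 - xi]. *)
Lemma source_age_L2 : exists L, forall t, \int[P]_w source_age t w ^+ 2 <= L.
Proof.
case/andP: xi01 => xi0 xi1.
apply: (@square_recurrence source_age (1 - xi) 0) => //; first by lra.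
move=> t /=; rewrite addr0 le_eqVlt; apply/orP; left; apply/eqP.
have bS : bounded_measurable (fun w : g_sigma_algebraType (K t) => (source_age t w + 1) ^+ 2).
  apply: bmX; apply: bmD; last exact: bmcst.
  by apply: source_age_bm => s; exact: bK.
rewrite mulrBl mul1r -(beta_indep bS) -bm_intB.
- apply: eq_Rintegral => w _; rewrite exprMn.
  by case: (b01 t.+1 w) => ->; ring.
- exact: (bm_sub (Km (t := t))).
- by apply: bmM => //; exact: (bm_sub (Km (t := t))).
Qed.

(** The square splits according to the value of [gamma]: with weight [q] it is the squared source
    age, whose mean is bounded, and otherwise the squared previous age, which yields the contraction
    factor [1 - q]. *)
Lemma sink_age_L2 : exists L, forall t, \int[P]_w sink_age t w ^+ 2 <= L.
Proof.
case/andP: q01 => q0 q1.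
have [L LP] := source_age_L2.
have L0 : 0 <= L.
  by apply: le_trans (LP 0%N); apply: Rintegral_ge0 => w _; rewrite sqr_ge0.
apply: (@square_recurrence sink_age (1 - q) (q * (2 * L + 2))) => //; first by lra.
  by rewrite mulr_ge0 ?(ltW q0)//; lra.
move=> t /=.
have bS : bounded_measurable (fun w : g_sigma_algebraType (G t) => (source_age t w + 1) ^+ 2).
  apply: bmX; apply: bmD; last exact: bmcst.
  by apply: source_age_bm => s; exact: bG.
have bT : bounded_measurable (fun w : g_sigma_algebraType (G t) => (sink_age t w + 1) ^+ 2).
  apply: bmX; apply: bmD; last exact: bmcst.
  by apply: sink_age_bm => s st; [by apply: bG; exact: ltnW|exact: cG].
have bS' := bm_sub (Gm (t := t)) bS; have bT' := bm_sub (Gm (t := t)) bT.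
rewrite mulrBl mul1r -(gamma_indep bT) -bm_intB//; last exact: bmM.
have -> : \int[P]_w (gamma t w * (source_age t w + 1) +
     (1 - gamma t w) * (sink_age t w + 1)) ^+ 2 =
  \int[P]_w ((sink_age t w + 1) ^+ 2 - gamma t w * (sink_age t w + 1) ^+ 2) +
  q * \int[P]_w (source_age t w + 1) ^+ 2.
  rewrite -(gamma_indep bS) -bm_intD.
  - by apply: eq_Rintegral => w _; case: (c01 t w) => ->; ring.
  - by apply: bmB => //; exact: bmM.
  - exact: bmM.
rewrite lerD2l ler_wpM2l ?(ltW q0)//.
apply: le_trans (_ : \int[P]_w (2 * source_age t w ^+ 2 + 2) <= _).
  apply: bm_int_le => //; first by apply: bmD; [apply: bmZ; exact: bmX|exact: bmcst].
  move=> w; have /= := @sqrD1_le (source_age t w) 1 ltr01.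
  by rewrite invr1; apply: le_trans; rewrite lexx.
rewrite bm_intD ?bm_int_cst ?bm_intZ; [|exact: bmX|by apply: bmZ; exact: bmX|exact: bmcst].
by rewrite lerD2r ler_wpM2l.
Qed.

(** These two sums are the martingale parts left when [beta] and [gamma] are replaced by their means
    in the recursions. *)
Let source_noise T w := \sum_(t < T) ((beta t.+1 w - xi) * (source_age t w + 1)).
Let sink_noise T w := \sum_(t < T) ((gamma t w - q) * (source_age t w - sink_age t w)).

(** Telescoping of the recursion with [beta] split into its mean and a centred part: after division
    by [T] only the term [1 - xi] survives. *)
Lemma sum_source_age T w :
  xi * \sum_(t < T) source_age t w =
  (1 - xi) * T%:R - source_noise T w - source_age T w + source_age 0 w.
Proof.
elim: T => [|T IH]; first by rewrite /source_noise !big_ord0; ring.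
rewrite /source_noise !big_ord_recr mulrDr IH /source_noise -natr1 /=.
by ring.
Qed.

Lemma sum_sink_age T w :
  q * \sum_(t < T) sink_age t w =
  T%:R + q * \sum_(t < T) source_age t w + sink_noise T w - sink_age T w + a0.
Proof.
elim: T => [|T IH]; first by rewrite /sink_noise !big_ord0 /=; ring.
rewrite /sink_noise !big_ord_recr mulrDr IH /sink_noise -natr1 /=.
by ring.
Qed.

(** Along squares, the martingale parts and the boundary terms of the two summed recursions are
    negligible by their second moments. Ages are nonnegative, so their partial sums are monotone and
    the limit extends to all times. *)
Theorem sink_age_strong_law :
  {ae P, forall w, (\sum_(t < T) sink_age t w) / T%:R @[T --> \oo] -->
    q^-1 + xi^-1 - 1}.
Proof.
case/andP: q01 => q0 q1; case/andP: xi01 => xi0 xi1.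
have [L LP] := source_age_L2; have [L' LP'] := sink_age_L2.
have L0 : 0 <= L.
  by apply: le_trans (LP 0%N); apply: Rintegral_ge0 => w _; rewrite sqr_ge0.
have L'0 : 0 <= L'.
  by apply: le_trans (LP' 0%N); apply: Rintegral_ge0 => w _; rewrite sqr_ge0.
have A1 := @L2_cvg_squares _ _ _ P source_age L source_bm.
have A2 := @L2_cvg_squares _ _ _ P sink_age L' sink_bm.
have bN : forall n, bounded_measurable (source_noise n).
  move=> n; apply: (@bm_sum _ _ _ n (fun t w => (beta t.+1 w - xi) * (source_age t w + 1))).
  move=> i _; apply: bmM; first by apply: bmB => //; exact: bmcst.
  by apply: bmD => //; exact: bmcst.
have bM : forall n, bounded_measurable (sink_noise n).
  move=> n; apply: (@bm_sum _ _ _ n (fun t w => (gamma t w - q) * (source_age t w - sink_age t w))).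
  by move=> i _; apply: bmM; apply: bmB => //; exact: bmcst.
have A3 := @L2_cvg_squares _ _ _ P source_noise (2 * L + 2) bN.
have A4 := @L2_cvg_squares _ _ _ P sink_noise (2 * L + 2 * L') bM.
(* The initial ages are also random in [w]; as constant sequences they fall under the same
   criterion. *)
have A5 := @L2_cvg_squares _ _ _ P (fun=> source_age 0) L (fun=> source_bm 0).
have A6 := @L2_cvg_squares _ _ _ P (fun=> sink_age 0) L' (fun=> sink_bm 0).
have mulL (B : R) n x : 0 <= B -> x <= B -> (0 < n)%N -> x <= B * n%:R.
  by move=> B0 xB n0; apply: (le_trans xB); rewrite ler_peMr// ler1n.
have sD1 t : \int[P]_w (source_age t w + 1) ^+ 2 <= 2 * L + 2.
  apply: le_trans (_ : \int[P]_w (2 * source_age t w ^+ 2 + 2) <= _).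
    apply: bm_int_le => //; [by apply: bmX; apply: bmD => //; exact: bmcst| |].
      by apply: bmD; [apply: bmZ; exact: bmX|exact: bmcst].
    move=> w; have /= := @sqrD1_le (source_age t w) 1 ltr01.
    by rewrite invr1; apply: le_trans; rewrite lexx.
  rewrite bm_intD ?bm_int_cst ?bm_intZ; [|exact: bmX|by apply: bmZ; exact: bmX|exact: bmcst].
  by rewrite lerD2r ler_wpM2l.
have sB t : \int[P]_w (source_age t w - sink_age t w) ^+ 2 <= 2 * L + 2 * L'.
  apply: le_trans (_ : \int[P]_w (2 * source_age t w ^+ 2 + 2 * sink_age t w ^+ 2) <= _).
    apply: bm_int_le => //; [by apply: bmX; exact: bmB| |].
      by apply: bmD; apply: bmZ; exact: bmX.
    move=> w; rewrite -subr_ge0.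
    have -> : 2 * source_age t w ^+ 2 + 2 * sink_age t w ^+ 2 -
       (source_age t w - sink_age t w) ^+ 2 = (source_age t w + sink_age t w) ^+ 2 by ring.
    exact: sqr_ge0.
  rewrite bm_intD ?bm_intZ; [|exact: bmX|exact: bmX|by apply: bmZ; exact: bmX|by apply: bmZ; exact: bmX].
  by rewrite lerD// ler_wpM2l.
have h1 := A1 (fun n => mulL _ _ _ L0 (LP n)).
have h2 := A2 (fun n => mulL _ _ _ L'0 (LP' n)).
have h5 := A5 (fun n => mulL _ _ _ L0 (LP 0%N)).
have h6 := A6 (fun n => mulL _ _ _ L'0 (LP' 0%N)).
have eps_le1 (x y : R) : x = 0 \/ x = 1 -> 0 < y <= 1 -> `|x - y| <= 1.
  by move=> x01 y01; rewrite ler_norml; case: x01 => ->; lra.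
(* The source age and its noise up to index [t] only involve arrivals up to slot [t], hence are
   [K t]-measurable, and arrival [t.+1] is independent of them. *)
have orthN t : \int[P]_w ((beta t.+1 w - xi) * ((source_age t w + 1) * source_noise t w)) = 0.
  have bZ : bounded_measurable
      (fun w : g_sigma_algebraType (K t) => (source_age t w + 1) * source_noise t w).
    apply: bmM.
      by apply: bmD; [apply: source_age_bm => s; exact: bK|exact: bmcst].
    apply: (@bm_sum _ _ _ t (fun s (w : g_sigma_algebraType (K t)) =>
      (beta s.+1 w - xi) * (source_age s w + 1))) => s st; apply: bmM.
      by apply: bmB; [apply: bm01 => //; exact: bK|exact: bmcst].
    by apply: bmD; [apply: source_age_bm => u us; apply: bK; apply: leq_trans us (ltnW st)|exact: bmcst].
  have bZ' := bm_sub (Km (t := t)) bZ.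
  under eq_Rintegral do rewrite mulrBl.
  by rewrite bm_intB ?bm_intZ ?beta_indep ?subrr//; [exact: bmM|exact: bmZ].
have orthM t : \int[P]_w ((gamma t w - q) * ((source_age t w - sink_age t w) * sink_noise t w)) = 0.
  have bS s u : (s <= u)%N ->
      bounded_measurable (fun w : g_sigma_algebraType (G u) => source_age s w - sink_age s w).
    move=> su; apply: bmB.
      by apply: source_age_bm => v vs; apply: bG; exact: leq_trans su.
    by apply: sink_age_bm => v vs; [apply: bG; exact: leq_trans (ltnW vs) su|apply: cG; exact: leq_trans su].
  have bZ : bounded_measurable
      (fun w : g_sigma_algebraType (G t) => (source_age t w - sink_age t w) * sink_noise t w).
    apply: bmM; first exact: bS.
    apply: (@bm_sum _ _ _ t (fun s (w : g_sigma_algebraType (G t)) =>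
      (gamma s w - q) * (source_age s w - sink_age s w))) => s st; apply: bmM.
      by apply: bmB; [apply: bm01 => //; exact: cG|exact: bmcst].
    by apply: bS; exact: ltnW.
  have bZ' := bm_sub (Gm (t := t)) bZ.
  under eq_Rintegral do rewrite mulrBl.
  by rewrite bm_intB ?bm_intZ ?gamma_indep ?subrr//; [exact: bmM|exact: bmZ].
have h3 : {ae P, forall w, source_noise (n.+1 ^ 2)%N w / (n.+1 ^ 2)%:R @[n --> \oo] --> (0 : R)}.
  apply: A3 => n _; apply: (@martingale_L2 _ _ _ P (fun t w => beta t.+1 w - xi)
    (fun t w => source_age t w + 1)) => //.
  - by move=> t; apply: bmB => //; exact: bmcst.
  - by move=> t; apply: bmD => //; exact: bmcst.
  - by move=> t w; exact: eps_le1.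
have h4 : {ae P, forall w, sink_noise (n.+1 ^ 2)%N w / (n.+1 ^ 2)%:R @[n --> \oo] --> (0 : R)}.
  apply: A4 => n _; apply: (@martingale_L2 _ _ _ P (fun t w => gamma t w - q)
    (fun t w => source_age t w - sink_age t w)) => //.
  - by move=> t; apply: bmB => //; exact: bmcst.
  - by move=> t; apply: bmB => //; exact: bmcst.
  - by move=> t w; exact: eps_le1.
apply: filterS (filterI (filterI (filterI h1 h2) (filterI h3 h4)) (filterI h5 h6)) => w [[[{}h1 {}h2] [{}h3 {}h4]] [{}h5 {}h6]].
apply: (@cvg_squares R (fun T => \sum_(t < T) sink_age t w)).
- by move=> n; apply: sumr_ge0 => i _; exact: sink_age_ge0.
- move=> m n mn; rewrite -(subnKC mn) big_split_ord/= lerDl sumr_ge0// => i _.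
  exact: sink_age_ge0.
(* By the summed recursions the mean sink age is [q^-1] plus the mean source age, and the latter is
   [xi^-1 * (1 - xi)]; the zeros are the vanishing noise and boundary terms. *)
have -> : q^-1 + xi^-1 - 1 = q^-1 * (1 + 0 - 0 + 0) + xi^-1 * ((1 - xi) - 0 - 0 + 0).
  by field; lra.
have -> : (fun n => (\sum_(t < (n.+1 ^ 2)%N) sink_age t w) / (n.+1 ^ 2)%:R) =
  (fun n => q^-1 * (1 + sink_noise (n.+1 ^ 2)%N w / (n.+1 ^ 2)%:R -
                    sink_age (n.+1 ^ 2)%N w / (n.+1 ^ 2)%:R + sink_age 0 w / (n.+1 ^ 2)%:R)
          + xi^-1 * ((1 - xi) - source_noise (n.+1 ^ 2)%N w / (n.+1 ^ 2)%:R
                    - source_age (n.+1 ^ 2)%N w / (n.+1 ^ 2)%:R + source_age 0 w / (n.+1 ^ 2)%:R)).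
  apply/funext => n.
  have := sum_source_age (n.+1 ^ 2) w; have := sum_sink_age (n.+1 ^ 2) w.
  have m0 : (n.+1 ^ 2)%:R != 0 :> R by rewrite pnatr_eq0 expn_eq0.
  move: m0; rewrite [sink_age 0 w]/=.
  move: (\sum_(t < _) sink_age t w) (\sum_(t < _) source_age t w) (sink_noise _ _)
    (source_noise _ _) (sink_age _ _) (source_age (n.+1 ^ 2)%N w) (source_age 0 w) (_%:R).
  move=> S A M N g s s0 m m0 e1 e2.
  have A0 : A = xi^-1 * ((1 - xi) * m - N - s + s0) by rewrite -e2 mulKf//; lra.
  have -> : S = q^-1 * (m + q * A + M - g + a0) by rewrite -e1 mulKf//; lra.
  by rewrite A0; field; lra.
apply: cvgD; apply: cvgM; try exact: cvg_cst.
- by apply: cvgD h6; apply: cvgB h2; apply: cvgD h4; exact: cvg_cst.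
- by apply: cvgD h5; apply: cvgB h1; apply: cvgB h3; exact: cvg_cst.
Qed.

End age_strong_law.

(** Inversion is discontinuous at 0; as [x] times the power -1 of its square it inherits the
    measurability of [powR], and at 0 both expressions are 0. *)
Lemma measurable_inv (R : realType) : measurable_fun setT (@GRing.inv R).
Proof.
have -> : @GRing.inv R = fun x => x * (x ^+ 2) `^ (-1).
  apply/funext => x; rewrite powR_inv1 ?sqr_ge0//.
  have [->|x0] := eqVneq x 0; first by rewrite invr0 mul0r.
  by field.
apply: measurable_funM => //.
by apply: (measurableT_comp (measurable_powR (-1))); exact: measurable_funX.
Qed.

Lemma measurable_inve_EFin d (T : measurableType d) (R : realType) (f : T -> R) :
  measurable_fun setT f -> measurable_fun setT (fun x => (f x)%:E^-1)%E.
Proof.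
move=> mf.
have -> : (fun x => (f x)%:E^-1)%E =
    (fun x => if f x == 0 then +oo%E else ((f x)^-1)%:E).
  by apply/funext => x; rewrite inver.
apply: measurable_fun_ifT.
- by apply: measurable_fun_eqr => //; exact: measurable_cst.
- exact: measurable_cst.
- by apply/measurable_EFinP; exact: measurableT_comp (@measurable_inv R) mf.
Qed.

Lemma probability_integral_cst d (T : measurableType d) (R : realType)
  (P : probability T R) (x : \bar R) : (\int[P]__ x = x)%E.
Proof.
transitivity (x * P setT)%E; first exact: integral_cst.
by rewrite probability_setT mule1.
Qed.

(** * The sample-path age as the abstract recursion *)

Section age_dynamics.
Context d (W : measurableType d) (R : realType) (b a s : nat -> W -> bool) (age0 : nat).

Let beta t w : R := (b t w)%:R.
Let gamma t w : R := (a t w && s t w)%:R.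
Let A t w := source_age beta age0%:R t w.
Let S t w := sink_age beta gamma age0%:R t w.

(** The second conjunct is the invariant that drives the induction: a non-empty buffer holds the
    freshest packet, and an empty one means that source and sink ages agree. *)
Lemma age_sink_age t w :
  (age (b^~ w) (a^~ w) (s^~ w) age0 t)%:R = S t w /\
  match buffer (b^~ w) (a^~ w) (s^~ w) t with
  | None => A t w = S t w
  | Some g => (g <= t)%N /\ A t w = (t - g)%:R
  end.
Proof.
rewrite /A /S; elim: t => [|t [IH1 IH2]] /=.
  split => //; rewrite /beta; case: (b 0%N w) => /=.
    by rewrite subnn subrr mul0r.
  by rewrite subr0 mul1r.
have gE : gamma t w = (a t w && s t w)%:R by [].
have bE : beta t.+1 w = (b t.+1 w)%:R by [].
split.
  rewrite /delivered gE; case: (a t w && s t w) => /=.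
    rewrite mul1r subrr mul0r addr0.
    case: (buffer _ _ _ t) IH2 => [g [gt ->]|->]; first by rewrite natrD.
    by rewrite natrD IH1.
  by rewrite natrD IH1 mul0r add0r subr0 mul1r.
rewrite bE gE; case: (b t.+1 w) => /=.
  by rewrite leqnn subnn subrr mul0r.
rewrite subr0 !mul1r.
case: (a t w && s t w) => /=; first by rewrite mul1r subrr mul0r addr0.
case: (buffer _ _ _ t) IH2 => [g [gt ->]|->].
  by split; [exact: leqW|rewrite natr1 subSn].
by rewrite mul0r add0r subr0 mul1r.
Qed.

End age_dynamics.

Lemma sigma_of_setI d (T : measurableType d) d' (U : measurableType d') (Y : T -> U) :
  setI_closed (sigma_of Y).
Proof.
move=> A B [A' mA' <-] [B' mB' <-]; exists (A' `&` B'); first exact: measurableI.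
by rewrite !setTI preimage_setI.
Qed.

Lemma sigma_of_setT d (T : measurableType d) d' (U : measurableType d') (Y : T -> U) :
  sigma_of Y setT.
Proof. by exists setT => //; rewrite setTI preimage_setT. Qed.

Lemma sigma_of_measurable d (T : measurableType d) d' (U : measurableType d')
  (Y : T -> U) : measurable_fun setT Y -> sigma_of Y `<=` measurable.
Proof. by move=> mY _ [B mB <-]; exact: mY. Qed.

Lemma measurable_sub_sigma_of d (T : measurableType d) (I : Type) (D : set I)
    (F : I -> set (set T)) (i : I) d' (U : measurableType d') (Y : T -> U) :
  D i -> sigma_of Y `<=` F i ->
  measurable_fun (setT : set (g_sigma_algebraType (\bigcup_(i in D) F i))) Y.
Proof.
move=> Di YF _ B mB; apply: sub_sigma_algebra; exists i => //.
by apply: YF; exists B.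
Qed.

Section run_independence.
Context (R : realType) de (E : measurableType de) dw (W : measurableType dw).
Variables (net : network R E W) (P : probability W R) (D : set run_index).
Hypothesis indP : mutually_independent P D (run_events net).

Lemma run_events_setI i : setI_closed (run_events net i).
Proof. by case: i => *; exact: sigma_of_setI. Qed.

Lemma run_events_setT i : run_events net i setT.
Proof. by case: i => *; exact: sigma_of_setT. Qed.

Lemma run_events_measurable i : run_events net i `<=` measurable.
Proof. by case: i => *; exact: sigma_of_measurable. Qed.

Lemma run_group_measurable (D1 : set run_index) :
  \bigcup_(i in D1) run_events net i `<=` measurable.
Proof. by move=> A [i _]; exact: run_events_measurable. Qed.

Lemma run_groups (D1 D2 : set run_index) : D1 `<=` D -> D2 `<=` D ->
  D1 `&` D2 = set0 -> forall A B,
  <<s \bigcup_(i in D1) run_events net i >> A ->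
  <<s \bigcup_(i in D2) run_events net i >> B ->
  P (A `&` B) = (P A * P B)%E.
Proof.
move=> D1D D2D D12 A B.
apply: (indep_groups indP) => //.
- by move=> i _; exact: run_events_setI.
- by move=> i _; exact: run_events_setT.
- by move=> i _; exact: run_events_measurable.
Qed.

End run_independence.

Lemma Rintegral_bool d (T : measurableType d) (R : realType) (P : probability T R)
    (B : T -> bool) (x : R) : measurable_fun setT B ->
  P [set w | B w] = x%:E -> \int[P]_w ((B w)%:R : R) = x.
Proof.
move=> mB PB.
have mS : measurable [set w | B w] by rewrite -[X in measurable X]setTI; exact: mB.
rewrite /Rintegral (eq_integral (fun w => (\1_[set w | B w] w)%:E)).
  by rewrite integral_indic// setIT; exact: (congr1 fine PB).
move=> w _; rewrite indicE; congr ((_ : bool)%:R%:E).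
by apply/idP/idP; rewrite inE.
Qed.

Lemma sum_natr_ge (R : realType) (T : nat) :
  T%:R / 2 * T.+1%:R <= \sum_(1 <= t < T.+2) t%:R :> R.
Proof.
elim: T => [|T IH]; first by rewrite mul0r mul0r sumr_ge0.
rewrite big_nat_recr//=; apply: le_trans (lerD IH (lexx _)).
rewrite -[T.+2%:R]natr1 -[T.+1%:R]natr1 -subr_ge0.
have -> : T%:R / 2 * (T%:R + 1) + (T%:R + 1 + 1) - (T%:R + 1) / 2 * (T%:R + 1 + 1) = 1 :> R by field.
exact: ler01.
Qed.

(** * Average age of the typical link under a fixed environment *)

Section typical_age_law.
Context (R : realType) de (E : measurableType de) dw (W : measurableType dw).
Variables (net : network R E W) (P : probability W R) (age0 : nat).
Variables (p xi m : R).
Hypotheses (p01 : 0 < p < 1) (xi01 : 0 < xi <= 1).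
Hypothesis Parr : forall t, P [set w | arr net 0 t w] = xi%:E.
Hypothesis Pacc : forall t, P [set w | acc net 0 t w] = p%:E.
Hypothesis Psuc : forall t, P [set w | suc net 0 t w] = m%:E.
Hypothesis indP : mutually_independent P
  [set i | if i is Fad _ _ then False else True] (run_events net).

Let beta t w : R := (arr net 0 t w)%:R.
Let gamma t w : R := (acc net 0 t w && suc net 0 t w)%:R.

(** [DG t] lists the variables of link 0 revealed before the attempt of slot [t], the arrival of
    that slot included; [DK t] lists those revealed by its end. *)
Let DG t := [set i | match i with
  | Arr 0 s => (s <= t)%N | Acc 0 s => (s < t)%N | Suc 0 s => (s < t)%N | _ => False end].
Let DK t := [set i | match i with
  | Arr 0 s => (s <= t)%N | Acc 0 s => (s <= t)%N | Suc 0 s => (s <= t)%N | _ => False end].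
Let G t := \bigcup_(i in DG t) run_events net i.
Let K t := \bigcup_(i in DK t) run_events net i.

Let DGF t : DG t `<=` [set i | if i is Fad _ _ then False else True].
Proof. by case. Qed.
Let DKF t : DK t `<=` [set i | if i is Fad _ _ then False else True].
Proof. by case. Qed.

Lemma measurable_natr_bool d (T : measurableType d) (B : T -> bool) :
  measurable_fun setT B -> measurable_fun setT (fun w => (B w)%:R : R).
Proof.
move=> mB; have -> : (fun w => (B w)%:R : R) = fun w => if B w then 1 else 0.
  by apply/funext => w; case: (B w).
by apply: measurable_fun_ifT => //; exact: measurable_cst.
Qed.

Let gamma_sub (D : set run_index) t : D (Acc 0 t) -> D (Suc 0 t) ->
  measurable_fun (setT : set (g_sigma_algebraType (\bigcup_(i in D) run_events net i))) (gamma t).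
Proof.
move=> D1 D2; apply: measurable_natr_bool; apply: measurable_and.
  exact: (measurable_sub_sigma_of D1).
exact: (measurable_sub_sigma_of D2).
Qed.

Let beta_sub (D : set run_index) t : D (Arr 0 t) ->
  measurable_fun (setT : set (g_sigma_algebraType (\bigcup_(i in D) run_events net i))) (beta t).
Proof.
by move=> D1; apply: measurable_natr_bool; exact: (measurable_sub_sigma_of D1).
Qed.

Let b01 t w : beta t w = 0 \/ beta t w = 1.
Proof. by rewrite /beta; case: (arr net 0 t w); [right|left]. Qed.

Let c01 t w : gamma t w = 0 \/ gamma t w = 1.
Proof. by rewrite /gamma; case: (_ && _); [right|left]. Qed.

Lemma success_prob_ge0 : 0 <= m.
Proof. by rewrite -lee_fin -(Psuc 0). Qed.

Lemma success_prob_le1 : m <= 1.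
Proof.
rewrite -lee_fin -(Psuc 0); apply: probability_le1.
by rewrite -[X in measurable X]setTI; exact: (measurable_funPT (suc net 0 0)).
Qed.

Lemma mean_gamma t : \int[P]_w gamma t w = p * m.
Proof.
have -> : \int[P]_w gamma t w = \int[P]_w ((acc net 0 t w)%:R * (suc net 0 t w)%:R).
  by apply: eq_Rintegral => w _; rewrite /gamma -natrM mulnb.
pose D1 := [set Acc 0 t]; pose D2 := [set Suc 0 t].
rewrite (indep_RintegralM (P := P) (G1 := \bigcup_(i in D1) run_events net i)
    (G2 := \bigcup_(i in D2) run_events net i)).
- by rewrite (Rintegral_bool _ (Pacc t))// (Rintegral_bool _ (Psuc t)).
- exact: run_group_measurable.
- exact: run_group_measurable.
- apply: (run_groups indP); [by move=> _ ->|by move=> _ ->|].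
  by apply/seteqP; split => // i [-> ].
- apply: bm01; last by move=> w; case: (acc net 0 t w); [right|left].
  by apply: measurable_natr_bool; exact: (@measurable_sub_sigma_of _ _ _ D1 _ (Acc 0 t)).
- apply: bm01; last by move=> w; case: (suc net 0 t w); [right|left].
  by apply: measurable_natr_bool; exact: (@measurable_sub_sigma_of _ _ _ D2 _ (Suc 0 t)).
Qed.

Let gamma_indep t (Z : g_sigma_algebraType (G t) -> R) :
  bounded_measurable Z -> \int[P]_w (gamma t w * Z w) = (p * m) * \int[P]_w Z w.
Proof.
move=> bZ; pose D1 := [set Acc 0 t; Suc 0 t].
rewrite (indep_RintegralM (P := P) (G1 := \bigcup_(i in D1) run_events net i)
    (G2 := G t)) ?mean_gamma//.
- exact: run_group_measurable.
- exact: run_group_measurable.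
- apply: (run_groups indP); [by move=> _ [->|->]|exact: DGF|].
  by apply/seteqP; split => // i [[->|->]] /=; rewrite ltnn.
- by apply: bm01 => //; apply: gamma_sub; [left|right].
Qed.

Let beta_indep t (Z : g_sigma_algebraType (K t) -> R) :
  bounded_measurable Z -> \int[P]_w (beta t.+1 w * Z w) = xi * \int[P]_w Z w.
Proof.
move=> bZ; pose D1 := [set Arr 0 t.+1].
rewrite (indep_RintegralM (P := P) (G1 := \bigcup_(i in D1) run_events net i)
    (G2 := K t)) ?(Rintegral_bool _ (Parr _))//.
- exact: run_group_measurable.
- exact: run_group_measurable.
- apply: (run_groups indP); [by move=> _ ->|exact: DKF|].
  by apply/seteqP; split => // i [->] /=; rewrite ltnn.
- by apply: bm01 => //; exact: beta_sub.
Qed.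

Let avg w (T : nat) : R :=
  T.+1%:R^-1 * \sum_(1 <= t < T.+2) (typical_age net age0 t w)%:R.

Lemma average_age_pos : 0 < m ->
  {ae P, forall w, avg w T @[T --> \oo] --> (p * m)^-1 + xi^-1 - 1}.
Proof.
move=> m0; case/andP: p01 => p0 p1.
have pm01 : 0 < p * m <= 1.
  by rewrite mulr_gt0//= mulr_ile1 ?(ltW p0) ?(ltW m0) ?(ltW p1)// success_prob_le1.
have := @sink_age_strong_law _ _ _ P beta gamma G K (p * m) xi age0%:R pm01 xi01
  (ler0n _ _) b01 c01 (fun t => @run_group_measurable _ _ _ _ _ net _)
  (fun t => @run_group_measurable _ _ _ _ _ net _).
move=> /(_ _ _ _ gamma_indep beta_indep) h.
have {h} h : {ae P, forall w, (\sum_(t < T) sink_age beta gamma age0%:R t w) / T%:R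
    @[T --> \oo] --> (p * m)^-1 + xi^-1 - 1}.
  by apply: h => s t st; [apply: beta_sub|apply: gamma_sub|apply: beta_sub].
apply: filterS h => w; set D := (_ + _ - 1).
rewrite -(cvg_shiftn 2) => h.
(* The average covers slots 1 to T+1 and is divided by T+1, while the strong law at T+2 covers slots
   0 to T+1: hence the factor (T+2)/(T+1) and the subtracted initial age. *)
have -> : avg w = fun T : nat => (\sum_(t < (T + 2)%N) sink_age beta gamma age0%:R t w) / (T + 2)%:R
    * (1 + T.+1%:R^-1) - age0%:R * T.+1%:R^-1.
  apply/funext => T; rewrite /avg addn2.
  have -> : \sum_(1 <= t < T.+2) (typical_age net age0 t w)%:R =
     \sum_(t < T.+2) sink_age beta gamma age0%:R t w - age0%:R.
    rewrite -(big_mkord xpredT (fun t => sink_age beta gamma age0%:R t w)).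
    rewrite [in RHS]big_ltn//= addrAC subrr add0r.
    apply: eq_bigr => t _.
    by have [<- _] := @age_sink_age _ _ R (arr net 0) (acc net 0) (suc net 0) age0 t w.
  have T1 : T.+1%:R != 0 :> R by rewrite pnatr_eq0.
  have T2 : T.+2%:R != 0 :> R by rewrite pnatr_eq0.
  rewrite -[T.+2%:R]natr1 in T2 *.
  move: (\sum_(t < _) _) => y; move: (T.+1%:R : R) T1 T2 => x x0 x1.
  by field; rewrite x0 x1.
have -> : D = D * (1 + 0) - age0%:R * 0 by rewrite mulr0 subr0 addr0 mulr1.
have hh : (T.+1%:R^-1 : R) @[T --> \oo] --> (0 : R) by exact: cvg_harmonic.
apply: cvgB.
  apply: cvgM; first exact: h.
  by apply: cvgD => //; exact: cvg_cst.
by apply: cvgM => //; exact: cvg_cst.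
Qed.

(** Almost surely no attempt ever succeeds, so the age grows by one in each slot and its running
    mean is at least of order T/2. *)
Lemma average_age_zero : m = 0 ->
  {ae P, forall w, (avg w T)%:E @[T --> \oo] --> +oo%E}.
Proof.
move=> m0.
have : {ae P, forall w, forall t, ~~ suc net 0 t w}.
  apply/ae_foralln => t; exists [set w | suc net 0 t w]; split.
  - by rewrite -[X in measurable X]setTI; exact: (measurable_funPT (suc net 0 t)).
  - by have := Psuc t; rewrite m0.
  - by move=> w /= /negP; rewrite negbK.
apply: filterS => w Ns; apply/cvgeyPge => A.
have ageE t : typical_age net age0 t w = (age0 + t)%N.
  rewrite /typical_age; elim: t => [|t IH] /=; first by rewrite addn0.
  by rewrite /delivered (negbTE (Ns t)) andbF IH addn1 addnS.
near=> T; rewrite lee_fin /avg.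
have : A * 2 <= T%:R by near: T; exact: nbhs_infty_ger.
move=> AT; apply: (@le_trans _ _ (T%:R / 2)); first by rewrite ler_pdivlMr.
rewrite [leRHS]mulrC ler_pdivlMr//; apply: (@le_trans _ _ (\sum_(1 <= t < T.+2) t%:R)); last first.
  by apply: ler_sum => t _; rewrite ageE ler_nat leq_addl.
exact: sum_natr_ge.
Unshelve. all: by end_near. Qed.

(** The extended inverse of 0 is +oo, so the diverging case [m = 0] and the strong law for [m > 0]
    are covered by one formula. *)
Lemma mean_average_age :
  (\int[P]_w limn_esup (fun T => (avg w T)%:E) = xi^-1%:E + (p * m)%:E^-1 - 1)%E.
Proof.
case/andP: p01 => p0 p1; case/andP: xi01 => xi0 xi1.
have mavg T : measurable_fun setT (fun w => (avg w T)%:E).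
  apply/measurable_EFinP; apply: measurable_funM; first exact: measurable_cst.
  apply: (@measurable_sum _ _ _ _ _ _ (fun t w => (typical_age net age0 t w)%:R)) => t.
  have -> : (fun w => (typical_age net age0 t w)%:R) = sink_age beta gamma age0%:R t.
    by apply/funext => w; have [<- _] := @age_sink_age _ _ R (arr net 0) (acc net 0) (suc net 0) age0 t w.
  by have [] := bm_sub (@run_group_measurable _ _ _ _ _ net (DG t))
    (@sink_age_bm _ _ R beta gamma age0%:R b01 c01 (G t) t
      (fun s st => beta_sub (ltnW st)) (fun s st => gamma_sub st st)).
have mlim := measurable_fun_limn_esup mavg.
have [m0|m0] := eqVneq m 0.
  rewrite m0 mulr0 inve0 addey// addye//.
  transitivity (\int[P]_w (+oo : \bar R))%E.
    apply: ae_eq_integral => //.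
    apply: filterS (average_age_zero m0) => w hw _.
    by have [_ ->] := cvg_limn_einf_sup hw.
  exact: probability_integral_cst.
have m_gt0 : 0 < m by rewrite lt_neqAle eq_sym m0 success_prob_ge0.
have pm0 : p * m != 0 by rewrite mulf_neq0// gt_eqF.
rewrite inver (negbTE pm0).
transitivity (\int[P]_w ((p * m)^-1 + xi^-1 - 1)%:E)%E.
  apply: ae_eq_integral => //.
  apply: filterS (average_age_pos m_gt0) => w hw _.
  have hE : (avg w T)%:E @[T --> \oo] --> ((p * m)^-1 + xi^-1 - 1)%:E.
    by apply: cvg_EFin => //; exact: nearW.
  by have [_ ->] := cvg_limn_einf_sup hE.
rewrite probability_integral_cst.
by rewrite (addrC _ xi^-1) EFinB EFinD.
Qed.

End typical_age_law.

Section kernel_probability.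
Context d d' (X : measurableType d) (Y : measurableType d') (R : realType).

(** Gives each [k x] the structure of a probability, so that results on a fixed probability space
    apply to the run given the environment. *)
Definition kernel_probability (k : R.-pker X ~> Y) (x : X) : set Y -> \bar R := k x.

HB.instance Definition _ k x := Measure.on (kernel_probability k x).

HB.instance Definition _ (k : R.-pker X ~> Y) x :=
  Measure_isProbability.Build _ _ _ (kernel_probability k x) (prob_kernel (s := k) x).

End kernel_probability.

Lemma probability_fin_ge0 d (T : measurableType d) (R : realType)
    (P : probability T R) (A : set T) (x : R) : measurable A -> P A = x%:E -> 0 <= x <= 1.
Proof.
move=> mA PA; rewrite -!lee_fin -PA measure_ge0/=; exact: probability_le1.
Qed.

Section average_age.
Context (R : realType) (N : params R)
    (de : measure_display) (E : measurableType de)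
    (dw : measure_display) (W : measurableType dw)
    (P0 : probability E R) (Q : R.-pker E ~> W) (net : network R E W)
    (age0 : nat).
Hypotheses (adm : admissible N) (prot : protocol N Q net)
  (mf : mean_field N P0 Q net).

Lemma mu01 j e : 0 <= mu net j e <= 1.
Proof.
have [_ _ _ h _] := mf.
apply: (probability_fin_ge0 (P := kernel_probability Q e) _ (h e j 0%N)).
by rewrite -[X in measurable X]setTI; exact: (measurable_funPT (suc net j 0)).
Qed.

Lemma average_age_formula : average_age P0 Q net age0 =
  ((arrival N)^-1%:E
   + \int[law_mu P0 net]_(t in `[0%R, 1%R]) (access N * t)%:E^-1 - 1)%E.
Proof.
have [_ _ /andP[xi0 xi1] /andP[p0 p1]] := adm.
have pge0 := ltW p0.
have m0 e : 0 <= mu net 0 e by case/andP: (mu01 0 e).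
have inner e : (\int[Q e]_w limn_esup (fun T : nat =>
       (T.+1%:R^-1 * \sum_(1 <= t < T.+2) (typical_age net age0 t w)%:R : R)%:E) =
    (arrival N)^-1%:E + (access N * mu net 0 e)%:E^-1 - 1)%E.
  have [Parr Pacc _ _] := prot e; have [_ _ _ Psuc /(_ e) [ind _]] := mf.
  apply: (@mean_average_age _ _ _ _ _ net (kernel_probability Q e) age0 (access N)
    (arrival N) (mu net 0 e)) => //.
  all: rewrite ?p0 ?xi0//.
  - exact: Parr.
  - exact: Pacc.
  - exact: Psuc.
rewrite /average_age (eq_integral (fun e => (arrival N)^-1%:E + (access N * mu net 0 e)%:E^-1 - 1)%E _ (fun e _ => inner e)).
have minv : measurable_fun setT (fun e => (access N * mu net 0 e)%:E^-1)%E.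
  by apply: measurable_inve_EFin; apply: measurable_funM => //; exact: measurable_cst.
have inv_ge0 e : (0 <= (access N * mu net 0 e)%:E^-1)%E.
  by rewrite inve_ge0 lee_fin mulr_ge0.
(* Grouping [xi^-1 - 1], which is nonnegative as [xi <= 1], allows additivity for nonnegative
   integrands, valid even when the integral of the inverse is infinite. *)
have -> : (fun e => (arrival N)^-1%:E + (access N * mu net 0 e)%:E^-1 - 1)%E =
  (fun e => ((arrival N)^-1 - 1)%:E + (access N * mu net 0 e)%:E^-1)%E.
  by apply/funext => e; rewrite EFinB -!addeA (addeC (- 1%:E)%E).
rewrite ge0_integralD//; last first.
  by move=> e _; rewrite lee_fin subr_ge0 invf_ge1.
rewrite probability_integral_cst EFinB.
rewrite [in RHS]/law_mu ge0_integral_pushforward//=.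
- rewrite -addeA (addeC (- 1%:E)%E) addeA.
  congr (_ + _ + _)%E.
  have -> : mu net 0 @^-1` [set x | x \in `[0, 1]] = setT.
    by apply/seteqP; split => // e _ /=; rewrite in_itv/= mu01.
  by [].
- apply: measurable_funTS; apply: measurable_inve_EFin.
  by apply: measurable_funM => //; exact: measurable_cst.
- move=> t; rewrite inE/= in_itv/= => /andP[t0 _].
  by rewrite inve_ge0 lee_fin mulr_ge0.
Qed.

End average_age.

(** * Laws with a density *)

Section density.
Context d (T : measurableType d) (R : realType).
Variables (mu nu : {measure set T -> \bar R}) (D : set T) (g : T -> R).
Hypotheses (mD : measurable D) (mg : measurable_fun setT g).
Hypothesis g0 : forall x, 0 <= g x.
Hypothesis nuE : forall A, measurable A ->
  nu A = (\int[mu]_(x in A `&` D) (g x)%:E)%E.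
Local Open Scope ereal_scope.
Import HBNNSimple.

(** For indicators this is [nuE]; linearity gives simple functions, and monotone convergence on both
    sides gives the general case. *)
Lemma integral_density (f : T -> \bar R) : measurable_fun setT f ->
  (forall x, 0 <= f x) -> \int[nu]_x f x = \int[mu]_(x in D) (f x * (g x)%:E).
Proof.
move=> mf f0; pose h := nnsfun_approx measurableT mf.
have hf x : (EFin \o h ^~ x) n @[n --> \oo] --> f x.
  by apply: cvg_nnsfun_approx.
have -> : \int[nu]_x f x = lim (\int[nu]_x (EFin \o h n) x @[n --> \oo]).
  under eq_integral => x _ do rewrite -(cvg_lim _ (hf x))//.
  apply: monotone_convergence => //.
  - by move=> n; apply/measurable_EFinP; exact/measurable_funP.
  - by move=> n x _ //=; rewrite lee_fin.
  - by move=> x _ a b ab; rewrite lee_fin; exact/lefP/nd_nnsfun_approx.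
have -> : \int[mu]_(x in D) (f x * (g x)%:E) =
    lim (\int[mu]_(x in D) ((EFin \o h n) x * (g x)%:E) @[n --> \oo]).
  have fg x : f x * (g x)%:E = lim (((EFin \o h n) x * (g x)%:E) @[n --> \oo]).
    by apply/esym/cvg_lim => //; apply: cvgeZr => //; exact: hf.
  under eq_integral => x _ do rewrite fg.
  apply: monotone_convergence => // [n|n x _|x _ a b ab].
  - apply/emeasurable_funM; apply/measurable_funTS; exact/measurable_EFinP.
  - by rewrite mule_ge0 ?lee_fin.
  - by rewrite lee_wpmul2r ?lee_fin//; exact/lefP/nd_nnsfun_approx.
congr (lim (_ @ \oo)); apply/funext => n.
transitivity (\int[nu]_x
   (\sum_(y \in range (h n)) (y * \1_(h n @^-1` [set y]) x)%:E)).
  by apply: eq_integral => t tE; rewrite /= [in LHS]fimfunE -fsumEFin.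
rewrite ge0_integral_fsum//; last 2 first.
- by move=> r; apply/measurable_EFinP; exact: measurable_funM.
- by move=> m y Ey; exact: nnfun_muleindic_ge0.
transitivity (\int[mu]_(x in D) (\sum_(y \in range (h n))
    (y * \1_(h n @^-1` [set y]) x)%:E * (g x)%:E)); last first.
  under eq_integral => x xE.
    rewrite -ge0_mule_fsuml => [|y]; last exact: nnfun_muleindic_ge0.
    rewrite fsumEFin // -(fimfunE _ x); over.
  by [].
rewrite ge0_integral_fsum//; last 2 first.
- move=> y; apply: emeasurable_funM; apply: measurable_funTS; apply/measurable_EFinP => //.
  exact: measurable_funM.
- by move=> m y Ey; rewrite mule_ge0 ?lee_fin// -?lee_fin; exact: nnfun_muleindic_ge0.
apply: eq_fsbigr => r /set_mem [z _ rz].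
have r0 : (0 <= r)%R by rewrite -rz.
under eq_integral do rewrite EFinM.
rewrite ge0_integralZl//; last by apply/measurable_EFinP.
rewrite integral_indic// setIT nuE//.
under [RHS]eq_integral do rewrite EFinM -muleA.
rewrite ge0_integralZl//; last 2 first.
- by apply: emeasurable_funM; apply: measurable_funTS; apply/measurable_EFinP.
- by move=> x _; rewrite mule_ge0 ?lee_fin.
congr (_ * _); rewrite setIC integral_mkcondr.
apply: eq_integral => x _; rewrite epatch_indic muleC.
by [].
Qed.

End density.

Section approximation.
Context (R : realType) (N : params R) (f g : R -> R) (law : probability R R).
Hypothesis (p_gt0 : 0 < access N).
Hypothesis f_lim : forall u : R, 0 < u < 1 -> f_seq N n u @[n --> \oo] --> f u.
Hypotheses (mg : measurable_fun setT g) (g0 : forall t, 0 <= g t).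
Hypothesis gE : forall A : set (measurableTypeR R), measurable A ->
  law A = (\int[lebesgue_measure]_(t in A `&` `]0%R, 1%R[) (g t)%:E)%E.
Let p := access N.

Lemma Beta_ge0 (a b : R) : 0 <= Beta a b.
Proof. by apply: Rintegral_ge0 => x _; rewrite mulr_ge0// powR_ge0. Qed.

Lemma f_seq_ge0 n u : 0 <= f_seq N n u.
Proof. by rewrite /f_seq /f_of divr_ge0 ?Beta_ge0// mulr_ge0// powR_ge0. Qed.

Lemma f_seq_measurable n : measurable_fun setT (f_seq N n).
Proof.
rewrite /f_seq /f_of; apply: measurable_funM; last exact: measurable_cst.
apply: measurable_funM; first exact: measurable_powR.
apply: (measurableT_comp (measurable_powR _)).
by apply: measurable_funB => //; exact: measurable_cst.
Qed.

Lemma f_ge0 u : 0 < u < 1 -> 0 <= f u.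
Proof.
move=> u01; rewrite -(cvg_lim _ (f_lim u01))//; apply: limr_ge.
  by apply/cvg_ex; exists (f u); exact: f_lim.
by apply: nearW => n; exact: f_seq_ge0.
Qed.

Lemma f_measurable : measurable_fun (`]0%R, 1%R[ : set R) f.
Proof.
apply: (measurable_fun_cvg (h := f_seq N)).
- by move=> n; apply: measurable_funTS; exact: f_seq_measurable.
- by move=> u /=; rewrite in_itv/=; exact: f_lim.
Qed.

Lemma integral_law_inv :
  (\int[law]_(t in `[0%R, 1%R]) (p * t)%:E^-1 =
   \int[lebesgue_measure]_(t in `]0%R, 1%R[) (g t / (p * t))%:E)%E.
Proof.
rewrite integral_mkcond.
set h := (_ \_ _).
have mh : measurable_fun (setT : set (measurableTypeR R)) h.
  apply/(measurable_restrictT _ _).1 => //; apply: measurable_funTS.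
  by apply: measurable_inve_EFin; apply: measurable_funM => //; exact: measurable_cst.
have h0 t : (0 <= h t)%E.
  rewrite /h patchE; case: ifPn => //; rewrite inE/= in_itv/= => /andP[t0 t1].
  by rewrite inve_ge0 lee_fin mulr_ge0// ltW.
have mD : measurable (`]0%R, 1%R[%classic : set (measurableTypeR R)) by [].
transitivity (\int[@lebesgue_measure R]_(t in `]0%R, 1%R[) (h t * (g t)%:E))%E.
  (* The law and Lebesgue measure sit on two measurable structures over the same reals; the identity
     is measurable between them and transports the law. *)
  have mid : measurable_fun (setT : set R) (id : R -> measurableTypeR R).
    by move=> _ A mA; rewrite setTI preimage_id.
  pose idR : {mfun R >-> measurableTypeR R} := HB.pack (id : R -> measurableTypeR R)
    (isMeasurableFun.Build _ _ _ _ _ mid).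
  rewrite -(@integral_density _ (measurableTypeR R) R (@lebesgue_measure R)
    (distribution law idR) _ g mD mg g0 gE h mh h0).
  by rewrite ge0_integral_distribution.
apply: eq_integral => t; rewrite inE/= in_itv/= => /andP[t0 t1].
rewrite /h patchE ifT; last by rewrite inE/= in_itv/= !ltW.
by rewrite inver gt_eqF ?mulr_gt0// -EFinM mulrC.
Qed.

(** The pointwise triangle inequality is integrated in additive form, which remains meaningful when
    the integrals are infinite. *)
Lemma integral_approx_error :
  let I (h : R -> R) := (\int[lebesgue_measure]_(t in `]0%R, 1%R[) (h t / (p * t))%:E)%E in
  (I g <= I f + I (fun t => `|g t - f t|%R) /\
   I f <= I g + I (fun t => `|g t - f t|%R))%E.
Proof.
move=> I.
have minv : measurable_fun (`]0%R, 1%R[ : set R) (fun t : R => (p * t)^-1).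
  apply: measurable_funTS; apply: (measurableT_comp (@measurable_inv R)).
  by apply: measurable_funM => //; exact: measurable_cst.
have mg' : measurable_fun (`]0%R, 1%R[ : set R) g by exact: measurable_funTS.
have mf' := f_measurable.
have m1 : measurable_fun (`]0%R, 1%R[ : set R) (fun t => (g t / (p * t))%:E).
  by apply/measurable_EFinP; exact: measurable_funM.
have m2 : measurable_fun (`]0%R, 1%R[ : set R) (fun t => (f t / (p * t))%:E).
  by apply/measurable_EFinP; exact: measurable_funM.
have m3 : measurable_fun (`]0%R, 1%R[ : set R) (fun t => (`|g t - f t| / (p * t))%:E).
  apply/measurable_EFinP; apply: measurable_funM => //.
  by apply: measurableT_comp => //; exact: measurable_funB.
have pos t : `]0%R, 1%R[%classic t -> 0 <= (p * t)^-1.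
  by rewrite /= in_itv/= => /andP[t0 _]; rewrite invr_ge0 mulr_ge0// ltW.
have p1 t : `]0%R, 1%R[%classic t -> (0 <= (g t / (p * t))%:E)%E.
  by move=> t01; rewrite lee_fin mulr_ge0// pos.
have p2 t : `]0%R, 1%R[%classic t -> (0 <= (f t / (p * t))%:E)%E.
  by move=> t01; rewrite lee_fin mulr_ge0 ?pos ?f_ge0//; move: t01; rewrite /= in_itv.
have p3 t : `]0%R, 1%R[%classic t -> (0 <= (`|g t - f t| / (p * t))%:E)%E.
  by move=> t01; rewrite lee_fin mulr_ge0// pos.
rewrite /I -!ge0_integralD//; split.
- apply: ge0_le_integral => //.
  + exact: emeasurable_funD.
  + move=> t t01; rewrite -EFinD lee_fin -mulrDl ler_wpM2r ?pos//.
    by rewrite -lerBlDl ler_norm.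
- apply: ge0_le_integral => //.
  + exact: emeasurable_funD.
  + move=> t t01; rewrite -EFinD lee_fin -mulrDl ler_wpM2r ?pos//.
    by rewrite -lerBlDl distrC ler_norm.
Qed.

End approximation.

(** * Gil-Pelaez inversion *)

Section derivative_rules.
Context {R : realType}.
Implicit Types (f g : R -> R) (x df dg c : R).

Lemma deriv_cst c x : is_derive x 1 (fun=> c) 0.
Proof. exact: is_derive_cst. Qed.

Lemma deriv_id x : is_derive x 1 (fun y : R => y) 1.
Proof. exact: is_derive_id. Qed.

Lemma derivD f g x df dg : is_derive x 1 f df -> is_derive x 1 g dg ->
  is_derive x 1 (fun y => f y + g y) (df + dg).
Proof. by move=> hf hg; exact: (@is_deriveD _ _ _ f g). Qed.

Lemma derivB f g x df dg : is_derive x 1 f df -> is_derive x 1 g dg ->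
  is_derive x 1 (fun y => f y - g y) (df - dg).
Proof. by move=> hf hg; exact: (@is_deriveB _ _ _ f g). Qed.

Lemma derivN f x df : is_derive x 1 f df -> is_derive x 1 (fun y => - f y) (- df).
Proof. by move=> hf; exact: (@is_deriveN _ _ _ f). Qed.

Lemma derivM f g x df dg : is_derive x 1 f df -> is_derive x 1 g dg ->
  is_derive x 1 (fun y => f y * g y) (df * g x + f x * dg).
Proof.
move=> hf hg; have := @is_deriveM _ _ f g x 1 df dg hf hg.
by rewrite /GRing.scale/= addrC (mulrC df).
Qed.

Lemma derivZ c f x df : is_derive x 1 f df -> is_derive x 1 (fun y => c * f y) (c * df).
Proof.
move=> hf; have := derivM (deriv_cst c x) hf.
by rewrite mul0r add0r.
Qed.

Lemma deriv_comp f g x df dg : is_derive (g x) 1 f df -> is_derive x 1 g dg ->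
  is_derive x 1 (fun y => f (g y)) (df * dg).
Proof. by move=> hf hg; exact: (@is_derive1_comp _ f g). Qed.

Lemma deriv_expR f x df : is_derive x 1 f df ->
  is_derive x 1 (fun y => expR (f y)) (expR (f x) * df).
Proof. exact: deriv_comp. Qed.

Lemma deriv_sin f x df : is_derive x 1 f df ->
  is_derive x 1 (fun y => sin (f y)) (cos (f x) * df).
Proof. exact: deriv_comp. Qed.

Lemma deriv_cos f x df : is_derive x 1 f df ->
  is_derive x 1 (fun y => cos (f y)) (- sin (f x) * df).
Proof. exact: deriv_comp. Qed.

Lemma derivX n f x df : is_derive x 1 f df ->
  is_derive x 1 (fun y => f y ^+ n) (n%:R * f x ^+ n.-1 * df).
Proof.
move=> hf; have := @is_deriveX _ _ f n x 1 df hf.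
by rewrite exprfctE.
Qed.

Lemma deriv_continuous f x df : is_derive x 1 f df -> {for x, continuous f}.
Proof. by move=> [h _]; apply: differentiable_continuous; apply/derivable1_diffP. Qed.

End derivative_rules.

Section FTC.
Context {R : realType}.
Notation mu := (@lebesgue_measure R).

Lemma Rintegral_FTC2 (f F : R -> R) (a b : R) : a <= b ->
  (forall x : R, is_derive x 1 F (f x)) -> continuous f ->
  mu.-integrable `[a, b] (EFin \o f) /\
  \int[mu]_(x in `[a, b]) f x = F b - F a.
Proof.
move=> ab dF cf; split.
  apply: continuous_compact_integrable; first exact: segment_compact.
  exact: continuous_subspaceT.
have cF : continuous F by move=> x; exact: deriv_continuous (dF x).
rewrite /Rintegral; move: ab; rewrite le_eqVlt => /orP[/eqP <-|ab].
  by rewrite set_itv1 integral_set1 subrr.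
rewrite (@continuous_FTC2 _ f F)//.
- exact: continuous_subspaceT.
- split.
  + by move=> x _; have [] := dF x.
  + by apply: cvg_at_right_filter; exact: cF.
  + by apply: cvg_at_left_filter; exact: cF.
- by move=> x _; rewrite derive1E; exact: derive_val.
Qed.

Lemma ge0_FTC2y (f F : R -> R) (a l v : R) : v = l - F a ->
  (forall x, a <= x -> 0 <= f x) ->
  (forall x : R, a <= x -> is_derive x 1 F (f x)) ->
  (forall x : R, a <= x -> {for x, continuous f}) ->
  F x @[x --> +oo] --> l ->
  (\int[mu]_(x in `[a, +oo[) (f x)%:E)%E = v%:E.
Proof.
move=> -> f0 dF cf Fl; rewrite EFinB.
apply: (@ge0_continuous_FTC2y _ f F) => //.
- apply/continuous_within_itvcyP; split.
    by move=> x; rewrite in_itv/= andbT => /ltW /cf.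
  by apply: cvg_at_right_filter; exact: cf.
- by move=> x /ltW /dF [].
- by apply: cvg_at_right_filter; exact: deriv_continuous (dF _ (lexx a)).
- by move=> x; rewrite in_itv/= andbT => /ltW ax; rewrite derive1E; have := dF x ax => ?; exact: derive_val.
Qed.

End FTC.

Section swap.
Context d1 d2 (T1 : measurableType d1) (T2 : measurableType d2) (R : realType).
Variable m1 : {sigma_finite_measure set T1 -> \bar R}.
Variable m2 : {sigma_finite_measure set T2 -> \bar R}.
Variables (f : T1 * T2 -> R) (a : T1 -> R) (b : T2 -> R).
Hypothesis mf : measurable_fun setT f.
Hypothesis ia : m1.-integrable setT (EFin \o a).
Hypothesis ib : m2.-integrable setT (EFin \o b).
Hypothesis f_le : forall x y, `|f (x, y)| <= a x * b y.

Let mF : measurable_fun setT (EFin \o f).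
Proof. exact/measurable_EFinP. Qed.

Lemma sect2_integrable x : m2.-integrable setT (fun y => (f (x, y))%:E).
Proof.
have ixb : m2.-integrable setT (fun y => (a x)%:E * (b y)%:E)%E by exact: integrableZl.
apply: (le_integrable measurableT _ _ ixb).
  by apply: (measurableT_comp mF); exact: measurable_pair1.
by move=> y _; rewrite /= lee_fin (le_trans (f_le x y))// ler_norm.
Qed.

Lemma sect1_integrable y : m1.-integrable setT (fun x => (f (x, y))%:E).
Proof.
have ixb : m1.-integrable setT (fun x => (a x)%:E * (b y)%:E)%E by exact: integrableZr.
apply: (le_integrable measurableT _ _ ixb).
  by apply: (measurableT_comp mF); exact: measurable_pair2.
by move=> x _; rewrite /= lee_fin (le_trans (f_le x y))// ler_norm.
Qed.

Lemma prod_integrable : (m1 \x m2)%E.-integrable setT (EFin \o f).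
Proof.
apply/(integrable12ltyP _ _ mF).
have ab0 x y : 0 <= a x * b y by apply: le_trans (f_le x y).
have ma : measurable_fun setT (fun x => `|a x|%:E).
  by apply/measurable_EFinP; apply: measurableT_comp => //; exact/measurable_EFinP/(measurable_int m1).
have mb : measurable_fun setT (fun x => `|b x|%:E).
  by apply/measurable_EFinP; apply: measurableT_comp => //; exact/measurable_EFinP/(measurable_int m2).
apply: (@le_lt_trans _ _ (\int[m1]_x ((`|a x|)%:E * \int[m2]_y (`|b y|)%:E))%E).
  apply: ge0_le_integral => //.
  - by move=> x _; exact: integral_ge0.
  - apply: (@measurable_fun_fubini_tonelli_F _ _ _ _ _ m2 (fun z => `|(f z)%:E|)%E) => //.
    exact: measurableT_comp.
  - apply: emeasurable_funM => //.
  - move=> x _; rewrite -ge0_integralZl//.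
    apply: ge0_le_integral => //.
    + by apply: measurableT_comp => //; apply: (measurableT_comp mF); exact: measurable_pair1.
    + exact: emeasurable_funM.
    + move=> y _; rewrite lee_fin (le_trans (f_le x y))//.
      by rewrite -normrM ler_norm.
have [_ a_fin] := integrableP _ _ _ ia; have [_ b_fin] := integrableP _ _ _ ib.
rewrite ge0_integralZr//; last exact: integral_ge0.
have fa : (\int[m1]_x `|a x|%:E)%E \is a fin_num.
  by rewrite ge0_fin_numE//; exact: integral_ge0.
have fb : (\int[m2]_x `|b x|%:E)%E \is a fin_num.
  by rewrite ge0_fin_numE//; exact: integral_ge0.
by rewrite -(fineK fa) -(fineK fb) -EFinM ltry.
Qed.

Let inner2 : (fun x => (\int[m2]_y f (x, y))%:E) = fubini_F m2 (EFin \o f).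
Proof.
apply/funext => x; rewrite /fubini_F /Rintegral fineK//.
by apply: integrable_fin_num => //; exact: sect2_integrable.
Qed.

Let inner1 : (fun y => (\int[m1]_x f (x, y))%:E) = fubini_G m1 (EFin \o f).
Proof.
apply/funext => y; rewrite /fubini_G /Rintegral fineK//.
by apply: integrable_fin_num => //; exact: sect1_integrable.
Qed.

Lemma swap_integrable1 : m1.-integrable setT (fun x => (\int[m2]_y f (x, y))%:E).
Proof. by rewrite inner2; apply: integrable_fubini_F; exact: prod_integrable. Qed.

(** The product bound [a x * b y] makes [f] integrable for the product measure, so Fubini's theorem
    applies and both inner integrals are finite everywhere. *)
Lemma Rintegral_swap :
  \int[m1]_x \int[m2]_y f (x, y) = \int[m2]_y \int[m1]_x f (x, y).
Proof.
rewrite /Rintegral; congr fine.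
have := Fubini prod_integrable.
rewrite -[X in integral m1 _ X](_ : (fun x => (\int[m2]_y f (x, y))%:E) = _); last by rewrite inner2.
rewrite -[X in _ = integral m2 _ X](_ : (fun y => (\int[m1]_x f (x, y))%:E) = _); last by rewrite inner1.
by [].
Qed.

End swap.

Section trigo_bounds.
Context {R : realType}.
Notation mu := (@lebesgue_measure R).

Lemma continuous_cosM (w : R) : continuous (fun s : R => cos (w * s)).
Proof.
move=> s; exact: deriv_continuous (deriv_cos (derivZ w (deriv_id s))).
Qed.

(** By oddness [y] may be taken nonnegative; then [sin y] is the integral over [[0, y]] of the
    cosine, which is at most 1 in modulus. *)
Lemma sin_abs_le (y : R) : `|sin y| <= `|y|.
Proof.
wlog y0 : y / 0 <= y.
  move=> h; have [|/ltW y0] := leP 0 y; first exact: h.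
  by have := h (- y); rewrite oppr_ge0 sinN !normrN; exact.
have [ic] := Rintegral_FTC2 (f := cos) (F := sin) y0 (@is_derive_sin R) (@continuous_cos R).
rewrite sin0 subr0 (ger0_norm y0) => <-.
apply: le_trans (le_normr_Rintegral _ ic) _ => //.
apply: (@le_trans _ _ (\int[mu]_(x in `[0, y]) 1)).
  apply: le_Rintegral => //.
  - exact: integrable_norm.
  - apply: continuous_compact_integrable; first exact: segment_compact.
    by apply: continuous_subspaceT => x; exact: cst_continuous.
  - by move=> x _; exact: cos_max.
rewrite Rintegral_cst//= lebesgue_measure_itv/= lte_fin.
by case: ltP => y0'; rewrite /= ?mul1r ?subr0// mulr0.
Qed.

Lemma powR_cvgy0 (b : R) : 0 < b -> x `^ (- b) @[x --> +oo] --> (0 : R).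
Proof.
move=> b0.
apply: (@cvg_trans _ ((fun x => expR (- (b * ln x))) x @[x --> +oo])).
  apply: near_eq_cvg; near=> x; have x0 : 0 < x by near: x; exact: nbhs_pinfty_gt.
  by rewrite /powR gt_eqF// mulNr.
apply: (@cvg_comp _ _ _ (fun x => b * ln x) (fun y => expR (- y)) _ (pinfty_nbhs R)); last exact: cvgr_expR.
apply/cvgryPge => A; near=> x.
rewrite -ler_pdivrMl// mulrC.
have x0 : expR (A / b) <= x by near: x; exact: nbhs_pinfty_ge.
by rewrite -(expRK (A / b)) ler_ln// posrE ?expR_gt0// (lt_le_trans (expR_gt0 _) x0).
Unshelve. all: by end_near. Qed.

Lemma powR_tail (s : R) : 1 < s ->
  (\int[mu]_(v in `[1%R, +oo[) (v `^ (- s))%:E = (s - 1)^-1%:E)%E.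
Proof.
move=> s1.
have s0 : s - 1 != 0 by rewrite subr_eq0 gt_eqF.
apply: (@ge0_FTC2y R (fun v => v `^ (- s)) (fun v => - (s - 1)^-1 * v `^ (1 - s)) 1 0).
- by rewrite powR1 mulr1 sub0r opprK.
- by move=> x _; exact: powR_ge0.
- move=> x x1; have x0 : 0 < x by apply: lt_le_trans x1.
  have h := derivZ (- (s - 1)^-1) (@is_derive1_powR R (1 - s) x x0).
  apply: is_derive_eq h _.
  rewrite (_ : 1 - s - 1 = - s); last by ring.
  by field.
- move=> x x1; have x0 : 0 < x by apply: lt_le_trans x1.
  exact: deriv_continuous (@is_derive1_powR R (- s) x x0).
- rewrite -(mulr0 (- (s - 1)^-1)); apply: cvgM; first exact: cvg_cst.
  by rewrite -(opprB s 1); apply: powR_cvgy0; rewrite subr_gt0.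
Qed.

Lemma powR_tail_integrable (s : R) : 1 < s ->
  mu.-integrable `[1, +oo[ (fun v => (v `^ (- s))%:E).
Proof.
move=> s1; apply/integrableP; split.
  by apply/measurable_EFinP; apply: measurable_funTS; exact: measurable_powR.
under eq_integral => v _ do rewrite /= ger0_norm ?powR_ge0//.
by rewrite powR_tail// ltry.
Qed.

End trigo_bounds.

(** * Exponentially damped trigonometric integrals *)

Section laplace.
Context {R : realType}.
Notation mu := (@lebesgue_measure R).
Variable eps : R.
Hypothesis eps0 : 0 < eps.
Let e (w : R) := expR (- eps * w).

Let de (w : R) : is_derive w 1 e (e w * - eps).
Proof.
have := deriv_expR (derivZ (- eps) (deriv_id w)).
by rewrite mulr1.
Qed.

Let e_cvg : e w @[w --> +oo] --> (0 : R).
Proof.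
have -> : e = fun w => expR (- (eps * w)) by apply/funext => w; rewrite /e mulNr.
apply: (@cvg_comp _ _ _ (fun x => eps * x) (fun y => expR (- y)) _ (pinfty_nbhs R)); last exact: cvgr_expR.
exact: gt0_cvgMry.
Qed.

Lemma laplace_cst : (\int[mu]_(w in `[0%R, +oo[) (e w)%:E = (eps^-1)%:E)%E.
Proof.
apply: (@ge0_FTC2y R e (fun w => - eps^-1 * e w) 0 0).
- by rewrite /e mulr0 expR0 mulr1 sub0r opprK.
- by move=> x _; exact: expR_ge0.
- move=> x _; apply: is_derive_eq (derivZ (- eps^-1) (de x)) _.
  by field; rewrite gt_eqF.
- by move=> x _; exact: deriv_continuous (de x).
- rewrite -(mulr0 (- eps^-1)); apply: cvgM; [exact: cvg_cst|exact: e_cvg].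
Qed.

Lemma e_integrable : mu.-integrable `[0, +oo[ (EFin \o e).
Proof.
apply/integrableP; split.
  apply/measurable_EFinP; apply: measurable_funTS; apply: continuous_measurable_fun.
  by move=> x; exact: deriv_continuous (de x).
under eq_integral => v _ do rewrite /= ger0_norm ?expR_ge0//.
by rewrite laplace_cst ltry.
Qed.

(** The shift by 1 makes the integrand nonnegative, as the half-line fundamental theorem of calculus
    requires; [G] is its antiderivative vanishing at infinity, and the shift is subtracted
    afterwards. *)
Lemma laplace_1Dcos (x : R) :
  (\int[mu]_(w in `[0%R, +oo[) (e w * (1 + cos (x * w)))%:E
    = (eps^-1 + eps / (eps ^+ 2 + x ^+ 2))%:E)%E.
Proof.
have d0 : eps ^+ 2 + x ^+ 2 != 0.
  by rewrite gt_eqF// ltr_pwDl ?sqr_ge0// exprn_gt0.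
pose G w := e w * (- eps^-1 + (eps ^+ 2 + x ^+ 2)^-1 * (x * sin (x * w) - eps * cos (x * w))).
apply: (@ge0_FTC2y R _ G 0 0).
- rewrite /G /e !mulr0 expR0 sin0 cos0.
  by field; rewrite d0 gt_eqF.
- by move=> w _; rewrite mulr_ge0 ?expR_ge0// -lerBlDl sub0r; exact: cos_geN1.
- move=> w _.
  have dx := derivZ x (deriv_id w).
  have h := derivM (de w) (derivD (deriv_cst (- eps^-1) w) (derivZ (eps ^+ 2 + x ^+ 2)^-1
     (derivB (derivZ x (deriv_sin dx)) (derivZ eps (deriv_cos dx))))).
  apply: is_derive_eq h _.
  by field; rewrite d0 gt_eqF.
- move=> w _.
  have dx := derivZ x (deriv_id w).
  exact: deriv_continuous (derivM (de w) (derivD (deriv_cst 1 w) (deriv_cos dx))).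
- pose C := `|eps^-1| + `|(eps ^+ 2 + x ^+ 2)^-1| * (`|x| + `|eps|).
  apply/norm_cvg0P.
  apply: (@squeeze_cvgr _ _ _ _ (fun=> 0) (fun w => e w * C)).
  + near=> w; rewrite normr_ge0/= /G normrM (ger0_norm (expR_ge0 _)) ler_wpM2l ?expR_ge0//.
    rewrite (le_trans (ler_normD _ _))// normrN lerD2l normrM ler_wpM2l//.
    rewrite (le_trans (ler_normB _ _))// !normrM lerD// ler_piMr//.
      exact: sin_max.
    exact: cos_max.
  + exact: cvg_cst.
  + by rewrite -(mul0r C); apply: cvgM; [exact: e_cvg|exact: cvg_cst].
Unshelve. all: by end_near. Qed.

Lemma laplace_cos (x : R) :
  \int[mu]_(w in `[0, +oo[) (e w * cos (x * w)) = eps / (eps ^+ 2 + x ^+ 2).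
Proof.
have i1 : mu.-integrable `[0, +oo[ (EFin \o (fun w => e w * (1 + cos (x * w)))).
  apply/integrableP; split.
    apply/measurable_EFinP; apply: measurable_funTS; apply: continuous_measurable_fun => w.
    have dx := derivZ x (deriv_id w).
    exact: deriv_continuous (derivM (de w) (derivD (deriv_cst 1 w) (deriv_cos dx))).
  under eq_integral => v _.
    rewrite /= ger0_norm; last first.
      by rewrite mulr_ge0 ?expR_ge0// -lerBlDl sub0r; exact: cos_geN1.
    over.
  by rewrite laplace_1Dcos ltry.
have -> : (fun w => e w * cos (x * w)) = (fun w => e w * (1 + cos (x * w)) - e w).
  by apply/funext => w; ring.
rewrite RintegralB//; last exact: e_integrable.
by rewrite /Rintegral laplace_1Dcos laplace_cst /= addrAC subrr add0r.
Qed.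

End laplace.

Lemma Rintegral_dominated d (T : measurableType d) (R : realType)
    (m : {measure set T -> \bar R}) (f_ : nat -> T -> R) (f g : T -> R) :
  (forall n, measurable_fun setT (f_ n)) -> measurable_fun setT f ->
  (forall x, f_ n x @[n --> \oo] --> f x) ->
  m.-integrable setT (EFin \o g) -> (forall n x, `|f_ n x| <= g x) ->
  \int[m]_x f_ n x @[n --> \oo] --> \int[m]_x f x.
Proof.
move=> mf_ mf ff ig fg.
have h : {ae m, forall x, setT x -> (f_ n x)%:E @[n --> \oo] --> (f x)%:E}.
  by apply: aeW => x _; apply: cvg_EFin; [exact: nearW|exact: ff].
have h' : {ae m, forall x n, setT x -> (`|(f_ n x)%:E| <= (g x)%:E)%E}.
  by apply: aeW => x n _; rewrite lee_fin.
have [h1 _ h2] := dominated_convergence measurableT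
  (fun n => (measurable_EFinP setT (f_ n)).2 (mf_ n)) ((measurable_EFinP setT f).2 mf) h ig h'.
apply: fine_cvg; rewrite /Rintegral fineK//.
exact: integrable_fin_num.
Qed.

Lemma Rintegral_indicM d (T : measurableType d) (R : realType)
    (m : {measure set T -> \bar R}) (D : set T) (f : T -> R) :
  \int[m]_(x in D) f x = \int[m]_x (\1_D x * f x).
Proof.
rewrite Rintegral_mkcond; apply: eq_Rintegral => x _.
by rewrite patch_indic /= mulrC.
Qed.

Lemma integrable_indicM d (T : measurableType d) (R : realType)
    (m : {measure set T -> \bar R}) (D : set T) (f : T -> R) : measurable D ->
  m.-integrable D (EFin \o f) <-> m.-integrable setT (fun x => (\1_D x * f x)%:E).
Proof.
move=> mD; rewrite (integrable_mkcond _ mD).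
have -> : (EFin \o f) \_ D = (fun x => (\1_D x * f x)%:E).
  apply/funext => x; rewrite patchE indicE.
  by case: ifPn => _ /=; rewrite ?mul1r ?mul0r.
by [].
Qed.

Section damped_inversion.
Context {R : realType}.
Notation mu := (@lebesgue_measure R).
Notation I := (`]0, +oo[%classic : set (measurableTypeR R)).
Variable eps : R.
Hypothesis eps0 : 0 < eps.
Let e (w : R) := expR (- eps * w).
(** Damping on the positive half-line, extended by 0, so that all integrals in the frequency run
    over the whole line and fit the exchange lemma. *)
Let chi (w : R) : R := \1_I w * e w.

Lemma measurable_indicI (D : set (measurableTypeR R)) : measurable D ->
  measurable_fun (setT : set (measurableTypeR R)) (\1_D : R -> R).
Proof. by move=> mD; exact: measurable_indic. Qed.

Let me' : measurable_fun (setT : set (measurableTypeR R)) e.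
Proof.
apply: (measurableT_comp (@measurable_expR R)).
by apply: measurable_funM => //; exact: measurable_cst.
Qed.

Let mchi : measurable_fun (setT : set (measurableTypeR R)) chi.
Proof. by apply: measurable_funM; [exact: measurable_indicI|exact: me']. Qed.

Lemma damping_integrable : mu.-integrable setT (EFin \o chi).
Proof.
apply/(@integrable_indicM _ _ _ mu I e) => //.
apply: integrableS (e_integrable eps0) => //.
by apply: subset_itvr; rewrite bnd_simp.
Qed.

Let chi_ge0 w : 0 <= chi w.
Proof. by rewrite mulr_ge0// ?expR_ge0. Qed.

Lemma damped_cos_integrable (x : R) :
  mu.-integrable setT (fun w => (chi w * cos (x * w))%:E).
Proof.
apply: (le_integrable measurableT _ _ damping_integrable).
  apply/measurable_EFinP; apply: measurable_funM; first exact: mchi.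
  by apply: continuous_measurable_fun; exact: continuous_cosM.
move=> w _; rewrite /= lee_fin normrM !(ger0_norm (chi_ge0 w)) ler_piMr//.
exact: cos_max.
Qed.

Lemma damped_cos (x : R) : \int[mu]_w (chi w * cos (x * w)) = eps / (eps ^+ 2 + x ^+ 2).
Proof.
rewrite -(laplace_cos eps0) -Rintegral_itv_obnd_cbnd; last first.
  apply/(@integrable_indicM _ _ _ mu I (fun w => e w * cos (x * w))) => //.
  by apply: eq_integrable (damped_cos_integrable x) => // w _; rewrite mulrA.
by rewrite [in RHS]Rintegral_indicM; apply: eq_Rintegral => w _; rewrite mulrA.
Qed.

Lemma Rintegral_arctan (x : R) : 0 <= x ->
  \int[mu]_(s in `[0, x]) (eps / (eps ^+ 2 + s ^+ 2)) = atan (x / eps).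
Proof.
move=> x0.
have d0 s : eps ^+ 2 + s ^+ 2 != 0.
  by rewrite gt_eqF// ltr_pwDl ?sqr_ge0// exprn_gt0.
have cd (s : R) : {for s, continuous (fun s : R => eps / (eps ^+ 2 + s ^+ 2))}.
  have h := derivD (deriv_cst (eps ^+ 2) s) (derivX 2 (deriv_id s)).
  apply: cvgM; first exact: cvg_cst.
  by apply: cvgV; [exact: d0|exact: deriv_continuous h].
have hd (s : R) : is_derive s 1 (fun s => atan (s / eps)) (eps / (eps ^+ 2 + s ^+ 2)).
  have h := @deriv_comp R atan (fun s => s / eps) s _ _ (@is_derive1_atan R (s / eps)) (derivM (deriv_id s) (deriv_cst eps^-1 s)).
  have d1 : 1 + (s / eps) ^+ 2 != 0 by rewrite gt_eqF// ltr_pwDl ?sqr_ge0.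
  apply: is_derive_eq h _.
  by field; rewrite d0 gt_eqF.
have [_ ->] := Rintegral_FTC2 x0 hd cd.
by rewrite mul0r atan0 subr0.
Qed.

Lemma sinc_le (x w : R) : `|chi w * (sin (x * w) / w)| <= `|x| * chi w.
Proof.
rewrite normrM (ger0_norm (chi_ge0 w)) mulrC /chi indicE.
case: (boolP (w \in I)) => [|_]; last by rewrite mul0r !mulr0.
rewrite inE/= in_itv/= andbT => w0; rewrite mul1r ler_wpM2r ?expR_ge0//.
rewrite normrM normfV (ger0_norm (ltW w0)) ler_pdivrMr//.
by apply: le_trans (sin_abs_le _) _; rewrite normrM (ger0_norm (ltW w0)).
Qed.

(** For [x >= 0], [sin (x * w) / w] is the integral of [cos (s * w)] over [s] in [[0, x]].
    Exchanging the integrals leaves [eps / (eps^2 + s^2)], whose primitive is the arctangent;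
    oddness covers [x < 0]. *)
Lemma damped_sin (x : R) : \int[mu]_w (chi w * (sin (x * w) / w)) = atan (x / eps).
Proof.
wlog x0 : x / 0 <= x.
  move=> h; have [|/ltW x0] := leP 0 x; first exact: h.
  have := h (- x); rewrite oppr_ge0 => /(_ x0).
  rewrite mulNr atanN => /(congr1 -%R); rewrite opprK => <-.
  rewrite -[RHS]mulN1r -RintegralZl//.
    by apply: eq_Rintegral => w _; rewrite (mulNr x) sinN; ring.
  apply: (le_integrable measurableT _ _ (integrableZl measurableT (`|x|) damping_integrable)).
    apply/measurable_EFinP; apply: measurable_funM; first exact: mchi.
    apply: measurable_funM; last exact: measurable_inv.
    apply: (measurableT_comp (@continuous_measurable_fun _ sin (@continuous_sin R))).
    by apply: measurable_funM => //; exact: measurable_cst.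
  move=> w _; rewrite /= lee_fin; apply: le_trans (sinc_le _ _) _.
  by rewrite normrN ler_norm.
pose J := (`[0, x]%classic : set (measurableTypeR R)).
pose f (z : measurableTypeR R * measurableTypeR R) : R :=
  chi z.1 * (cos (z.1 * z.2) * \1_J z.2).
have mJ : measurable J by exact: measurable_itv.
have mf : measurable_fun setT f.
  apply: measurable_funM; first exact: (measurableT_comp mchi).
  apply: measurable_funM; last exact: (measurableT_comp (measurable_indicI mJ) measurable_snd).
  apply: (measurableT_comp (@continuous_measurable_fun _ cos (@continuous_cos R))).
  exact: measurable_funM.
have iJ : mu.-integrable setT (EFin \o (\1_J : _ -> R)).
  exact: (@integrable_indic_itv R 0 x true false).
have f_le s t : `|f (s, t)| <= chi s * \1_J t.
  rewrite /f/= normrM (ger0_norm (chi_ge0 s)) ler_wpM2l// normrM.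
  by rewrite [X in _ * X]ger0_norm// ler_piMl// cos_max.
have := Rintegral_swap mf damping_integrable iJ f_le.
have -> : \int[mu]_s \int[mu]_t f (s, t) = \int[mu]_w (chi w * (sin (x * w) / w)).
  apply: eq_Rintegral => w _; rewrite /f/=.
  have ic : mu.-integrable setT (fun t => (\1_J t * cos (w * t))%:E).
    apply/(@integrable_indicM _ _ _ mu J (fun t => cos (w * t))) => //.
    apply: continuous_compact_integrable; first exact: segment_compact.
    by apply: continuous_subspaceT; exact: continuous_cosM.
  under eq_Rintegral do rewrite [cos _ * _]mulrC.
  rewrite RintegralZl// -Rintegral_indicM /chi indicE.
  case: (boolP (w \in I)) => [|_]; last by rewrite !mul0r.
  rewrite inE/= in_itv/= andbT => w0; congr (_ * _).
  have hd (t : R) : is_derive t 1 (fun t => w^-1 * sin (w * t)) (cos (w * t)).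
    apply: is_derive_eq (derivZ w^-1 (deriv_sin (derivZ w (deriv_id t)))) _.
    by field; rewrite gt_eqF.
  have [_ ->] := Rintegral_FTC2 x0 hd (@continuous_cosM R w).
  by rewrite !mulr0 sin0 mulr0 subr0 mulrC (mulrC w).
move=> ->; rewrite -(Rintegral_arctan x0) [in RHS]Rintegral_indicM.
apply: eq_Rintegral => s _; rewrite -damped_cos -RintegralZl//.
  by apply: eq_Rintegral => w _; rewrite /f/= (mulrC w); ring.
exact: damped_cos_integrable.
Qed.

End damped_inversion.

Section gil_pelaez.
Context d (T : measurableType d) {R : realType} (P : probability T R).
Notation mu := (@lebesgue_measure R).
Notation I := (`]0, +oo[%classic : set (measurableTypeR R)).
Variable X : T -> R.
Hypothesis mX : measurable_fun setT X.
Hypothesis iX : P.-integrable setT (EFin \o X).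
Variable C : R.
Let phis (w : R) := \int[P]_t sin (X t * w).
Let phic (w : R) := \int[P]_t cos (X t * w).
Hypothesis phis_le : forall w, 1 <= w -> `|phis w| <= C * w `^ (- 2).
Hypothesis phic_le : forall w, 1 <= w -> `|phic w| <= C * w `^ (- 2).

Let damp (eps w : R) : R := \1_I w * expR (- eps * w).

Let mdamp eps : measurable_fun (setT : set (measurableTypeR R)) (damp eps).
Proof.
apply: measurable_funM; first exact: measurable_indicI.
apply: (measurableT_comp (@measurable_expR R)).
by apply: measurable_funM => //; exact: measurable_cst.
Qed.

Let damp_ge0 eps w : 0 <= damp eps w.
Proof. by rewrite mulr_ge0// expR_ge0. Qed.

Let mXw (g : R -> R) : continuous g ->
  measurable_fun setT (fun z : measurableTypeR R * T => g (X z.2 * z.1)).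
Proof.
move=> cg; apply: (measurableT_comp (continuous_measurable_fun cg)).
by apply: measurable_funM => //; exact: (measurableT_comp mX).
Qed.

Let sin_bm w : bounded_measurable (fun t => sin (X t * w)).
Proof.
split; last by exists 1 => t; exact: sin_max.
apply: (measurableT_comp (continuous_measurable_fun (@continuous_sin R))).
by apply: measurable_funM => //; exact: measurable_cst.
Qed.

Let cos_bm w : bounded_measurable (fun t => cos (X t * w)).
Proof.
split; last by exists 1 => t; exact: cos_max.
apply: (measurableT_comp (continuous_measurable_fun (@continuous_cos R))).
by apply: measurable_funM => //; exact: measurable_cst.
Qed.

Let iabsX : P.-integrable setT (EFin \o (fun t => `|X t|)).
Proof. exact: integrable_norm. Qed.

Let i1 : P.-integrable setT (EFin \o (fun=> 1 : R)).
Proof. by apply: bm_integrable; exact: bmcst. Qed.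

Lemma damp_le eps w y : 0 < eps -> `|damp eps w * y| <= `|\1_I w * y|.
Proof.
move=> eps0; rewrite /damp indicE.
case: (boolP (w \in I)) => [|_]; last by rewrite !mul0r.
rewrite inE/= in_itv/= andbT !mul1r => w0; rewrite normrM ler_piMl//.
by rewrite (ger0_norm (expR_ge0 _)) -expR0 ler_expR mulNr oppr_le0 mulr_ge0// ltW.
Qed.

(** The damping gives integrability in the frequency and the integrability of [X] controls the
    quotient near 0, so the mean and the frequency integral commute. *)
Lemma damped_mean_sin eps : 0 < eps ->
  \int[mu]_w (damp eps w * (phis w / w)) = \int[P]_t atan (X t / eps).
Proof.
move=> eps0.
pose f (z : measurableTypeR R * T) := damp eps z.1 * (sin (X z.2 * z.1) / z.1).
have mf : measurable_fun setT f.
  apply: measurable_funM; first exact: (measurableT_comp (mdamp eps) measurable_fst).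
  apply: measurable_funM; first exact: (mXw (@continuous_sin R)).
  exact: (measurableT_comp (@measurable_inv R) measurable_fst).
have f_le w t : `|f (w, t)| <= damp eps w * `|X t|.
  by rewrite mulrC; exact: sinc_le.
have := Rintegral_swap mf (damping_integrable eps0) iabsX f_le.
rewrite /f/= => h.
transitivity (\int[mu]_x \int[P]_y (damp eps x * (sin (X y * x) / x))).
  apply: eq_Rintegral => w _.
  have -> : damp eps w * (phis w / w) = (damp eps w / w) * \int[P]_t sin (X t * w).
    by rewrite /phis; ring.
  rewrite -bm_intZ; last exact: sin_bm.
  by apply: eq_Rintegral => t _; ring.
rewrite h; apply: eq_Rintegral => t _; exact: damped_sin.
Qed.

Lemma damped_mean_cos eps : 0 < eps ->
  \int[mu]_w (damp eps w * phic w) = \int[P]_t (eps / (eps ^+ 2 + X t ^+ 2)).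
Proof.
move=> eps0.
pose f (z : measurableTypeR R * T) := damp eps z.1 * cos (X z.2 * z.1).
have mf : measurable_fun setT f.
  apply: measurable_funM; first exact: (measurableT_comp (mdamp eps) measurable_fst).
  exact: (mXw (@continuous_cos R)).
have f_le w t : `|f (w, t)| <= damp eps w * 1.
  by rewrite /f/= normrM (ger0_norm (damp_ge0 _ _)) ler_wpM2l// cos_max.
have := Rintegral_swap mf (damping_integrable eps0) i1 f_le.
rewrite /f/= => h.
transitivity (\int[mu]_x \int[P]_y (damp eps x * cos (X y * x))).
  by apply: eq_Rintegral => w _; rewrite /phic bm_intZ.
rewrite h; apply: eq_Rintegral => t _; exact: damped_cos.
Qed.

(** Fubini's theorem yields measurability in [w] for the damped integrand, which is integrable on
    the product; multiplying by [expR w] removes the damping. *)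
Lemma undamped_measurable (g : R -> R) : continuous g -> (forall x, `|g x| <= 1) ->
  measurable_fun (setT : set (measurableTypeR R)) (fun w => \1_I w * \int[P]_t g (X t * w)).
Proof.
move=> cg g1.
pose f (z : measurableTypeR R * T) := damp 1 z.1 * g (X z.2 * z.1).
have mf : measurable_fun setT f.
  apply: measurable_funM; first exact: (measurableT_comp (mdamp 1) measurable_fst).
  exact: mXw.
have f_le w t : `|f (w, t)| <= damp 1 w * 1.
  by rewrite /f/= normrM (ger0_norm (damp_ge0 _ _)) ler_wpM2l.
have /measurable_int /measurable_EFinP h := swap_integrable1 mf (damping_integrable ltr01) i1 f_le.
have -> : (fun w => \1_I w * \int[P]_t g (X t * w)) =
    (fun w => (\int[P]_t f (w, t)) * expR w).
  apply/funext => w; rewrite /f/= bm_intZ.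
    have -> : damp 1 w = \1_I w * (expR w)^-1 by rewrite /damp mulN1r expRN.
    by rewrite -!mulrA [_ * expR w]mulrC mulKf// gt_eqF// expR_gt0.
  split; last by exists 1.
  apply: (measurableT_comp (continuous_measurable_fun cg)).
  by apply: measurable_funM => //; exact: measurable_cst.
by apply: measurable_funM => //; exact: measurable_expR.
Qed.

Lemma half_line_integrable (K : R) (g : R -> R) :
  measurable_fun (setT : set (measurableTypeR R)) (fun w => \1_I w * g w) ->
  (forall w, 0 < w -> w <= 1 -> `|g w| <= K) ->
  (forall w, 1 <= w -> `|g w| <= C * w `^ (- 2)) ->
  mu.-integrable setT (fun w => (\1_I w * g w)%:E).
Proof.
move=> mg g0 g1.
pose J1 := (`[0, 1]%classic : set (measurableTypeR R)).
pose J2 := (`[1, +oo[%classic : set (measurableTypeR R)).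
have mJ2 : measurable J2 by exact: measurable_itv.
have i2 : mu.-integrable setT (fun w => (\1_J2 w * w `^ (- 2))%:E).
  by apply/(@integrable_indicM _ _ _ mu J2 (fun w => w `^ (- 2))) => //; apply: powR_tail_integrable; rewrite ltr1n.
have iJ1 := @integrable_indic_itv R 0 1 true false.
have iB : mu.-integrable setT (fun w => (K%:E * (\1_J1 w)%:E + C%:E * (\1_J2 w * w `^ (- 2))%:E)%E).
  by apply: integrableD => //; exact: integrableZl.
have K0 : 0 <= K by apply: le_trans (g0 1 _ _).
have C0 : 0 <= C.
  by have := le_trans (normr_ge0 _) (g1 1 (lexx _)); rewrite powR1 mulr1.
apply: (le_integrable measurableT _ _ iB); first exact/measurable_EFinP.
move=> w _; rewrite /= lee_fin normrM (ger0_norm (_ : 0 <= \1_I w))//.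
rewrite (le_trans _ (ler_norm _))// !indicE.
case: (boolP (w \in I)) => [|_]; last first.
  by rewrite mul0r addr_ge0// mulr_ge0// mulr_ge0// powR_ge0.
rewrite inE/= in_itv/= andbT mul1r => w0.
have [w1|w1] := leP w 1.
  have -> : w \in J1 by apply: mem_set; rewrite /J1/= in_itv/= w1 ltW.
  rewrite mulr1.
  by rewrite (le_trans (g0 _ w0 w1))// lerDl !mulr_ge0// powR_ge0.
have -> : w \in J2 by apply: mem_set; rewrite /J2/= in_itv/= (ltW w1).
by rewrite mul1r (le_trans (g1 _ (ltW w1)))// lerDr mulr_ge0.
Qed.

(** Near 0 the quotient is bounded by the mean of [|X|]; beyond 1 the assumed decay takes over. *)
Lemma sinc_mean_integrable : mu.-integrable setT (fun w => (\1_I w * (phis w / w))%:E).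
Proof.
apply: (@half_line_integrable (\int[P]_t `|X t|)).
- have -> : (fun w => \1_I w * (phis w / w)) = (fun w => (\1_I w * phis w) * w^-1).
    by apply/funext => w; rewrite mulrA.
  apply: measurable_funM; last exact: measurable_inv.
  by apply: undamped_measurable; [exact: continuous_sin|exact: sin_max].
- move=> w w0 w1; rewrite normrM normfV (ger0_norm (ltW w0)) ler_pdivrMr//.
  apply: le_trans (le_normr_Rintegral _ (bm_integrable P (sin_bm w))) _ => //.
  rewrite -RintegralZr//; apply: le_Rintegral => //.
  + by apply: integrable_norm => //; exact: (bm_integrable P (sin_bm w)).
  + by have := integrableZr measurableT w iabsX.
  + by move=> t _; apply: le_trans (sin_abs_le _) _; rewrite normrM (ger0_norm (ltW w0)).
- move=> w w1; have w0 : 0 < w by apply: lt_le_trans w1.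
  rewrite normrM normfV (ger0_norm (ltW w0)).
  apply: le_trans (phis_le w1); rewrite ler_piMr// invf_le1//.
Qed.

Lemma cos_mean_integrable : mu.-integrable setT (fun w => (\1_I w * phic w)%:E).
Proof.
apply: (@half_line_integrable 1).
- by apply: undamped_measurable; [exact: continuous_cos|exact: cos_max].
- by move=> w _ _; apply: bm_int_norm => // t; exact: cos_max.
- exact: phic_le.
Qed.

(* The mean of [eps / (eps ^+ 2 + X ^+ 2)] is the damped integral of the
   characteristic function, hence bounded, while an atom at 0 of mass [m] makes
   it at least [m / eps]. *)
Lemma no_atom : P [set t | X t = 0] = 0%E.
Proof.
pose K := \int[mu]_w `|\1_I w * phic w|.
have mE : measurable [set t | X t = 0].
  by rewrite -[X in measurable X]setTI; exact: (mX measurableT (measurable_set1 0)).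
have PE : P [set t | X t = 0] \is a fin_num by exact: fin_num_measure.
have bE : bounded_measurable (\1_[set t | X t = 0] : T -> R).
  split; first exact: measurable_indic.
  by exists 1 => t; rewrite indicE; case: (_ \in _); rewrite ?normr1 ?normr0.
have h eps : 0 < eps -> fine (P [set t | X t = 0]) <= K * eps.
  move=> eps0; rewrite -ler_pdivrMr//.
  have d0 (x : R) : 0 < eps ^+ 2 + x ^+ 2.
    by rewrite ltr_pwDl ?sqr_ge0// exprn_gt0.
  have bq : bounded_measurable (fun t => eps / (eps ^+ 2 + X t ^+ 2)).
    split; last first.
      exists eps^-1 => t; rewrite ger0_norm; last by rewrite divr_ge0// ltW.
      rewrite ler_pdivrMr// mulrDr expr2 mulrA mulVf ?gt_eqF// mul1r lerDl.
      by rewrite mulr_ge0 ?sqr_ge0// invr_ge0 ltW.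
    apply: measurable_funM; first exact: measurable_cst.
    apply: (measurableT_comp (@measurable_inv R)).
    by apply: measurable_funD; [exact: measurable_cst|exact: measurable_funX].
  apply: (@le_trans _ _ (\int[P]_t (eps / (eps ^+ 2 + X t ^+ 2)))).
    have -> : fine (P [set t | X t = 0]) / eps =
        \int[P]_t (eps^-1 * \1_[set t | X t = 0] t).
      by rewrite bm_intZ// mulrC /Rintegral integral_indic// setIT.
    apply: bm_int_le => //; first exact: bmZ.
    move=> t; rewrite indicE; case: (boolP (t \in _)) => [|_].
      rewrite inE/= => ->; rewrite expr0n/= addr0 mulr1 expr2 invfM mulrA.
      by rewrite mulfV ?gt_eqF// mul1r.
    by rewrite mulr0 divr_ge0// ltW.
  rewrite -damped_mean_cos//; apply: le_trans (ler_norm _) _.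
  have id : mu.-integrable setT (fun w => (damp eps w * phic w)%:E).
    apply: (le_integrable measurableT _ _ cos_mean_integrable).
      have -> : (fun w => (damp eps w * phic w)%:E) =
          (fun w => (expR (- eps * w) * (\1_I w * phic w))%:E).
        by apply/funext => w; rewrite /damp; congr EFin; ring.
      apply/measurable_EFinP; apply: measurable_funM.
        apply: (measurableT_comp (@measurable_expR R)).
        by apply: measurable_funM => //; exact: measurable_cst.
      by apply: undamped_measurable; [exact: continuous_cos|exact: cos_max].
    by move=> w _; rewrite /= lee_fin; exact: damp_le.
  apply: le_trans (le_normr_Rintegral _ id) _ => //.
  apply: le_Rintegral => //.
  - exact: integrable_norm.
  - by apply: integrable_norm => //; exact: cos_mean_integrable.
  - by move=> w _; exact: damp_le.
rewrite -(fineK PE); congr EFin; apply/eqP; rewrite eq_le fine_ge0// andbT.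
apply/ler_addgt0Pr => e e0; rewrite add0r.
have K1 : 0 < K + 1.
  by rewrite ltr_pwDr// Rintegral_ge0.
apply: le_trans (h (e / (K + 1)) _) _; first by rewrite divr_gt0.
rewrite mulrA ler_pdivrMr// mulrC ler_wpM2l ?(ltW e0)//.
by rewrite lerDl.
Qed.

(** The sign is 1 minus twice the indicator of [X < 0] minus the indicator of [X = 0], and the last
    event is null. *)
Lemma mean_sign : \int[P]_t (pi / 2 * Num.sg (X t)) =
  pi / 2 * (1 - 2 * fine (P [set t | X t < 0])).
Proof.
have mneg : measurable [set t | X t < 0].
  by rewrite -[X in measurable X]setTI; apply: (measurable_fun_ltr mX (measurable_cst (0 : R)) measurableT (Y := [set true])).
have m0 : measurable [set t | X t = 0].
  by rewrite -[X in measurable X]setTI; exact: (mX measurableT (measurable_set1 0)).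
have b A : measurable A -> bounded_measurable (\1_A : T -> R).
  move=> mA; split; first exact: measurable_indic.
  by exists 1 => t; rewrite indicE; case: (_ \in _); rewrite ?normr1 ?normr0.
have sgE t : Num.sg (X t) = 1 - 2 * \1_[set t | X t < 0] t - \1_[set t | X t = 0] t.
  rewrite !indicE.
  have [n0|n0|n0] := ltrgt0P (X t).
  - rewrite memNset/=; last by rewrite lt_gtF.
    by rewrite memNset/=; [rewrite gtr0_sg//; ring|move=> h; rewrite h ltxx in n0].
  - rewrite mem_set//= memNset/=; [by rewrite ltr0_sg//; ring|].
    by move=> h; rewrite h ltxx in n0.
  - rewrite memNset/=; last by rewrite n0 ltxx.
    by rewrite mem_set//= n0 sgr0; ring.
under eq_Rintegral do rewrite sgE.
have intA A : measurable A -> \int[P]_t (\1_A t : R) = fine (P A).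
  by move=> mA; rewrite /Rintegral integral_indic// setIT.
rewrite bm_intZ; last by apply: bmB; [apply: bmB; [exact: bmcst|apply: bmZ; exact: b]|exact: b].
rewrite bm_intB; [|by apply: bmB; [exact: bmcst|apply: bmZ; exact: b]|exact: b].
rewrite bm_intB; [|exact: bmcst|by apply: bmZ; exact: b].
rewrite bm_int_cst bm_intZ; last exact: b.
rewrite !intA//.
have := no_atom => /(congr1 fine) /= h.
by rewrite [X in _ - X]h subr0.
Qed.

(** The damping tends to 0 in the identity of [damped_mean_sin]: the left side converges by
    domination, and on the right [atan (X / eps)] tends boundedly to [pi / 2] times the sign of
    [X]. *)
Lemma sinc_integral : \int[mu]_w (\1_I w * (phis w / w)) =
  pi / 2 * (1 - 2 * fine (P [set t | X t < 0])).
Proof.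
rewrite -mean_sign.
pose eps (n : nat) : R := n.+1%:R^-1.
have eps0 n : 0 < eps n by rewrite invr_gt0.
have epsc : eps n @[n --> \oo] --> (0 : R) by exact: cvg_harmonic.
have mphi : measurable_fun (setT : set (measurableTypeR R)) (fun w => \1_I w * (phis w / w)).
  by have /measurable_int /measurable_EFinP := sinc_mean_integrable.
have ig : mu.-integrable setT (EFin \o (fun w => `|\1_I w * (phis w / w)|)).
  by apply: integrable_norm => //; exact: sinc_mean_integrable.
have h1 : \int[mu]_w (damp (eps n) w * (phis w / w)) @[n --> \oo] -->
    \int[mu]_w (\1_I w * (phis w / w)).
  apply: (@Rintegral_dominated _ _ _ mu _ _ _ _ _ _ ig) => //.
  - move=> n.
    have -> : (fun w => damp (eps n) w * (phis w / w)) =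
        (fun w => expR (- eps n * w) * (\1_I w * (phis w / w))).
      by apply/funext => w; rewrite /damp; ring.
    apply: measurable_funM => //.
    apply: (measurableT_comp (@measurable_expR R)).
    by apply: measurable_funM => //; exact: measurable_cst.
  - move=> w; apply: cvgM; last exact: cvg_cst.
    rewrite -[X in _ --> X]mulr1; apply: cvgM; first exact: cvg_cst.
    rewrite -expR0; apply: (@cvg_comp _ _ _ (fun n => - eps n * w) expR _ (nbhs (0 : R))); last exact: continuous_expR.
    rewrite -(mul0r w) -oppr0; apply: cvgM; last exact: cvg_cst.
    by rewrite oppr0 -[X in _ --> X]oppr0; exact: cvgN.
  - by move=> n w; exact: damp_le.
have h2 : \int[P]_t atan (X t / eps n) @[n --> \oo] --> \int[P]_t (pi / 2 * Num.sg (X t)).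
  apply: (@Rintegral_dominated _ _ _ P _ _ (fun=> pi / 2)).
  - move=> n; apply: (measurableT_comp (continuous_measurable_fun (@continuous_atan R))).
    by apply: measurable_funM => //; exact: measurable_cst.
  - apply: measurable_funM; first exact: measurable_cst.
    have -> : (fun t => Num.sg (X t)) = (fun t => if X t < 0 then -1 else if X t == 0 then 0 else 1).
      by apply/funext => t; rewrite /Num.sg; case: ltrgt0P.
    apply: measurable_fun_ifT; [|exact: measurable_cst|].
      by apply: measurable_fun_ltr => //; exact: measurable_cst.
    apply: measurable_fun_ifT; [|exact: measurable_cst|exact: measurable_cst].
    by apply: measurable_fun_eqr => //; exact: measurable_cst.
  - move=> t; rewrite /eps; under eq_fun do rewrite invrK.
    have pos (x : R) : 0 < x -> atan (x * n.+1%:R) @[n --> \oo] --> pi / 2.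
      move=> x0; apply: (@cvg_comp _ _ _ (fun n => x * n.+1%:R) atan _ (pinfty_nbhs R)); last exact: cvgy_atan.
      apply/cvgryPge => A; near=> n; rewrite -ler_pdivrMl// mulrC.
      by rewrite (@le_trans _ _ n%:R)// ?ler_nat//; near: n; exact: nbhs_infty_ger.
    have [n0|n0|n0] := ltrgt0P (X t).
    + by rewrite gtr0_sg// mulr1; exact: pos.
    + rewrite ltr0_sg// mulrN1.
      under eq_fun do rewrite -(opprK (X t)) mulNr atanN.
      by apply: cvgN; apply: pos; rewrite oppr_gt0.
    + rewrite n0 sgr0 mulr0; under eq_fun do rewrite mul0r atan0.
      exact: cvg_cst.
  - by apply: bm_integrable; exact: bmcst.
  - by move=> n t; rewrite ler_norml !ltW// ?atan_gtNpi2 ?atan_ltpi2.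
have h3 : (fun n => \int[mu]_w (damp (eps n) w * (phis w / w))) =
    (fun n => \int[P]_t atan (X t / eps n)).
  by apply/funext => n; exact: damped_mean_sin.
rewrite h3 in h1.
exact: (cvg_unique _ h1 h2).
Unshelve. all: by end_near. Qed.

Theorem gil_pelaez_inversion : fine (P [set t | X t < 0]) =
  2^-1 - \int[mu]_(w in I) (phis w / (pi * w)).
Proof.
have -> : \int[mu]_(w in I) (phis w / (pi * w)) =
    pi^-1 * \int[mu]_w (\1_I w * (phis w / w)).
  rewrite -RintegralZl//; last exact: sinc_mean_integrable.
  by rewrite Rintegral_indicM; apply: eq_Rintegral => w _; rewrite invfM; ring.
rewrite sinc_integral mulrA mulrA mulVf ?gt_eqF ?pi_gt0// mul1r.
by field.
Qed.

End gil_pelaez.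

(** * Complex-valued integrals *)

Notation normc := Normc.normc.

Section complex_basics.
Context {R : realType}.
Implicit Types (z w : R[i]) (x y : R).

Lemma complexP z w : complex.Re z = complex.Re w -> complex.Im z = complex.Im w -> z = w.
Proof. by case: z => a b; case: w => c d /= -> ->. Qed.

Lemma cReM z w : complex.Re (z * w) =
  complex.Re z * complex.Re w - complex.Im z * complex.Im w.
Proof. by case: z => a b; case: w. Qed.

Lemma cImM z w : complex.Im (z * w) =
  complex.Re z * complex.Im w + complex.Im z * complex.Re w.
Proof. by case: z => a b; case: w. Qed.

Lemma ReD z w : complex.Re (z + w) = complex.Re z + complex.Re w.
Proof. by case: z => a b; case: w. Qed.

Lemma ImD z w : complex.Im (z + w) = complex.Im z + complex.Im w.
Proof. by case: z => a b; case: w. Qed.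

Lemma ReN z : complex.Re (- z) = - complex.Re z.
Proof. by case: z. Qed.

Lemma ImN z : complex.Im (- z) = - complex.Im z.
Proof. by case: z. Qed.

Definition ReImE := (cReM, cImM, ReD, ImD, ReN, ImN).

Lemma Re_sum (I : Type) (s : seq I) (p : pred I) (f : I -> R[i]) :
  complex.Re (\sum_(i <- s | p i) f i) = \sum_(i <- s | p i) complex.Re (f i).
Proof. exact: (big_morph _ ReD (erefl : complex.Re (0 : R[i]) = 0)). Qed.

Lemma Im_sum (I : Type) (s : seq I) (p : pred I) (f : I -> R[i]) :
  complex.Im (\sum_(i <- s | p i) f i) = \sum_(i <- s | p i) complex.Im (f i).
Proof. exact: (big_morph _ ImD (erefl : complex.Im (0 : R[i]) = 0)). Qed.

Lemma sqr_normcE z : normc z ^+ 2 = complex.Re z ^+ 2 + complex.Im z ^+ 2.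
Proof. by case: z => a b /=; rewrite sqr_sqrtr// addr_ge0 ?sqr_ge0. Qed.

Lemma normc_ge0 z : 0 <= normc z.
Proof. by case: z => a b /=; exact: sqrtr_ge0. Qed.

Lemma normcD z w : normc (z + w) <= normc z + normc w.
Proof. exact: le_normcD. Qed.

Lemma normcN' z : normc (- z) = normc z.
Proof. exact: normcN. Qed.

Lemma normcB z w : normc (z - w) = normc (w - z).
Proof. by rewrite -normcN' opprB. Qed.

Lemma normc_Re z : `|complex.Re z| <= normc z.
Proof.
rewrite -(@ler_pXn2r _ 2)// ?nnegrE ?normc_ge0//.
by rewrite sqr_normcE real_normK ?num_real// lerDl sqr_ge0.
Qed.

Lemma normc_Im z : `|complex.Im z| <= normc z.
Proof.
rewrite -(@ler_pXn2r _ 2)// ?nnegrE ?normc_ge0//.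
by rewrite sqr_normcE real_normK ?num_real// lerDr sqr_ge0.
Qed.

Lemma normc_real x : normc (Complex x 0) = `|x|.
Proof. by rewrite /= expr0n/= addr0 sqrtr_sqr. Qed.

Lemma normc_imag x : normc (Complex 0 x) = `|x|.
Proof. by rewrite /= expr0n/= add0r sqrtr_sqr. Qed.

Lemma normc_le_ReIm z : normc z <= `|complex.Re z| + `|complex.Im z|.
Proof.
have -> : z = Complex (complex.Re z) 0 + Complex 0 (complex.Im z).
  by apply: complexP; rewrite ReImE /= ?addr0 ?add0r.
by apply: le_trans (normcD _ _) _; rewrite normc_real normc_imag !ReImE/= addr0 add0r.
Qed.

Lemma normcX z n : normc (z ^+ n) = normc z ^+ n.
Proof.
elim: n => [|n IH]; first by rewrite !expr0 Normc.normc1.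
by rewrite !exprS Normc.normcM IH.
Qed.

Lemma natCE n : n%:R = Complex n%:R 0 :> R[i].
Proof. by rewrite -(rmorph_nat (real_complex R)). Qed.

Lemma cexpD z w : cexp (z + w) = cexp z * cexp w.
Proof.
by apply: complexP; rewrite ReImE/= !ReImE expRD ?cosD ?sinD; ring.
Qed.

Lemma cexp0 : cexp (0 : R[i]) = 1.
Proof. by apply: complexP; rewrite /= expR0 ?cos0 ?sin0 mul1r. Qed.

Lemma cexpNK z : cexp (- z) * cexp z = 1.
Proof. by rewrite -cexpD addNr cexp0. Qed.

Lemma normc_cexp z : normc (cexp z) = expR (complex.Re z).
Proof.
rewrite /= !exprMn -mulrDr cos2Dsin2 mulr1 sqrtr_sqr.
by rewrite ger0_norm ?expR_ge0.
Qed.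

Definition cis (x : R) : R[i] := Complex (cos x) (sin x).

Lemma cis_cexp x : cis x = cexp (Complex 0 x).
Proof. by apply: complexP; rewrite /= expR0 mul1r. Qed.

Lemma cisD x y : cis (x + y) = cis x * cis y.
Proof. by apply: complexP; rewrite ReImE /= ?cosD ?sinD; ring. Qed.

Lemma cis0 : cis 0 = 1.
Proof. by rewrite cis_cexp cexp0. Qed.

Lemma cis_sum (I : Type) (s : seq I) (f : I -> R) :
  cis (\sum_(i <- s) f i) = \prod_(i <- s) cis (f i).
Proof. exact: (big_morph _ cisD cis0). Qed.

Lemma normc_cis x : normc (cis x) = 1.
Proof. by rewrite cis_cexp normc_cexp expR0. Qed.

(** Half-angle formula: [1 - cos x] is twice the squared sine of [x / 2]. *)
Lemma cos_ge_quadratic x : 1 - cos x <= x ^+ 2 / 2.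
Proof.
have -> : x = x / 2 + x / 2 by field.
rewrite cosD -!expr2; have := cos2Dsin2 (x / 2).
have : sin (x / 2) ^+ 2 <= (x / 2) ^+ 2.
  by rewrite -(real_normK (num_real (sin _))) -(real_normK (num_real (x / 2))) ler_pXn2r// ?nnegrE// sin_abs_le.
set s := sin _ ^+ 2; set c := cos _ ^+ 2; set y := x / 2 => h1 h2.
by rewrite (_ : (y + y) ^+ 2 / 2 = 2 * y ^+ 2); [lra|field].
Qed.

(** The squared distance is [2 * (1 - cos (x - y))]. *)
Lemma cis_lipschitz x y : normc (cis x - cis y) <= `|x - y|.
Proof.
rewrite -(@ler_pXn2r _ 2)// ?nnegrE ?normc_ge0//.
rewrite sqr_normcE !ReImE/= real_normK ?num_real//.
have := cos_ge_quadratic (x - y); rewrite cosB.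
have := cos2Dsin2 x; have := cos2Dsin2 y.
set a := cos x; set b := sin x; set c := cos y; set e := sin y.
by nra.
Qed.

Lemma normc_prod_le1 (I : Type) (s : seq I) (f : I -> R[i]) :
  (forall i, normc (f i) <= 1) -> normc (\prod_(i <- s) f i) <= 1.
Proof.
move=> f1; apply: (big_ind (fun z => normc z <= 1)) => //.
  by rewrite Normc.normc1.
by move=> z w hz hw; rewrite Normc.normcM mulr_ile1// normc_ge0.
Qed.

(** The factors are exchanged one at a time, the remaining ones having modulus at most 1. *)
Lemma normc_prodB (I : Type) (s : seq I) (f g : I -> R[i]) :
  (forall i, normc (f i) <= 1) -> (forall i, normc (g i) <= 1) ->
  normc (\prod_(i <- s) f i - \prod_(i <- s) g i) <= \sum_(i <- s) normc (f i - g i).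
Proof.
move=> f1 g1; elim: s => [|i s IH].
  by rewrite !big_nil subrr Normc.normc0.
rewrite !big_cons.
have -> : f i * \prod_(j <- s) f j - g i * \prod_(j <- s) g j =
   (f i - g i) * \prod_(j <- s) f j + g i * (\prod_(j <- s) f j - \prod_(j <- s) g j) by ring.
apply: le_trans (normcD _ _) _; rewrite !Normc.normcM; apply: lerD.
  by rewrite ler_piMr ?normc_ge0// normc_prod_le1.
by apply: le_trans IH; rewrite ler_piMl ?normc_ge0.
Qed.

End complex_basics.

Section complex_integral.
Context d (T : measurableType d) {R : realType}.
Implicit Types f g : T -> R[i].

Definition cbounded_measurable f : Prop :=
  bounded_measurable (fun x => complex.Re (f x)) /\
  bounded_measurable (fun x => complex.Im (f x)).

Lemma cbm_cst (z : R[i]) : cbounded_measurable (fun=> z).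
Proof. by split; exact: bmcst. Qed.

Lemma cbmD f g : cbounded_measurable f -> cbounded_measurable g ->
  cbounded_measurable (fun x => f x + g x).
Proof.
move=> [f1 f2] [g1 g2]; split.
  by under eq_fun do rewrite ReD; exact: bmD.
by under eq_fun do rewrite ImD; exact: bmD.
Qed.

Lemma cbmM f g : cbounded_measurable f -> cbounded_measurable g ->
  cbounded_measurable (fun x => f x * g x).
Proof.
move=> [f1 f2] [g1 g2]; split.
  by under eq_fun do rewrite cReM; apply: bmB; exact: bmM.
by under eq_fun do rewrite cImM; apply: bmD; exact: bmM.
Qed.

Lemma cbm_prod (I : Type) (s : seq I) (f : I -> T -> R[i]) :
  (forall i, cbounded_measurable (f i)) ->
  cbounded_measurable (fun x => \prod_(i <- s) f i x).
Proof.
move=> bf; elim: s => [|i s IH].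
  by under eq_fun do rewrite big_nil; exact: cbm_cst.
by under eq_fun do rewrite big_cons; exact: cbmM.
Qed.

Lemma cbm_cis (h : T -> R) : measurable_fun setT h ->
  cbounded_measurable (fun x => cis (h x)).
Proof.
move=> mh; split => /=; split.
- by apply: (measurableT_comp (continuous_measurable_fun (@continuous_cos R))).
- by exists 1 => x; exact: cos_max.
- by apply: (measurableT_comp (continuous_measurable_fun (@continuous_sin R))).
- by exists 1 => x; exact: sin_max.
Qed.

Variable P : probability T R.

Definition cint f : R[i] :=
  Complex (\int[P]_x complex.Re (f x)) (\int[P]_x complex.Im (f x)).

Lemma cint_cst z : cint (fun=> z) = z.
Proof. by apply: complexP; rewrite /= bm_int_cst. Qed.

Lemma cintD f g : cbounded_measurable f -> cbounded_measurable g ->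
  cint (fun x => f x + g x) = cint f + cint g.
Proof.
move=> [f1 f2] [g1 g2]; apply: complexP; rewrite ReImE/= -bm_intD//.
  by apply: eq_Rintegral => x _; rewrite ReD.
by apply: eq_Rintegral => x _; rewrite ImD.
Qed.

Lemma cintZ z f : cbounded_measurable f -> cint (fun x => z * f x) = z * cint f.
Proof.
move=> [f1 f2]; apply: complexP; rewrite ReImE/= -!bm_intZ//.
  rewrite -bm_intB; [|exact: bmZ|exact: bmZ].
  by apply: eq_Rintegral => x _; rewrite cReM.
rewrite -bm_intD; [|exact: bmZ|exact: bmZ].
by apply: eq_Rintegral => x _; rewrite cImM.
Qed.

Lemma sqr_Rintegral_le (f : T -> R) : bounded_measurable f ->
  (\int[P]_x f x) ^+ 2 <= \int[P]_x (f x ^+ 2).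
Proof.
move=> bf; set m := \int[P]_x f x; rewrite -subr_ge0.
have -> : \int[P]_x (f x ^+ 2) - m ^+ 2 = \int[P]_x ((f x - m) ^+ 2).
  have -> : \int[P]_x ((f x - m) ^+ 2) = \int[P]_x (f x ^+ 2 - (2 * m) * f x + m ^+ 2).
    by apply: eq_Rintegral => x _; ring.
  have b2 := bmX 2 bf; have bm := bmZ (2 * m) bf.
  rewrite bm_intD; [|exact: bmB|exact: bmcst].
  rewrite bm_intB//.
  by rewrite bm_intZ// bm_int_cst -/m; ring.
by apply: Rintegral_ge0 => x _; exact: sqr_ge0.
Qed.

(** Jensen's inequality for the square of each component avoids the factor 2 of the componentwise
    bound; the exact constant 1 is needed in products. *)
Lemma normc_cint f : cbounded_measurable f -> (forall x, normc (f x) <= 1) ->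
  normc (cint f) <= 1.
Proof.
move=> [f1 f2] fle; rewrite -(@ler_pXn2r _ 2)// ?nnegrE ?normc_ge0//.
rewrite sqr_normcE/= expr1n; apply: le_trans (lerD (sqr_Rintegral_le f1) (sqr_Rintegral_le f2)) _.
rewrite -bm_intD; [|exact: bmX|exact: bmX].
rewrite -[leRHS](bm_int_cst P); apply: bm_int_le; [|exact: bmcst|].
  by apply: bmD; exact: bmX.
by move=> x; rewrite -sqr_normcE expr_le1// normc_ge0.
Qed.

(** The factor 2 comes from bounding the real and imaginary parts separately; it is harmless since
    only smallness matters. *)
Lemma normc_cint_le f (g : T -> R) : cbounded_measurable f ->
  P.-integrable setT (EFin \o g) -> (forall x, normc (f x) <= g x) ->
  normc (cint f) <= 2 * \int[P]_x g x.
Proof.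
move=> [f1 f2] ig fg; apply: le_trans (normc_le_ReIm _) _ => /=.
rewrite mulr_natl mulr2n; apply: lerD.
  apply: le_trans (le_normr_Rintegral _ (bm_integrable P f1)) _ => //.
  apply: le_Rintegral => //; first exact: integrable_norm (bm_integrable P f1).
  by move=> x _; exact: le_trans (normc_Re _) (fg x).
apply: le_trans (le_normr_Rintegral _ (bm_integrable P f2)) _ => //.
apply: le_Rintegral => //; first exact: integrable_norm (bm_integrable P f2).
by move=> x _; exact: le_trans (normc_Im _) (fg x).
Qed.

End complex_integral.

Section complex_limits.
Context {R : realType}.
Implicit Types (u v : nat -> R[i]) (z w : R[i]).

(** Componentwise, in keeping with [cint] and [cseries], so that every limit is one of real
    sequences. *)
Definition ccvg u z : Prop :=
  (complex.Re (u n) @[n --> \oo] --> complex.Re z) /\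
  (complex.Im (u n) @[n --> \oo] --> complex.Im z).

Lemma ccvg_cst z : ccvg (fun=> z) z.
Proof. by split; exact: cvg_cst. Qed.

Lemma ccvg_unique u z w : ccvg u z -> ccvg u w -> z = w.
Proof.
by move=> [u1 u2] [v1 v2]; apply: complexP; [exact: (cvg_unique _ u1 v1)|exact: (cvg_unique _ u2 v2)].
Qed.

Lemma ccvgM u v z w : ccvg u z -> ccvg v w -> ccvg (fun n => u n * v n) (z * w).
Proof.
move=> [u1 u2] [v1 v2]; split; rewrite ?cReM ?cImM; under eq_fun do rewrite ?cReM ?cImM.
  by apply: cvgB; exact: cvgM.
by apply: cvgD; exact: cvgM.
Qed.

Lemma ccvg_prod (I : Type) (s : seq I) (u : I -> nat -> R[i]) (z : I -> R[i]) :
  (forall i, ccvg (u i) (z i)) ->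
  ccvg (fun n => \prod_(i <- s) u i n) (\prod_(i <- s) z i).
Proof.
move=> uz; elim: s => [|i s IH].
  by rewrite big_nil; under eq_fun do rewrite big_nil; exact: ccvg_cst.
by rewrite big_cons; under eq_fun do rewrite big_cons; exact: ccvgM.
Qed.

Lemma cvg_dist_le (u e : nat -> R) (l : R) : (forall n, `|u n - l| <= e n) ->
  e n @[n --> \oo] --> (0 : R) -> u n @[n --> \oo] --> l.
Proof.
move=> ue e0.
have h : (u n - l) @[n --> \oo] --> (0 : R).
  apply/norm_cvg0P; apply: (squeeze_cvgr _ (cvg_cst (0 : R)) e0).
  by near=> n; rewrite normr_ge0 ue.
have {1}-> : u = (fun n => (u n - l) + l) by apply/funext => n; rewrite subrK.
by rewrite -[X in _ --> X]add0r; apply: cvgD => //; exact: cvg_cst.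
Unshelve. all: by end_near. Qed.

Lemma ccvg_normc u z (e : nat -> R) : (forall n, normc (u n - z) <= e n) ->
  e n @[n --> \oo] --> (0 : R) -> ccvg u z.
Proof.
move=> ue e0; split; apply: cvg_dist_le e0 => n; apply: le_trans (ue n).
  by rewrite -ReN -ReD normc_Re.
by rewrite -ImN -ImD normc_Im.
Qed.

Lemma ccvg_norm u z : ccvg u z -> normc (u n - z) @[n --> \oo] --> (0 : R).
Proof.
move=> [u1 u2].
have h : (`|complex.Re (u n) - complex.Re z| + `|complex.Im (u n) - complex.Im z|) @[n --> \oo] --> (0 : R).
  rewrite -[X in _ --> X](addr0 0); apply: cvgD.
    by rewrite -(normr0 R) -(subrr (complex.Re z)); apply: cvg_norm; apply: cvgB => //; exact: cvg_cst.
  by rewrite -(normr0 R) -(subrr (complex.Im z)); apply: cvg_norm; apply: cvgB => //; exact: cvg_cst.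
apply: (squeeze_cvgr _ (cvg_cst (0 : R)) h).
near=> n; rewrite normc_ge0/=; apply: le_trans (normc_le_ReIm _) _.
by rewrite !ReImE.
Unshelve. all: by end_near. Qed.

End complex_limits.

Section complex_derivative.
Context {R : realType}.
Implicit Types (f g df dg : R -> R[i]) (x : R).

Definition cderiv x f (d : R[i]) : Prop :=
  is_derive x 1 (fun y => complex.Re (f y)) (complex.Re d) /\
  is_derive x 1 (fun y => complex.Im (f y)) (complex.Im d).

Lemma cderiv_eq x f (d d' : R[i]) : cderiv x f d -> d = d' -> cderiv x f d'.
Proof. by move=> h <-. Qed.

Lemma cderiv_cst x (z : R[i]) : cderiv x (fun=> z) 0.
Proof. by split; exact: deriv_cst. Qed.

Lemma cderiv_real x (g : R -> R) (d : R) : is_derive x 1 g d ->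
  cderiv x (fun y => Complex (g y) 0) (Complex d 0).
Proof. by move=> h; split => //=; exact: deriv_cst. Qed.

Lemma cderivD x f g (d e : R[i]) : cderiv x f d -> cderiv x g e ->
  cderiv x (fun y => f y + g y) (d + e).
Proof.
move=> [f1 f2] [g1 g2]; split.
  rewrite ReD; under eq_fun do rewrite ReD; exact: derivD.
rewrite ImD; under eq_fun do rewrite ImD; exact: derivD.
Qed.

Lemma cderivM x f g (d e : R[i]) : cderiv x f d -> cderiv x g e ->
  cderiv x (fun y => f y * g y) (d * g x + f x * e).
Proof.
move=> [f1 f2] [g1 g2]; split.
  under eq_fun do rewrite cReM.
  apply: is_derive_eq (derivB (derivM f1 g1) (derivM f2 g2)) _.
  by rewrite !ReImE; ring.
under eq_fun do rewrite cImM.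
apply: is_derive_eq (derivD (derivM f1 g2) (derivM f2 g1)) _.
by rewrite !ReImE; ring.
Qed.

Lemma cderivZ x (z : R[i]) f (d : R[i]) : cderiv x f d ->
  cderiv x (fun y => z * f y) (z * d).
Proof.
move=> h; apply: cderiv_eq (cderivM (cderiv_cst x z) h) _.
by rewrite mul0r add0r.
Qed.

Lemma cderiv_cexp x f (d : R[i]) : cderiv x f d ->
  cderiv x (fun y => cexp (f y)) (cexp (f x) * d).
Proof.
move=> [f1 f2]; split => /=.
  apply: is_derive_eq (derivM (deriv_expR f1) (deriv_cos f2)) _.
  by rewrite cReM/=; ring.
apply: is_derive_eq (derivM (deriv_expR f1) (deriv_sin f2)) _.
by rewrite cImM/=; ring.
Qed.

Lemma cderiv_cis x (g : R -> R) (d : R) : is_derive x 1 g d ->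
  cderiv x (fun y => cis (g y)) (cis (g x) * Complex 0 d).
Proof.
move=> h; split => /=.
  by apply: is_derive_eq (deriv_cos h) _; ring.
by apply: is_derive_eq (deriv_sin h) _; ring.
Qed.

Lemma deriv_bound (f f' : R -> R) (b M : R) : 0 <= b ->
  (forall x, 0 <= x <= b -> is_derive x 1 f (f' x)) ->
  (forall x, 0 <= x <= b -> `|f' x| <= M) -> `|f b - f 0| <= M * b.
Proof.
move=> b0 hf fM.
have [c cb ->] : exists2 c : R, c \in `[0, b] & f b - f 0 = f' c * (b - 0).
  apply: MVT_segment => //.
    by move=> x; rewrite in_itv/= => /andP[x0 xb]; apply: hf; rewrite !ltW.
  apply: continuous_in_subspaceT => x; rewrite inE/= in_itv/= => h.
  exact: deriv_continuous (hf _ h).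
rewrite subr0 normrM (ger0_norm b0) ler_wpM2r// fM//.
Qed.

(** The mean value theorem holds for each component only, with different intermediate points, hence
    the factor 2. *)
Lemma cderiv_bound f f' (b M : R) : 0 <= b ->
  (forall x, 0 <= x <= b -> cderiv x f (f' x)) ->
  (forall x, 0 <= x <= b -> normc (f' x) <= M) ->
  normc (f b - f 0) <= 2 * M * b.
Proof.
move=> b0 hf fM; apply: le_trans (normc_le_ReIm _) _; rewrite !ReImE.
rewrite -mulrA mulr_natl mulr2n; apply: lerD.
  apply: (deriv_bound (f := fun y => complex.Re (f y)) (f' := fun y => complex.Re (f' y))) => // x hx.
    by have [] := hf x hx.
  exact: le_trans (normc_Re _) (fM x hx).
apply: (deriv_bound (f := fun y => complex.Im (f y)) (f' := fun y => complex.Im (f' y))) => // x hx.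
  by have [] := hf x hx.
exact: le_trans (normc_Im _) (fM x hx).
Qed.

End complex_derivative.

(** * Convergence of the complex exponential series *)

Section exponential_series.
Context {R : realType}.
Variable z : R[i].

Definition exp_poly n : R[i] := \sum_(k < n) z ^+ k / k`!%:R.

Let P n (t : R) : R[i] := \sum_(k < n) Complex (t ^+ k) 0 * (z ^+ k / k`!%:R).

Let dP n (t : R) : cderiv t (P n.+1) (z * P n t).
Proof.
elim: n => [|n IH].
  rewrite /P big_ord0 mulr0; under eq_fun do rewrite big_ord1 expr0.
  exact: cderiv_cst.
have PS m : P m.+1 = fun t => P m t + Complex (t ^+ m) 0 * (z ^+ m / m`!%:R).
  by apply/funext => s; rewrite /P big_ord_recr.
rewrite (PS n.+1); have hX := cderiv_real (derivX n.+1 (deriv_id t)).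
apply: cderiv_eq (cderivD IH (cderivM hX (cderiv_cst t (z ^+ n.+1 / n.+1`!%:R)))) _.
rewrite mulr0 addr0 mulr1 (PS n) mulrDr; congr (_ + _) => /=.
have -> : Complex (n.+1%:R * t ^+ n) 0 = n.+1%:R * Complex (t ^+ n) 0 :> R[i].
  rewrite -(rmorph_nat (real_complex R)) /=.
  by apply: complexP; rewrite ReImE/=; ring.
rewrite factS natrM exprS.
have n1 : n.+1%:R != 0 :> R[i] by rewrite pnatr_eq0.
have f0 : n`!%:R != 0 :> R[i] by rewrite pnatr_eq0 -lt0n fact_gt0.
move: (n.+1%:R : R[i]) (n`!%:R : R[i]) n1 f0 => a b a0 b0.
by field; rewrite a0 b0.
Qed.

(** The product [g] of exp(-tz) with the partial sum equals 1 at 0, and its derivative telescopes to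
    the single term [- z * cexp (- t z) * (t z)^n / n!]. The mean value inequality on [[0, 1]]
    bounds the error by a vanishing exponential coefficient. *)
Lemma exp_poly_cvg : ccvg exp_poly (cexp z).
Proof.
pose e n := expR (normc z) * (2 * (expR (normc z) * normc z * exp_coeff (normc z) n)).
have h n : normc (exp_poly n.+1 - cexp z) <= e n.
  pose g (t : R) := cexp (Complex t 0 * - z) * P n.+1 t.
  have dg (t : R) : cderiv t g (- z * cexp (Complex t 0 * - z) * (Complex (t ^+ n) 0 * (z ^+ n / n`!%:R))).
    have hi := cderiv_real (deriv_id t).
    have hz := cderivM hi (cderiv_cst t (- z)).
    apply: cderiv_eq (cderivM (cderiv_cexp hz) (dP n t)) _.
    rewrite mulr0 addr0.
    have -> : Complex 1 0 = 1 :> R[i] by [].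
    have -> : P n.+1 t = P n t + Complex (t ^+ n) 0 * (z ^+ n / n`!%:R) by rewrite /P big_ord_recr.
    by ring.
  have := @cderiv_bound _ g _ 1 (expR (normc z) * normc z * exp_coeff (normc z) n) ler01 (fun t _ => dg t).
  rewrite mulr1.
  have -> : g 0 = 1.
    rewrite /g (_ : Complex 0 0 = 0)// mul0r cexp0 mul1r /P big_ord_recl big1 ?addr0.
      by rewrite !expr0 divr1 mul1r.
    by move=> i _; rewrite exprS !mul0r.
  have -> : g 1 = cexp (- z) * exp_poly n.+1.
    rewrite /g (_ : Complex 1 0 = 1)// mul1r; congr (_ * _).
    by apply: eq_bigr => i _; rewrite expr1n mul1r.
  move=> /(_ _) h.
  have -> : exp_poly n.+1 - cexp z = cexp z * (cexp (- z) * exp_poly n.+1 - 1).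
    by rewrite mulrBr mulr1 mulrA (mulrC (cexp z)) cexpNK mul1r.
  rewrite Normc.normcM normc_cexp /e; apply: ler_pM; [exact: expR_ge0|exact: normc_ge0| |].
    by rewrite ler_expR (le_trans (ler_norm _) (normc_Re _)).
  apply: h => x /andP[x0 x1].
  rewrite !Normc.normcM normc_cexp normcN' normc_real.
  rewrite (_ : expR _ * normc z = normc z * expR (normc z)); last by rewrite mulrC.
  apply: ler_pM; rewrite ?mulr_ge0 ?normc_ge0 ?expR_ge0//.
    apply: ler_wpM2l; first exact: normc_ge0.
    rewrite ler_expR (le_trans (ler_norm _))//; apply: le_trans (normc_Re _) _.
    by rewrite Normc.normcM normcN' normc_real ler_piMl ?normc_ge0// ger0_norm.
  rewrite normcX Normc.normcV.
  have -> : normc (n`!%:R : R[i]) = n`!%:R.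
    by rewrite natCE normc_real normr_nat.
  rewrite /exp_coeff /= ler_piMl//.
    by rewrite divr_ge0// exprn_ge0// normc_ge0.
  by rewrite ger0_norm ?exprn_ge0// exprn_ile1.
suff : ccvg (fun n => exp_poly n.+1) (cexp z).
  by move=> [h1 h2]; split; rewrite -cvg_shiftS.
apply: ccvg_normc h _; rewrite /e.
have c0 : exp_coeff (normc z) n @[n --> \oo] --> (0 : R).
  by apply: cvg_series_cvg_0; exact: is_cvg_series_exp_coeff.
rewrite -(mulr0 (expR (normc z))); apply: cvgM; first exact: cvg_cst.
rewrite -(mulr0 2); apply: cvgM; first exact: cvg_cst.
by rewrite -(mulr0 (expR (normc z) * normc z)); apply: cvgM => //; exact: cvg_cst.
Qed.

End exponential_series.

(** * The binomial series with imaginary exponent *)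

(** From some index on the ratio is at most [q = (1 + r) / 2 < 1], and the sequence is dominated by
    a geometric one. *)
Lemma ratio_cvg0 (R : realType) (u : nat -> R) (K r : R) : 0 <= K -> 0 <= r < 1 ->
  (forall n, 0 <= u n) -> (forall n, u n.+1 <= (1 + K / n.+1%:R) * r * u n) ->
  u n @[n --> \oo] --> (0 : R).
Proof.
move=> K0 /andP[r0 r1] u0 ur.
pose q := (1 + r) / 2.
have q1 : q < 1 by rewrite /q; lra.
have q0 : 0 <= q by rewrite /q; lra.
have [n0 n0P] : exists n0 : nat, forall n, (n0 <= n)%N -> (1 + K / n.+1%:R) * r <= q.
  have [m mK] : exists m : nat, 2 * K * r / (1 - r) <= m%:R.
    exists (Num.truncn (2 * K * r / (1 - r))).+1.
    by apply: ltW; exact: truncnS_gt.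
  exists m => n mn.
  have n1 : 0 < n.+1%:R :> R by [].
  have -> : (1 + K / n.+1%:R) * r = r + K * r / n.+1%:R by ring.
  have -> : q = r + (1 - r) / 2 by rewrite /q; field.
  rewrite lerD2l ler_pdivrMr//.
  have h : 2 * K * r / (1 - r) <= n.+1%:R.
    by apply: le_trans mK _; rewrite ler_nat leqW.
  rewrite ler_pdivrMr in h; last by lra.
  by lra.
rewrite -(cvg_shiftn n0).
apply: (@squeeze_cvgr _ _ _ _ (fun=> 0) (fun n => q ^+ n * u n0)); last 2 first.
- exact: cvg_cst.
- rewrite -(mul0r (u n0)); apply: cvgM; last exact: cvg_cst.
  by apply: cvg_expr; rewrite ger0_norm.
apply: nearW => n; rewrite u0/=; elim: n => [|n IH]; first by rewrite expr0 mul1r add0n.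
rewrite addSn; apply: le_trans (ur _) _; rewrite exprS -(mulrA q).
apply: ler_pM => //; last by apply: n0P; exact: leq_addl.
by rewrite mulr_ge0// addr_ge0// divr_ge0.
Qed.

Section binomial_series.
Context {R : realType}.
Variable w : R.
Let z : R[i] := Complex 0 w.
Let b k : R[i] := gbinom z k.

Lemma gbinom_ratio k : k.+1%:R * b k.+1 = (z - k%:R) * b k.
Proof.
rewrite /b /gbinom big_ord_recr/= factS natrM.
have k1 : k.+1%:R != 0 :> R[i] by rewrite pnatr_eq0.
have f0 : k`!%:R != 0 :> R[i] by rewrite pnatr_eq0 -lt0n fact_gt0.
move: (k.+1%:R : R[i]) (k`!%:R : R[i]) k1 f0 => a c a0 c0.
by field; rewrite a0 c0.
Qed.

Let S n (x : R) : R[i] := \sum_(k < n) b k * Complex ((- x) ^+ k) 0.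
Let dS n (x : R) : R[i] := \sum_(k < n) b k * Complex (k%:R * (- x) ^+ k.-1 * - 1) 0.

Let deriv_S n x : cderiv x (S n) (dS n x).
Proof.
elim: n => [|n IH].
  by rewrite /S /dS big_ord0; under eq_fun do rewrite big_ord0; exact: cderiv_cst.
rewrite /S /dS big_ord_recr/=; under eq_fun do rewrite big_ord_recr/=.
apply: cderivD => //; apply: cderivZ; apply: cderiv_real.
exact: derivX (derivN (deriv_id x)).
Qed.

(* The partial sum [S] solves the differential equation of [(1 - x) `^ z] up to
   a single term, since the recurrence [gbinom_ratio] makes the sum telescope. *)
Let dS_eq n x : Complex (1 - x) 0 * dS n.+1 x + z * S n.+1 x =
  n.+1%:R * b n.+1 * Complex ((- x) ^+ n) 0.
Proof.
elim: n => [|n IH].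
  rewrite /S /dS !big_ord1 gbinom_ratio /= mul0r mul0r expr0 subr0.
  by rewrite (_ : Complex 0 0 = 0)// mulr0 mulr0 add0r mulrA.
have -> : S n.+2 x = S n.+1 x + b n.+1 * Complex ((- x) ^+ n.+1) 0 by rewrite /S big_ord_recr.
have -> : dS n.+2 x = dS n.+1 x + b n.+1 * Complex (n.+1%:R * (- x) ^+ n * - 1) 0.
  by rewrite /dS big_ord_recr.
rewrite gbinom_ratio (natCE n.+1).
have -> : Complex (1 - x) 0 * (dS n.+1 x + b n.+1 * Complex (n.+1%:R * (- x) ^+ n * - 1) 0) +
    z * (S n.+1 x + b n.+1 * Complex ((- x) ^+ n.+1) 0) =
  (Complex (1 - x) 0 * dS n.+1 x + z * S n.+1 x) +
  (Complex (1 - x) 0 * b n.+1 * Complex (n.+1%:R * (- x) ^+ n * - 1) 0 +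
    z * b n.+1 * Complex ((- x) ^+ n.+1) 0) by ring.
rewrite IH (natCE n.+1) exprS.
have CM (s t : R) : Complex (s * t) 0 = Complex s 0 * Complex t 0 :> R[i].
  by apply: complexP; rewrite ReImE/=; ring.
have CB (s t : R) : Complex (s - t) 0 = Complex s 0 - Complex t 0 :> R[i].
  by apply: complexP; rewrite !ReImE/= ?subr0.
have C1 : Complex 1 0 = 1 :> R[i] by [].
have CN (s : R) : Complex (- s) 0 = - Complex s 0 :> R[i].
  by apply: complexP; rewrite ReImE/= ?oppr0.
rewrite !CM CB !CN C1.
move: (Complex x 0) (b n.+1) (Complex n.+1%:R 0) (Complex ((- x) ^+ n) 0) => X B m Y.
by ring.
Qed.

Variable p : R.
Hypothesis p01 : 0 < p < 1.

(** Bound on [[0, p]] for the derivative of the truncated series divided by its limit: the leftover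
    term of [dS_eq], with [1 - t >= 1 - p]; the factor 2 is that of the complex mean value
    inequality. *)
Definition binomial_error n : R := 2 * (normc (n.+1%:R * b n.+1) * p ^+ n / (1 - p)).

(** The scaled coefficients grow by a ratio of at most [1 + |w| / (n+1)], which the geometric factor
    [p < 1] outweighs. *)
Lemma binomial_error_cvg0 : binomial_error n @[n --> \oo] --> (0 : R).
Proof.
case/andP: p01 => p0 p1; rewrite -(mulr0 2); apply: cvgM; first exact: cvg_cst.
rewrite -(mul0r (1 - p)^-1); apply: cvgM; last exact: cvg_cst.
apply: (@ratio_cvg0 _ _ `|w| p) => //.
- by rewrite (ltW p0).
- by move=> n; rewrite mulr_ge0 ?normc_ge0// exprn_ge0// ltW.
move=> n.
have n1 : 0 < n.+1%:R :> R by [].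
rewrite gbinom_ratio exprS.
have -> : (1 + `|w| / n.+1%:R) * p * (normc (n.+1%:R * b n.+1) * p ^+ n) =
    ((1 + `|w| / n.+1%:R) * normc (n.+1%:R * b n.+1)) * (p * p ^+ n) by ring.
apply: ler_wpM2r; first by rewrite mulr_ge0 ?exprn_ge0// ltW.
move: (b n.+1) => bn.
rewrite !Normc.normcM mulrA (natCE n.+1) normc_real normr_nat.
apply: ler_wpM2r; first exact: normc_ge0.
rewrite mulrDl mul1r divfK ?gt_eqF//.
by apply: le_trans (normcD _ _) _; rewrite normcN' normc_real normc_imag normr_nat addrC.
Qed.

(** Multiplying the partial sum by [(1 - t)^(- i w)] gives a function equal to 1 at 0 whose
    derivative is the single leftover term of [dS_eq]. The factor [x] is kept in the bound because
    it makes the error integrable once [x] is a gain. *)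
Lemma binomial_series_le (n : nat) (x : R) : 0 <= x <= p ->
  normc (\sum_(1 <= k < n.+1) b k * Complex ((- x) ^+ k) 0
    - (cis (w * ln (1 - x)) - 1)) <= binomial_error n * x.
Proof.
case/andP: p01 => p0 p1 /andP[x0 xp].
have -> : \sum_(1 <= k < n.+1) b k * Complex ((- x) ^+ k) 0 = S n.+1 x - 1.
  rewrite /S -(big_mkord xpredT (fun k => b k * Complex ((- x) ^+ k) 0)) [in RHS]big_ltn//=.
  rewrite expr0 /b /gbinom big_ord0 fact0 divr1 (_ : Complex 1 0 = 1)// mulr1.
  by rewrite addrAC subrr add0r.
have -> : S n.+1 x - 1 - (cis (w * ln (1 - x)) - 1) = - cis (w * ln (1 - x)) + S n.+1 x by ring.
pose g (t : R) := cis (- w * ln (1 - t)) * S n.+1 t.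
have dg (t : R) : 0 <= t <= x -> cderiv t g
    (cis (- w * ln (1 - t)) * Complex (1 - t)^-1 0 * (n.+1%:R * b n.+1 * Complex ((- t) ^+ n) 0)).
  move=> /andP[t0 tx].
  have t1 : 0 < 1 - t by lra.
  have dl := deriv_comp (f := @ln R) (g := fun t => 1 - t) (is_derive1_ln t1) (derivB (deriv_cst 1 t) (deriv_id t)).
  apply: cderiv_eq (cderivM (cderiv_cis (derivZ (- w) dl)) (deriv_S n.+1 t)) _.
  rewrite -dS_eq.
  have -> : Complex 0 (- w * ((1 - t)^-1 * (0 - 1))) = Complex (1 - t)^-1 0 * z.
    by apply: complexP; rewrite ReImE/=; ring.
  have h : Complex (1 - t)^-1 0 * Complex (1 - t) 0 = 1 :> R[i].
    by apply: complexP; rewrite ReImE/= ?mulVf ?gt_eqF//; ring.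
  move: (cis _) (Complex (1 - t)^-1 0) (Complex (1 - t) 0) (S n.+1 t) (dS n.+1 t) h => c u v s s' h.
  by rewrite mulrDr (mulrA (c * u)) -(mulrA c u v) h; ring.
have := @cderiv_bound _ g _ x (normc (n.+1%:R * b n.+1) * p ^+ n / (1 - p)) x0 dg.
have -> : g 0 = 1.
  rewrite /g subr0 ln1 mulr0 cis0 mul1r /S big_ord_recl big1 ?addr0.
    by rewrite expr0 /b /gbinom big_ord0 fact0 divr1 mul1r.
  by move=> i _; rewrite oppr0 /= exprS mul0r (_ : Complex 0 0 = 0)// mulr0.
move=> h.
have -> : - cis (w * ln (1 - x)) + S n.+1 x = cis (w * ln (1 - x)) * (g x - 1).
  rewrite mulrBr mulr1 /g mulrA mulNr -cisD addrN cis0 mul1r addrC.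
  by [].
rewrite Normc.normcM normc_cis mul1r /binomial_error.
apply: h => t /andP[t0 tx].
have t1 : 0 < 1 - t by lra.
rewrite !Normc.normcM normc_cis mul1r !normc_real mulrC normfV normrX normrN.
rewrite (ger0_norm t0) (ger0_norm (ltW t1)).
apply: ler_pM; rewrite ?invr_ge0 ?mulr_ge0 ?normc_ge0 ?exprn_ge0 ?(ltW t1)//.
  rewrite ler_wpM2l ?mulr_ge0 ?normc_ge0// lerXn2r ?nnegrE ?(ltW p0)//.
  exact: le_trans tx xp.
by rewrite lef_pV2 ?posrE; lra.
Qed.

End binomial_series.

(** * Polar coordinates *)

Section half_disc.
Context {R : realType}.
Notation mu := (@lebesgue_measure R).

(** The substitution [x = r sin t] turns the integrand into [2 r^2 cos^2 t], of which [H] is an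
    antiderivative. *)
Lemma integral_half_disc (r : R) : 0 < r ->
  (\int[mu]_(x in `[(- r)%R, r%R]) (2 * Num.sqrt (r ^+ 2 - x ^+ 2))%:E = (pi * r ^+ 2)%:E)%E.
Proof.
move=> r0.
have pi0 := @pi_gt0 R.
have pil : - (pi / 2) <= pi / 2 :> R by lra.
pose F t : R := r * sin t.
have dF (t : R) : is_derive t 1 F (r * cos t).
  by apply: is_derive_eq (derivZ r (deriv_sin (deriv_id t))) _; rewrite mulr1.
have dFE : derive1 F = fun t => r * cos t.
  by apply/funext => t; rewrite derive1E; exact: derive_val.
have Fa : F (- (pi / 2)) = - r by rewrite /F sinN sin_pihalf mulrN1.
have Fb : F (pi / 2) = r by rewrite /F sin_pihalf mulr1.
have cF' : continuous (fun t => r * cos t).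
  by move=> t; exact: deriv_continuous (derivZ r (deriv_cos (deriv_id t))).
have cF : continuous F by move=> t; exact: deriv_continuous (dF t).
have cG : continuous (fun x : R => 2 * Num.sqrt (r ^+ 2 - x ^+ 2)).
  move=> x; apply: cvgM; first exact: cvg_cst.
  apply: (@continuous_comp _ _ _ (fun x : R => r ^+ 2 - x ^+ 2) Num.sqrt x); last exact: sqrt_continuous.
  exact: deriv_continuous (derivB (deriv_cst _ x) (derivX 2 (deriv_id x))).
have := @integration_by_substitution_increasing R F (fun x => 2 * Num.sqrt (r ^+ 2 - x ^+ 2)) _ _ pil.
rewrite Fa Fb => -> //; last 6 first.
- by move=> x y hx hy xy; rewrite /F ltr_pM2l// ltr_sin.
- by move=> x _; rewrite dFE; exact: cF'.
- by rewrite dFE; apply/cvg_ex; exists (r * cos (- (pi / 2))); apply: cvg_at_right_filter; exact: cF'.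
- by rewrite dFE; apply/cvg_ex; exists (r * cos (pi / 2)); apply: cvg_at_left_filter; exact: cF'.
- split.
  + by move=> x _; have [] := dF x.
  + by apply: cvg_at_right_filter; exact: cF.
  + by apply: cvg_at_left_filter; exact: cF.
- exact: continuous_subspaceT.
pose H t := r ^+ 2 * (t + sin t * cos t).
have dH (t : R) : is_derive t 1 H (2 * r ^+ 2 * cos t ^+ 2).
  apply: is_derive_eq (derivZ (r ^+ 2) (derivD (deriv_id t) (derivM (deriv_sin (deriv_id t)) (deriv_cos (deriv_id t))))) _.
  rewrite !mulr1; have := cos2Dsin2 t; set c := cos t; set s := sin t => h.
  have -> : 1 + (c * c + s * - s) = 2 * c ^+ 2 by lra.
  by ring.
have cH' : continuous (fun t => 2 * r ^+ 2 * cos t ^+ 2).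
  by move=> t; exact: deriv_continuous (derivZ (2 * r ^+ 2) (derivX 2 (deriv_cos (deriv_id t)))).
have [ih hE] := Rintegral_FTC2 pil dH cH'.
transitivity (\int[mu]_(x in `[(- (pi / 2))%R, (pi / 2)%R]) (2 * r ^+ 2 * cos x ^+ 2)%:E)%E.
  apply: eq_integral => t; rewrite inE/= in_itv/= => tI.
  rewrite /F dFE/=; congr EFin.
  rewrite -[LHS]/(2 * Num.sqrt (r ^+ 2 - (r * sin t) ^+ 2) * (r * cos t)).
  have -> : r ^+ 2 - (r * sin t) ^+ 2 = (r * cos t) ^+ 2.
    by rewrite !exprMn -[X in X - _]mulr1 -(cos2Dsin2 t); ring.
  rewrite sqrtr_sqr ger0_norm; first by rewrite /=; ring.
  by rewrite mulr_ge0 ?(ltW r0)//; exact: cos_ge0_pihalf.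
move: hE; rewrite /Rintegral => hE.
rewrite -[LHS]fineK; last exact: integrable_fin_num ih.
rewrite [X in X%:E]hE /H sinN cosN sin_pihalf cos_pihalf; congr EFin; by field.
Qed.

End half_disc.

Section radial.
Context {R : realType}.
Notation mu := (@lebesgue_measure R).

Definition sqnorm (x : plane R) : R := (x.1 : R) ^+ 2 + (x.2 : R) ^+ 2.

Lemma measurable_sqnorm : measurable_fun setT sqnorm.
Proof.
apply: measurable_funD; apply: measurable_funX; first exact: measurable_fst.
exact: measurable_snd.
Qed.

Lemma sqnorm_ge0 x : 0 <= sqnorm x.
Proof. by rewrite addr_ge0// sqr_ge0. Qed.

Lemma sqrt_bound (s y : R) : 0 <= s -> (y ^+ 2 <= s) = (- Num.sqrt s <= y <= Num.sqrt s).
Proof.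
move=> s0; rewrite -ler_norml -[in LHS](sqr_sqrtr s0) -(real_normK (num_real y)).
by rewrite ler_pXn2r// nnegrE// sqrtr_ge0.
Qed.

(** Integration of the slice lengths [2 * Num.sqrt (s - x^2)]. The square root of a negative number
    is 0, so the same expression covers empty slices and nonpositive [s]. *)
Lemma area_disc (s : R) : area [set x : plane R | sqnorm x <= s] = (pi * Num.max 0 s)%:E.
Proof.
have secE (x : measurableTypeR R) : xsection [set x : plane R | sqnorm x <= s] x =
    [set y : measurableTypeR R | (y : R) ^+ 2 <= s - (x : R) ^+ 2].
  apply/seteqP; split => y /=; rewrite /xsection/= inE/= /sqnorm/=; lra.
have sec (x : measurableTypeR R) : mu (xsection [set x : plane R | sqnorm x <= s] x) =
   (2 * Num.sqrt (s - (x : R) ^+ 2))%:E.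
  rewrite secE; have [h|h] := leP 0 (s - (x : R) ^+ 2).
    have -> : [set y : measurableTypeR R | (y : R) ^+ 2 <= s - (x : R) ^+ 2] =
       `[- Num.sqrt (s - (x : R) ^+ 2), Num.sqrt (s - (x : R) ^+ 2)]%classic.
      by apply/seteqP; split => y /=; rewrite in_itv/= sqrt_bound.
    rewrite lebesgue_measure_itv/= lte_fin.
    have := sqrtr_ge0 (s - (x : R) ^+ 2); move: (Num.sqrt _) => q q0.
    case: ifPn => hq; first by rewrite -EFinB; congr EFin; ring.
    by congr EFin; lra.
  rewrite ler0_sqrtr ?(ltW h)// mulr0.
  rewrite (_ : [set y | _] = set0) ?measure0//.
  by apply/seteqP; split => y //= hy; have := sqr_ge0 (y : R); lra.
rewrite /area /product_measure1 /=.
under eq_integral do rewrite sec.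
have [s0|s0] := leP s 0.
  rewrite mulr0 integral0_eq// => x _.
  by rewrite ler0_sqrtr ?mulr0//; have := sqr_ge0 (x : R); lra.
have r0 : 0 < Num.sqrt s by rewrite sqrtr_gt0.
have := integral_half_disc r0; rewrite sqr_sqrtr ?(ltW s0)// => <-.
rewrite [RHS]integral_mkcond; apply: eq_integral => x _.
rewrite patchE; case: ifPn => // /negP hx.
rewrite ler0_sqrtr ?mulr0// leNgt; apply/negP => h; apply: hx.
by rewrite inE/= in_itv/= -sqrt_bound; lra.
Qed.

Variable kappa : R.
Hypothesis kappa0 : 0 < kappa.
Let phi (x : plane R) : measurableTypeR R := sqnorm x / kappa.

Let mphi : measurable_fun setT phi.
Proof.
by apply: measurable_funM; [exact: measurable_sqnorm|exact: measurable_cst].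
Qed.

Let area_m : {measure set (plane R) -> \bar R} := (mu \x mu)%E.

Let k : {nonneg R} := NngNum (ltW (divr_gt0 (@ltr01 R) (mulr_gt0 (@pi_gt0 R) kappa0))).

Let image : {measure set (measurableTypeR R) -> \bar R} :=
  measure_function_pushforward__canonical__measure_function_Measure area_m mphi.
Let m1 : {measure set (measurableTypeR R) -> \bar R} := mscale k image.
Let mneg : measurable (`]-oo, 0] : set (measurableTypeR R)).
Proof. exact: measurable_itv. Qed.
Let m2 : {measure set (measurableTypeR R) -> \bar R} := mrestr mu mneg.
(** The rescaled image of the area lives on the nonnegative half-line only. Adding Lebesgue measure
    on the negative one gives a measure that agrees with Lebesgue measure on all intervals []a, b]],
    so the uniqueness theorem applies. *)
Let m : {measure set (measurableTypeR R) -> \bar R} := measure_add m1 m2.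

Let discs (s : R) : area_m (phi @^-1` `]-oo, s]) = (pi * kappa * Num.max 0 s)%:E.
Proof.
have -> : phi @^-1` `]-oo, s] = [set x | sqnorm x <= kappa * s].
  by apply/seteqP; split => x /=; rewrite in_itv/= /phi ler_pdivrMr// mulrC.
rewrite [LHS]area_disc -mulrA; congr (_ * _)%:E.
by rewrite maxr_pMr ?(ltW kappa0)// mulr0.
Qed.

Let mE (a b : R) : m `]a, b]%classic = mu `]a, b]%classic.
Proof.
rewrite [LHS]measure_addE.
rewrite -[LHS]/((1 / (pi * kappa))%:E * area_m (phi @^-1` `]a, b]) +
  mu (`]a, b]%classic `&` `]-oo, 0%R]%classic))%E.
have [ba|ab] := leP b a.
  have -> : `]a, b]%classic = set0 :> set R.
    by apply/seteqP; split => y //=; rewrite in_itv/= => /andP[]; lra.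
  by rewrite preimage_set0 set0I !measure0 mule0 adde0.
have -> : phi @^-1` `]a, b] = phi @^-1` `]-oo, b] `\` phi @^-1` `]-oo, a].
  apply/seteqP; split => x /=; rewrite !in_itv/=.
    by move=> /andP[h1 h2]; split => //; apply/negP; rewrite -ltNge.
  by move=> [-> /negP]; rewrite -ltNge => ->.
have mi s : measurable (phi @^-1` `]-oo, s]).
  by rewrite -[X in measurable X]setTI; apply: mphi => //; exact: measurable_itv.
have fin : (area_m (phi @^-1` `]-oo, b]) < +oo)%E by rewrite discs ltry.
have -> : area_m (phi @^-1` `]-oo, b] `\` phi @^-1` `]-oo, a]) =
    (pi * kappa * Num.max 0 b - pi * kappa * Num.max 0 a)%:E.
  rewrite [LHS](measureD (mi b) (mi a) fin) EFinB; congr (_ - _)%E; first exact: discs.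
  rewrite setIidr; first exact: discs.
  by move=> x /=; rewrite !in_itv/= => h; lra.
have -> : `]a, b]%classic `&` `]-oo, 0]%classic = `]a, Num.min b 0]%classic :> set R.
  apply/seteqP; split => y /=; rewrite !in_itv/= le_min.
    by move=> [/andP[-> ->] ->].
  by move=> /and3P[-> -> ->].
rewrite !lebesgue_measure_itv/= !lte_fin ab.
have pik : pi * kappa != 0 by rewrite gt_eqF// mulr_gt0// pi_gt0.
have -> : ((1 / (pi * kappa))%:E * (pi * kappa * Num.max 0 b - pi * kappa * Num.max 0 a)%:E)%E
    = (Num.max 0 b - Num.max 0 a)%:E.
  by rewrite -EFinM -mulrBr mulrA mul1r mulVf// mul1r.
have [b0|b0] := leP b 0.
  have a0 : a <= 0 by apply: ltW; exact: lt_le_trans ab b0.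
  by rewrite ab (max_l a0) subrr add0e.
have [a0|a0] := ltP a 0.
  by rewrite -!EFinD subr0 add0r.
by rewrite adde0.
Qed.

Let pushE (A : set (measurableTypeR R)) : measurable A ->
  image A = (\int[mu]_(x in A `&` `[0%R, +oo[) (pi * kappa)%:E)%E.
Proof.
move=> mA; have mB : measurable (A `&` `[0, +oo[) by apply: measurableI => //; exact: measurable_itv.
rewrite integral_cst//.
have h : mu (A `&` `[0, +oo[) = m (A `&` `[0, +oo[).
  by apply: lebesgue_measure_unique => // _ [x _ <-]; rewrite mE.
transitivity ((pi * kappa)%:E * m (A `&` `[0%R, +oo[))%E; last by congr (_ * _)%E; exact: esym h.
rewrite [X in (_ * X)%E]measure_addE.
rewrite -[RHS]/((pi * kappa)%:E * ((1 / (pi * kappa))%:E * area_m (phi @^-1` (A `&` `[0%R, +oo[)) +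
  mu (A `&` `[0%R, +oo[ `&` `]-oo, 0%R]%classic)))%E.
have -> : mu (A `&` `[0, +oo[ `&` `]-oo, 0]) = 0%E.
  apply/eqP; rewrite eq_le measure_ge0 andbT.
  apply: (@le_trans _ _ (mu [set (0 : R)])); last by rewrite lebesgue_measure_set1.
  apply: le_measure; rewrite ?inE//.
    by apply: measurableI => //; exact: measurable_itv.
  by move=> x [[_ /=]]; rewrite !in_itv/= andbT => x0 /= ?; apply/eqP; rewrite eq_le; apply/andP.
rewrite adde0 muleA -EFinM mul1r mulfV ?mul1e; last by rewrite gt_eqF// mulr_gt0// pi_gt0.
congr (area_m _); apply/seteqP; split => x /=; last by case.
by move=> ?; split => //; rewrite in_itv/= andbT /phi divr_ge0 ?sqnorm_ge0// ltW.
Qed.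

(** Polar coordinates with the squared radius as variable: its image measure is Lebesgue measure up
    to the constant [pi * kappa]. The identity is shown for nonnegative functions, then for positive
    and negative parts. *)
Lemma radial_integral (f : measurableTypeR R -> \bar R) : measurable_fun setT f ->
  (\int[@area R]_x f (sqnorm x / kappa)%R =
   \int[mu]_(v in `[0%R, +oo[) ((pi * kappa)%:E * f v))%E.
Proof.
move=> mf.
have pik : 0 <= pi * kappa by rewrite mulr_ge0 ?pi_ge0// ltW.
have ge0 (g : measurableTypeR R -> \bar R) : measurable_fun setT g -> (forall v, (0 <= g v)%E) ->
    (\int[area_m]_x g (phi x) = \int[mu]_(v in `[0%R, +oo[) ((pi * kappa)%:E * g v))%E.
  move=> mg g0; have := @ge0_integral_pushforward _ _ _ _ _ _ mphi area_m setT g measurableT mg.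
  move=> /(_ (fun v _ => g0 v)); rewrite preimage_setT => <-.
  rewrite (@integral_density _ _ _ mu image `[0, +oo[ (fun=> pi * kappa))//.
  by apply: eq_integral => v _; rewrite muleC.
rewrite -[LHS]/(\int[area_m]_x f (phi x))%E integralE [RHS]integralE; congr (_ - _)%E.
- transitivity (\int[area_m]_x (f^\+)%E (phi x))%E.
    by apply: eq_integral => x _; rewrite !funeposE.
  rewrite (ge0 (f^\+)%E (measurable_funepos mf) (fun v => funepos_ge0 f v)).
  by apply: eq_integral => v _; rewrite ge0_funeposM.
- transitivity (\int[area_m]_x (f^\-)%E (phi x))%E.
    by apply: eq_integral => x _; rewrite !funenegE.
  rewrite (ge0 (f^\-)%E (measurable_funeneg mf) (fun v => funeneg_ge0 f v)).
  by apply: eq_integral => v _; rewrite ge0_funenegM.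
Qed.

End radial.

(** * Poisson point processes *)

Lemma Rintegral_dominated_ae d (T : measurableType d) (R : realType)
    (m : {measure set T -> \bar R}) (f_ : nat -> T -> R) (f g : T -> R) :
  (forall n, measurable_fun setT (f_ n)) -> measurable_fun setT f ->
  {ae m, forall x, f_ n x @[n --> \oo] --> f x} ->
  m.-integrable setT (EFin \o g) -> (forall n x, `|f_ n x| <= g x) ->
  \int[m]_x f_ n x @[n --> \oo] --> \int[m]_x f x.
Proof.
move=> mf_ mf ff ig fg.
have h : {ae m, forall x, setT x -> (f_ n x)%:E @[n --> \oo] --> (f x)%:E}.
  by apply: filterS ff => x fx _; apply: cvg_EFin => //; exact: nearW.
have h' : {ae m, forall x n, setT x -> (`|(f_ n x)%:E| <= (g x)%:E)%E}.
  by apply: aeW => x n _; rewrite lee_fin.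
have [h1 _ h2] := dominated_convergence measurableT
  (fun n => (measurable_EFinP setT (f_ n)).2 (mf_ n)) ((measurable_EFinP setT f).2 mf) h ig h'.
apply: fine_cvg; rewrite /Rintegral fineK//.
exact: integrable_fin_num.
Qed.

Section poisson_mass.
Context {R : realType}.
Variable r : R.

Lemma poisson_mass_cvg : \sum_(0 <= i < n) poisson_mass r i @[n --> \oo] --> (1 : R).
Proof.
have -> : (fun n => \sum_(0 <= i < n) poisson_mass r i) =
    (fun n => expR (- r) * series (exp_coeff r) n).
  apply/funext => n; rewrite /series/= mulr_sumr; apply: eq_bigr => i _.
  by rewrite /poisson_mass /exp_coeff/= mulrA.
rewrite -(expRxMexpNx_1 r) mulrC; apply: cvgM; first exact: cvg_cst.
exact: is_cvg_series_exp_coeff.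
Qed.

Lemma poisson_mass_mean : 
  \sum_(0 <= i < n) (i%:R * poisson_mass r i) @[n --> \oo] --> r.
Proof.
rewrite -cvg_shiftS.
have -> : [sequence \sum_(0 <= i < n.+1) (i%:R * poisson_mass r i)]_n =
    (fun n => r * \sum_(0 <= i < n) poisson_mass r i).
  apply/funext => n /=; rewrite big_nat_recl// mul0r add0r mulr_sumr.
  apply: eq_bigr => i _; rewrite /poisson_mass factS natrM exprS.
  have i1 : i.+1%:R != 0 :> R by rewrite pnatr_eq0.
  have f0 : i`!%:R != 0 :> R by rewrite pnatr_eq0 -lt0n fact_gt0.
  move: (i.+1%:R : R) (i`!%:R : R) i1 f0 => a b a0 b0.
  by field; rewrite a0 b0.
have h : r * \sum_(0 <= i < n) poisson_mass r i @[n --> \oo] --> r * 1.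
  by apply: cvgM; [exact: cvg_cst|exact: poisson_mass_cvg].
by rewrite mulr1 in h.
Qed.

Lemma poisson_mass_pgf (z : R[i]) :
  ccvg (fun n => \sum_(k < n) z ^+ k * Complex (poisson_mass r k) 0)
    (cexp (- (Complex r 0 * (1 - z)))).
Proof.
have -> : - (Complex r 0 * (1 - z)) = Complex (- r) 0 + Complex r 0 * z.
  by apply: complexP; rewrite !ReImE/=; ring.
rewrite cexpD.
have -> : (fun n => \sum_(k < n) z ^+ k * Complex (poisson_mass r k) 0) =
    (fun n => cexp (Complex (- r) 0) * exp_poly (Complex r 0 * z) n).
  apply/funext => n; rewrite /exp_poly mulr_sumr; apply: eq_bigr => k _.
  have -> : cexp (Complex (- r) 0) = Complex (expR (- r)) 0.
    by apply: complexP; rewrite /= ?cos0 ?sin0 ?mulr1 ?mulr0.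
  have CM (s t : R) : Complex (s * t) 0 = Complex s 0 * Complex t 0 :> R[i].
    by apply: complexP; rewrite ReImE/=; ring.
  have CX (s : R) m : Complex (s ^+ m) 0 = Complex s 0 ^+ m :> R[i].
    by elim: m => // m IH; rewrite !exprS CM IH.
  rewrite /poisson_mass !CM CX exprMn natCE.
  have -> : (Complex k`!%:R 0)^-1 = Complex (k`!%:R^-1) 0 :> R[i].
    by rewrite -[RHS]/(real_complex R (k`!%:R^-1)) fmorphV.
  by ring.
by apply: ccvgM; [exact: ccvg_cst|exact: exp_poly_cvg].
Qed.

End poisson_mass.

(** * Campbell's formula *)

Section campbell.
Context d (T : measurableType d) {R : realType} (P : probability T R).
Variables (lam : R) (Y : nat -> {mfun T >-> plane R}).
Hypothesis lam0 : 0 < lam.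
Hypothesis ppp : poisson_point_process P lam (fun j => Y j).

Let N := number_of_points (fun j => Y j).
Let areaM : {measure set (plane R) -> \bar R} :=
  (@lebesgue_measure R \x @lebesgue_measure R)%E.

Lemma measurable_indic_point j A : measurable A ->
  measurable_fun setT (fun e => \1_A (Y j e) : R).
Proof.
by move=> mA; apply: (measurableT_comp (measurable_indic mA)).
Qed.

Lemma measurable_number_of_points A : measurable A -> measurable_fun setT (N A).
Proof.
move=> mA; rewrite /N /number_of_points.
have := @ge0_emeasurable_sum _ T R setT (fun j e => (\1_A (Y j e) : R)%:E) xpredT.
apply => [k x _ _|k _]; first by rewrite lee_fin.
by apply/measurable_EFinP; exact: measurable_indic_point.
Qed.

Lemma measurable_count A (n : nat) : measurable A ->
  measurable [set e | N A e = (n%:R : R)%:E].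
Proof.
move=> mA; rewrite -[X in measurable X]setTI.
exact: (measurable_number_of_points mA measurableT (emeasurable_set1 (n%:R : R)%:E)).
Qed.

Lemma count_law A (n : nat) : measurable A -> (area A < +oo)%E ->
  P [set e | N A e = (n%:R : R)%:E] = (poisson_mass (lam * fine (area A)) n)%:E.
Proof.
move=> mA fA; have := @ppp 1 (fun=> A) (fun=> n).
rewrite big_ord1 => <- //; last first.
  by move=> i j _ _ _; rewrite (ord1 i) (ord1 j).
by congr (P _); apply/seteqP; split => [e h k _//|e h]; exact: (h ord0).
Qed.

Lemma trivIset_count A :
  trivIset setT (fun n : nat => [set e | N A e = (n%:R : R)%:E]).
Proof.
move=> i j _ _ [e [/= -> [] /eqP]].
by rewrite eqr_nat => /eqP.
Qed.

(** The point counts are extended reals; since the Poisson masses sum to 1, no probability is left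
    for an infinite count. *)
Lemma count_finite A : measurable A -> (area A < +oo)%E ->
  {ae P, forall e, exists n : nat, N A e = (n%:R : R)%:E}.
Proof.
move=> mA fA; pose C n := [set e | N A e = (n%:R : R)%:E].
have mC n : measurable (C n) by exact: measurable_count.
have mUC : measurable (\bigcup_n C n) by exact: bigcupT_measurable.
have := @measure_sigma_additive _ _ _ P C mC (trivIset_count (A := A)).
have -> : (fun n => \sum_(0 <= i < n) P (C i))%E =
    (fun n => (\sum_(0 <= i < n) poisson_mass (lam * fine (area A)) i)%:E).
  by apply/funext => n; rewrite -sumEFin; apply: eq_bigr => i _; exact: count_law.
move=> h.
have h1 : (\sum_(0 <= i < n) poisson_mass (lam * fine (area A)) i)%:E @[n --> \oo] --> 1%:E.
  by apply: cvg_EFin; [exact: nearW|exact: poisson_mass_cvg].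
have PU : (P (\bigcup_n C n) = 1)%E by exact: (cvg_unique _ h h1).
exists (~` \bigcup_n C n); split; first exact: measurableC.
  by apply: etrans (probability_setC P mUC) _; rewrite [X in (_ - X)%E]PU subee.
by move=> e /= ne [n _ /= Cn]; apply: ne; exists n.
Qed.

Lemma count_sum A (g : nat -> R) (m : nat) e (n : nat) : N A e = (n%:R : R)%:E ->
  \sum_(0 <= i < m) g i * \1_[set e | N A e = (i%:R : R)%:E] e =
  if (n < m)%N then g n else 0.
Proof.
move=> Nn.
have iE i : \1_[set e | N A e = (i%:R : R)%:E] e = (n == i)%:R :> R.
  rewrite indicE; congr ((_ : bool)%:R); apply/idP/eqP => [|<-]; last by rewrite inE.
  by rewrite inE/= Nn => -[/eqP]; rewrite eqr_nat => /eqP.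
under eq_bigr do rewrite iE.
elim: m => [|m IH]; first by rewrite big_geq.
rewrite big_nat_recr//= IH ltnS.
case: ltngtP => [_|_|->].
- by rewrite mulr0 addr0.
- by rewrite mulr0 addr0.
- by rewrite mulr1 add0r.
Qed.

(** Almost surely the count is the sum of [n] times the indicator of the value [n]; integrating term
    by term gives the mean of the Poisson law. *)
Lemma mean_count A : measurable A -> (area A < +oo)%E ->
  (\int[P]_e N A e = lam%:E * area A)%E.
Proof.
move=> mA fA; pose C n := [set e | N A e = (n%:R : R)%:E].
have mC n : measurable (C n) by exact: measurable_count.
have aA : (area A) \is a fin_num.
  by rewrite ge0_fin_numE//; exact: (measure_ge0 areaM).
transitivity (\int[P]_e (\sum_(n <oo) (n%:R * \1_(C n) e)%:E))%E.
  apply: ae_eq_integral => //.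
  - exact: measurable_number_of_points.
  - apply: (@ge0_emeasurable_sum _ T R setT (fun n e => (n%:R * \1_(C n) e)%:E) xpredT).
      by move=> k x _ _; rewrite lee_fin mulr_ge0.
    move=> k _; apply/measurable_EFinP; apply: measurable_funM; first exact: measurable_cst.
    exact: measurable_indic.
  apply: filterS (count_finite mA fA) => e [n Nn] _.
  apply/esym/cvg_lim => //; apply: cvg_near_cst; near=> m.
  rewrite sumEFin (count_sum (fun n => n%:R) m Nn) ifT//.
  by near: m; exact: nbhs_infty_gt.
rewrite integral_nneseries//; last first.
  move=> n; apply/measurable_EFinP; apply: measurable_funM; first exact: measurable_cst.
  exact: measurable_indic.
apply/cvg_lim => //.
have -> : (fun n => \sum_(0 <= i < n) \int[P]_e (i%:R * \1_(C i) e)%:E)%E =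
    (fun n => (\sum_(0 <= i < n) (i%:R * poisson_mass (lam * fine (area A)) i))%:E).
  apply/funext => n; rewrite -sumEFin; apply: eq_bigr => i _.
  under eq_integral do rewrite EFinM.
  rewrite ge0_integralZl//; last first.
    by apply/measurable_EFinP; exact: measurable_indic.
  by rewrite integral_indic// setIT EFinM; congr (_ * _)%E; exact: count_law.
rewrite -(fineK aA) -EFinM; apply: cvg_EFin; first exact: nearW.
exact: poisson_mass_mean.
Unshelve. all: by end_near. Qed.

Let dist j : {measure set (plane R) -> \bar R} := distribution P (Y j).
Let intensity : {measure set (plane R) -> \bar R} := mseries dist 0.

Let intensity_fin A : measurable A -> (area A < +oo)%E ->
  intensity A = (lam%:E * area A)%E.
Proof.
move=> mA fA; rewrite -mean_count// /N /number_of_points integral_nneseries//.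
  apply: eq_eseriesr => j _.
  transitivity (\int[distribution P (Y j)]_x (\1_A x)%:E)%E.
    by rewrite integral_indic// setIT.
  rewrite ge0_integral_distribution//.
  by apply/measurable_EFinP; exact: measurable_indic.
by move=> j; apply/measurable_EFinP; exact: measurable_indic_point.
Qed.

(** The mean count is known for finite area only; [A] is exhausted by its intersections with discs
    of finite area, and both measures are continuous from below. *)
Let intensityE A : measurable A -> intensity A = (lam%:E * areaM A)%E.
Proof.
move=> mA; pose D (n : nat) := A `&` [set x | sqnorm x <= n%:R].
have mD n : measurable (D n).
  apply: measurableI => //; rewrite -[X in measurable X]setTI.
  rewrite (_ : [set x | _] = sqnorm @^-1` `]-oo, n%:R]); last first.
    by apply/seteqP; split => x /=; rewrite in_itv.
  by apply: (@measurable_sqnorm R) => //; exact: measurable_itv.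
have UD : \bigcup_n D n = A.
  apply/seteqP; split => [x [n _ []]//|x Ax].
  exists (Num.truncn (sqnorm x)).+1 => //; split => //=.
  by apply: ltW; exact: truncnS_gt.
have ndD : nondecreasing_seq D.
  move=> m n mn; apply/subsetPset => x [Ax /= h]; split => //=.
  by apply: le_trans h _; rewrite ler_nat.
have fD n : (areaM (D n) < +oo)%E.
  apply: (@le_lt_trans _ _ (areaM [set x | sqnorm x <= n%:R])).
    apply: le_measure; rewrite ?inE//.
      rewrite (_ : [set x | _] = setT `&` sqnorm @^-1` `]-oo, n%:R]); last first.
        by apply/seteqP; split => x /=; rewrite in_itv/=; [split|case].
      by apply: (@measurable_sqnorm R) => //; exact: measurable_itv.
    by move=> x [].
  by rewrite [X in (X < _)%E](area_disc n%:R) ltry.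
have mUD : measurable (\bigcup_n D n) by rewrite UD.
have h1 := @nondecreasing_cvg_mu _ _ _ intensity D mD mUD ndD.
have h2 := @nondecreasing_cvg_mu _ _ _ areaM D mD mUD ndD.
have h3 : (lam%:E * areaM (D n))%E @[n --> \oo] --> (lam%:E * areaM (\bigcup_n D n))%E.
  by apply: cvgeZl.
have h4 : (fun n => intensity (D n)) = (fun n => (lam%:E * areaM (D n))%E).
  apply/funext => n; exact: (intensity_fin (mD n) (fD n)).
rewrite -UD; apply: (cvg_unique (@ereal_hausdorff R) _ h3).
by rewrite -h4.
Qed.

(** The series of integrals is the integral against the sum of the laws of the points, and that
    intensity measure is [lam] times the area. *)
Theorem campbell (k : plane R -> \bar R) : measurable_fun setT k ->
  (forall x, (0 <= k x)%E) ->
  (\sum_(j <oo) \int[P]_e k (Y j e) = lam%:E * \int[@area R]_x k x)%E.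
Proof.
move=> mk k0.
transitivity (\int[intensity]_x k x)%E.
  rewrite ge0_integral_measure_series//; apply: eq_eseriesr => j _.
  by rewrite ge0_integral_distribution.
rewrite (@integral_density _ _ _ areaM intensity setT (fun=> lam))//; last 2 first.
- by move=> _; exact: ltW.
- by move=> A mA; rewrite setIT integral_cst//; exact: intensityE.
under eq_integral do rewrite muleC.
by rewrite ge0_integralZl// lee_fin ltW.
Qed.

Lemma campbell_partial (k : plane R -> R) n : measurable_fun setT k ->
  (forall x, 0 <= k x) ->
  (\int[P]_e (\sum_(j < n) k (Y j e))%:E <= lam%:E * \int[@area R]_x (k x)%:E)%E.
Proof.
move=> mk k0.
have mkY j : measurable_fun setT (fun e => (k (Y j e))%:E).
  by apply/measurable_EFinP; exact: (measurableT_comp mk).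
rewrite -campbell//; last exact/measurable_EFinP.
under eq_integral do rewrite -sumEFin.
rewrite ge0_integral_sum//; last by move=> j e _; rewrite lee_fin.
rewrite -(big_mkord xpredT (fun j => \int[P]_e (k (Y j e))%:E)%E).
by apply: nneseries_lim_ge => j _ _; apply: integral_ge0 => e _; rewrite lee_fin.
Qed.

End campbell.

Lemma cint_dominated d (T : measurableType d) (R : realType) (P : probability T R)
    (f_ : nat -> T -> R[i]) (f : T -> R[i]) :
  (forall n, cbounded_measurable (f_ n)) -> cbounded_measurable f ->
  (forall n x, normc (f_ n x) <= 1) ->
  {ae P, forall x, ccvg (f_ ^~ x) (f x)} ->
  ccvg (fun n => cint P (f_ n)) (cint P f).
Proof.
move=> bf_ bf f1 ff; split => /=.
- apply: (@Rintegral_dominated_ae _ _ _ P _ _ (fun=> 1)).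
  + by move=> n; have [[]] := bf_ n.
  + by have [[]] := bf.
  + by apply: filterS ff => x [].
  + by apply: bm_integrable; exact: bmcst.
  + by move=> n x; exact: le_trans (normc_Re _) (f1 n x).
- apply: (@Rintegral_dominated_ae _ _ _ P _ _ (fun=> 1)).
  + by move=> n; have [_ []] := bf_ n.
  + by have [_ []] := bf.
  + by apply: filterS ff => x [].
  + by apply: bm_integrable; exact: bmcst.
  + by move=> n x; exact: le_trans (normc_Im _) (f1 n x).
Qed.

(** * Generating functional of a Poisson process on step functions *)

Section generating_functional.
Context d (T : measurableType d) {R : realType} (P : probability T R).
Variables (lam : R) (Y : nat -> {mfun T >-> plane R}).
Hypothesis lam0 : 0 < lam.
Hypothesis ppp : poisson_point_process P lam (fun j => Y j).

Notation N := (number_of_points (fun j => Y j)).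
Notation count A n := [set e | N A e = (n%:R : R)%:E].

Let psum (g : nat -> R) (A : set (plane R)) m e : R :=
  \sum_(0 <= i < m) g i * \1_(count A i) e.

(** A function of the point count, written as a limit of finite sums of indicators: measurability is
    immediate and an infinite count receives the value 0. *)
Definition of_count (g : nat -> R) A e : R := limn (fun m => psum g A m e).

Let psumP g A e : (exists n, forall m, psum g A m e = if (n < m)%N then g n else 0)
  \/ (forall m, psum g A m e = 0).
Proof.
have [[n Nn]|h] := pselect (exists n : nat, N A e = (n%:R : R)%:E).
  by left; exists n => m; exact: count_sum.
right => m; rewrite /psum big1// => i _; rewrite indicE memNset ?mulr0//=.
by move=> Ni; apply: h; exists i.
Qed.

Let psum_cvg g A e : psum g A m e @[m --> \oo] --> of_count g A e.
Proof.
suff : cvg (psum g A m e @[m --> \oo]) by [].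
have [[n h]|h] := psumP g A e.
  apply/cvg_ex; exists (g n); apply: cvg_near_cst; near=> m.
  by rewrite h ifT//; near: m; exact: nbhs_infty_gt.
by apply/cvg_ex; exists 0; under eq_fun do rewrite h; exact: cvg_cst.
Unshelve. all: by end_near. Qed.

Lemma of_countE g A e (n : nat) : N A e = (n%:R : R)%:E -> of_count g A e = g n.
Proof.
move=> Nn; apply/cvg_lim => //; apply: cvg_near_cst; near=> m.
rewrite /psum (count_sum _ _ Nn) ifT//; near: m; exact: nbhs_infty_gt.
Unshelve. all: by end_near. Qed.

Let psum_measurable g A m : measurable A -> measurable_fun setT (psum g A m).
Proof.
move=> mA; rewrite /psum; elim: m => [|m IH].
  by under eq_fun do rewrite big_geq//; exact: measurable_cst.
under eq_fun do rewrite big_nat_recr//=; apply: measurable_funD => //.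
apply: measurable_funM; first exact: measurable_cst.
by apply: measurable_indic; exact: measurable_count.
Qed.

Lemma measurable_of_count g A : measurable A -> measurable_fun setT (of_count g A).
Proof.
move=> mA; apply: (measurable_fun_cvg (h := psum g A)) => [m|e _].
  exact: psum_measurable.
exact: psum_cvg.
Qed.

Lemma of_count_Re_Im (g : nat -> R[i]) A e (k : R) :
  (forall n, normc (g n) <= k) -> 0 <= k ->
  normc (Complex (of_count (fun n => complex.Re (g n)) A e)
                 (of_count (fun n => complex.Im (g n)) A e)) <= k.
Proof.
move=> gk k0; have [[n Nn]|h] := pselect (exists n : nat, N A e = (n%:R : R)%:E).
  by rewrite !(of_countE _ Nn); have := gk n; case: (g n).
have h0 g' : of_count g' A e = 0.
  apply/cvg_lim => //; apply: cvg_near_cst; apply: nearW => m.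
  rewrite /psum big1// => i _; rewrite indicE memNset ?mulr0//=.
  by move=> Ni; apply: h; exists i.
by rewrite !h0 Normc.normc0.
Qed.

(** The random variable [z] to the power of the number of points in [A]; [wpart] truncates it to
    counts below [m]. *)
Let w (z : R[i]) A e : R[i] :=
  Complex (of_count (fun n => complex.Re (z ^+ n)) A e)
          (of_count (fun n => complex.Im (z ^+ n)) A e).

Let wpart (z : R[i]) A m e : R[i] :=
  Complex (psum (fun n => complex.Re (z ^+ n)) A m e)
          (psum (fun n => complex.Im (z ^+ n)) A m e).

Let w_le (z : R[i]) A e : normc z <= 1 -> normc (w z A e) <= 1.
Proof.
by move=> z1; apply: of_count_Re_Im => // n; rewrite normcX exprn_ile1// normc_ge0.
Qed.

Let wpart_le (z : R[i]) A m e : normc z <= 1 -> normc (wpart z A m e) <= 1.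
Proof.
move=> z1; rewrite /wpart.
have [[n Nn]|h] := pselect (exists n : nat, N A e = (n%:R : R)%:E).
  rewrite /psum !(count_sum _ _ Nn); case: ifP => _; last by rewrite Normc.normc0.
  have : normc (z ^+ n) <= 1 by rewrite normcX exprn_ile1// normc_ge0.
  by case: (z ^+ n).
have h0 g : psum g A m e = 0.
  rewrite /psum big1// => i _; rewrite indicE memNset ?mulr0//=.
  by move=> Ni; apply: h; exists i.
by rewrite !h0 Normc.normc0.
Qed.

Let cbm_of (f : T -> R[i]) : measurable_fun setT (fun e => complex.Re (f e)) ->
  measurable_fun setT (fun e => complex.Im (f e)) -> (forall e, normc (f e) <= 1) ->
  cbounded_measurable f.
Proof.
move=> m1 m2 f1; split; split => //; exists 1 => e.
  exact: le_trans (normc_Re _) (f1 e).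
exact: le_trans (normc_Im _) (f1 e).
Qed.

Let w_bm z A : measurable A -> normc z <= 1 -> cbounded_measurable (w z A).
Proof.
by move=> mA z1; apply: cbm_of => [||e]; [exact: measurable_of_count..|exact: w_le].
Qed.

Let wpart_bm z A m : measurable A -> normc z <= 1 -> cbounded_measurable (wpart z A m).
Proof.
by move=> mA z1; apply: cbm_of => [||e]; [exact: psum_measurable..|exact: wpart_le].
Qed.

Let wpart_cvg z A e : ccvg (fun m => wpart z A m e) (w z A e).
Proof. by split; exact: psum_cvg. Qed.

Section cells.
Variables (m : nat) (A : 'I_m -> set (plane R)) (z : 'I_m -> R[i]).
Hypothesis mA : forall k, measurable (A k).
Hypothesis fA : forall k, (area (A k) < +oo)%E.
Hypothesis tA : trivIset setT A.
Hypothesis z1 : forall k, normc (z k) <= 1.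

Let mass k : R := lam * fine (area (A k)).
Let phi k : R[i] := cexp (- (Complex (mass k) 0 * (1 - z k))).

Let one k n e : R[i] := Complex (\1_(count (A k) n) e) 0.

Let one_le k n e : normc (one k n e) <= 1.
Proof.
by rewrite /one normc_real indicE; case: (_ \in _); rewrite ?normr1 ?normr0.
Qed.

Let one_bm k n : cbounded_measurable (one k n).
Proof.
apply: cbm_of => [||e]; [|exact: measurable_cst|exact: one_le].
by apply: measurable_indic; exact: measurable_count.
Qed.

(* The independence of the counts is transferred to functions of the counts one
   cell at a time: the first [r] cells carry [w], the others an indicator. *)
Let fac (r : nat) (n : 'I_m -> nat) (k : 'I_m) e : R[i] :=
  if (k < r)%N then w (z k) (A k) e else one k (n k) e.

Let val (r : nat) (n : 'I_m -> nat) (k : 'I_m) : R[i] :=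
  if (k < r)%N then phi k else Complex (poisson_mass (mass k) (n k)) 0.

Let fac_bm r n k : cbounded_measurable (fac r n k).
Proof. by rewrite /fac; case: (k < r)%N; [exact: w_bm|exact: one_bm]. Qed.

Let fac_le r n k e : normc (fac r n k e) <= 1.
Proof. by rewrite /fac; case: (k < r)%N; [exact: w_le|exact: one_le]. Qed.

(** With an indicator in every cell the formula is exactly the joint law of the counts postulated by
    [ppp]. *)
Let base n : cint P (fun e => \prod_(k < m) fac 0 n k e) = \prod_(k < m) val 0 n k.
Proof.
pose B := \bigcap_k count (A k) (n k).
have CM (s t : R) : Complex (s * t) 0 = Complex s 0 * Complex t 0 :> R[i].
  by apply: complexP; rewrite ReImE/=; ring.
have prodC (I : Type) (s : seq I) (f : I -> R) :
    \prod_(i <- s) Complex (f i) 0 = Complex (\prod_(i <- s) f i) 0 :> R[i].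
  by elim: s => [|i s IH]; rewrite ?big_nil// !big_cons IH CM.
have PB : P B = (\prod_(k < m) poisson_mass (mass k) (n k))%:E.
  by rewrite /B ppp// -prodEFin.
have mB : measurable B.
  rewrite /B; apply: fin_bigcap_measurable => // k _; exact: measurable_count.
have -> : (fun e => \prod_(k < m) fac 0 n k e) = (fun e => Complex (\1_B e) 0).
  apply/funext => e; rewrite /fac /one /= prodC; congr Complex.
  rewrite [RHS]indicE; case: (boolP (e \in B)) => [|].
    rewrite inE => Be; rewrite big1// => k _.
    by rewrite indicE mem_set//; exact: Be.
  rewrite notin_setE => /existsNP[k] /not_implyP[_ nk].
  by rewrite (bigD1 k)//= indicE memNset// mul0r.
rewrite /val /= prodC; apply: complexP => /=; last by rewrite bm_int_cst.
by rewrite /Rintegral integral_indic// setIT; exact: (congr1 fine PB).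
Qed.

(** One more indicator is traded for [w]: the induction hypothesis is summed over the values of the
    count in cell [i0] with weights [z^k], and the sum converges to the Poisson generating
    function. *)
Let step r n : (forall n', cint P (fun e => \prod_(k < m) fac r n' k e) = \prod_(k < m) val r n' k) ->
  (r < m)%N ->
  cint P (fun e => \prod_(k < m) fac r.+1 n k e) = \prod_(k < m) val r.+1 n k.
Proof.
move=> IH rm; pose i0 := Ordinal rm.
pose upd i (k : 'I_m) := if k == i0 then i else n k.
pose h e := \prod_(k < m | k != i0) fac r n k e.
pose H := \prod_(k < m | k != i0) val r n k.
have nlt (k : 'I_m) : k != i0 -> (k < r.+1)%N = (k < r)%N.
  move=> ki; rewrite ltnS leq_eqVlt.
  by have /negbTE -> : (k : nat) != r.
have -> : (fun e => \prod_(k < m) fac r.+1 n k e) = (fun e => w (z i0) (A i0) e * h e).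
  apply/funext => e; rewrite (bigD1 i0)//= {1}/fac ltnSn; congr (_ * _).
  by apply: eq_bigr => k ki; rewrite /fac nlt.
have -> : \prod_(k < m) val r.+1 n k = phi i0 * H.
  rewrite (bigD1 i0)//= {1}/val ltnSn; congr (_ * _).
  by apply: eq_bigr => k ki; rewrite /val nlt.
have h_bm : cbounded_measurable h.
  rewrite /h; under eq_fun do rewrite -big_filter.
  by apply: cbm_prod => k; exact: fac_bm.
have h_le e : normc (h e) <= 1.
  by rewrite /h -big_filter; apply: normc_prod_le1 => k; exact: fac_le.
have hi i : cint P (fun e => one i0 i e * h e) = Complex (poisson_mass (mass i0) i) 0 * H.
  have := IH (upd i).
  have -> : (fun e => \prod_(k < m) fac r (upd i) k e) = (fun e => one i0 i e * h e).
    apply/funext => e; rewrite (bigD1 i0)//= {1}/fac ltnn /upd eqxx; congr (_ * _).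
    by apply: eq_bigr => k /negbTE ki; rewrite /fac ki.
  move=> ->; rewrite (bigD1 i0)//= {1}/val ltnn /upd eqxx; congr (_ * _).
  by apply: eq_bigr => k /negbTE ki; rewrite /val ki.
have part M : cint P (fun e => wpart (z i0) (A i0) M e * h e) =
    (\sum_(k < M) z i0 ^+ k * Complex (poisson_mass (mass i0) k) 0) * H.
  elim: M => [|M IHM].
    rewrite big_ord0 mul0r -[RHS](cint_cst P); congr cint; apply/funext => e.
    by rewrite /wpart /psum !big_geq// mul0r.
  rewrite big_ord_recr/= mulrDl -IHM -mulrA -hi -cintZ; last exact: cbmM.
  rewrite -cintD.
  - congr cint; apply/funext => e.
    rewrite mulrA -mulrDl; congr (_ * _).
    rewrite /wpart /psum !big_nat_recr//=; apply: complexP; rewrite !ReImE/= mulr0 ?subr0 ?addr0//.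
    by rewrite add0r.
  - by apply: cbmM => //; exact: wpart_bm.
  - by apply: cbmM; [exact: cbm_cst|exact: cbmM].
have c1 : ccvg (fun M => cint P (fun e => wpart (z i0) (A i0) M e * h e))
    (cint P (fun e => w (z i0) (A i0) e * h e)).
  apply: cint_dominated.
  - by move=> M; apply: cbmM => //; exact: wpart_bm.
  - by apply: cbmM => //; exact: w_bm.
  - by move=> M e; rewrite Normc.normcM mulr_ile1 ?normc_ge0//; exact: wpart_le.
  - by apply: aeW => e; apply: ccvgM; [exact: wpart_cvg|exact: ccvg_cst].
apply: (ccvg_unique c1).
have -> : (fun M => cint P (fun e => wpart (z i0) (A i0) M e * h e)) =
  (fun M => (\sum_(k < M) z i0 ^+ k * Complex (poisson_mass (mass i0) k) 0) * H).
  by apply/funext => M; exact: part.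
by apply: ccvgM; [exact: poisson_mass_pgf|exact: ccvg_cst].
Qed.

Let w_prod : cint P (fun e => \prod_(k < m) w (z k) (A k) e) = \prod_(k < m) phi k.
Proof.
have h r : (r <= m)%N -> forall n,
    cint P (fun e => \prod_(k < m) fac r n k e) = \prod_(k < m) val r n k.
  elim: r => [_ n|r IH rm n]; first exact: base.
  by apply: step => //; apply: IH; exact: ltnW.
have := h m (leqnn m) (fun=> 0%N).
have -> : (fun e => \prod_(k < m) fac m (fun=> 0%N) k e) = (fun e => \prod_(k < m) w (z k) (A k) e).
  by apply/funext => e; apply: eq_bigr => k _; rewrite /fac ltn_ord.
by move=> ->; apply: eq_bigr => k _; rewrite /val ltn_ord.
Qed.

Let hit (x : plane R) k : R[i] := if x \in A k then z k else 1.

(** The number of enumerated points in the cell is an integer sequence converging to the finite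
    count, hence eventually constant. *)
Let hit_cvg k e (n0 : nat) : N (A k) e = (n0%:R : R)%:E ->
  ccvg (fun n => \prod_(j < n) hit (Y j e) k) (w (z k) (A k) e).
Proof.
move=> Nn.
pose c n := (\sum_(j < n) (Y j e \in A k : nat))%N.
have cE n : \prod_(j < n) hit (Y j e) k = z k ^+ c n.
  rewrite /c; elim: n => [|n IH]; first by rewrite !big_ord0 expr0.
  rewrite !big_ord_recr/= IH exprD; congr (_ * _).
  by rewrite /hit; case: (_ \in _).
have cn : (c n)%:R @[n --> \oo] --> (n0%:R : R).
  have h : ((c n)%:R : R)%:E @[n --> \oo] --> (n0%:R : R)%:E.
    rewrite -Nn /number_of_points.
    have -> : (fun n => ((c n)%:R : R)%:E) = (fun n => \sum_(0 <= j < n) (\1_(A k) (Y j e) : R)%:E)%E.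
      apply/funext => n; rewrite sumEFin big_mkord /c natr_sum; congr EFin.
    by apply: is_cvg_nneseries => j _ _; rewrite lee_fin.
  exact: (fine_cvg h).
have ev : \forall n \near \oo, c n = n0.
  have : \forall n \near \oo, `|n0%:R - (c n)%:R| < 1 :> R by apply: cvgr_dist_lt.
  apply: filterS => n.
  rewrite ltr_norml ltrBlDl natr1 ltr_nat ltnS ltrBrDr addrC => /andP[h1 h2].
  rewrite -[_ - 1]/(_ + (- 1)) ltrBlDr natr1 ltr_nat ltnS in h1.
  by apply/eqP; rewrite eqn_leq h1.
have wE : w (z k) (A k) e = z k ^+ n0.
  by rewrite /w !(of_countE _ Nn); case: (z k ^+ n0).
by split; apply: cvg_near_cst; apply: filterS ev => n cn0; rewrite cE cn0 wE.
Qed.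

Lemma step_generating_functional :
  ccvg (fun n => cint P (fun e => \prod_(j < n) \prod_(k < m) hit (Y j e) k))
    (\prod_(k < m) phi k).
Proof.
rewrite -w_prod; apply: cint_dominated.
- move=> n; apply: cbm_prod => j; apply: cbm_prod => k.
  apply: cbm_of.
  + have -> : (fun e => complex.Re (hit (Y j e) k)) =
        (fun e => complex.Re (z k) * \1_(A k) (Y j e) + (1 - \1_(A k) (Y j e))).
      by apply/funext => e; rewrite /hit indicE; case: (_ \in _) => /=; ring.
    have mi := @measurable_indic_point _ _ _ Y j (A k) (mA k).
    apply: measurable_funD; first by apply: measurable_funM => //; exact: measurable_cst.
    by apply: measurable_funB => //; exact: measurable_cst.
  + have -> : (fun e => complex.Im (hit (Y j e) k)) =
        (fun e => complex.Im (z k) * \1_(A k) (Y j e)).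
      by apply/funext => e; rewrite /hit indicE; case: (_ \in _) => /=; ring.
    have mi := @measurable_indic_point _ _ _ Y j (A k) (mA k).
    by apply: measurable_funM => //; exact: measurable_cst.
  + by move=> e; rewrite /hit; case: ifP => _ //; rewrite Normc.normc1.
- by apply: cbm_prod => k; exact: w_bm.
- move=> n e; apply: normc_prod_le1 => j; apply: normc_prod_le1 => k.
  by rewrite /hit; case: ifP => _ //; rewrite Normc.normc1.
- have : {ae P, forall e, forall k, exists n : nat, N (A k) e = (n%:R : R)%:E}.
    by apply: filter_forall => k; exact: (count_finite ppp (mA k) (fA k)).
  apply: filterS => e he.
  under [X in ccvg X _]eq_fun do rewrite exchange_big/=.
  apply: ccvg_prod => k; have [n0] := he k; exact: hit_cvg.
Qed.

End cells.

End generating_functional.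

Section complex_limit_interchange.
Context {R : realType}.
Implicit Types (u : nat -> R[i]) (z : R[i]).

Lemma ccvgP u z : (forall e : R, 0 < e -> \forall n \near \oo, normc (u n - z) < e) ->
  ccvg u z.
Proof.
move=> h; split; apply/cvgrPdist_lt => e /h; apply: filterS => n.
  by apply: le_lt_trans; rewrite -ReN -ReD normcB normc_Re.
by apply: le_lt_trans; rewrite -ImN -ImD normcB normc_Im.
Qed.

Lemma ccvg_near u z (e : R) : ccvg u z -> 0 < e ->
  \forall n \near \oo, normc (u n - z) < e.
Proof.
move=> /ccvg_norm h e0.
have : \forall n \near \oo, `|0 - normc (u n - z)| < e by exact: cvgr_dist_lt.
by apply: filterS => n; rewrite sub0r normrN ger0_norm// normc_ge0.
Qed.

(** Three-epsilon argument; what matters is that the error [e m] is uniform in [n]. *)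
Lemma ccvg_interchange u (v : nat -> nat -> R[i]) (c : nat -> R[i]) (e : nat -> R) z :
  (forall m n, normc (u n - v m n) <= e m) -> (forall m, ccvg (v m) (c m)) ->
  ccvg c z -> e m @[m --> \oo] --> (0 : R) -> ccvg u z.
Proof.
move=> uv vc cz e0; apply: ccvgP => eps eps0.
have eps3 : 0 < eps / 3 by rewrite divr_gt0.
have h1 := ccvg_near cz eps3.
have h2 : \forall m \near \oo, `|0 - e m| < eps / 3 by exact: cvgr_dist_lt.
have [m [hm1 hm2]] : exists m, normc (c m - z) < eps / 3 /\ `|0 - e m| < eps / 3.
  have [m _ hm] := filterI h1 h2; exists m; exact: hm m (leqnn m).
have h3 := ccvg_near (vc m) eps3.
apply: filterS h3 => n hn.
have -> : u n - z = (u n - v m n) + ((v m n - c m) + (c m - z)) by ring.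
apply: le_lt_trans (normcD _ _) _.
apply: le_lt_trans (lerD (uv m n) (normcD _ _)) _.
have := ler_norm (- (0 - e m)); rewrite normrN.
have -> : eps = eps / 3 + (eps / 3 + eps / 3) by field.
by lra.
Qed.

Lemma ccvg_cexp u z : ccvg u z -> ccvg (fun n => cexp (u n)) (cexp z).
Proof.
move=> [h1 h2].
have e1 : expR (complex.Re (u n)) @[n --> \oo] --> expR (complex.Re z).
  by apply: continuous_cvg => //; exact: continuous_expR.
have e2 : cos (complex.Im (u n)) @[n --> \oo] --> cos (complex.Im z).
  by apply: continuous_cvg => //; exact: continuous_cos.
have e3 : sin (complex.Im (u n)) @[n --> \oo] --> sin (complex.Im z).
  by apply: continuous_cvg => //; exact: continuous_sin.
by split => /=; exact: cvgM.
Qed.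

Lemma lipschitz_continuous (f : R -> R) (L : R) :
  (forall x y, `|f x - f y| <= L * `|x - y|) -> continuous f.
Proof.
move=> fL x; apply/cvgrPdist_lt => e e0.
have L0 : 0 <= L.
  by have := fL 1 0; rewrite subr0 normr1 mulr1; apply: le_trans.
have L1 : 0 < L + 1 by rewrite ltr_wpDl.
near=> y; apply: le_lt_trans (fL x y) _.
apply: (@le_lt_trans _ _ ((L + 1) * `|x - y|)).
  by rewrite ler_wpM2r// lerDl.
rewrite mulrC -ltr_pdivlMr//; near: y.
by apply: cvgr_dist_lt; rewrite ?divr_gt0//; exact: cvg_id.
Unshelve. all: by end_near. Qed.

Lemma lipschitz_Re_continuous (G : R -> R[i]) (L : R) :
  (forall x y, normc (G x - G y) <= L * `|x - y|) ->
  continuous (fun y => complex.Re (G y)) /\ continuous (fun y => complex.Im (G y)).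
Proof.
move=> GL; split; apply: (@lipschitz_continuous _ L) => x y; apply: le_trans (GL x y).
  by rewrite -ReN -ReD normc_Re.
by rewrite -ImN -ImD normc_Im.
Qed.

End complex_limit_interchange.

(** * Generating functional for integrable functions *)

Section generating_functional_limit.
Context d (T : measurableType d) {R : realType} (P : probability T R).
Variables (lam : R) (Y : nat -> {mfun T >-> plane R}).
Hypothesis lam0 : 0 < lam.
Hypothesis ppp : poisson_point_process P lam (fun j => Y j).

Let areaM : {measure set (plane R) -> \bar R} :=
  (@lebesgue_measure R \x @lebesgue_measure R)%E.

Variables (G : R -> R[i]) (L : R) (h : plane R -> R).
Hypothesis G1 : forall y, normc (G y) <= 1.
Hypothesis G0 : G 0 = 1.
Hypothesis GL : forall x y, normc (G x - G y) <= L * `|x - y|.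
Hypothesis mh : measurable_fun setT h.
Hypothesis h01 : forall x, 0 <= h x <= 1.
Hypothesis ih : areaM.-integrable setT (EFin \o h).

Let L0 : 0 <= L.
Proof.
have := GL 1 0; rewrite subr0 normr1 mulr1; apply: le_trans; exact: normc_ge0.
Qed.

(* Step functions from below: the generating functional is explicit for them
   and passes to the limit. *)
Let hm (m : nat) x : R := (Num.truncn (m.+1%:R * h x))%:R / m.+1%:R.

Let trunc_itv m x : (Num.truncn (m.+1%:R * h x))%:R <= m.+1%:R * h x
   < (Num.truncn (m.+1%:R * h x)).+1%:R.
Proof.
by apply: truncn_itv; rewrite mulr_ge0//; have /andP[] := h01 x.
Qed.

Let hm_le m x : hm m x <= h x.
Proof. by rewrite /hm ler_pdivrMr// [leRHS]mulrC; have /andP[] := trunc_itv m x. Qed.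

Let hm_ge0 m x : 0 <= hm m x.
Proof. by rewrite /hm divr_ge0. Qed.

Let hm_dist m x : h x - hm m x <= m.+1%:R^-1.
Proof.
rewrite lerBlDr /hm -{1}[_^-1]mul1r -mulrDl ler_pdivlMr// [leLHS]mulrC addrC natr1.
by have /andP[_ /ltW] := trunc_itv m x.
Qed.

Let hm_cvg x : hm m x @[m --> \oo] --> h x.
Proof.
apply: (@cvg_dist_le _ _ (fun m => m.+1%:R^-1)); last exact: cvg_harmonic.
by move=> m; rewrite distrC ger0_norm ?hm_dist// subr_ge0.
Qed.

Let cell m (k : nat) := [set x | Num.truncn (m.+1%:R * h x) = k].

Let cellE m k : cell m k = [set x | (k%:R <= m.+1%:R * h x) && (m.+1%:R * h x < k.+1%:R)].
Proof.
apply/seteqP; split => x /=; first by move=> <-; exact: trunc_itv.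
by move=> hx; exact: truncn_def.
Qed.

Let mcell m k : measurable (cell m k).
Proof.
rewrite cellE -[X in measurable X]setTI.
have mg : measurable_fun setT (fun x => m.+1%:R * h x).
  by apply: measurable_funM => //; exact: measurable_cst.
apply: (measurable_and (measurable_fun_ler (measurable_cst _) mg)
  (measurable_fun_ltr mg (measurable_cst _)) measurableT (Y := [set true])).
by [].
Qed.

Let mhm m : measurable_fun setT (hm m).
Proof.
have -> : hm m = fun x => \sum_(k < m.+2) (k%:R / m.+1%:R) * \1_(cell m k) x.
  apply/funext => x.
  have tm : (Num.truncn (m.+1%:R * h x) < m.+2)%N.
    rewrite -(ltr_nat R); have /andP[h1 _] := trunc_itv m x.
    apply: le_lt_trans h1 _; apply: (@le_lt_trans _ _ m.+1%:R); last by rewrite ltr_nat.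
    by rewrite ler_piMr//; have /andP[] := h01 x.
  rewrite (bigD1 (Ordinal tm))//= indicE mem_set// mulr1 big1 ?addr0// => k kt.
  rewrite indicE memNset ?mulr0// => /= tk; move/eqP: kt; apply.
  by apply: val_inj => /=; rewrite tk.
elim: (m.+2) => [|n IH].
  by under eq_fun do rewrite big_ord0; exact: measurable_cst.
under eq_fun do rewrite big_ord_recr/=; apply: measurable_funD => //.
apply: measurable_funM; first exact: measurable_cst.
exact: measurable_indic.
Qed.

Let ihle (k : plane R -> R) : measurable_fun setT k -> (forall x, `|k x| <= h x) ->
  areaM.-integrable setT (EFin \o k).
Proof.
move=> mk kh; apply: (le_integrable measurableT _ _ ih); first exact/measurable_EFinP.
by move=> x _; rewrite /= lee_fin (le_trans (kh x))// ler_norm.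
Qed.

(** On a cell of positive level [h] is at least [1 / (m+1)], so Markov's inequality bounds its area
    by the integral of [h]. The level 0 cell may have infinite area, but there [G 0 = 1] contributes
    nothing. *)
Let fcell m k : (area (cell m k.+1) < +oo)%E.
Proof.
rewrite -[area _]/(areaM (cell m k.+1)) -[cell _ _]setIT -integral_indic//.
have : (\int[areaM]_x (m.+1%:R * h x)%:E < +oo)%E.
  have := integrableZl measurableT m.+1%:R ih.
  move=> /integrableP[_]; apply: le_lt_trans; apply: ge0_le_integral => //.
  - by move=> x _; rewrite lee_fin mulr_ge0//; have /andP[] := h01 x.
  - by apply/measurable_EFinP; apply: measurable_funM => //; exact: measurable_cst.
  - apply: measurableT_comp => //; apply/measurable_EFinP.
    by apply: measurable_funM => //; exact: measurable_cst.
  - by move=> x _; rewrite /= lee_fin ler_norm.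
apply: le_lt_trans; apply: ge0_le_integral => //.
- by apply/measurable_EFinP; exact: measurable_indic.
- by apply/measurable_EFinP; apply: measurable_funM => //; exact: measurable_cst.
move=> x _; rewrite lee_fin indicE; case: (boolP (x \in _)) => [|_].
  rewrite inE cellE/= => /andP[h1 _]; apply: le_trans h1.
  by rewrite ler1n.
by rewrite mulr_ge0//; have /andP[] := h01 x.
Qed.

Definition gap_integral (k : plane R -> R) : R[i] :=
  Complex (\int[areaM]_x complex.Re (1 - G (k x))) (\int[areaM]_x complex.Im (1 - G (k x))).

Let G_gap y : 0 <= y -> normc (1 - G y) <= L * y.
Proof.
by move=> y0; have := GL 0 y; rewrite G0 sub0r normrN ger0_norm.
Qed.

Let ReG := (lipschitz_Re_continuous GL).1.
Let ImG := (lipschitz_Re_continuous GL).2.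

Let mRe (k : plane R -> R) : measurable_fun setT k ->
  measurable_fun setT (fun x => complex.Re (1 - G (k x))).
Proof.
move=> mk; under eq_fun do rewrite ReD ReN.
apply: measurable_funB; first exact: measurable_cst.
exact: (measurableT_comp (continuous_measurable_fun ReG)).
Qed.

Let mIm (k : plane R -> R) : measurable_fun setT k ->
  measurable_fun setT (fun x => complex.Im (1 - G (k x))).
Proof.
move=> mk; under eq_fun do rewrite ImD ImN.
apply: measurable_funB; first exact: measurable_cst.
exact: (measurableT_comp (continuous_measurable_fun ImG)).
Qed.

Let iLh : areaM.-integrable setT (EFin \o (fun x => L * h x)).
Proof. exact: (integrableZl measurableT L ih). Qed.

Let gap_cvg : ccvg (fun m => gap_integral (hm m)) (gap_integral h).
Proof.
have le m x : normc (1 - G (hm m x)) <= L * h x.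
  by apply: le_trans (G_gap (hm_ge0 m x)) _; rewrite ler_wpM2l.
split => /=.
- apply: (@Rintegral_dominated _ _ _ areaM _ _ _ _ _ _ iLh) => //.
  + by move=> n; exact: mRe.
  + exact: mRe.
  + move=> x; rewrite ReD ReN; under eq_fun do rewrite ReD ReN.
    apply: cvgB; first exact: cvg_cst.
    exact: (cvg_comp _ _ (@hm_cvg x) (@ReG (h x))).
  + by move=> n x; exact: le_trans (normc_Re _) (le n x).
- apply: (@Rintegral_dominated _ _ _ areaM _ _ _ _ _ _ iLh) => //.
  + by move=> n; exact: mIm.
  + exact: mIm.
  + move=> x; rewrite ImD ImN; under eq_fun do rewrite ImD ImN.
    apply: cvgB; first exact: cvg_cst.
    exact: (cvg_comp _ _ (@hm_cvg x) (@ImG (h x))).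
  + by move=> n x; exact: le_trans (normc_Im _) (le n x).
Qed.

Let excess_cvg : \int[areaM]_x (h x - hm m x) @[m --> \oo] --> (0 : R).
Proof.
have -> : (0 : R) = \int[areaM]_x (0 : R).
  by rewrite /Rintegral integral0.
apply: (@Rintegral_dominated _ _ _ areaM _ _ _ _ _ _ ih) => //.
- by move=> n; exact: measurable_funB.
- move=> x; rewrite -(subrr (h x)); apply: cvgB; first exact: cvg_cst.
  exact: hm_cvg.
- move=> n x; rewrite ger0_norm ?subr_ge0//.
  by rewrite lerBlDr lerDl.
Qed.

Let z m (k : 'I_m.+1) : R[i] := G (k.+1%:R / m.+1%:R).
Let A m (k : 'I_m.+1) := cell m k.+1.

(** The cells are disjoint, so at most one factor differs from 1; outside all of them the step
    function is 0 and [G 0 = 1]. *)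
Let step_prod m x : \prod_(k < m.+1) (if x \in A k then z k else 1) = G (hm m x).
Proof.
have tm : (Num.truncn (m.+1%:R * h x) <= m.+1)%N.
  rewrite -ltnS -(ltr_nat R); have /andP[h1 _] := trunc_itv m x.
  apply: le_lt_trans h1 _; apply: (@le_lt_trans _ _ m.+1%:R); last by rewrite ltr_nat.
  by rewrite ler_piMr//; have /andP[] := h01 x.
rewrite /hm; move: tm; case E : (Num.truncn (m.+1%:R * h x)) => [|k] km.
  rewrite mul0r G0 big1// => k _; rewrite memNset//= /A /cell /= E.
  by [].
have km' : (k < m.+1)%N by [].
rewrite (bigD1 (Ordinal km'))//= mem_set// big1 ?mulr1// => i ik.
rewrite memNset// /A /cell /= E => -[ki]; move/eqP: ik; apply.
by apply: val_inj.
Qed.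

Let step_gap m : \prod_(k < m.+1) cexp (- (Complex (lam * fine (area (A k))) 0 * (1 - z k))) =
  cexp (- (Complex lam 0 * gap_integral (hm m))).
Proof.
have -> : gap_integral (hm m) = \sum_(k < m.+1) Complex (fine (area (A k))) 0 * (1 - z k).
  have mA (k : 'I_m.+1) : measurable (A k) by exact: mcell.
  have iA (k : 'I_m.+1) : areaM.-integrable setT (EFin \o (\1_(A k) : plane R -> R)).
    apply/integrableP; split; first by apply/measurable_EFinP; exact: measurable_indic.
    rewrite (eq_integral (fun x => (\1_(A k) x)%:E)).
      by rewrite integral_indic// setIT; exact: fcell.
    by move=> x _; rewrite /= ger0_norm.
  have pw x : 1 - G (hm m x) = \sum_(k < m.+1) Complex (\1_(A k) x) 0 * (1 - z k).
    have : \sum_(k < m.+1) Complex (\1_(A k) x) 0 * (1 - z k) =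
        1 - \prod_(k < m.+1) (if x \in A k then z k else 1).
      have [[k Ak]|nA] := pselect (exists k : 'I_m.+1, x \in A k).
        have other (i : 'I_m.+1) : i != k -> (x \in A i) = false.
          move=> ik; apply: memNset => /=; rewrite inE in Ak.
          rewrite /A /cell/= => Ai; move: Ak; rewrite /A /cell/= Ai => -[ki].
          by move/eqP: ik; apply; apply: val_inj.
        rewrite (bigD1 k)//= [in RHS](bigD1 k)//= indicE Ak mul1r !big1 ?mulr1 ?addr0//.
          by move=> i /other ->.
        by move=> i /other; rewrite indicE => ->; rewrite mul0r.
      rewrite !big1 ?subrr// => k _; last first.
        by rewrite indicE; case: (boolP (x \in A k)) => [Ak|_]; [case: nA; exists k|rewrite mul0r].
      by case: ifP => // Ak; case: nA; exists k.
    by move=> ->; rewrite step_prod.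
  have RS (f : 'I_m.+1 -> R) :
      \int[areaM]_x (\sum_(k < m.+1) \1_(A k) x * f k) = \sum_(k < m.+1) fine (area (A k)) * f k.
    have if_ k : areaM.-integrable setT (fun x => (\1_(A k) x * f k)%:E).
      exact: (integrableZr measurableT (f k) (iA k)).
    rewrite /Rintegral; under eq_integral do rewrite -sumEFin.
    rewrite integral_sum//.
    rewrite (eq_bigr (fun k => (fine (area (A k)) * f k)%:E)) ?sumEFin// => k _.
    rewrite -[LHS]fineK; last exact: (integrable_fin_num measurableT (if_ k)).
    rewrite -[X in X%:E]/(\int[areaM]_x (\1_(A k) x * f k)) RintegralZr//.
    by rewrite /Rintegral integral_indic// setIT.
  apply: complexP; rewrite ?Re_sum ?Im_sum /gap_integral /=.
    transitivity (\int[areaM]_x (\sum_(k < m.+1) \1_(A k) x * complex.Re (1 - z k))).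
      apply: eq_Rintegral => x _; rewrite pw Re_sum; apply: eq_bigr => k _.
      by rewrite cReM/= mul0r subr0.
    by rewrite RS; apply: eq_bigr => k _; rewrite cReM/= mul0r subr0.
  transitivity (\int[areaM]_x (\sum_(k < m.+1) \1_(A k) x * complex.Im (1 - z k))).
    apply: eq_Rintegral => x _; rewrite pw Im_sum; apply: eq_bigr => k _.
    by rewrite cImM/= mul0r addr0.
  by rewrite RS; apply: eq_bigr => k _; rewrite cImM/= mul0r addr0.
rewrite mulr_sumr -sumrN (big_morph _ (@cexpD R) (@cexp0 R)).
apply: eq_bigr => k _; congr cexp; congr (- _); rewrite mulrA; congr (_ * _).
by apply: complexP; rewrite ReImE/=; ring.
Qed.

Let GY_bm (k : plane R -> R) j : measurable_fun setT k ->
  cbounded_measurable (fun e => G (k (Y j e))).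
Proof.
move=> mk; have mkY : measurable_fun setT (fun e => k (Y j e)) by exact: (measurableT_comp mk).
split; split.
- exact: (measurableT_comp (continuous_measurable_fun ReG)).
- by exists 1 => e; exact: le_trans (normc_Re _) (G1 _).
- exact: (measurableT_comp (continuous_measurable_fun ImG)).
- by exists 1 => e; exact: le_trans (normc_Im _) (G1 _).
Qed.

(** Replacing [h] by a step function changes the product by at most [L] times the sum of [h - hm]
    over the points. By Campbell's formula the mean of this sum is bounded by [lam] times the
    integral of [h - hm], uniformly in the number of points, so the two limits may be exchanged. *)
Theorem generating_functional :
  ccvg (fun n => cint P (fun e => \prod_(j < n) G (h (Y j e))))
    (cexp (- (Complex lam 0 * gap_integral h))).
Proof.
pose v m n := cint P (fun e => \prod_(j < n) G (hm m (Y j e))).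
pose eps m := 2 * (L * (lam * \int[areaM]_x (h x - hm m x))).
apply: (@ccvg_interchange _ _ v (fun m => cexp (- (Complex lam 0 * gap_integral (hm m)))) eps).
- move=> m n; rewrite /v.
  have bm1 := cbm_prod (index_enum 'I_n) (fun j : 'I_n => GY_bm j mh).
  have bm2 := cbm_prod (index_enum 'I_n) (fun j : 'I_n => GY_bm j (mhm m)).
  have -> : cint P (fun e => \prod_(j < n) G (h (Y j e))) - cint P (fun e => \prod_(j < n) G (hm m (Y j e)))
     = cint P (fun e => \prod_(j < n) G (h (Y j e)) + (- 1) * \prod_(j < n) G (hm m (Y j e))).
    rewrite cintD//; last by apply: cbmM => //; exact: cbm_cst.
    by rewrite cintZ// mulN1r.
  pose k x := h x - hm m x.
  have mk : measurable_fun setT k by exact: measurable_funB.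
  have k0 x : 0 <= k x by rewrite subr_ge0.
  have k1 x : k x <= 1.
    by rewrite /k lerBlDr (le_trans (y := 1))//; [have /andP[] := h01 x|rewrite lerDl].
  have bk j : bounded_measurable (fun e => k (Y j e)).
    by split; [exact: (measurableT_comp mk)|exists 1 => e; rewrite ger0_norm].
  have bsum : bounded_measurable (fun e => L * \sum_(j < n) k (Y j e)).
    by apply: bmZ; apply: (@bm_sum _ _ _ n (fun j e => k (Y j e))) => j _; exact: bk.
  apply: le_trans (normc_cint_le (g := fun e => L * \sum_(j < n) k (Y j e)) _ _ _) _.
  + by apply: cbmD => //; apply: cbmM => //; exact: cbm_cst.
  + exact: bm_integrable.
  + move=> e; rewrite mulN1r; apply: le_trans (normc_prodB _ _ _) _ => //.
    rewrite mulr_sumr; apply: ler_sum => j _.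
    by apply: le_trans (GL _ _) _; rewrite ger0_norm// subr_ge0.
  + have bs : bounded_measurable (fun e => \sum_(j < n) k (Y j e)).
      by apply: (@bm_sum _ _ _ n (fun j e => k (Y j e))) => j _; exact: bk.
    rewrite ler_wpM2l// bm_intZ// ler_wpM2l//.
    have ik : areaM.-integrable setT (EFin \o k).
      apply: ihle => // x; rewrite ger0_norm//.
      by rewrite /k lerBlDr lerDl.
    rewrite -lee_fin bm_EFin//; apply: le_trans (campbell_partial lam0 ppp n mk k0) _.
    rewrite EFinM; apply: lee_wpmul2l; first by rewrite lee_fin ltW.
    by rewrite /Rintegral fineK//; exact: (integrable_fin_num measurableT ik).
- move=> m; rewrite -step_gap.
  have tA : trivIset setT (@A m).
    by move=> i j _ _ [x []]; rewrite /A /cell/= => -> [ij]; apply: val_inj.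
  have := step_generating_functional ppp (fun k : 'I_m.+1 => mcell m k.+1) (fun k => fcell m k)
    tA (fun k => G1 (k.+1%:R / m.+1%:R)).
  have -> : (fun n => cint P (fun e => \prod_(j < n) \prod_(k < m.+1)
      (if Y j e \in cell m k.+1 then G (k.+1%:R / m.+1%:R) else 1))) = v m.
    by apply/funext => n; congr cint; apply/funext => e; apply: eq_bigr => j _; exact: step_prod.
  by [].
- apply: ccvg_cexp.
  have c := ccvgM (ccvg_cst (- Complex lam 0)) gap_cvg.
  rewrite -mulNr; move: c; congr ccvg; apply/funext => m; by rewrite mulNr.
- rewrite /eps -(mulr0 2); apply: cvgM; first exact: cvg_cst.
  rewrite -(mulr0 L); apply: cvgM; first exact: cvg_cst.
  rewrite -(mulr0 lam); apply: cvgM; first exact: cvg_cst.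
  exact: excess_cvg.
Qed.

End generating_functional_limit.

(** * Success probability of the typical link *)

Section exponential_variable.
Context d (T : measurableType d) {R : realType} (P : probability T R).
Variable X : {mfun T >-> R}.
Hypothesis PX : forall A : set R, measurable A -> P (X @^-1` A) = exponential_prob 1 A.
Notation mu := (@lebesgue_measure R).

Lemma exponential_integral (f : measurableTypeR R -> \bar R) : measurable_fun setT f ->
  (forall x, (0 <= f x)%E) ->
  (\int[P]_w f (X w) = \int[mu]_(x in `[0%R, +oo[) (f x * (expR (- x))%:E))%E.
Proof.
move=> mf f0.
have mX : measurable_fun setT (X : T -> measurableTypeR R).
  have mid : measurable_fun (setT : set R) (id : R -> measurableTypeR R).
    by move=> _ A mA; rewrite setTI preimage_id.
  by apply: (measurableT_comp mid); exact: measurable_funPT.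
pose X' : {mfun T >-> measurableTypeR R} := HB.pack (X : T -> measurableTypeR R)
  (isMeasurableFun.Build _ _ _ _ _ mX).
rewrite -(@integral_density _ (measurableTypeR R) R mu (distribution P X') `[0, +oo[
   (fun x => expR (- x)))//.
- by rewrite ge0_integral_distribution.
- by apply: (measurableT_comp (@measurable_expR R)); exact: measurable_funN.
move=> A mA; apply: etrans (PX mA) _; rewrite /exponential_prob.
rewrite integral_mkcondr; apply: eq_integral => x _.
rewrite /exponential_pdf !patchE; case: ifP => _ //.
by rewrite mul1r mulN1r.
Qed.

Lemma exponential_tail_integral (a : R) :
  (\int[mu]_(x in `[a, +oo[) (expR (- x))%:E = (expR (- a))%:E)%E.
Proof.
have dN (x : R) : is_derive x 1 (fun x => expR (- x)) (expR (- x) * - 1).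
  exact: deriv_expR (derivN (deriv_id x)).
apply: (@ge0_FTC2y R (fun x => expR (- x)) (fun x => - expR (- x)) a 0).
- by rewrite sub0r opprK.
- by move=> x _; exact: expR_ge0.
- by move=> x _; apply: is_derive_eq (derivN (dN x)) _; rewrite mulrN1 opprK.
- by move=> x _; exact: deriv_continuous (dN x).
- rewrite -oppr0; apply: cvgN; exact: cvgr_expR.
Qed.

Lemma exponential_ge0 : {ae P, forall w, 0 <= X w}.
Proof.
have mN : measurable [set w | X w < 0].
  rewrite -[X in measurable X]setTI (_ : [set w | _] = X @^-1` `]-oo, 0[); last first.
    by apply/seteqP; split => w /=; rewrite in_itv.
  by apply: (measurable_funPT X) => //; exact: measurable_itv.
exists [set w | X w < 0]; split => //; last first.
  by move=> w /= /negP; rewrite -ltNge.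
rewrite -[X in P X]setIT -integral_indic//.
transitivity (\int[P]_w (\1_(`]-oo, 0[%classic : set (measurableTypeR R)) (X w))%:E)%E.
  by apply: eq_integral => w _; rewrite !indicE; congr ((_ : bool)%:R%:E).
rewrite (@exponential_integral (fun x => (\1_(`]-oo, 0[%classic : set (measurableTypeR R)) x)%:E)).
- rewrite integral0_eq// => x; rewrite /= in_itv/= andbT => x0.
  by rewrite indicE memNset ?mul0e//= in_itv/= ltNge x0.
- by apply/measurable_EFinP; apply: measurable_indicI; exact: measurable_itv.
- by move=> x; rewrite lee_fin.
Qed.

Lemma exponential_below (l : R) : 0 <= l <= 1 ->
  \int[P]_w (expR (- X w) < l)%R%:R = l.
Proof.
move=> /andP[l0 l1].
have mlt : measurable_fun (setT : set (measurableTypeR R)) (fun x : measurableTypeR R => (expR (- (x : R)) < l)%R%:R : R).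
  apply: measurable_natr_bool; apply: measurable_fun_ltr; last exact: measurable_cst.
  by apply: (measurableT_comp (@measurable_expR R)); exact: measurable_funN.
rewrite /Rintegral (exponential_integral (f := fun x => ((expR (- x) < l)%R%:R)%:E)); last 2 first.
- exact/measurable_EFinP.
- by move=> x; rewrite lee_fin.
have [l00|lp] := eqVneq l 0.
  rewrite integral0_eq ?l00// => x _.
  by rewrite ltNge expR_ge0 mul0e.
have l_gt0 : 0 < l by rewrite lt_neqAle eq_sym lp.
have a0 : 0 <= - ln l by rewrite oppr_ge0 ln_le0.
have ltE x : (expR (- x) < l) = (- ln l < x).
  by rewrite -{1}(@lnK _ l)// ltr_expR ltrNl.
transitivity (fine (\int[mu]_(x in `](- ln l)%R, +oo[) (expR (- x))%:E)%E); last first.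
  rewrite integral_itv_obnd_cbnd; last first.
    apply: measurable_funTS; apply/measurable_EFinP.
    by apply: (measurableT_comp (@measurable_expR R)); exact: measurable_funN.
  by rewrite exponential_tail_integral /= opprK lnK.
congr fine; rewrite integral_mkcond [RHS]integral_mkcond.
apply: eq_integral => x _; rewrite !patchE ltE.
case: (boolP (x \in `](- ln l)%R, +oo[%classic)) => [|].
  rewrite inE/= in_itv/= andbT => lx; rewrite ifT.
    by rewrite lx mul1e.
  by rewrite inE/= in_itv/= andbT (le_trans a0)// ltW.
rewrite notin_setE/= in_itv/= andbT => /negP/negbTE ->.
by case: ifP => // _; rewrite mul0e.
Qed.

(** The fading is nonnegative only almost surely; clipping it at 0 leaves the mean unchanged and
    keeps the integrand in [0, 1] on every sample. *)
Lemma exponential_laplace (l : R) : 0 <= l ->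
  \int[P]_w expR (- (l * Num.max 0 (X w))) = (1 + l)^-1.
Proof.
move=> l0; rewrite /Rintegral.
rewrite (exponential_integral (f := fun x => (expR (- (l * Num.max 0 x)))%:E)); last 2 first.
- apply/measurable_EFinP; apply: (measurableT_comp (@measurable_expR R)).
  apply: measurable_funN; apply: measurable_funM; first exact: measurable_cst.
  by apply: measurable_maxr => //; exact: measurable_cst.
- by move=> x; rewrite lee_fin expR_ge0.
have l1 : 0 < 1 + l by rewrite ltr_wpDr.
have := laplace_cst l1 => /(congr1 fine) /= <-.
congr fine; apply: eq_integral => x; rewrite inE/= in_itv/= andbT => x0.
rewrite (max_r x0) -EFinM -expRD; congr (expR _)%:E; ring.
Qed.

End exponential_variable.

Section extended_limits.
Context d (T : measurableType d) {R : realType}.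

Lemma limn_esup_einf_cvg (u : nat -> \bar R) : limn_esup u = limn_einf u ->
  u n @[n --> \oo] --> limn_esup u.
Proof.
move=> h; apply: (squeeze_cvge (f := einfs u) (h := esups u)).
- near=> n; apply/andP; split.
    by apply: ereal_inf_lbound; exists n => /=.
  by apply: ereal_sup_ubound; exists n => /=.
- by rewrite h limn_einf_lim; exact: is_cvg_einfs.
- by rewrite limn_esup_lim; exact: is_cvg_esups.
Unshelve. all: by end_near. Qed.

(** Where upper and lower limits differ, [limn] takes the constant default value. This covers the
    interference, whose terms may be negative on the null set of negative fading, so its series need
    not converge everywhere. *)
Lemma emeasurable_limn (f : nat -> T -> \bar R) :
  (forall n, measurable_fun setT (f n)) ->
  measurable_fun setT (fun x => limn (f ^~ x)).
Proof.
move=> mf.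
have m1 : measurable_fun setT (fun x => limn_esup (f ^~ x)) by exact: measurable_fun_limn_esup.
have m2 : measurable_fun setT (fun x => limn_einf (f ^~ x)).
  have -> : (fun x => limn_einf (f ^~ x)) = (fun x => - limn_esup (fun n => - f n x))%E.
    apply/funext => x; rewrite -limn_einfN; congr limn_einf.
    by apply/funext => n /=; rewrite oppeK.
  apply: (measurableT_comp (f := -%E)) => //.
  by apply: measurable_fun_limn_esup => n; apply: (measurableT_comp (f := -%E)).
have mE : measurable [set x | limn_esup (f ^~ x) = limn_einf (f ^~ x)].
  by rewrite -[X in measurable X]setTI; exact: measurable_eqe.
pose b x := `[< limn_esup (f ^~ x) = limn_einf (f ^~ x) >].
have mb : measurable_fun setT b.
  apply: (measurable_fun_bool true); rewrite setTI.
  rewrite (_ : b @^-1` [set true] = [set x | limn_esup (f ^~ x) = limn_einf (f ^~ x)])//.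
  by apply/seteqP; split => x /= /asboolP.
have -> : (fun x => limn (f ^~ x)) = fun x => if b x then limn_esup (f ^~ x) else point.
  apply/funext => x; rewrite /b; case: asboolP => [h|h].
    by apply/cvg_lim => //; exact: limn_esup_einf_cvg.
  apply: dvgP => cv; apply: h.
  by rewrite is_cvg_limn_esupE// is_cvg_limn_einfE.
by apply: measurable_fun_ifT => //; exact: measurable_cst.
Qed.

Lemma measurable_inve (f : T -> \bar R) : measurable_fun setT f ->
  measurable_fun setT (fun x => (f x)^-1)%E.
Proof.
move=> mf.
have mEq (y : \bar R) : measurable_fun setT (fun x => f x == y).
  apply: (measurable_fun_bool true); rewrite setTI.
  rewrite (_ : _ @^-1` [set true] = [set x | f x = y]); last first.
    by apply/seteqP; split => x /= /eqP.
  by rewrite -[X in measurable X]setTI; apply: measurable_eqe => //; exact: measurable_cst.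
have -> : (fun x => (f x)^-1)%E = fun x => if f x == +oo%E then 0%E else
    if f x == -oo%E then -oo%E else ((fine (f x))%:E^-1)%E.
  by apply/funext => x; case: (f x).
apply: measurable_fun_ifT; [exact: mEq|exact: measurable_cst|].
apply: measurable_fun_ifT; [exact: mEq|exact: measurable_cst|].
by apply: measurable_inve_EFin; exact: measurableT_comp.
Qed.

End extended_limits.

(** * Interfering links: occupancy, activity and attenuation *)

Section link_dynamics.
Context (R : realType) de (E : measurableType de) dw (W : measurableType dw).
Variables (net : network R E W) (P : probability W R).
Variables (p xi : R) (m : nat -> R).
Hypothesis xi01 : 0 < xi <= 1.
Hypothesis p01 : 0 < p < 1.
Hypothesis m01 : forall j, 0 <= m j <= 1.
Hypothesis Parr : forall j t, P [set w | arr net j t w] = xi%:E.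
Hypothesis Pacc : forall j t, P [set w | acc net j t w] = p%:E.
Hypothesis Psuc : forall j t, P [set w | suc net j t w] = (m j)%:E.
Hypothesis Pfad : forall j t (A : set R), measurable A ->
  P (fad net j t @^-1` A) = exponential_prob 1 A.
(** The family used for the SINR of link 0: everything but the attempts of that link, whose joint
    law with the fading is unspecified. *)
Let D0 := [set i | if i is Suc 0 _ then False else True].
Hypothesis indP : mutually_independent P D0 (run_events net).

Let G (D : set run_index) := \bigcup_(i in D) run_events net i.

Lemma zetaS j t w : zeta net j t.+1 w =
  arr net j t.+1 w || (zeta net j t w && ~~ (acc net j t w && suc net j t w)).
Proof.
rewrite /zeta /Defs.nonempty /=; case: (arr net j t.+1 w) => //=.
by case: (acc net j t w && suc net j t w); rewrite ?andbF ?andbT.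
Qed.

Let past j t := [set i | match i with
  | Arr k s => k = j /\ (s <= t)%N | Acc k s => k = j /\ (s < t)%N
  | Suc k s => k = j /\ (s < t)%N | _ => False end].

Lemma zeta_measurable (D : set run_index) j t : past j t `<=` D ->
  measurable_fun (setT : set (g_sigma_algebraType (G D))) (zeta net j t).
Proof.
elim: t => [|t IH] pD.
  have -> : zeta net j 0 = arr net j 0.
    by apply/funext => w; rewrite /zeta /Defs.nonempty/=; case: (arr net j 0 w).
  by apply: (measurable_sub_sigma_of (i := Arr j 0)) => //; apply: pD.
have -> : zeta net j t.+1 = fun w =>
    arr net j t.+1 w || (zeta net j t w && ~~ (acc net j t w && suc net j t w)).
  by apply/funext => w; exact: zetaS.
apply: measurable_or.
  by apply: (measurable_sub_sigma_of (i := Arr j t.+1)) => //; apply: pD.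
apply: measurable_and.
  apply: IH => -[k s|k s|k s|k s] //= [-> st]; apply: pD => //=; split => //; exact: leqW.
apply: measurable_neg; apply: measurable_and.
  by apply: (measurable_sub_sigma_of (i := Acc j t)) => //; apply: pD.
by apply: (measurable_sub_sigma_of (i := Suc j t)) => //; apply: pD.
Qed.

(** Probability that the buffer is non-empty in slot [t] on a link of success probability [x]: a new
    arrival, or a packet kept because no attempt delivered it. *)
Fixpoint occupancy (x : R) (t : nat) : R :=
  match t with
  | 0 => xi
  | t'.+1 => xi + (1 - xi) * (occupancy x t' * (1 - p * x))
  end.

Let bnat (B : W -> bool) w : R := (B w)%:R.

Let bnat_bm (D : set run_index) (B : W -> bool) :
  measurable_fun (setT : set (g_sigma_algebraType (G D))) B ->
  bounded_measurable (bnat B : g_sigma_algebraType (G D) -> R).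
Proof.
move=> mB; split; first exact: measurable_natr_bool.
by exists 1 => w; rewrite /bnat; case: (B w); rewrite ?normr1 ?normr0.
Qed.

Let bnat_bmW (D : set run_index) (B : W -> bool) :
  measurable_fun (setT : set (g_sigma_algebraType (G D))) B ->
  bounded_measurable (bnat B).
Proof. by move=> mB; apply: (bm_sub (@run_group_measurable _ _ _ _ _ net D)); exact: bnat_bm. Qed.

Let split_int (D1 D2 : set run_index) (f : g_sigma_algebraType (G D1) -> R)
    (g : g_sigma_algebraType (G D2) -> R) :
  D1 `<=` D0 -> D2 `<=` D0 -> D1 `&` D2 = set0 ->
  bounded_measurable f -> bounded_measurable g ->
  \int[P]_w (f w * g w) = \int[P]_w f w * \int[P]_w g w.
Proof.
move=> D10 D20 D12 bf bg.
apply: (indep_RintegralM (G1 := G D1) (G2 := G D2)) => //.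
- exact: run_group_measurable.
- exact: run_group_measurable.
- exact: (run_groups indP).
Qed.

Let past0 j t : (0 < j)%N -> past j t `<=` D0.
Proof. by case: j => // j _ [] //= [|k] // s []. Qed.

Let m_arr j t (D : set run_index) : D (Arr j t) ->
  measurable_fun (setT : set (g_sigma_algebraType (G D))) (arr net j t).
Proof. by move=> Di; exact: (measurable_sub_sigma_of Di). Qed.
Let m_acc j t (D : set run_index) : D (Acc j t) ->
  measurable_fun (setT : set (g_sigma_algebraType (G D))) (acc net j t).
Proof. by move=> Di; exact: (measurable_sub_sigma_of Di). Qed.
Let m_suc j t (D : set run_index) : D (Suc j t) ->
  measurable_fun (setT : set (g_sigma_algebraType (G D))) (suc net j t).
Proof. by move=> Di; exact: (measurable_sub_sigma_of Di). Qed.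

(** The buffer state in slot [t] depends on variables of the link that precede its access and
    attempt in that slot and its next arrival, so all means factorise. *)
Lemma zeta_mean j t : (0 < j)%N ->
  \int[P]_w (zeta net j t w)%:R = occupancy (m j) t.
Proof.
move=> j0; elim: t => [|t IH].
  have -> : zeta net j 0 = arr net j 0.
    by apply/funext => w; rewrite /zeta /Defs.nonempty/=; case: (arr net j 0 w).
  by rewrite (Rintegral_bool _ (Parr j 0)).
pose D1 := [set Arr j t.+1].
pose D2 := past j t `|` [set Acc j t; Suc j t].
have D10 : D1 `<=` D0 by move=> _ ->.
have D20 : D2 `<=` D0.
  move=> i [/past0|[->|->]] //=; first exact.
  by case: (j) j0.
have D12 : D1 `&` D2 = set0.
  by apply/seteqP; split => // i [->] [[_]|[]] //=; rewrite ltnn.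
have mz : measurable_fun (setT : set (g_sigma_algebraType (G D2))) (zeta net j t).
  by apply: zeta_measurable => i hi; left.
pose Z w := zeta net j t w && ~~ (acc net j t w && suc net j t w).
have mZ : measurable_fun (setT : set (g_sigma_algebraType (G D2))) Z.
  apply: measurable_and => //; apply: measurable_neg; apply: measurable_and.
    by apply: m_acc; right; left.
  by apply: m_suc; right; right.
have ma : measurable_fun (setT : set (g_sigma_algebraType (G D1))) (arr net j t.+1).
  exact: m_arr.
have -> : \int[P]_w (zeta net j t.+1 w)%:R =
    \int[P]_w (bnat (arr net j t.+1) w + (1 - bnat (arr net j t.+1) w) * bnat Z w).
  apply: eq_Rintegral => w _; rewrite zetaS -/(Z w) /bnat.
  by case: (arr net j t.+1 w); case: (Z w); rewrite /= ?subrr ?mul0r ?mulr0 ?mulr1 ?addr0 ?subr0 ?add0r.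
have ba := bnat_bmW ma; have bZ := bnat_bmW mZ.
have b1a : bounded_measurable (fun w => 1 - bnat (arr net j t.+1) w) by apply: bmB => //; exact: bmcst.
rewrite bm_intD//; last exact: bmM.
rewrite (split_int (f := fun w => 1 - bnat (arr net j t.+1) w) D10 D20 D12); last 2 first.
- by apply: bmB; [exact: bmcst|exact: bnat_bm].
- exact: bnat_bm.
rewrite bm_intB//; last exact: bmcst.
rewrite bm_int_cst (Rintegral_bool _ (Parr j t.+1))//=; congr (_ + _ * _).
have -> : \int[P]_w bnat Z w = \int[P]_w (bnat (zeta net j t) w -
     bnat (zeta net j t) w * (bnat (acc net j t) w * bnat (suc net j t) w)).
  apply: eq_Rintegral => w _; rewrite /Z /bnat.
  by case: (zeta _ _ _ _); case: (acc _ _ _ _); case: (suc _ _ _ _) => /=; ring.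
pose D3 := past j t; pose D4 := [set Acc j t; Suc j t].
have D30 : D3 `<=` D0 by exact: past0.
have D40 : D4 `<=` D0 by move=> i hi; apply: D20; right.
have D34 : D3 `&` D4 = set0.
  by apply/seteqP; split => // i [] /[swap] -[->|->] /= [_]; rewrite ltnn.
have D50 : [set Acc j t] `<=` D0 by move=> _ ->.
have D60 : [set Suc j t] `<=` D0 by move=> _ ->; apply: D40; right.
have D56 : [set Acc j t] `&` [set Suc j t] = set0 by apply/seteqP; split => // i [->].
have bz := bnat_bmW mz.
have bac : bounded_measurable (bnat (acc net j t)).
  by apply: (@bnat_bmW [set Acc j t]); exact: m_acc.
have bsu : bounded_measurable (bnat (suc net j t)).
  by apply: (@bnat_bmW [set Suc j t]); exact: m_suc.
rewrite bm_intB//; last by apply: bmM => //; exact: bmM.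
rewrite (split_int (g := fun w => bnat (acc net j t) w * bnat (suc net j t) w) D30 D40 D34); last 2 first.
- by apply: bnat_bm; exact: zeta_measurable.
- by apply: bmM; apply: bnat_bm; [apply: m_acc; left|apply: m_suc; right].
rewrite (split_int D50 D60 D56); last 2 first.
- by apply: bnat_bm; exact: m_acc.
- by apply: bnat_bm; exact: m_suc.
rewrite IH (Rintegral_bool _ (Pacc j t))// (Rintegral_bool _ (Psuc j t))//.
by ring.
Qed.

Definition active j t w := zeta net j t w && acc net j t w.

Let own j t := past j t `|` [set Acc j t].

Let own0 j t : (0 < j)%N -> own j t `<=` D0.
Proof. by move=> j0 i [/past0|->] //; exact. Qed.

Let active_measurable (D : set run_index) j t : own j t `<=` D ->
  measurable_fun (setT : set (g_sigma_algebraType (G D))) (active j t).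
Proof.
move=> oD; apply: measurable_and; last by apply: m_acc; apply: oD; right.
by apply: zeta_measurable => i hi; apply: oD; left.
Qed.

Lemma active_mean j t : (0 < j)%N ->
  \int[P]_w (active j t w)%:R = p * occupancy (m j) t.
Proof.
move=> j0.
have -> : \int[P]_w (active j t w)%:R = \int[P]_w (bnat (zeta net j t) w * bnat (acc net j t) w).
  by apply: eq_Rintegral => w _; rewrite /active /bnat -natrM mulnb.
have D10 : [set Acc j t] `<=` D0 by move=> _ ->.
have D12 : past j t `&` [set Acc j t] = set0.
  by apply/seteqP; split => // i [] /[swap] -> /= [_]; rewrite ltnn.
rewrite (split_int (past0 j0) D10 D12); last 2 first.
- by apply: bnat_bm; exact: zeta_measurable.
- by apply: bnat_bm; exact: m_acc.
by rewrite zeta_mean// (Rintegral_bool _ (Pacc j t))// mulrC.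
Qed.

Variable t : nat.
Variable ell : nat -> R.
Hypothesis ell0 : forall j, 0 <= ell j.

Let att j w : R := expR (- (ell j * Num.max 0 (fad net j t w))).
(** Factor that interferer [j] contributes to the success probability of link 0 once the
    interference is known; clipping the fading at 0 keeps it in [0, 1] on every sample. *)
Let fac j w : R := expR (- (ell j * Num.max 0 (fad net j t w) * (active j t w)%:R)).

Let facE j w : fac j w = 1 - bnat (active j t) w * (1 - att j w).
Proof.
rewrite /fac /bnat; case: (active j t w) => /=; last by rewrite mulr0 oppr0 expR0 mul0r subr0.
by rewrite mulr1 mul1r /att opprB addrC subrK.
Qed.

Let att01 j w : 0 <= att j w <= 1.
Proof.
rewrite /att expR_ge0/= -expR0 ler_expR oppr_le0 mulr_ge0//.
by rewrite le_max lexx.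
Qed.

Let fac01 j w : 0 <= fac j w <= 1.
Proof.
rewrite /fac expR_ge0/= -expR0 ler_expR oppr_le0 !mulr_ge0//.
by rewrite le_max lexx.
Qed.

Let m_fad j (D : set run_index) : D (Fad j t) ->
  measurable_fun (setT : set (g_sigma_algebraType (G D))) (fad net j t).
Proof. by move=> Di; exact: (measurable_sub_sigma_of Di). Qed.

Let att_bm j (D : set run_index) : D (Fad j t) ->
  bounded_measurable (att j : g_sigma_algebraType (G D) -> R).
Proof.
move=> Di; split; last first.
  by exists 1 => w; have /andP[a0 a1] := att01 j w; rewrite ger0_norm.
apply: (measurableT_comp (@measurable_expR R)); apply: measurable_funN.
apply: measurable_funM; first exact: measurable_cst.
by apply: measurable_maxr; [exact: measurable_cst|exact: m_fad].
Qed.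

Let fac_bm j (D : set run_index) : D (Fad j t) -> own j t `<=` D ->
  bounded_measurable (fac j : g_sigma_algebraType (G D) -> R).
Proof.
move=> Di oD.
have -> : fac j = fun w => 1 - bnat (active j t) w * (1 - att j w).
  by apply/funext => w; exact: facE.
apply: bmB; first exact: bmcst.
apply: bmM; first by apply: bnat_bm; exact: active_measurable.
by apply: bmB; [exact: bmcst|exact: att_bm].
Qed.

(** An inactive interferer contributes 1 and an active one the Laplace transform [1 / (1 + ell)] of
    the exponential law; activity is independent of the fading. *)
Let fac_mean j : (0 < j)%N ->
  \int[P]_w fac j w = 1 - p * occupancy (m j) t * (ell j / (1 + ell j)).
Proof.
move=> j0.
have bA : bounded_measurable (bnat (active j t)).
  by apply: (@bnat_bmW (own j t)); exact: active_measurable.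
have ba : bounded_measurable (att j).
  apply: (bm_sub (@run_group_measurable _ _ _ _ _ net [set Fad j t])).
  exact: att_bm.
have b1a : bounded_measurable (fun w => 1 - att j w) by apply: bmB => //; exact: bmcst.
have -> : \int[P]_w fac j w = \int[P]_w (1 - bnat (active j t) w * (1 - att j w)).
  by apply: eq_Rintegral => w _; exact: facE.
rewrite bm_intB//; [|exact: bmcst|exact: bmM].
rewrite bm_int_cst; congr (_ - _).
have D10 : [set Fad j t] `<=` D0 by move=> _ ->.
have D12 : own j t `&` [set Fad j t] = set0.
  by apply/seteqP; split => // i [] /[swap] -> [].
rewrite (split_int (g := fun w => 1 - att j w) (own0 j0) D10 D12); last 2 first.
- by apply: bnat_bm; exact: active_measurable.
- by apply: bmB; [exact: bmcst|exact: att_bm].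
rewrite active_mean//; congr (_ * _).
rewrite bm_intB//; last exact: bmcst.
rewrite bm_int_cst (exponential_laplace (@Pfad j t) (ell0 j)).
have l1 : 1 + ell j != 0 by rewrite gt_eqF// ltr_wpDr.
by field.
Qed.

Let link i := match i with Arr j _ => j | Acc j _ => j | Suc j _ => j | Fad j _ => j end.
Let links n := [set i | (0 < link i < n)%N].

Let own_links j n : (0 < j < n)%N -> own j t `<=` links n.
Proof. by move=> jn [k s|k s|k s|k s] [|] //=; [case=> -> |case=> ->|case=> ->|case=> -> _]. Qed.

Let links0 n : links n `<=` D0.
Proof. by case=> // -[|j] s //. Qed.

Let prod_bm n D : links n.+1 `<=` D ->
  bounded_measurable ((fun w => \prod_(1 <= j < n.+1) fac j w) : g_sigma_algebraType (G D) -> R).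
Proof.
elim: n => [|n IH] lD.
  by under eq_fun do rewrite big_geq//; exact: bmcst.
under eq_fun do rewrite big_nat_recr//=; apply: bmM.
  by apply: IH => i /andP[i0 ilt]; apply: lD; rewrite /links/= i0 (ltn_trans ilt).
apply: fac_bm; first by apply: lD; rewrite /links/= ltnSn.
by move=> i /own_links h; apply: lD; apply: h; rewrite /= ltnSn.
Qed.

(** Each factor depends on the variables of its own link only, so the mean of the product is the
    product of the means. *)
Lemma attenuation_mean n : \int[P]_w \prod_(1 <= j < n.+1) fac j w =
  \prod_(1 <= j < n.+1) (1 - p * occupancy (m j) t * (ell j / (1 + ell j))).
Proof.
elim: n => [|n IH].
  by rewrite [RHS]big_geq//; under eq_Rintegral do rewrite big_geq//; rewrite bm_int_cst.
rewrite [RHS]big_nat_recr//= -IH -fac_mean//.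
under eq_Rintegral do rewrite big_nat_recr//=.
pose D2 := own n.+1 t `|` [set Fad n.+1 t].
have D2link i : D2 i -> link i = n.+1.
  by case=> [[|->//]|->//]; case: i => //= j s [].
apply: (@split_int (links n.+1) D2 (fun w => \prod_(1 <= j < n.+1) fac j w) (fac n.+1)).
- exact: links0.
- by move=> i [/(own0 (ltn0Sn n))|->].
- by apply/seteqP; split => // i [/andP[_ li] /D2link iE]; rewrite iE ltnn in li.
- exact: prod_bm.
- by apply: fac_bm; [right|move=> i hi; left].
Qed.

Variable s : R.
Hypothesis s0 : 0 <= s.

Let att_part n w : R := expR (- s) * \prod_(1 <= j < n.+1) fac j w.

Let att_part_ge0 n w : 0 <= att_part n w.
Proof.
rewrite mulr_ge0 ?expR_ge0//; apply: prodr_ge0 => j _.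
by have /andP[] := fac01 j w.
Qed.

Let att_part_noninc w : nonincreasing_seq (att_part ^~ w).
Proof.
apply/nonincreasing_seqP => n; rewrite /att_part big_nat_recr//=.
rewrite mulrA ler_piMr//; first exact: att_part_ge0.
by have /andP[] := fac01 n.+1 w.
Qed.

(** The exponential of minus the normalised noise plus interference, taken as a decreasing limit of
    partial products so that it exists on every sample, and is 0 when nonnegative fading gives an
    infinite interference. *)
Definition attenuation w : R := limn (att_part ^~ w).

Let att_part_cvg w : att_part n w @[n --> \oo] --> attenuation w.
Proof.
apply: nonincreasing_is_cvgn => //; exists 0 => _ [n _ <-]; exact: att_part_ge0.
Qed.

Let att_part_le1 n w : att_part n w <= 1.
Proof.
apply: (@le_trans _ _ (att_part 0 w)); first by apply: att_part_noninc.
by rewrite /att_part big_geq// mulr1 -expR0 ler_expR oppr_le0.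
Qed.

Let attenuation01 w : 0 <= attenuation w <= 1.
Proof.
apply/andP; split.
  by apply: limr_ge; [exact: att_part_cvg|apply: nearW => n; exact: att_part_ge0].
by apply: limr_le; [exact: att_part_cvg|apply: nearW => n; exact: att_part_le1].
Qed.

Let others := [set i | (0 < link i)%N].

Let others0 : others `<=` D0.
Proof. by case=> // -[|j] k //. Qed.

Let att_part_bm n :
  bounded_measurable (att_part n : g_sigma_algebraType (G others) -> R).
Proof. by apply: bmZ; apply: prod_bm => i /andP[]. Qed.

Let attenuation_bm : bounded_measurable (attenuation : g_sigma_algebraType (G others) -> R).
Proof.
split; last by exists 1 => w; have /andP[a0 a1] := attenuation01 w; rewrite ger0_norm.
apply: (@measurable_fun_cvg _ (g_sigma_algebraType (G others)) R setT att_part attenuation) => [n|w _]; last exact: att_part_cvg.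
by have [] := att_part_bm n.
Qed.

Let others_bm (f : W -> R) : bounded_measurable (f : g_sigma_algebraType (G others) -> R) ->
  bounded_measurable f.
Proof. exact: (bm_sub (@run_group_measurable _ _ _ _ _ net others)). Qed.

Lemma mean_attenuation : expR (- s) *
    \prod_(1 <= j < n.+1) (1 - p * occupancy (m j) t * (ell j / (1 + ell j))) @[n --> \oo]
  --> \int[P]_w attenuation w.
Proof.
have -> : (fun n => expR (- s) *
    \prod_(1 <= j < n.+1) (1 - p * occupancy (m j) t * (ell j / (1 + ell j)))) =
    (fun n => \int[P]_w att_part n w).
  apply/funext => n; rewrite -attenuation_mean -bm_intZ//.
  by apply: others_bm; apply: prod_bm => i /andP[].
apply: (@Rintegral_dominated _ _ _ P _ _ (fun=> 1)).
- by move=> n; have [] := others_bm (att_part_bm n).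
- by have [] := others_bm attenuation_bm.
- exact: att_part_cvg.
- by apply: bm_integrable; exact: bmcst.
- by move=> n w; rewrite ger0_norm.
Qed.

Lemma measurable_signal_above :
  measurable_fun setT (fun w => (expR (- fad net 0 t w) < attenuation w)%R%:R : R).
Proof.
apply: measurable_natr_bool; apply: measurable_fun_ltr; last by have [] := others_bm attenuation_bm.
by apply: (measurableT_comp (@measurable_expR R)); apply: measurable_funN; exact: measurable_funPT.
Qed.

(* The signal power is independent of the interference and [expR] of its
   opposite is uniform on [0, 1]. *)
Lemma signal_above : \int[P]_w (expR (- fad net 0 t w) < attenuation w)%R%:R =
  \int[P]_w attenuation w.
Proof.
pose D1 := [set Fad 0 t].
pose f (v : g_sigma_algebraType (G others) * g_sigma_algebraType (G D1)) : R :=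
  (expR (- fad net 0 t v.2) < attenuation v.1)%R%:R.
have D10 : D1 `<=` D0 by move=> _ ->.
have D12 : others `&` D1 = set0 by apply/seteqP; split => // i [] /[swap] ->.
have bf : bounded_measurable f.
  split; last by exists 1 => v; rewrite /f; case: (_ < _)%R; rewrite ?normr1 ?normr0.
  apply: measurable_natr_bool; apply: measurable_fun_ltr.
    apply: (measurableT_comp (@measurable_expR R)); apply: measurable_funN.
    apply: (measurableT_comp (f := fad net 0 t : g_sigma_algebraType (G D1) -> R)) => //.
    exact: m_fad.
  apply: (measurableT_comp (f := attenuation : g_sigma_algebraType (G others) -> R)) => //.
  by have [] := attenuation_bm.
have [_ h] := indep_sub_Rintegral (P := P) (@run_group_measurable _ _ _ _ _ net others)
  (@run_group_measurable _ _ _ _ _ net D1) (run_groups indP others0 D10 D12) bf.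
transitivity (\int[P]_w f (w, w)); first by [].
rewrite h; apply: eq_Rintegral => v _.
exact: (exponential_below (@Pfad 0%N t) (attenuation01 v)).
Qed.

End link_dynamics.

Lemma normr_prodB (R : realType) (s : seq nat) (f g : nat -> R) :
  (forall i, 0 <= f i <= 1) -> (forall i, 0 <= g i <= 1) ->
  `|\prod_(i <- s) f i - \prod_(i <- s) g i| <= \sum_(i <- s) `|f i - g i|.
Proof.
move=> f1 g1.
have p01 (u : nat -> R) (s' : seq nat) : (forall i, 0 <= u i <= 1) -> 0 <= \prod_(i <- s') u i <= 1.
  move=> u1; apply: (big_ind (fun x => 0 <= x <= 1)) => //; first by rewrite ler01 lexx.
  by move=> x y /andP[x0 x1] /andP[y0 y1]; rewrite mulr_ge0// mulr_ile1.
elim: s => [|i s IH]; first by rewrite !big_nil subrr normr0.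
rewrite !big_cons.
have -> : f i * \prod_(j <- s) f j - g i * \prod_(j <- s) g j =
   (f i - g i) * \prod_(j <- s) f j + g i * (\prod_(j <- s) f j - \prod_(j <- s) g j) by ring.
apply: le_trans (ler_normD _ _) _; rewrite !normrM; apply: lerD.
  have /andP[a b] := p01 f s f1.
  by rewrite (ger0_norm a) ler_piMr.
have /andP[a b] := g1 i.
by apply: le_trans IH; rewrite (ger0_norm a) ler_piMl.
Qed.

(** * Success probability as an infinite product over interferers *)

Section signal.
Context (R : realType) de (E : measurableType de) dw (W : measurableType dw).
Variables (N : params R) (net : network R E W) (P : probability W R) (m : nat -> R).
Hypothesis adm : admissible N.
Hypothesis m01 : forall j, 0 <= m j <= 1.
Hypothesis Parr : forall j t, P [set w | arr net j t w] = (arrival N)%:E.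
Hypothesis Pacc : forall j t, P [set w | acc net j t w] = (access N)%:E.
Hypothesis Psuc : forall j t, P [set w | suc net j t w] = (m j)%:E.
Hypothesis Pfad : forall j t (A : set R), measurable A ->
  P (fad net j t @^-1` A) = exponential_prob 1 A.
Hypothesis indP : mutually_independent P
  [set i | if i is Suc 0 _ then False else True] (run_events net).
Variable e : E.

Let theta0 : 0 < threshold N. Proof. by case: adm => _ []. Qed.
Let ptx0 : 0 < tx_power N. Proof. by case: adm => _ []. Qed.
Let noise0 : 0 < noise N. Proof. by case: adm => _ []. Qed.
Let r0 : 0 < link_dist N. Proof. by case: adm => -[]. Qed.
Let xi01 : 0 < arrival N <= 1. Proof. by case: adm. Qed.
Let p01 : 0 < access N < 1. Proof. by case: adm. Qed.
Let ra0 : 0 < link_dist N `^ pathloss N. Proof. exact: powR_gt0. Qed.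

(** Gain in units of the typical link: the SINR exceeds the threshold when the fading of link 0
    exceeds [noise_term N] plus the sum of these gains weighted by the fading of the active
    interferers. *)
Definition path_gain (x : plane R) : R :=
  threshold N * link_dist N `^ pathloss N * euclidean_norm x `^ (- pathloss N).

Lemma path_gain_ge0 x : 0 <= path_gain x.
Proof. by rewrite mulr_ge0 ?powR_ge0// mulr_ge0 ?ltW. Qed.

Let ell j := path_gain (tx net j e).
Let ell0 j : 0 <= ell j. Proof. exact: path_gain_ge0. Qed.

Let c : R := threshold N * link_dist N `^ pathloss N / tx_power N.
Let c0 : 0 < c. Proof. by rewrite divr_gt0// mulr_gt0. Qed.

Let noiseE : noise_term N = c * noise N.
Proof.
rewrite /noise_term /rho /c; field.
by rewrite !gt_eqF.
Qed.

Lemma noise_term_ge0 : 0 <= noise_term N.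
Proof. by rewrite noiseE mulr_ge0// ltW. Qed.

Let term t j w : R := tx_power N * fad net j t w * (zeta net j t w)%:R * (acc net j t w)%:R
  * euclidean_norm (tx net j e) `^ (- pathloss N).

Let psum t n w : R := \sum_(1 <= j < n.+1) term t j w.

Let att_part t n w : R := expR (- noise_term N) *
  \prod_(1 <= j < n.+1) expR (- (ell j * Num.max 0 (fad net j t w) * (active net j t w)%:R)).

Let att_partE t n w : (forall j, 0 <= fad net j t w) ->
  att_part t n w = expR (- (c * (noise N + psum t n w))).
Proof.
move=> f0; rewrite /att_part mulrDr opprD expRD noiseE; congr (_ * _).
rewrite /psum mulr_sumr -sumrN (big_morph _ (@expRD R) (@expR0 R)).
apply: eq_bigr => j _; congr (expR (- _)).
rewrite (max_r (f0 j)) /active /term /ell /path_gain /c -mulnb natrM.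
by field; rewrite gt_eqF.
Qed.

Let psum_cvg t w : (forall j, 0 <= fad net j t w) ->
  (psum t n w)%:E @[n --> \oo] --> interference N net e t w.
Proof.
move=> f0; rewrite /interference.
have : cvgn (fun n => \sum_(1 <= j < n) (term t j w)%:E)%E.
  apply: is_cvg_nneseries => j _ _; rewrite lee_fin /term.
  by rewrite !mulr_ge0 ?powR_ge0// ltW.
rewrite -(cvg_shiftS (fun n => \sum_(1 <= j < n) (term t j w)%:E)%E).
by under eq_fun do rewrite sumEFin.
Qed.

(** Solving for the fading of link 0 and applying the decreasing map exp(-y) gives the comparison.
    With infinite interference the SINR and the attenuation are both 0, and both sides are false. *)
Lemma sinr_event t w : (forall j, 0 <= fad net j t w) ->
  ((threshold N)%:E < SINR N net e t w)%E =
  (expR (- fad net 0 t w) < attenuation net t ell (noise_term N) w).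
Proof.
move=> f0.
have cI := psum_cvg f0.
have I0 : (0 <= interference N net e t w)%E.
  rewrite /interference; apply: nneseries_ge0 => j _ _; rewrite lee_fin.
  by rewrite !mulr_ge0 ?powR_ge0// ltW.
rewrite /SINR; case EI : (interference N net e t w) cI I0 => [S| |]// cI I0.
- have cS : psum t n w @[n --> \oo] --> S by exact: (fine_cvg cI).
  have -> : attenuation net t ell (noise_term N) w = expR (- (c * (noise N + S))).
    apply/cvg_lim => //.
    rewrite [X in X @ _ --> _](_ : _ = (fun n => expR (- (c * (noise N + psum t n w))))); last first.
      by apply/funext => n; exact: att_partE.
    apply: (@cvg_comp _ _ _ _ expR _ (nbhs (- (c * (noise N + S))))); last exact: continuous_expR.
    apply: cvgN; apply: cvgM; first exact: cvg_cst.
    by apply: cvgD => //; exact: cvg_cst.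
  have S0 : 0 < S + noise N by rewrite ltr_wpDl// -lee_fin.
  rewrite -EFinD inver gt_eqF// -EFinM lte_fin ltr_expR ltrN2.
  rewrite ltr_pdivlMr// powRN ltr_pdivlMr// /c.
  have -> : threshold N * link_dist N `^ pathloss N / tx_power N * (noise N + S) =
    (threshold N * (S + noise N) * link_dist N `^ pathloss N) / tx_power N by ring.
  by rewrite ltr_pdivrMr// [fad net 0 t w * _]mulrC.
- have -> : attenuation net t ell (noise_term N) w = 0.
    apply/cvg_lim => //.
    rewrite [X in X @ _ --> _](_ : _ = (fun n => expR (- (c * (noise N + psum t n w))))); last first.
      by apply/funext => n; exact: att_partE.
    apply: (@cvg_comp _ _ _ (fun n => c * (noise N + psum t n w)) (fun y => expR (- y)) _ (pinfty_nbhs R)); last exact: cvgr_expR.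
    have : psum t n w @[n --> \oo] --> +oo by apply/cvgeryP.
    move=> /cvgryPge h; apply/cvgryPge => A.
    apply: filterS (h (A / c)) => n; rewrite ler_pdivrMr// mulrC => hA.
    by apply: le_trans hA _; rewrite ler_wpM2l ?(ltW c0)// lerDr ltW.
  rewrite [RHS]ltNge expR_ge0 addye// invey mule0 lte_fin.
  by apply/negbTE; rewrite -leNgt ltW.
Qed.

Lemma sinr_measurable t : measurable [set w | ((threshold N)%:E < SINR N net e t w)%E].
Proof.
have mI : measurable_fun setT (interference N net e t).
  rewrite /interference.
  apply: (@emeasurable_limn _ _ _ (fun n w => \sum_(1 <= j < n) (term t j w)%:E)%E) => n.
  have -> : (fun w => \sum_(1 <= j < n) (term t j w)%:E)%E = (fun w => (\sum_(1 <= j < n) term t j w)%:E).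
    by apply/funext => w; rewrite sumEFin.
  apply/measurable_EFinP; elim: n => [|[|n] IH].
  - by under eq_fun do rewrite big_geq//; exact: measurable_cst.
  - by under eq_fun do rewrite big_geq//; exact: measurable_cst.
  under eq_fun do rewrite big_nat_recr//=; apply: measurable_funD => //.
  apply: measurable_funM; last exact: measurable_cst.
  apply: measurable_funM; last by apply: measurable_natr_bool; exact: measurable_funPT.
  apply: measurable_funM; last first.
    apply: measurable_natr_bool.
    have mz := @zeta_measurable _ _ _ _ _ net setT n.+1 t (fun _ _ => I).
    exact: (measurableT_comp mz (measurable_sub_id (@run_group_measurable _ _ _ _ _ net setT))).
  by apply: measurable_funM; [exact: measurable_cst|exact: measurable_funPT].
have mS : measurable_fun setT (SINR N net e t).
  apply: emeasurable_funM.
    apply/measurable_EFinP; apply: measurable_funM; last exact: measurable_cst.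
    by apply: measurable_funM; [exact: measurable_cst|exact: measurable_funPT].
  by apply: measurable_inve; apply: emeasurable_funD => //; exact: measurable_cst.
rewrite -[X in measurable X]setTI.
by apply: emeasurable_fun_lt => //; exact: measurable_cst.
Qed.

Let h j : R := ell j / (1 + ell j).

Lemma success_probability t : expR (- noise_term N) *
    \prod_(1 <= j < n.+1) (1 - access N * occupancy (access N) (arrival N) (m j) t * h j) @[n --> \oo]
  --> fine (P [set w | ((threshold N)%:E < SINR N net e t w)%E]).
Proof.
have -> : fine (P [set w | ((threshold N)%:E < SINR N net e t w)%E]) =
    \int[P]_w attenuation net t ell (noise_term N) w.
  rewrite -(signal_above Pfad indP t ell0 noise_term_ge0).
  rewrite -[X in P X]setIT -integral_indic//; last exact: sinr_measurable.
  congr fine; apply: ae_eq_integral => //.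
  - by apply/measurable_EFinP; apply: measurable_indic; exact: sinr_measurable.
  - by apply/measurable_EFinP; exact: (measurable_signal_above net t ell0 noise_term_ge0).
  have f0 : {ae P, forall w, forall j, 0 <= fad net j t w}.
    by apply/ae_foralln => j; exact: (exponential_ge0 (@Pfad j t)).
  apply: filterS f0 => w f0 _; rewrite indicE -sinr_event//.
  by congr ((_ : bool)%:R%:E); apply/idP/idP; rewrite inE.
exact: (@mean_attenuation _ _ _ _ _ _ _ _ _ _ Parr Pacc Psuc Pfad indP t _ ell0 _ noise_term_ge0).
Qed.

(** Steady-state probability that a link of success probability [x] transmits: [access N] times the
    fixed point of the [occupancy] recursion. *)
Definition activity1 (x : R) : R :=
  access N * arrival N / (arrival N + (1 - arrival N) * access N * x).

Let den0 x : 0 <= x -> 0 < arrival N + (1 - arrival N) * access N * x.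
Proof.
move=> x0; case/andP: xi01 => xi0 xi1; case/andP: p01 => p0 p1.
by rewrite ltr_pwDl// !mulr_ge0 ?subr_ge0// ltW.
Qed.

Lemma activity1_ge0 x : 0 <= x -> 0 <= activity1 x.
Proof.
move=> x0; case/andP: xi01 => xi0 xi1; case/andP: p01 => p0 p1.
by rewrite divr_ge0 ?mulr_ge0// ?ltW// den0.
Qed.

Lemma activity1_le x : 0 <= x -> activity1 x <= access N.
Proof.
move=> x0; case/andP: xi01 => xi0 xi1; case/andP: p01 => p0 p1.
rewrite /activity1 ler_pdivrMr ?den0// ler_wpM2l ?(ltW p0)// lerDl.
by rewrite !mulr_ge0 ?subr_ge0// ltW.
Qed.

Lemma activity1_ge x : 0 <= x <= 1 -> access N * arrival N <= activity1 x.
Proof.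
move=> /andP[x0 x1]; case/andP: xi01 => xi0 xi1; case/andP: p01 => p0 p1.
rewrite /activity1 ler_pdivlMr ?den0// ler_piMr ?mulr_ge0 ?(ltW p0) ?(ltW xi0)//.
have : (1 - arrival N) * access N * x <= (1 - arrival N) * 1.
  rewrite -mulrA ler_wpM2l ?subr_ge0// mulr_ile1 ?(ltW p0) ?(ltW p1)//.
by rewrite mulr1; lra.
Qed.

Let occ x t := occupancy (access N) (arrival N) x t.

Let occ01 x t : 0 <= x <= 1 -> 0 <= occ x t <= 1.
Proof.
move=> /andP[x0 x1]; case/andP: xi01 => xi0 xi1; case/andP: p01 => p0 p1.
elim: t => [|t IH]; first by rewrite /occ/= (ltW xi0).
rewrite /occ/= -/(occ x t); case/andP: IH => oc0 oc1.
have px0 : 0 <= access N * x by rewrite mulr_ge0// ltW.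
have px1 : access N * x <= 1 by rewrite mulr_ile1// ltW.
have q0 : 0 <= occ x t * (1 - access N * x) by rewrite mulr_ge0// subr_ge0.
have q1 : occ x t * (1 - access N * x) <= 1 by rewrite mulr_ile1// ?subr_ge0// gerBl.
have h0 : 0 <= (1 - arrival N) * (occ x t * (1 - access N * x)) by rewrite mulr_ge0// subr_ge0.
have h1 : (1 - arrival N) * (occ x t * (1 - access N * x)) <= 1 - arrival N by rewrite ler_piMr// subr_ge0.
by rewrite addr_ge0 ?(ltW xi0)//=; lra.
Qed.

(** The occupancy recursion is affine with slope [(1 - xi) * (1 - p x)], at most [1 - xi], and
    starts at distance at most 1 from its fixed point [s]. The rate does not depend on [x]. *)
Let occ_limit x t : 0 <= x <= 1 ->
  `|access N * occ x t - activity1 x| <= (1 - arrival N) ^+ t.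
Proof.
move=> /andP[x0 x1]; case/andP: xi01 => xi0 xi1; case/andP: p01 => p0 p1.
pose s := arrival N / (arrival N + (1 - arrival N) * access N * x).
have -> : activity1 x = access N * s by rewrite /activity1 /s mulrA.
have s0 : 0 <= s by rewrite divr_ge0// ltW// den0.
have s1 : s <= 1.
  by rewrite /s ler_pdivrMr ?den0// mul1r lerDl !mulr_ge0 ?subr_ge0// ltW.
rewrite -mulrBr normrM (ger0_norm (ltW p0)).
apply: (@le_trans _ _ `|occ x t - s|); first by rewrite ler_piMl// ltW.
have fixs : s = arrival N + (1 - arrival N) * (s * (1 - access N * x)).
  by rewrite /s; field; rewrite gt_eqF// den0.
elim: t => [|t IH].
  by rewrite expr0 ler_norml /occ/=; lra.
rewrite {1}fixs /occ/= -/(occ x t).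
have -> : arrival N + (1 - arrival N) * (occ x t * (1 - access N * x)) -
   (arrival N + (1 - arrival N) * (s * (1 - access N * x))) =
   (1 - arrival N) * ((1 - access N * x) * (occ x t - s)) by ring.
rewrite exprS normrM (ger0_norm (_ : 0 <= 1 - arrival N)) ?subr_ge0//.
rewrite ler_wpM2l ?subr_ge0//; apply: le_trans IH.
have px0 : 0 <= access N * x by rewrite mulr_ge0// ltW.
have px1 : access N * x <= 1 by rewrite mulr_ile1// ltW.
rewrite normrM ger0_norm ?subr_ge0// ler_piMl//.
by lra.
Qed.

Let h01 j : 0 <= h j <= 1.
Proof.
have l1 : 0 < 1 + ell j by rewrite ltr_pwDl.
rewrite /h divr_ge0 ?(ltW l1)//= ler_pdivrMr// mul1r; lra.
Qed.

Variables (B mu0 : R).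
Hypothesis hB : forall n, \sum_(1 <= j < n.+1) h j <= B.
Hypothesis mu0E : P [set w | ((threshold N)%:E < SINR N net e t w)%E] @[t --> \oo] --> mu0%:E.

(** The limits over slots and over interferers are exchanged: replacing the occupancies in slot [t]
    by their limits costs at most [(1 - xi)^t * B], uniformly in the number of interferers, because
    the gains have a bounded sum. *)
Lemma success_limit : expR (- noise_term N) *
    \prod_(1 <= j < n.+1) (1 - activity1 (m j) * h j) @[n --> \oo] --> mu0.
Proof.
case/andP: xi01 => xi0 xi1; case/andP: p01 => p0 p1.
pose u t := fine (P [set w | ((threshold N)%:E < SINR N net e t w)%E]).
pose U t n := expR (- noise_term N) *
    \prod_(1 <= j < n.+1) (1 - access N * occ (m j) t * h j).
pose V n := expR (- noise_term N) * \prod_(1 <= j < n.+1) (1 - activity1 (m j) * h j).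
have fa01 j : 0 <= 1 - activity1 (m j) * h j <= 1.
  have /andP[mj0 mj1] := m01 j; have /andP[hj0 hj1] := h01 j.
  have a0 := activity1_ge0 mj0; have a1 := le_trans (activity1_le mj0) (ltW p1).
  rewrite subr_ge0 mulr_ile1//= gerBl mulr_ge0//.
have fq01 t j : 0 <= 1 - access N * occ (m j) t * h j <= 1.
  have /andP[hj0 hj1] := h01 j; have /andP[oc0 oc1] := occ01 t (m01 j).
  have q0 : 0 <= access N * occ (m j) t by rewrite mulr_ge0// ltW.
  have q1 : access N * occ (m j) t <= 1 by rewrite mulr_ile1// ltW.
  by rewrite subr_ge0 mulr_ile1//= gerBl mulr_ge0.
have B0 : 0 <= B by apply: le_trans (hB 0); rewrite big_geq.
have UV t n : `|U t n - V n| <= (1 - arrival N) ^+ t * B.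
  rewrite /U /V -mulrBr normrM (ger0_norm (expR_ge0 _)).
  have e1 : expR (- noise_term N) <= 1 by rewrite -expR0 ler_expR oppr_le0 noise_term_ge0.
  apply: (@le_trans _ _ (1 * \sum_(1 <= j < n.+1) (1 - arrival N) ^+ t * h j)); last first.
    by rewrite mul1r -mulr_sumr ler_wpM2l// exprn_ge0// subr_ge0.
  apply: ler_pM => //.
  apply: le_trans (normr_prodB _ (fq01 t) fa01) _.
  apply: ler_sum => j _.
  have /andP[hj0 hj1] := h01 j.
  have -> : 1 - access N * occ (m j) t * h j - (1 - activity1 (m j) * h j) =
    - ((access N * occ (m j) t - activity1 (m j)) * h j) by ring.
  rewrite normrN normrM (ger0_norm hj0) ler_wpM2r//.
  exact: occ_limit.
have Vninc : nonincreasing_seq V.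
  apply/nonincreasing_seqP => n; rewrite /V big_nat_recr//= mulrA ler_piMr//.
    by rewrite mulr_ge0 ?expR_ge0//; apply: prodr_ge0 => j _; have /andP[] := fa01 j.
  by have /andP[] := fa01 n.+1.
have Vcvg : V n @[n --> \oo] --> limn V.
  apply: nonincreasing_is_cvgn => //; exists 0 => _ [n _ <-].
  by rewrite mulr_ge0 ?expR_ge0//; apply: prodr_ge0 => j _; have /andP[] := fa01 j.
have ut t : `|u t - limn V| <= (1 - arrival N) ^+ t * B.
  have cU : `|U t n - V n| @[n --> \oo] --> `|u t - limn V|.
    by apply: cvg_norm; apply: cvgB => //; exact: success_probability.
  rewrite -(cvg_lim (@Rhausdorff R) cU); apply: limr_le; last exact: nearW.
  by apply/cvg_ex; eexists; exact: cU.
have uV : u t @[t --> \oo] --> limn V.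
  apply: cvg_dist_le ut _; rewrite -(mul0r B); apply: cvgM; last exact: cvg_cst.
  by apply: cvg_expr; rewrite ger0_norm ?subr_ge0//; lra.
have umu : u t @[t --> \oo] --> mu0 by exact: (fine_cvg mu0E).
by rewrite (cvg_unique _ umu uV).
Qed.

End signal.

(** * The gain of an interferer as a function of its distance *)

Section gain.
Context {R : realType}.
Variable N : params R.
Hypothesis adm : admissible N.
Notation mu := (@lebesgue_measure R).

Let areaM : {measure set (plane R) -> \bar R} := (mu \x mu)%E.

Let theta0 : 0 < threshold N. Proof. by case: adm => _ []. Qed.
Let r0 : 0 < link_dist N. Proof. by case: adm => -[]. Qed.
Let alpha2 : 2 < pathloss N. Proof. by case: adm => -[]. Qed.
Let alpha0 : 0 < pathloss N. Proof. by apply: lt_trans alpha2. Qed.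
Let a2 : 1 < pathloss N / 2. Proof. by rewrite ltr_pdivlMr// mul1r. Qed.

Definition gain (x : plane R) : R := path_gain N x / (1 + path_gain N x).

(** Unit of squared distance for which the path gain is the pure power [v^(- alpha / 2)]; [pi] times
    the density times [scale] is [spatial_const]. *)
Definition scale : R := link_dist N ^+ 2 * threshold N `^ delta N.

(** The form with negative powers agrees with [gain] at the origin too, where [powR] of 0 is 0; the
    form [1 / (1 + v^(alpha / 2))] would give 1 there. *)
Definition radial_gain (v : R) : R :=
  v `^ (- (pathloss N / 2)) / (1 + v `^ (- (pathloss N / 2))).

Lemma scale_gt0 : 0 < scale.
Proof. by rewrite mulr_gt0 ?exprn_gt0 ?powR_gt0. Qed.

Lemma path_gainE x : path_gain N x = (sqnorm x / scale) `^ (- (pathloss N / 2)).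
Proof.
have k0 := scale_gt0; have s0 := sqnorm_ge0 x.
rewrite powRM ?invr_ge0 ?(ltW k0)//.
have -> : scale^-1 `^ (- (pathloss N / 2)) = threshold N * link_dist N `^ pathloss N.
  rewrite -(@powR_inv1 _ scale) ?(ltW k0)// -powRrM mulN1r opprK /scale.
  rewrite powRM ?exprn_ge0 ?powR_ge0 ?(ltW r0)// -powRrM.
  have -> : delta N * (pathloss N / 2) = 1.
    by rewrite /delta; field; rewrite gt_eqF.
  rewrite powRr1 ?(ltW theta0)// -(@powR_mulrn _ _ 2) ?(ltW r0)// -powRrM mulrC.
  by congr (_ * _ `^ _); field.
rewrite /path_gain mulrC; congr (_ * _).
rewrite /euclidean_norm -/(sqnorm x) -powR12_sqrt// -powRrM; congr (_ `^ _); ring.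
Qed.

Lemma gainE x : gain x = radial_gain (sqnorm x / scale).
Proof. by rewrite /gain path_gainE. Qed.

Lemma radial_gain01 v : 0 <= radial_gain v <= 1.
Proof.
have h := powR_ge0 v (- (pathloss N / 2)).
have h1 : 0 < 1 + v `^ (- (pathloss N / 2)) by rewrite ltr_pwDl.
by rewrite /radial_gain divr_ge0 ?(ltW h1)//= ler_pdivrMr// mul1r lerDr.
Qed.

Lemma radial_gainE v : 0 < v -> radial_gain v = (1 + v `^ (pathloss N / 2))^-1.
Proof.
move=> v0; rewrite /radial_gain powRN.
have h : 0 < v `^ (pathloss N / 2) by exact: powR_gt0.
move: (v `^ _) h => y y0; field.
by rewrite !gt_eqF// ltr_wpDr// ltW.
Qed.

Lemma measurable_radial_gain : measurable_fun setT radial_gain.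
Proof.
apply: measurable_funM; first exact: measurable_powR.
apply: (measurableT_comp (@measurable_inv R)).
by apply: measurable_funD; [exact: measurable_cst|exact: measurable_powR].
Qed.

(** Bounded by 1 on [[0, 1]] and by [v^(- alpha / 2)] beyond, which is integrable because
    [alpha > 2]. *)
Lemma radial_gain_integrable : mu.-integrable `[0, +oo[ (EFin \o radial_gain).
Proof.
pose J1 := (`[0, 1]%classic : set (measurableTypeR R)).
pose J2 := (`[1, +oo[%classic : set (measurableTypeR R)).
have mJ2 : measurable J2 by exact: measurable_itv.
have mr : measurable_fun (setT : set (measurableTypeR R)) radial_gain by exact: measurable_radial_gain.
have i2 : mu.-integrable setT (fun w => (\1_J2 w * w `^ (- (pathloss N / 2)))%:E).
  by apply/(@integrable_indicM _ _ _ mu J2 (fun w => w `^ (- (pathloss N / 2)))) => //; exact: powR_tail_integrable.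
have iJ1 := @integrable_indic_itv R 0 1 true false.
have iB : mu.-integrable setT (fun w => ((\1_J1 w)%:E + (\1_J2 w * w `^ (- (pathloss N / 2)))%:E)%E).
  by apply: integrableD.
apply/(@integrable_indicM _ _ _ mu `[0, +oo[ radial_gain) => //.
have mI : measurable_fun (setT : set (measurableTypeR R)) (\1_`[0, +oo[ : R -> R).
  by apply: measurable_indicI; exact: measurable_itv.
apply: (le_integrable measurableT _ _ iB).
  by apply/measurable_EFinP; exact: measurable_funM.
move=> v _ /=; have /andP[g0 g1] := radial_gain01 v.
rewrite lee_fin normrM (ger0_norm g0) ger0_norm//.
rewrite (le_trans _ (ler_norm _))// !indicE.
case: (boolP (v \in `[0, +oo[%classic)) => [|_]; last first.
  by rewrite mul0r addr_ge0// mulr_ge0// powR_ge0.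
rewrite inE/= in_itv/= andbT mul1r => v0.
have [v1|v1] := leP v 1.
  have -> : v \in J1 by apply: mem_set; rewrite /J1/= in_itv/= v1 v0.
  by rewrite (le_trans g1)// lerDl mulr_ge0// powR_ge0.
have -> : v \in J2 by apply: mem_set; rewrite /J2/= in_itv/= (ltW v1).
rewrite mul1r; apply: (@le_trans _ _ (v `^ (- (pathloss N / 2)))); last by rewrite lerDr.
have h := powR_ge0 v (- (pathloss N / 2)).
have h1 : 0 < 1 + v `^ (- (pathloss N / 2)) by rewrite ltr_pwDl.
by rewrite /radial_gain ler_pdivrMr// ler_peMr// lerDl.
Qed.

Lemma measurable_gain : measurable_fun setT gain.
Proof.
have -> : gain = fun x => radial_gain (sqnorm x / scale) by apply/funext => x; exact: gainE.
apply: (measurableT_comp measurable_radial_gain).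
by apply: measurable_funM; [exact: measurable_sqnorm|exact: measurable_cst].
Qed.

Lemma gain01 x : 0 <= gain x <= 1.
Proof. by rewrite gainE radial_gain01. Qed.

Let mrad (g : R -> R) : measurable_fun setT g ->
  measurable_fun (setT : set (measurableTypeR R)) (fun v => (g (radial_gain v))%:E).
Proof.
move=> mg; apply/measurable_EFinP; apply: (measurableT_comp mg).
exact: measurable_radial_gain.
Qed.

Lemma gain_integral (g : R -> R) (K : R) : measurable_fun setT g ->
  (forall y, 0 <= y <= 1 -> `|g y| <= K * y) ->
  \int[areaM]_x g (gain x) = pi * scale * \int[mu]_(v in `[0, +oo[) g (radial_gain v).
Proof.
move=> mg gK.
have ig : mu.-integrable `[0, +oo[ (EFin \o (fun v => g (radial_gain v))).
  apply: (le_integrable _ _ _ (integrableZl _ K radial_gain_integrable)) => //.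
    by apply: measurable_funTS; exact: mrad.
  move=> v _ /=; rewrite lee_fin; apply: le_trans (gK _ (radial_gain01 v)) _.
  exact: ler_norm.
rewrite -RintegralZl//.
have := radial_integral scale_gt0 (mrad mg) => /(congr1 fine) h.
rewrite /Rintegral; apply: etrans _ (etrans h _).
- by congr fine; apply: eq_integral => x _; rewrite gainE.
- by congr fine; apply: eq_integral => v _; rewrite EFinM.
Qed.

Lemma gain_integrable : areaM.-integrable setT (EFin \o gain).
Proof.
apply/integrableP; split; first by apply/measurable_EFinP; exact: measurable_gain.
have := radial_integral scale_gt0 (mrad (g := id) (@measurable_id _ _ _)) => /= h.
rewrite [X in (X < _)%E](_ : _ = \int[@area R]_x (radial_gain (sqnorm x / scale))%:E)%E; last first.
  apply: eq_integral => x _ /=; rewrite gainE ger0_norm//.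
  by have /andP[] := radial_gain01 (sqnorm x / scale).
rewrite h.
have pk : 0 <= pi * scale by rewrite mulr_ge0 ?pi_ge0// ltW// scale_gt0.
rewrite ge0_integralZl//.
- rewrite -ge0_fin_numE.
    by rewrite fin_numM//; exact: (integrable_fin_num _ radial_gain_integrable).
  by rewrite mule_ge0//; apply: integral_ge0 => v _; rewrite lee_fin; have /andP[] := radial_gain01 v.
- by apply: measurable_funTS; exact: (mrad (g := id)).
- by move=> v _; rewrite lee_fin; have /andP[] := radial_gain01 v.
Qed.

End gain.

(** * Law of the success probability *)

Section log_factor.
Context {R : realType}.
Variable p : R.
Hypothesis p01 : 0 < p < 1.

(* Makes [log_factor] globally Lipschitz in its second argument. *)
Definition clamp (y : R) : R := Num.max 0 (Num.min y 1).

Definition log_factor (a y : R) : R := ln (1 - a * clamp y).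

Lemma clamp01 y : 0 <= clamp y <= 1.
Proof. by rewrite /clamp le_max lexx/= ge_max ler01 ge_min lexx orbT. Qed.

Lemma clamp_id y : 0 <= y <= 1 -> clamp y = y.
Proof. by move=> /andP[y0 y1]; rewrite /clamp (min_l y1) max_r. Qed.

Lemma clamp_lipschitz x y : `|clamp x - clamp y| <= `|x - y|.
Proof.
wlog xy : x y / x <= y => [h|].
  by case/orP: (le_total x y) => /h //; rewrite distrC (distrC x).
rewrite !ler0_norm ?subr_le0//; last first.
  by rewrite /clamp ge_max !le_max lexx/= le_min !ge_min xy lexx !orbT.
have [x0|x0] := leP x 0; have [y0|y0] := leP y 0; have [x1|x1] := leP x 1; have [y1|y1] := leP y 1;
  rewrite /clamp ?(min_l x1) ?(min_r (ltW x1)) ?(min_l y1) ?(min_r (ltW y1)) ?(max_r ler01)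
    ?(max_l x0) ?(max_r (ltW x0)) ?(max_l y0) ?(max_r (ltW y0)); lra.
Qed.

Lemma measurable_clamp : measurable_fun setT clamp.
Proof.
apply: measurable_maxr; first exact: measurable_cst.
by apply: measurable_minr => //; exact: measurable_cst.
Qed.

Let p1 : p < 1. Proof. by case/andP: p01. Qed.
Let q0 : 0 < 1 - p. Proof. by rewrite subr_gt0. Qed.

Lemma one_minus_ge a c : 0 <= a <= p -> 0 <= c <= 1 -> 1 - p <= 1 - a * c.
Proof.
move=> /andP[a0 ap] /andP[c0 c1]; rewrite lerD2l lerN2.
by apply: le_trans ap; rewrite ler_piMr.
Qed.

Let ln_diff (s t : R) : 1 - p <= s -> s <= t -> ln t - ln s <= (t - s) / (1 - p).
Proof.
move=> ps st; have s0 : 0 < s by apply: lt_le_trans ps.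
have t0 : 0 < t by apply: lt_le_trans st.
rewrite -ln_div ?posrE//.
have : ln (1 + (t / s - 1)) <= t / s - 1.
  by apply: le_ln1Dx; rewrite ltrBrDr addNr divr_gt0.
rewrite subrKC => /le_trans; apply.
have -> : t / s - 1 = (t - s) / s by field; rewrite gt_eqF.
by rewrite ler_wpM2l ?subr_ge0// lef_pV2 ?posrE.
Qed.

(** The argument of the logarithm varies by at most [p * |x - y|] and stays above [1 - p], where the
    logarithm has slope at most [1 / (1 - p)]. *)
Lemma log_factor_lipschitz a x y : 0 <= a <= p ->
  `|log_factor a x - log_factor a y| <= p / (1 - p) * `|x - y|.
Proof.
move=> a01; have := clamp_lipschitz x y.
rewrite /log_factor; have := clamp01 x; have := clamp01 y.
move: (clamp x) (clamp y) => c d d01 c01 cd.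
have main u v : 0 <= u <= 1 -> 0 <= v <= 1 -> u <= v -> `|u - v| <= `|x - y| ->
    `|ln (1 - a * u) - ln (1 - a * v)| <= p / (1 - p) * `|x - y|.
  move=> u01 v01 uv; rewrite ler0_norm ?subr_le0// opprB => uvxy.
  case/andP: (a01) => a0 ap.
  have h : 1 - a * v <= 1 - a * u by rewrite lerD2l lerN2 ler_wpM2l.
  rewrite ger0_norm; last first.
    by rewrite subr_ge0 ler_ln ?posrE//; apply: lt_le_trans q0 _; apply: one_minus_ge.
  apply: le_trans (ln_diff (one_minus_ge a01 v01) h) _.
  rewrite [leRHS]mulrAC ler_wpM2r ?invr_ge0 ?(ltW q0)//.
  have -> : 1 - a * u - (1 - a * v) = a * (v - u) by ring.
  by apply: ler_pM => //; rewrite subr_ge0.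
case/orP: (le_total c d) => h; first exact: main.
by rewrite distrC main// distrC.
Qed.

Lemma log_factor0 a : log_factor a 0 = 0.
Proof. by rewrite /log_factor clamp_id ?lexx ?ler01// mulr0 subr0 ln1. Qed.

Lemma log_factor_le a y : 0 <= a <= p -> 0 <= y -> `|log_factor a y| <= p / (1 - p) * y.
Proof.
move=> a01 y0; have := log_factor_lipschitz y 0 a01.
by rewrite log_factor0 !subr0 (ger0_norm y0).
Qed.

End log_factor.

(** * Integration of the marks *)

Section environment.
Context (R : realType) de (E : measurableType de) dw (W : measurableType dw).
Variables (N : params R) (P0 : probability E R) (Q : R.-pker E ~> W).
Variable (net : network R E W).
Hypothesis adm : admissible N.
Hypothesis mf : mean_field N P0 Q net.
Notation mu := (@lebesgue_measure R).

Let p01 : 0 < access N < 1. Proof. by case: adm. Qed.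
Let p0 : 0 < access N. Proof. by case/andP: p01. Qed.
Let p1 : access N < 1. Proof. by case/andP: p01. Qed.
Let K := access N / (1 - access N).

Let Y j := tx net j.+1.

Definition duty (j : nat) (e : E) : R := activity1 N (Defs.mu net j e).

Lemma duty01 j e : 0 <= duty j e <= access N.
Proof.
have /andP[m0 m1] := mu01 mf j e.
by rewrite activity1_ge0// activity1_le.
Qed.

Lemma measurable_activity1 : measurable_fun setT (activity1 N).
Proof.
apply: measurable_funM; first exact: measurable_cst.
apply: (measurableT_comp (@measurable_inv R)).
apply: measurable_funD; first exact: measurable_cst.
by apply: measurable_funM => //; exact: measurable_cst.
Qed.

Lemma env_events_setI i : setI_closed (env_events net i).
Proof.
case: i => [|j|j]; last 2 first.
- exact: sigma_of_setI.
- exact: sigma_of_setI.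
move=> A B sA sB C [sC iC].
have sigI : setI_closed C.
  move=> X Z CX CZ; rewrite -(setCK (X `&` Z)) setCI.
  rewrite -setTD; case: sC => C0 CC CU; apply: (CC).
  have -> : ~` X `|` ~` Z = \bigcup_k (if k == 0%N then setT `\` X else setT `\` Z).
    apply/seteqP; split => x /=.
      by move=> [h|h]; [exists 0%N|exists 1%N] => //=; rewrite setTD.
    by move=> [[|k] _ /= [_ nx]]; [left|right].
  by apply: CU => -[|k] /=; apply: (CC).
by apply: sigI; [exact: sA|exact: sB].
Qed.

Lemma env_events_setT i : env_events net i setT.
Proof.
case: i => [|j|j]; last 2 first.
- exact: sigma_of_setT.
- exact: sigma_of_setT.
by apply: sub_sigma_algebra; exists 0%N => //; exact: sigma_of_setT.
Qed.

Lemma env_events_measurable i : env_events net i `<=` measurable.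
Proof.
case: i => [|j|j]; last 2 first.
- by apply: sigma_of_measurable; exact: measurable_funPT.
- by apply: sigma_of_measurable; exact: measurable_funPT.
move=> A sA; apply: sA; split; first exact: sigma_algebra_measurable.
by move=> B [j _]; apply: sigma_of_measurable; exact: measurable_funPT.
Qed.

Let D0 := [set i | if i is Mark 0 then False else True].
Let indE : mutually_independent P0 D0 (env_events net). Proof. by case: mf. Qed.
Let G (D : set env_index) := \bigcup_(i in D) env_events net i.

Let Gm D : G D `<=` measurable.
Proof. by move=> A [i _]; exact: env_events_measurable. Qed.

Let env_groups (D1 D2 : set env_index) : D1 `<=` D0 -> D2 `<=` D0 -> D1 `&` D2 = set0 ->
  forall A B, <<s G D1 >> A -> <<s G D2 >> B -> P0 (A `&` B) = (P0 A * P0 B)%E.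
Proof.
move=> h1 h2 h12 A B.
apply: (indep_groups indE) => // i _.
- exact: env_events_setI.
- exact: env_events_setT.
- exact: env_events_measurable.
Qed.

Let m_duty j (D : set env_index) : D (Mark j) ->
  measurable_fun (setT : set (g_sigma_algebraType (G D))) (duty j).
Proof.
move=> Dj; apply: (measurableT_comp measurable_activity1).
exact: (measurable_sub_sigma_of Dj).
Qed.

Let m_point j (D : set env_index) : D Points ->
  measurable_fun (setT : set (g_sigma_algebraType (G D))) (Y j).
Proof.
move=> Dj; apply: (measurable_sub_sigma_of Dj).
by move=> A sA; apply: sub_sigma_algebra; exists j.
Qed.

Lemma measurable_duty j : measurable_fun setT (duty j).
Proof. by apply: (measurableT_comp measurable_activity1); exact: measurable_funPT. Qed.

(** All marks have the law of [mu net 0] by [mean_field]. Through this identity the unknown law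
    enters its own characteristic function. *)
Lemma cint_duty j (g : R -> R[i]) : cbounded_measurable g ->
  cint P0 (fun e => g (duty j e)) = cint P0 (fun e => g (duty 0 e)).
Proof.
have law (h : R -> R) : bounded_measurable h ->
    \int[P0]_e h (duty j e) = \int[P0]_e h (duty 0 e).
  move=> bh; pose h' := h \o activity1 N.
  have bh' : bounded_measurable h' by apply: bm_comp => //; exact: measurable_activity1.
  have distr k : \int[P0]_e h' (Defs.mu net k e) = \int[distribution P0 (Defs.mu net k)]_t h' t.
    rewrite /Rintegral integral_distribution//.
    - by apply/measurable_EFinP; case: bh'.
    - exact: bm_integrable (bm_comp bh' (measurable_funPT (Defs.mu net k))).
  rewrite (distr j) (distr 0%N) /Rintegral; congr fine.
  apply: eq_measure_integral => A mA _.
  by case: mf => _ same _ _ _; exact: same.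
by move=> [bR bI]; rewrite /cint (law _ bR) (law _ bI).
Qed.

(** Characteristic function at [w] of the logarithmic contribution of an interferer with gain [y],
    averaged over its mark. *)
Definition mark_transform (w y : R) : R[i] :=
  cint P0 (fun e => cis (w * log_factor (duty 0 e) y)).

Lemma measurable_log_factor d (T : measurableType d) (a h : T -> R) :
  measurable_fun setT a -> measurable_fun setT h ->
  measurable_fun setT (fun x => log_factor (a x) (h x)).
Proof.
move=> ma mh; apply: (measurableT_comp (@measurable_ln R)).
apply: measurable_funB; first exact: measurable_cst.
by apply: measurable_funM => //; exact: (measurableT_comp measurable_clamp).
Qed.

Let cbm_factor w j y : cbounded_measurable (fun e => cis (w * log_factor (duty j e) y)).
Proof.
apply: cbm_cis; apply: measurable_funM; first exact: measurable_cst.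
by apply: measurable_log_factor; [exact: measurable_duty|exact: measurable_cst].
Qed.

Lemma mark_transform_le1 w y : normc (mark_transform w y) <= 1.
Proof. by apply: normc_cint => // e; rewrite normc_cis. Qed.

Lemma mark_transform0 w : mark_transform w 0 = 1.
Proof.
rewrite /mark_transform; under eq_fun do rewrite log_factor0 mulr0 cis0.
exact: cint_cst.
Qed.

Lemma mark_transform_lipschitz w x y :
  normc (mark_transform w x - mark_transform w y) <= 2 * (`|w| * K) * `|x - y|.
Proof.
have -> : mark_transform w x - mark_transform w y = cint P0 (fun e =>
    cis (w * log_factor (duty 0 e) x) + (-1) * cis (w * log_factor (duty 0 e) y)).
  rewrite cintD//; last by apply: cbmM => //; exact: cbm_cst.
  by rewrite cintZ// mulN1r.
rewrite -2!mulrA -[X in 2 * X](bm_int_cst P0).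
apply: normc_cint_le.
- by apply: cbmD => //; apply: cbmM => //; exact: cbm_cst.
- by apply: bm_integrable; exact: bmcst.
- move=> e; rewrite mulN1r; apply: le_trans (cis_lipschitz _ _) _.
  by rewrite -mulrBr normrM ler_wpM2l// log_factor_lipschitz// duty01.
Qed.

Lemma measurable_mark_transform w :
  measurable_fun setT (fun y : R => complex.Re (mark_transform w y)) /\
  measurable_fun setT (fun y : R => complex.Im (mark_transform w y)).
Proof.
have [cR cI] := lipschitz_Re_continuous (mark_transform_lipschitz w).
by split; apply: continuous_measurable_fun.
Qed.

Lemma cbm_mark_transform w d (T : measurableType d) (h : T -> R) :
  measurable_fun setT h -> cbounded_measurable (fun x => mark_transform w (h x)).
Proof.
have [mR mI] := measurable_mark_transform w.
move=> mh; split; split.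
- exact: (measurableT_comp mR mh).
- by exists 1 => z; apply: le_trans (normc_Re _) (mark_transform_le1 _ _).
- exact: (measurableT_comp mI mh).
- by exists 1 => z; apply: le_trans (normc_Im _) (mark_transform_le1 _ _).
Qed.

Lemma indep_sub_cint (G1 G2 : set (set E)) : G1 `<=` measurable -> G2 `<=` measurable ->
  (forall A B, <<s G1 >> A -> <<s G2 >> B -> P0 (A `&` B) = (P0 A * P0 B)%E) ->
  forall f : g_sigma_algebraType G1 * g_sigma_algebraType G2 -> R[i],
  cbounded_measurable f ->
  cint P0 (fun e => f (e, e)) = cint P0 (fun v => cint P0 (fun e => f (v, e))).
Proof.
move=> m1 m2 ind f [bR bI]; rewrite /cint.
by have [_ ->] := indep_sub_Rintegral m1 m2 ind bR; have [_ ->] := indep_sub_Rintegral m1 m2 ind bI.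
Qed.

Let h e j := gain N (Y j e).

(** The marks are averaged one at a time: in [X r] the first [r] are done. Mark [r.+1] is
    independent of the points and of the other marks; mark 0 stays out of both groups since it is a
    function of the environment, not an independent variable. *)
Lemma integrate_marks w n :
  cint P0 (fun e => \prod_(j < n) cis (w * log_factor (duty j.+1 e) (h e j))) =
  cint P0 (fun e => \prod_(j < n) mark_transform w (h e j)).
Proof.
pose X r e j := if (j < r)%N then mark_transform w (h e j)
                else cis (w * log_factor (duty j.+1 e) (h e j)).
suff H r : (r <= n)%N -> cint P0 (fun e => \prod_(j < n) X r e j) =
    cint P0 (fun e => \prod_(j < n) X 0%N e j).
  have := H n (leqnn n) => {}H.
  transitivity (cint P0 (fun e => \prod_(j < n) X 0%N e j)) => //.
  rewrite -H; congr (cint P0 _); apply/funext => e; apply: eq_bigr => j _.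
  by rewrite /X ltn_ord.
elim: r => // r IH rn; rewrite -IH; last exact: ltnW.
pose D1 := [set i | match i with Points => True | Angle _ => False
                    | Mark k => k <> 0%N /\ k <> r.+1 end].
pose D2 := [set Mark r.+1].
have D10 : D1 `<=` D0 by move=> [|k|[|k]] //= [].
have D20 : D2 `<=` D0 by move=> _ ->.
have D12 : D1 `&` D2 = set0 by apply/seteqP; split => // i [] /[swap] -> /= [].
pose o := Ordinal rn.
pose C v : R[i] := \prod_(j < n) (if j == o then 1 else X r v j).
pose f (z : g_sigma_algebraType (G D1) * g_sigma_algebraType (G D2)) : R[i] :=
  C z.1 * cis (w * log_factor (duty r.+1 z.2) (h z.1 r)).
have mh j : measurable_fun (setT : set (g_sigma_algebraType (G D1))) (fun e => h e j).
  by apply: (measurableT_comp (f := gain N) (measurable_gain adm)); exact: m_point.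
have cmark j := cbm_mark_transform w (mh j).
have cC : cbounded_measurable (C : g_sigma_algebraType (G D1) -> R[i]).
  apply: cbm_prod => j; case: eqP => [_|/eqP jo]; first exact: cbm_cst.
  rewrite /X; case: ltnP => jr //.
  apply: cbm_cis; apply: measurable_funM; first exact: measurable_cst.
  apply: measurable_log_factor => //; apply: m_duty => /=; split => // -[jr1].
  by move/eqP: jo; apply; apply: val_inj.
have cf : cbounded_measurable f.
  apply: cbmM.
    by case: cC => c1 c2; split; [exact: (bm_comp c1)|exact: (bm_comp c2)].
  apply: cbm_cis; apply: measurable_funM; first exact: measurable_cst.
  apply: measurable_log_factor.
  - by apply: (measurableT_comp _ measurable_snd); exact: m_duty.
  - exact: (measurableT_comp (mh r) measurable_fst).
have CE v : C v = \prod_(j < n | j != o) X r v j.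
  by rewrite /C (bigD1 o)//= eqxx mul1r; apply: eq_bigr => j /negbTE ->.
transitivity (cint P0 (fun v => cint P0 (fun e => f (v, e)))).
  congr (cint P0 _); apply/funext => v; rewrite /f/= cintZ//.
  rewrite (@cint_duty r.+1 (fun a => cis (w * log_factor a (h v r)))); last first.
    apply: cbm_cis; apply: measurable_funM; first exact: measurable_cst.
    by apply: measurable_log_factor => //; exact: measurable_cst.
  rewrite -/(mark_transform w (h v r)) CE mulrC (bigD1 o)//=.
  rewrite {1}/X/= ltnSn; congr (_ * _); apply: eq_bigr => j jo.
  by rewrite /X ltnS leq_eqVlt -[(j == r :> nat)]/(j == o) (negbTE jo).
rewrite -(indep_sub_cint _ _ _ cf); [|exact: Gm|exact: Gm|exact: env_groups].
congr (cint P0 _); apply/funext => e; rewrite /f/= CE mulrC [RHS](bigD1 o)//=.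
by rewrite {2}/X/= ltnn.
Qed.

End environment.

(** * The logarithm of the success probability as a shot noise *)

Section log_success.
Context (R : realType) de (E : measurableType de) dw (W : measurableType dw).
Variables (N : params R) (P0 : probability E R) (Q : R.-pker E ~> W).
Variable (net : network R E W).
Hypothesis adm : admissible N.
Hypothesis palm : palm_model N P0 net.
Hypothesis proto : protocol N Q net.
Hypothesis mf : mean_field N P0 Q net.
Notation mu := (@lebesgue_measure R).

Let lam0 : 0 < density N. Proof. by case: adm => -[]. Qed.
Let p01 : 0 < access N < 1. Proof. by case: adm. Qed.
Let K := access N / (1 - access N).
Let K0 : 0 < K. Proof. by case/andP: p01 => p0 p1; rewrite /K divr_gt0// subr_gt0. Qed.

Let Y j := tx net j.+1.
Let ppp : poisson_point_process P0 (density N) (fun j => Y j). Proof. by case: palm. Qed.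
Let h e j := gain N (Y j e).
Let h01 e j : 0 <= h e j <= 1. Proof. exact: gain01. Qed.
Let h0 e j : 0 <= h e j. Proof. by have /andP[] := h01 e j. Qed.
Let mh j : measurable_fun setT (fun e => h e j).
Proof. by apply: (measurableT_comp (f := gain N) (measurable_gain adm)); exact: measurable_funPT. Qed.

Let total e : \bar R := (\sum_(0 <= j <oo) (h e j)%:E)%E.

Let total_ge0 e : (0 <= total e)%E.
Proof. by apply: nneseries_ge0 => j _ _; rewrite lee_fin. Qed.

Let mtotal : measurable_fun setT total.
Proof.
have := @ge0_emeasurable_sum _ E R setT (fun j e => (h e j)%:E) xpredT.
apply => [k x _ _|k _]; first by rewrite lee_fin.
exact/measurable_EFinP.
Qed.

(** By Campbell's formula the mean is the density times the integral of [gain] over the plane, which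
    is finite. *)
Let int_total : (\int[P0]_e total e < +oo)%E.
Proof.
rewrite /total integral_nneseries//; last 2 first.
- by move=> j; apply/measurable_EFinP.
- by move=> j e _; rewrite lee_fin.
have mg : measurable_fun setT (fun x : plane R => (gain N x)%:E).
  by apply/measurable_EFinP; exact: measurable_gain.
rewrite (campbell lam0 ppp mg) => [|x]; last by rewrite lee_fin; have /andP[] := gain01 adm x.
have /integrableP[_ fin] := gain_integrable adm.
rewrite lte_mul_pinfty ?lee_fin ?(ltW lam0)//.
apply: le_lt_trans fin; apply: ge0_le_integral => //.
- by move=> x _; rewrite lee_fin; have /andP[] := gain01 adm x.
- by apply: measurableT_comp.
- by move=> x _; rewrite lee_fin ler_norm.
Qed.

Let total_fin : {ae P0, forall e, total e \is a fin_num}.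
Proof.
have it : P0.-integrable setT total.
  apply/integrableP; split => //; apply: le_lt_trans int_total.
  apply: ge0_le_integral => //; first exact: measurableT_comp.
  by move=> x _; rewrite gee0_abs.
have := integrable_ae measurableT it.
by apply: filterS => e; exact.
Qed.

Let partial e n := \sum_(j < n) log_factor (duty N net j.+1 e) (h e j).

Let partial_sum_le e n : total e \is a fin_num -> \sum_(j < n) h e j <= fine (total e).
Proof.
move=> fin; rewrite -lee_fin fineK// -sumEFin.
rewrite -(big_mkord xpredT (fun j => (h e j)%:E)).
by apply: nneseries_lim_ge => j _ _; rewrite lee_fin.
Qed.

Let partial_bound e n : total e \is a fin_num -> `|partial e n| <= K * fine (total e).
Proof.
move=> fin; apply: le_trans (ler_norm_sum _ _ _) _.
apply: (@le_trans _ _ (\sum_(j < n) K * h e j)).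
  by apply: ler_sum => j _; apply: log_factor_le => //; exact: (duty01 adm mf).
by rewrite -mulr_sumr ler_wpM2l ?(ltW K0)// partial_sum_le.
Qed.

Let partial_cvg e : total e \is a fin_num -> partial e n @[n --> \oo] --> limn (partial e).
Proof.
move=> fin; apply: nonincreasing_is_cvgn.
  apply/nonincreasing_seqP => n; rewrite /partial big_ord_recr/= gerDl.
  have := one_minus_ge (duty01 adm mf n.+1 e) (clamp01 (h e n)).
  have /andP[d0 _] := duty01 adm mf n.+1 e; have /andP[c0 _] := clamp01 (h e n).
  by move=> _; apply: ln_le0; rewrite lerBlDr lerDl mulr_ge0.
exists (- (K * fine (total e))) => _ [n _ <-].
by have := partial_bound n fin; rewrite ler_norml => /andP[].
Qed.

(** Almost surely the total gain is finite. Duty cycles being at most [access N < 1], the logarithms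
    of the factors are dominated by [K] times the gains, so their partial sums converge and the
    product limit is the exponential of a finite number, hence positive. *)
Lemma log_success : {ae P0, forall e, [/\ 0 < Defs.mu net 0 e,
   partial e n @[n --> \oo] --> ln (Defs.mu net 0 e) + noise_term N &
   ((`|ln (Defs.mu net 0 e) + noise_term N|)%:E <= K%:E * total e)%E]}.
Proof.
case: (mf) => lim _ _ Psuc indQ.
apply: filterS2 total_fin lim => e fin lime.
have [Parr Pacc Pfad _] := proto e.
have [_ indQe] := indQ e.
have hB n : \sum_(1 <= j < n.+1) path_gain N (tx net j e) / (1 + path_gain N (tx net j e)) <= fine (total e).
  by rewrite big_add1/= big_mkord; exact: partial_sum_le.
have := @success_limit _ _ _ _ _ N net (kernel_probability Q e) (fun j => Defs.mu net j e)
  adm (fun j => mu01 mf j e) Parr Pacc (Psuc e) Pfad indQe e _ _ hB lime.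
have pE n : expR (- noise_term N) * \prod_(1 <= j < n.+1)
   (1 - activity1 N (Defs.mu net j e) * (path_gain N (tx net j e) / (1 + path_gain N (tx net j e)))) =
   expR (- noise_term N + partial e n).
  rewrite expRD; congr (_ * _); rewrite /partial (big_morph _ (@expRD R) (@expR0 R)).
  rewrite big_add1/= big_mkord; apply: eq_bigr => j _.
  rewrite /log_factor clamp_id// lnK// posrE.
  have /andP[pp0 pp1] := p01.
  apply: lt_le_trans (one_minus_ge (duty01 adm mf j.+1 e) (h01 e j)).
  by rewrite subr_gt0.
under eq_fun do rewrite pE; move=> c1.
have c2 : expR (- noise_term N + partial e n) @[n --> \oo] --> expR (- noise_term N + limn (partial e)).
  apply: continuous_cvg; first exact: continuous_expR.
  by apply: cvgD; [exact: cvg_cst|exact: partial_cvg].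
have muE : Defs.mu net 0 e = expR (- noise_term N + limn (partial e)).
  by apply: cvg_unique c1 c2.
have lnE : ln (Defs.mu net 0 e) + noise_term N = limn (partial e).
  by rewrite muE expRK addrAC addNr add0r.
split; first by rewrite muE expR_gt0.
  by rewrite lnE; exact: partial_cvg.
rewrite -(fineK fin) -EFinM lee_fin lnE.
have c3 : `|partial e n| @[n --> \oo] --> `|limn (partial e)|.
  by apply: cvg_norm; exact: partial_cvg.
rewrite -(cvg_lim (@Rhausdorff R) c3); apply: limr_le.
  by apply/cvg_ex; eexists; exact: c3.
by apply: nearW => n; exact: partial_bound.
Qed.

Lemma success_positive : {ae P0, forall e, 0 < Defs.mu net 0 e}.
Proof. by apply: filterS log_success => e []. Qed.

Lemma measurable_log_mu : measurable_fun setT (fun e => ln (Defs.mu net 0 e)).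
Proof. by apply: (measurableT_comp (@measurable_ln R)); exact: measurable_funPT. Qed.

(** Domination by [K] times the total gain, which has finite mean; the inversion formula requires
    this integrability near frequency 0. *)
Lemma integrable_log_mu (c : R) :
  P0.-integrable setT (EFin \o (fun e => ln (Defs.mu net 0 e) - c)).
Proof.
have m1 : measurable_fun setT (fun e => (ln (Defs.mu net 0 e) + noise_term N)%:E).
  by apply/measurable_EFinP; apply: measurable_funD => //; exact: measurable_log_mu.
have i1 : P0.-integrable setT (EFin \o (fun e => ln (Defs.mu net 0 e) + noise_term N)).
  apply/integrableP; split => //.
  apply: (@le_lt_trans _ _ (\int[P0]_e (K%:E * total e))%E).
    apply: ae_ge0_le_integral => //.
    - by apply: measurableT_comp.
    - by move=> e _; rewrite mule_ge0// lee_fin ltW.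
    - exact: emeasurable_funM.
    - by apply: filterS log_success => e [_ _].
  by rewrite ge0_integralZl ?lte_mul_pinfty ?lee_fin ?(ltW K0).
have i2 : P0.-integrable setT (EFin \o (fun _ : E => - (noise_term N + c))).
  by apply: bm_integrable; exact: bmcst.
apply: eq_integrable (integrableD measurableT i1 i2) => // e _ /=.
by rewrite -EFinD; congr EFin; ring.
Qed.

(** The modulus of [cis] is 1, so dominated convergence reduces the claim to partial sums, where the
    marks are averaged out before the generating functional is applied. *)
Lemma characteristic_function w :
  cint P0 (fun e => cis (w * (ln (Defs.mu net 0 e) + noise_term N))) =
  cexp (- (Complex (density N) 0 * gap_integral (mark_transform N P0 net w) (gain N))).
Proof.
have mX : measurable_fun setT (fun e => w * (ln (Defs.mu net 0 e) + noise_term N)).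
  apply: measurable_funM; first exact: measurable_cst.
  by apply: measurable_funD => //; exact: measurable_log_mu.
have mp n : measurable_fun setT (fun e => w * partial e n).
  apply: measurable_funM; first exact: measurable_cst.
  apply: measurable_sum => j; apply: measurable_log_factor => //.
  exact: (measurable_duty N net j.+1).
have c1 : ccvg (fun n => cint P0 (fun e => cis (w * partial e n)))
    (cint P0 (fun e => cis (w * (ln (Defs.mu net 0 e) + noise_term N)))).
  apply: cint_dominated.
  - by move=> n; exact: cbm_cis.
  - exact: cbm_cis.
  - by move=> n e; rewrite normc_cis.
  - apply: filterS log_success => e [_ ce _].
    have cw : w * partial e n @[n --> \oo] --> w * (ln (Defs.mu net 0 e) + noise_term N).
      by apply: cvgM => //; exact: cvg_cst.
    by split => /=; apply: continuous_cvg => //; [exact: continuous_cos|exact: continuous_sin].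
apply: (ccvg_unique c1).
have -> : (fun n => cint P0 (fun e => cis (w * partial e n))) =
  fun n => cint P0 (fun e => \prod_(j < n) mark_transform N P0 net w (gain N (Y j e))).
  apply/funext => n; rewrite -(integrate_marks adm mf); congr (cint P0 _).
  by apply/funext => e; rewrite /partial mulr_sumr cis_sum.
apply: (generating_functional lam0 ppp).
- exact: mark_transform_le1.
- exact: mark_transform0.
- exact: (mark_transform_lipschitz adm mf w).
- exact: measurable_gain.
- exact: gain01.
- exact: gain_integrable.
Qed.

End log_success.

(** * The binomial series integrated over the half-line *)

Section radial_series.
Context (R : realType) de (E : measurableType de) dw (W : measurableType dw).
Variables (N : params R) (P0 : probability E R) (Q : R.-pker E ~> W).
Variable (net : network R E W).
Hypothesis adm : admissible N.
Hypothesis mf : mean_field N P0 Q net.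
Notation leb := (@lebesgue_measure R).

Let p01 : 0 < access N < 1. Proof. by case: adm. Qed.
Let p0 : 0 < access N. Proof. by case/andP: p01. Qed.
Let p1 : access N < 1. Proof. by case/andP: p01. Qed.
Let K := access N / (1 - access N).
Let half := (`[0, +oo[%classic : set (measurableTypeR R)).
Let mhalf : measurable half. Proof. exact: measurable_itv. Qed.
Let g : measurableTypeR R -> R := radial_gain N.
Let mg : measurable_fun setT g. Proof. exact: measurable_radial_gain. Qed.
Let g01 v : 0 <= g v <= 1. Proof. exact: radial_gain01. Qed.
Let g0 v : 0 <= g v. Proof. by have /andP[] := g01 v. Qed.
Let ig : leb.-integrable half (EFin \o g). Proof. exact: radial_gain_integrable. Qed.

Lemma radial_integrable (f : measurableTypeR R -> R) (C : R) : measurable_fun setT f ->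
  (forall v, `|f v| <= C * g v) -> leb.-integrable half (EFin \o f).
Proof.
move=> mff fC; apply: (le_integrable mhalf _ _ (integrableZl mhalf C ig)).
  by apply: measurable_funTS; exact/measurable_EFinP.
by move=> v _ /=; rewrite lee_fin; apply: le_trans (fC v) _; exact: ler_norm.
Qed.

Lemma radial_power_integrable k : leb.-integrable half (EFin \o (fun v => (- g v) ^+ k.+1)).
Proof.
apply: (@radial_integrable _ 1).
  by apply: measurable_funX; exact: measurable_funN.
move=> v; rewrite mul1r normrX normrN ger0_norm// exprS ler_piMr// exprn_ile1//.
by have /andP[] := g01 v.
Qed.

(** For [v > 0] the integrand is [- J * (- g v)^(k+1)]; at 0 the two forms differ, so both integrals
    are first moved to the open half-line. *)
Lemma outer_integralE k J :
  outer_integral N k.+1 J = - (J * \int[leb]_(v in half) (- g v) ^+ k.+1).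
Proof.
have i1 := radial_power_integrable k.
pose pos := (`]0, +oo[%classic : set (measurableTypeR R)).
have mpos : measurable pos by exact: measurable_itv.
have i2 : leb.-integrable pos (EFin \o (fun v => (- g v) ^+ k.+1)).
  apply: (integrableS mhalf mpos _ i1) => v; rewrite /half/pos/= !in_itv/= !andbT; exact: ltW.
have i3 := integrableZl mpos (- J) i2.
have e v : 0 < v -> (-1) ^+ k.+2 / (1 + v `^ (pathloss N / 2)) ^+ k.+1 * J = - J * (- g v) ^+ k.+1.
  move=> v0; rewrite /g radial_gainE// [(- _^-1) ^+ _]exprNn exprVn [(-1) ^+ k.+2]exprS; ring.
rewrite -mulNr -(Rintegral_itv_obnd_cbnd i2) -RintegralZl//.
rewrite /outer_integral -Rintegral_itv_obnd_cbnd; last first.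
  apply: (eq_integrable mpos _ _ _ i3) => v; rewrite inE/pos/= in_itv/= andbT => v0.
  by rewrite /= e.
by apply: eq_Rintegral => v; rewrite inE/= in_itv/= andbT => v0; exact: e.
Qed.

Lemma mean_activity k :
  \int[law_mu P0 net]_(t in `[0, 1]) activity N k t = \int[P0]_e duty N net 0 e ^+ k.
Proof.
have aE t : activity N k t = activity1 N t ^+ k by rewrite /activity /activity1 expr_div_n.
rewrite /Rintegral /law_mu ge0_integral_pushforward//=.
- have -> : Defs.mu net 0 @^-1` [set x | x \in `[0, 1]] = setT.
    by apply/seteqP; split => // e _ /=; rewrite in_itv/= (mu01 mf).
  by congr fine; apply: eq_integral => e _; rewrite /= aE.
- apply: measurable_funTS; apply/measurable_EFinP.
  have -> : activity N k = fun t => activity1 N t ^+ k by apply/funext.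
  by apply: measurable_funX; exact: measurable_activity1.
- move=> t; rewrite inE/= in_itv/= => /andP[t0 _].
  by rewrite lee_fin aE exprn_ge0// activity1_ge0.
Qed.

Section component.
(** [c] stands for the real or the imaginary part: the series argument is carried out once for a
    real-linear component bounded by the modulus. *)
Variable c : R[i] -> R.
Hypothesis cD : forall x y, c (x + y) = c x + c y.
Hypothesis cZ : forall z x, c (z * Complex x 0) = c z * x.
Hypothesis c_le : forall z, `|c z| <= normc z.
Hypothesis c_bm : forall d (T : measurableType d) (f : T -> R[i]),
  cbounded_measurable f -> bounded_measurable (fun x => c (f x)).
Hypothesis c_int : forall d (T : measurableType d) (P : probability T R) (f : T -> R[i]),
  c (cint P f) = \int[P]_x c (f x).
Variable w : R.
Let mt y := mark_transform N P0 net w y.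

Let cN z : c (- z) = - c z.
Proof. by rewrite -mulrN1 -[RHS]mulrN1 -cZ; congr (c (_ * _)); apply: complexP; rewrite ReImE/= ?oppr0. Qed.

Let c0 : c 0 = 0.
Proof. by have := cZ 0 0; rewrite mul0r mulr0. Qed.

Lemma component_gap_le y : 0 <= y -> `|c (1 - mt y)| <= 2 * (`|w| * K) * y.
Proof.
move=> y0; apply: le_trans (c_le _) _.
have := mark_transform_lipschitz adm mf w 0 y.
by rewrite mark_transform0 sub0r normrN (ger0_norm y0).
Qed.

Lemma measurable_component_gap d (T : measurableType d) (h : T -> R) :
  measurable_fun setT h -> measurable_fun setT (fun x => c (1 - mt (h x))).
Proof.
move=> mh; have cb := cbm_mark_transform adm mf w mh.
have [//] : bounded_measurable (fun x => c (1 - mt (h x))).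
under eq_fun do rewrite cD cN.
by apply: bmB; [exact: bmcst|exact: c_bm].
Qed.

Lemma component_gap_integrable : leb.-integrable half (EFin \o (fun v => c (1 - mt (g v)))).
Proof.
apply: radial_integrable; first exact: measurable_component_gap.
by move=> v; exact: component_gap_le.
Qed.

Lemma component_gap_plane :
  \int[(leb \x leb)%E]_x c (1 - mt (gain N x)) =
  pi * scale N * \int[leb]_(v in half) c (1 - mt (g v)).
Proof.
apply: (@gain_integral R N adm (fun y => c (1 - mt y)) (2 * (`|w| * K))).
  exact: (@measurable_component_gap _ _ id).
by move=> y /andP[y0 _]; exact: component_gap_le.
Qed.

Let b k := c (gbinom (Complex 0 w) k).
Let M k := \int[P0]_e duty N net 0 e ^+ k.
Let S n v := \sum_(1 <= k < n.+1) b k * (M k * (- g v) ^+ k).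

Let S_integrable n : leb.-integrable half (EFin \o S n) /\
  \int[leb]_(v in half) S n v = \sum_(1 <= k < n.+1) b k * (M k * \int[leb]_(v in half) (- g v) ^+ k).
Proof.
rewrite /S; elim: n => [|n [IH1 IH2]].
  split.
    apply: (eq_integrable mhalf _ _ _ (integrableZl mhalf 0 ig)) => v _ /=.
    by rewrite mul0e big_geq.
  rewrite big_geq//; under eq_Rintegral do rewrite big_geq//.
  by rewrite Rintegral_cst ?mul0r.
have i1 := radial_power_integrable n.
have i2 := integrableZl mhalf (M n.+1) i1.
have i3 := integrableZl mhalf (b n.+1) i2.
have i4 := integrableD mhalf IH1 i3.
have e v : EFin (\sum_(1 <= k < n.+2) b k * (M k * (- g v) ^+ k)) =
  ((EFin \o (fun v => (\sum_(1 <= k < n.+1) b k * (M k * (- g v) ^+ k))%R)) v +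
   (b n.+1)%:E * ((M n.+1)%:E * (EFin \o (fun v => ((- g v) ^+ n.+1)%R)) v))%E.
  by rewrite big_nat_recr//= EFinD !EFinM.
split; first by apply: (eq_integrable mhalf _ _ _ i4) => v _; rewrite [RHS]e.
rewrite [RHS]big_nat_recr//= -IH2.
transitivity (\int[leb]_(v in half) (\sum_(1 <= k < n.+1) b k * (M k * (- g v) ^+ k) +
    b n.+1 * (M n.+1 * (- g v) ^+ n.+1))).
  by apply: eq_Rintegral => v _; rewrite big_nat_recr.
by rewrite RintegralD// RintegralZl// RintegralZl.
Qed.

Let bm_duty k : bounded_measurable (fun e => duty N net 0 e ^+ k).
Proof.
apply: bmX; split; first exact: measurable_duty.
exists 1 => e; have /andP[a0 a1] := duty01 adm mf 0 e.
by rewrite ger0_norm// (le_trans a1)// ltW.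
Qed.

(** For each environment the binomial estimate is applied at [x = duty * g v] and then averaged. The
    partial sums approximate [mt - 1], hence the plus sign; [x <= g v] leaves a factor [g v]. *)
Let S_error n v : `|S n v + c (1 - mt (g v))| <= binomial_error w (access N) n * g v.
Proof.
pose T' m e := \sum_(1 <= k < m.+1) b k * (- (duty N net 0 e * g v)) ^+ k.
pose T := T' n.
pose L e := c (1 - cis (w * log_factor (duty N net 0 e) (g v))).
have bL : bounded_measurable L.
  rewrite /L; under eq_fun do rewrite cD cN.
  apply: bmB; first exact: bmcst.
  apply: c_bm; apply: cbm_cis; apply: measurable_funM; first exact: measurable_cst.
  by apply: measurable_log_factor; [exact: measurable_duty|exact: measurable_cst].
have bT : bounded_measurable T /\ \int[P0]_e T e = S n v.
  suff : bounded_measurable (T' n) /\ \int[P0]_e T' n e = S n v by [].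
  move: (n); rewrite /T' /S; elim=> [|m [IH1 IH2]].
    rewrite [in RHS]big_geq//; split.
      by under eq_fun do rewrite big_geq//; exact: bmcst.
    by under eq_Rintegral do rewrite big_geq//; exact: bm_int_cst.
  have tE e : \sum_(1 <= k < m.+2) b k * (- (duty N net 0 e * g v)) ^+ k =
     \sum_(1 <= k < m.+1) b k * (- (duty N net 0 e * g v)) ^+ k +
     b m.+1 * (- g v) ^+ m.+1 * duty N net 0 e ^+ m.+1.
    by rewrite big_nat_recr//= -mulrN exprMn; congr (_ + _); ring.
  have bn := bmZ (b m.+1 * (- g v) ^+ m.+1) (bm_duty m.+1).
  split; first by under eq_fun do rewrite tE; exact: bmD.
  rewrite [RHS]big_nat_recr//= -IH2.
  under eq_Rintegral do rewrite tE.
  by rewrite bm_intD// bm_intZ//; congr (_ + _); rewrite /M; ring.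
case: bT => bT <-.
have -> : c (1 - mt (g v)) = \int[P0]_e L e.
  rewrite /L /mt /mark_transform cD cN c_int.
  have bc : bounded_measurable (fun e => c (cis (w * log_factor (duty N net 0 e) (g v)))).
    apply: c_bm; apply: cbm_cis; apply: measurable_funM; first exact: measurable_cst.
    by apply: measurable_log_factor; [exact: measurable_duty|exact: measurable_cst].
  under [RHS]eq_Rintegral do rewrite cD cN.
  by rewrite bm_intB ?bm_int_cst//; exact: bmcst.
rewrite -bm_intD//; apply: bm_int_norm; first exact: bmD.
move=> e; have /andP[a0 a1] := duty01 adm mf 0 e; have /andP[gv0 gv1] := g01 v.
pose x := duty N net 0 e * g v.
have x0p : 0 <= x <= access N.
  by rewrite /x mulr_ge0//=; apply: le_trans a1; rewrite ler_piMr.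
have := binomial_series_le w p01 n x0p.
set z := (X in normc X) => zle.
have -> : T e + L e = c z.
  rewrite /z cD cN; congr (_ + _).
    rewrite /T /T' (big_morph c cD c0); apply: eq_bigr => k _; by rewrite cZ.
  by rewrite /L -cN opprB /log_factor clamp_id.
apply: le_trans (c_le _) _; apply: le_trans zle _.
rewrite /x ler_wpM2l//; last by rewrite ler_piMl// (le_trans a1)// ltW.
(* The error constant is nonnegative because it bounds a modulus at the positive point
   [x = access N]. *)
by have := le_trans (normc_ge0 _) (binomial_series_le w p01 n (_ : 0 <= access N <= access N)); rewrite (ltW p0) lexx pmulr_lge0//; exact.
Qed.

(** Sum and integral are exchanged: after integration the truncation error is at most
    [binomial_error] times the finite integral of [g], and it tends to 0. *)
Lemma component_series_cvg :
  \sum_(1 <= k < n) c (gbinom (Complex 0 w) k *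
     Complex (outer_integral N k (\int[law_mu P0 net]_(t in `[0, 1]) activity N k t)) 0)
  @[n --> \oo] --> \int[leb]_(v in half) c (1 - mt (g v)).
Proof.
rewrite -(cvg_shiftS (fun n => \sum_(1 <= k < n) _)).
have -> : (fun n => \sum_(1 <= k < n.+1) c (gbinom (Complex 0 w) k *
     Complex (outer_integral N k (\int[law_mu P0 net]_(t in `[0, 1]) activity N k t)) 0)) =
   (fun n => - \int[leb]_(v in half) S n v).
  apply/funext => n; rewrite (S_integrable n).2 -sumrN; apply: eq_big_nat => -[//|k] _.
  by rewrite cZ outer_integralE mean_activity mulrN.
have bound n : `|- (\int[leb]_(v in half) S n v) - \int[leb]_(v in half) c (1 - mt (g v))| <=
    binomial_error w (access N) n * \int[leb]_(v in half) g v.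
  have [iS _] := S_integrable n; have iG := component_gap_integrable.
  rewrite -opprD normrN -RintegralD// -RintegralZl//.
  have iSG : leb.-integrable half (EFin \o (fun v => S n v + c (1 - mt (g v)))).
    by apply: (eq_integrable mhalf _ _ _ (integrableD mhalf iS iG)) => v _; rewrite /= EFinD.
  apply: le_trans (le_normr_Rintegral mhalf iSG) _.
  apply: le_Rintegral => //.
  - exact: integrable_norm.
  - by apply: (eq_integrable mhalf _ _ _ (integrableZl mhalf (binomial_error w (access N) n) ig)) => v _; rewrite /= EFinM.
apply: cvg_dist_le bound _.
rewrite -(mul0r (\int[leb]_(v in half) g v)); apply: cvgM; last exact: cvg_cst.
exact: binomial_error_cvg0.
Qed.

End component.

End radial_series.

(** * Decay of the characteristic function *)

Section decay.
Context (R : realType) de (E : measurableType de) dw (W : measurableType dw).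
Variables (N : params R) (P0 : probability E R) (Q : R.-pker E ~> W).
Variable (net : network R E W).
Hypothesis adm : admissible N.
Hypothesis mf : mean_field N P0 Q net.
Notation leb := (@lebesgue_measure R).

Let p01 : 0 < access N < 1. Proof. by case: adm. Qed.
Let p0 : 0 < access N. Proof. by case/andP: p01. Qed.
Let p1 : access N < 1. Proof. by case/andP: p01. Qed.
Let xi0 : 0 < arrival N. Proof. by case: adm => _ _ /andP[]. Qed.
Let xi1 : arrival N <= 1. Proof. by case: adm => _ _ /andP[]. Qed.
Let K := access N / (1 - access N).
Let K0 : 0 < K. Proof. by rewrite /K divr_gt0// subr_gt0. Qed.
Let alpha0 : 0 < pathloss N. Proof. by case: adm => -[_ _ /(lt_trans _)->]. Qed.
Let half := (`[0, +oo[%classic : set (measurableTypeR R)).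
Let mhalf : measurable half. Proof. exact: measurable_itv. Qed.
Let g : measurableTypeR R -> R := radial_gain N.

Let ReZ (z : R[i]) x : complex.Re (z * Complex x 0) = complex.Re z * x.
Proof. by rewrite cReM/= mulr0 subr0. Qed.
Let ImZ (z : R[i]) x : complex.Im (z * Complex x 0) = complex.Im z * x.
Proof. by rewrite cImM/= mulr0 add0r. Qed.
Let Re_bm d (T : measurableType d) (f : T -> R[i]) :
  cbounded_measurable f -> bounded_measurable (fun x => complex.Re (f x)).
Proof. by case. Qed.
Let Im_bm d (T : measurableType d) (f : T -> R[i]) :
  cbounded_measurable f -> bounded_measurable (fun x => complex.Im (f x)).
Proof. by case. Qed.

Definition radial_gap (w : R) : R[i] :=
  Complex (\int[leb]_(v in half) complex.Re (1 - mark_transform N P0 net w (g v)))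
          (\int[leb]_(v in half) complex.Im (1 - mark_transform N P0 net w (g v))).

Definition transform (w : R) : R[i] := cexp (- (Complex (spatial_const N) 0 * radial_gap w)).

Lemma gap_integral_radial w :
  Complex (density N) 0 * gap_integral (mark_transform N P0 net w) (gain N) =
  Complex (spatial_const N) 0 * radial_gap w.
Proof.
have hR := @component_gap_plane _ _ _ _ _ N P0 Q net adm mf (@complex.Re R) (@ReD R) ReZ (@normc_Re R) Re_bm w.
have hI := @component_gap_plane _ _ _ _ _ N P0 Q net adm mf (@complex.Im R) (@ImD R) ImZ (@normc_Im R) Im_bm w.
have sE : spatial_const N = density N * (pi * scale N) by rewrite /spatial_const /scale !mulrA.
rewrite /gap_integral hR hI /radial_gap /half /g sE.
move: (\int[leb]_(v in _) complex.Re _) (\int[leb]_(v in _) complex.Im _) => x y.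
by apply: complexP; rewrite ?cReM ?cImM /=; ring.
Qed.

Lemma series_radial w :
  cseries (fun k => gbinom (Complex 0 w) k *
    Complex (outer_integral N k (\int[law_mu P0 net]_(t in `[0, 1]) activity N k t)) 0) =
  radial_gap w.
Proof.
have hR := @component_series_cvg _ _ _ _ _ N P0 Q net adm mf (@complex.Re R) (@ReD R) ReZ (@normc_Re R) Re_bm (fun _ _ _ _ => erefl) w.
have hI := @component_series_cvg _ _ _ _ _ N P0 Q net adm mf (@complex.Im R) (@ImD R) ImZ (@normc_Im R) Im_bm (fun _ _ _ _ => erefl) w.
rewrite /cseries /radial_gap; congr Complex.
  exact: (cvg_lim (@Rhausdorff R) hR).
exact: (cvg_lim (@Rhausdorff R) hI).
Qed.

(** Chosen so that [K / kappa <= 1]: the phases considered below then stay in [0, 1], where the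
    cosine decreases. *)
Let kappa := 1 + K.
Let a := pathloss N / 2.
Let a0 : 0 < a. Proof. by rewrite divr_gt0. Qed.
Let kappa1 : 1 <= kappa. Proof. by rewrite lerDl ltW. Qed.
Let kappa0 : 0 < kappa. Proof. exact: lt_le_trans kappa1. Qed.

(* Gains of order 1/w turn the phase by an angle bounded away from 0. *)
Let c1 := access N * arrival N * 2 `^ (- a) / (2 * kappa).
Let c1_gt0 : 0 < c1.
Proof. by rewrite /c1 divr_gt0 ?mulr_gt0 ?powR_gt0. Qed.

(** Since [delta * (alpha / 2) = 1], the power [alpha / 2] of this radius is [kappa * w]; between it
    and its double the gain is of order [1 / w]. *)
Let radius w := (kappa * w) `^ delta N.

Let radius_gain w v : 1 <= w -> radius w <= v <= 2 * radius w ->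
  2 `^ (- a) / (2 * kappa) <= w * g v /\ w * g v <= kappa^-1.
Proof.
move=> w1 /andP[Vv v2].
have w0 : 0 < w by apply: lt_le_trans w1.
have kw : 1 <= kappa * w by rewrite mulr_ege1.
have kw0 : 0 < kappa * w by apply: lt_le_trans kw.
have da : delta N * a = 1 by rewrite /delta /a; field; rewrite gt_eqF.
have V0 : 0 < radius w by exact: powR_gt0.
have Va : radius w `^ a = kappa * w by rewrite /radius -powRrM da powRr1// ltW.
have v0 : 0 < v by apply: lt_le_trans Vv.
have Vva : kappa * w <= v `^ a by rewrite -Va ge0_ler_powR// ?nnegrE ltW.
have v2a : v `^ a <= 2 `^ a * (kappa * w).
  rewrite -Va -powRM ?(ltW V0)//; apply: ge0_ler_powR => //; rewrite ?nnegrE ?mulr_ge0 ?(ltW V0) ?(ltW v0) ?(ltW a0) ?(ltW alpha0)//.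
have gE : g v = (1 + v `^ a)^-1 by rewrite /g radial_gainE.
have va1 : 1 <= v `^ a by apply: le_trans Vva.
have va0 : 0 < v `^ a by apply: lt_le_trans va1.
have t0 : 0 < 2 `^ a :> R by rewrite powR_gt0.
have dv : 0 < 1 + v `^ a by exact: addr_gt0.
split.
- have -> : 2 `^ (- a) / (2 * kappa) = (2 `^ a * (2 * kappa))^-1 by rewrite powRN [in RHS]invfM.
  rewrite gE ler_pdivlMr// ler_pdivrMl ?mulr_gt0//.
  apply: (@le_trans _ _ (2 * v `^ a)); first lra.
  apply: (@le_trans _ _ (2 * (2 `^ a * (kappa * w)))); first by rewrite ler_wpM2l.
  by rewrite le_eqVlt; apply/orP; left; apply/eqP; ring.
- by rewrite gE ler_pdivrMr// ler_pdivlMl//; lra.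
Qed.

(** For every mark the phase [- w * ln (1 - a g)] lies between [c1] and 1: the lower bound uses
    [ln (1 + y) <= y], the upper one the constant [K]. The cosine decreases on [[0, pi]], so each
    environment contributes at least [1 - cos c1]. *)
Let gap_point w v : 1 <= w -> radius w <= v <= 2 * radius w ->
  1 - cos c1 <= complex.Re (1 - mark_transform N P0 net w (g v)).
Proof.
move=> w1 vV; have [lo hi] := radius_gain w1 vV.
have w0 : 0 < w by apply: lt_le_trans w1.
have /andP[g0 g1] := radial_gain01 N v : 0 <= g v <= 1.
rewrite ReD ReN /= lerD2l lerN2 -[leRHS](bm_int_cst P0).
have mX : measurable_fun setT (fun e => w * log_factor (duty N net 0 e) (g v)).
  apply: measurable_funM; first exact: measurable_cst.
  by apply: measurable_log_factor; [exact: measurable_duty|exact: measurable_cst].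
have [bc _] := cbm_cis mX.
apply: bm_int_le => //; first exact: bmcst.
move=> e /=; have /andP[d0 dp] := duty01 adm mf 0 e.
have dlo : access N * arrival N <= duty N net 0 e by apply: activity1_ge => //; exact: (mu01 mf).
rewrite -(cosN (w * _)) -mulrN.
set x := w * _.
have xle : x <= 1.
  rewrite /x; apply: (@le_trans _ _ (w * (K * g v))).
    rewrite ler_wpM2l ?(ltW w0)//; apply: le_trans (ler_norm _) _.
    by rewrite normrN; apply: log_factor_le => //; rewrite d0.
  rewrite mulrCA; apply: (@le_trans _ _ (K * kappa^-1)); first by rewrite ler_wpM2l// ltW.
  by rewrite ler_pdivrMr// mul1r /kappa lerDr.
have xge : c1 <= x.
  apply: (@le_trans _ _ (w * (duty N net 0 e * g v))).
    rewrite mulrCA /c1 -mulrA; apply: ler_pM => //.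
    - by rewrite mulr_ge0// ltW.
    - by rewrite mulr_ge0 ?powR_ge0// invr_ge0 mulr_ge0// ltW.
  rewrite /x ler_wpM2l ?(ltW w0)// lerNr /log_factor clamp_id ?g0//.
  have := @le_ln1Dx R (- (duty N net 0 e * g v)).
  apply; rewrite ltrN2; apply: le_lt_trans p1; apply: le_trans dp; by rewrite ler_piMr.
have pi1 : 1 <= pi :> R by apply: le_trans (pi_ge2 R); rewrite ler1n.
case: (ltgtP c1 x) xge => // [lt _|-> //].
have c1x : c1 \in `[0, pi] by rewrite in_itv/= (ltW c1_gt0) (le_trans (ltW lt))// (le_trans xle).
have xx : x \in `[0, pi] by rewrite in_itv/= (le_trans (ltW c1_gt0) (ltW lt)) (le_trans xle).
by rewrite ltW// ltr_cos.
Qed.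

Let eta0 := 1 - cos c1.

Let eta0_gt0 : 0 < eta0.
Proof.
have c1_lt : c1 <= 1.
  rewrite /c1 ler_pdivrMr ?mulr_gt0// mul1r.
  have t1 : 2 `^ (- a) <= 1 :> R.
    rewrite powRN invf_le1 ?powR_gt0//.
    by rewrite -[leLHS](powRr0 (2 : R)) ler_powR ?ler1n// ltW.
  apply: (@le_trans _ _ 1).
    by rewrite mulr_ile1 ?mulr_ge0 ?powR_ge0 ?(ltW p0) ?(ltW xi0)// mulr_ile1 ?(ltW p0) ?(ltW xi0)// ltW.
  by move: kappa1; lra.
have pi1 : 1 <= pi :> R by apply: le_trans (pi_ge2 R); rewrite ler1n.
rewrite /eta0 subr_gt0 -(cos0 R) ltr_cos// in_itv/= ?lexx ?pi_ge0//.
by rewrite (ltW c1_gt0) (le_trans c1_lt).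
Qed.

(** The integrand is nonnegative, and at least [eta0] on an interval of length [radius w], which is
    at least [w^delta] because [kappa >= 1]. *)
Lemma radial_gap_lower w : 1 <= w -> eta0 * w `^ delta N <= complex.Re (radial_gap w).
Proof.
move=> w1; have w0 : 0 < w by apply: lt_le_trans w1.
have d0 : 0 < delta N by rewrite divr_gt0.
have V0 : 0 < radius w by rewrite powR_gt0 ?mulr_gt0.
pose f v := complex.Re (1 - mark_transform N P0 net w (g v)).
pose I := (`[radius w, 2 * radius w]%classic : set (measurableTypeR R)).
have mI : measurable I by exact: measurable_itv.
have f0 v : 0 <= f v.
  rewrite /f ReD ReN subr_ge0; apply: le_trans (ler_norm _) _.
  by apply: le_trans (normc_Re _) _; exact: mark_transform_le1.
have iF : leb.-integrable half (EFin \o f).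
  exact: (@component_gap_integrable _ _ _ _ _ N P0 Q net adm mf (@complex.Re R) (@ReD R) ReZ (@normc_Re R) Re_bm w).
apply: (@le_trans _ _ (eta0 * radius w)).
  rewrite ler_wpM2l ?(ltW eta0_gt0)//; apply: ge0_ler_powR; first exact: ltW.
  - by rewrite nnegrE ltW.
  - by rewrite nnegrE mulr_ge0// ltW.
  - by rewrite ler_peMl// ltW.
have mfI (D : set (measurableTypeR R)) : measurable D -> D `<=` half -> measurable_fun D (EFin \o f).
  by move=> mD Dh; case/integrableP: iF => mff _; apply: measurable_funS Dh mff.
have Ihalf : I `<=` half.
  by move=> v; rewrite /I /half/= !in_itv/= andbT => /andP[h _]; apply: le_trans h; exact: ltW.
rewrite -lee_fin /= /Rintegral fineK; last exact: integrable_fin_num.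
apply: (@le_trans _ _ (\int[leb]_(v in I) (f v)%:E)%E); last first.
  apply: ge0_subset_integral => //; first exact: mfI.
  by move=> v _; rewrite lee_fin.
apply: (@le_trans _ _ (\int[leb]_(v in I) eta0%:E)%E).
  have IE : leb `[radius w, 2 * radius w]%classic = (radius w)%:E.
    rewrite lebesgue_measure_itv/= lte_fin ifT; last by rewrite ltr_pMl// ltr1n.
    by rewrite -EFinB; congr EFin; ring.
  have -> : (\int[leb]_(v in I) eta0%:E = eta0%:E * leb I)%E by exact: integral_cst.
  by rewrite [leb I]IE -EFinM.
apply: ge0_le_integral => //.
- by move=> v _; rewrite lee_fin ltW.
- exact: mfI.
- by move=> v; rewrite /I/= in_itv/= => vV; rewrite lee_fin; exact: gap_point.
Qed.

(** The lower bound on the gap gives exp(-x) with [x = c * w^delta], and [expR (x / m) >= x / m]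
    turns this into [(m / x)^m], a power of [w] as small as desired. *)
Lemma transform_decay : exists C, forall w, 1 <= w -> normc (transform w) <= C * w `^ (-2).
Proof.
pose c := spatial_const N * eta0.
have d0 : 0 < delta N by rewrite divr_gt0.
have s0 : 0 < spatial_const N.
  case: adm => -[l0 r0 _] [_ _ th0] _ _.
  by rewrite /spatial_const !mulr_gt0 ?pi_gt0 ?powR_gt0.
have c0 : 0 < c by rewrite mulr_gt0.
(* This integer exceeds [pathloss N], which is [2 / delta], so that [delta * m >= 2]. *)
pose m := (Num.truncn (pathloss N)).+1.
have m0 : 0 < m%:R :> R by rewrite ltr0n.
exists ((m%:R / c) ^+ m) => w w1; have w0 : 0 < w by apply: lt_le_trans w1.
rewrite /transform normc_cexp ReN cReM/= mul0r subr0.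
set x := c * w `^ delta N.
have x0 : 0 < x by rewrite mulr_gt0 ?powR_gt0.
apply: (@le_trans _ _ (expR (- x))).
  by rewrite ler_expR lerN2 /x /c -mulrA ler_wpM2l ?(ltW s0)//; exact: radial_gap_lower.
apply: (@le_trans _ _ ((m%:R / x) ^+ m)).
  rewrite expRN -[leRHS]invrK lef_pV2 ?posrE ?expR_gt0 ?invr_gt0 ?exprn_gt0 ?divr_gt0//.
  rewrite -exprVn invf_div.
  have -> : expR x = expR (x / m%:R) ^+ m by rewrite -expRM_natr divfK// gt_eqF.
  apply: lerXn2r; rewrite ?nnegrE ?expR_ge0 ?divr_ge0 ?ltW//.
  by apply: lt_le_trans (expR_ge1Dx _); rewrite ltrDr.
rewrite /x invfM mulrA exprMn ler_wpM2l ?exprn_ge0 ?divr_ge0 ?(ltW c0) ?(ltW m0)//.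
rewrite -powRN -powR_mulrn ?powR_ge0// -powRrM ler_powR//.
rewrite mulNr lerN2 /delta mulrAC ler_pdivlMr// ler_wpM2l//.
by have := truncnS_gt (pathloss N) => /ltW.
Qed.

End decay.

(** * The fixed-point equation *)

Section fixed_point.
Context (R : realType) de (E : measurableType de) dw (W : measurableType dw).
Variables (N : params R) (P0 : probability E R) (Q : R.-pker E ~> W).
Variable (net : network R E W).
Hypothesis adm : admissible N.
Hypothesis palm : palm_model N P0 net.
Hypothesis proto : protocol N Q net.
Hypothesis mf : mean_field N P0 Q net.
Variable u : R.
Hypothesis u0 : 0 < u.

Let X e := ln (Defs.mu net 0 e) - ln u.

Let mX : measurable_fun setT X.
Proof. by apply: measurable_funB; [exact: measurable_log_mu|exact: measurable_cst]. Qed.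

Let phase w := cis (- (w * (noise_term N + ln u))).

Let phase_transform w : cint P0 (fun e => cis (X e * w)) = phase w * transform N P0 net w.
Proof.
rewrite /transform -(gap_integral_radial adm mf) -(characteristic_function adm palm proto mf w).
rewrite -cintZ; last first.
  apply: cbm_cis; apply: measurable_funM; first exact: measurable_cst.
  by apply: measurable_funD => //; exact: measurable_log_mu.
congr (cint P0 _); apply/funext => e; rewrite -cisD; congr cis.
by rewrite /X; ring.
Qed.

(** Inversion is applied to [X = ln mu_0 - ln u], whose negativity is almost surely the event
    [mu_0 < u]. The shift by [ln u] produces [u^(- i w)], and [phase] collects it with the noise
    factor. *)
Lemma success_distribution : F P0 net u = fixed_point_rhs N (law_mu P0 net) u.
Proof.
have [C decay] := transform_decay adm mf.
have bound w : 1 <= w -> normc (cint P0 (fun e => cis (X e * w))) <= C * w `^ (-2).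
  move=> w1; rewrite phase_transform Normc.normcM normc_cis mul1r.
  exact: decay.
have inv := gil_pelaez_inversion mX (integrable_log_mu adm palm proto mf (ln u))
  (fun w w1 => le_trans (normc_Im _) (bound w w1)) (fun w w1 => le_trans (normc_Re _) (bound w w1)).
transitivity (fine (P0 [set e | X e < 0])).
  have mlt (f : E -> R) c : measurable_fun setT f -> measurable [set e | f e < c].
    move=> hf; rewrite -[Z in measurable Z]setTI (_ : [set e | _] = f @^-1` `]-oo, c[).
      by apply: hf => //; exact: measurable_itv.
    by apply/seteqP; split => e /=; rewrite in_itv.
  have mA := mlt _ u (measurable_funPT (Defs.mu net 0)); have mB := mlt _ 0 mX.
  rewrite /F -[Z in P0 Z]setIT -[Z in _ = fine (P0 Z)]setIT -!integral_indic//.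
  congr fine; apply: ae_eq_integral => //.
  - by apply/measurable_EFinP; exact: measurable_indic.
  - by apply/measurable_EFinP; exact: measurable_indic.
  (* The logarithm compares as its argument only on positive reals, hence the appeal to almost sure
     positivity of mu_0. *)
  apply: filterS (success_positive adm palm proto mf) => e mu0 _.
  rewrite !indicE; congr ((_ : bool)%:R%:E); apply/idP/idP.
    by rewrite !inE/= /X subr_lt0 ltr_ln.
  by rewrite !inE/= /X subr_lt0 ltr_ln.
rewrite inv /fixed_point_rhs; congr (_ - _); apply: eq_Rintegral => x _.
congr (_ / _).
transitivity (complex.Im (cint P0 (fun e => cis (X e * x)))) => //.
rewrite phase_transform (series_radial adm mf) /cpow cexpD mulrA; congr (complex.Im (_ * _)).
have -> : Complex 0 (- x) * Complex (ln u) 0 = Complex 0 (- (x * ln u)).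
  by apply: complexP; rewrite ?cReM ?cImM/=; ring.
have -> : - Complex 0 (x * noise_term N) = Complex 0 (- (x * noise_term N)).
  by apply: complexP; rewrite ?ReN ?ImN/= ?oppr0.
by rewrite -!cis_cexp -cisD /phase; congr cis; ring.
Qed.

End fixed_point.

Theorem theorem2 (R : realType) (N : params R)
    (de : measure_display) (E : measurableType de)
    (dw : measure_display) (W : measurableType dw)
    (P0 : probability E R) (Q : R.-pker E ~> W) (net : network R E W)
    (age0 : nat) :
  admissible N -> palm_model N P0 net -> protocol N Q net ->
  mean_field N P0 Q net ->
  [/\ average_age P0 Q net age0 =
        ((arrival N)^-1%:E
         + \int[law_mu P0 net]_(t in `[0%R, 1%R]) (access N * t)%:E^-1
         - 1)%E,
      (forall u : R, 0 < u ->
         F P0 net u = fixed_point_rhs N (law_mu P0 net) u) &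
      (* the approximation: replacing the density g of the success probability
         by f changes the average age by at most the resulting change of the
         integral in absolute value *)
      (forall f g : R -> R,
         (forall u, 0 < u < 1 -> f_seq N n u @[n --> \oo] --> f u) ->
         measurable_fun setT g -> (forall t, 0 <= g t) ->
         (forall A : set (measurableTypeR R), measurable A ->
            law_mu P0 net A =
            (\int[lebesgue_measure]_(t in A `&` `]0%R, 1%R[) (g t)%:E)%E) ->
         let approx :=
           ((arrival N)^-1%:E
            + \int[@lebesgue_measure R]_(t in `]0%R, 1%R[)
                (f t / (access N * t))%:E
            - 1)%E in
         let error :=
           (\int[@lebesgue_measure R]_(t in `]0%R, 1%R[)
              (`|g t - f t| / (access N * t))%:E)%E in
         (average_age P0 Q net age0 <= approx + error)%E /\
         (approx <= average_age P0 Q net age0 + error)%E)].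
Proof.
move=> adm palm proto mf; have age := average_age_formula age0 adm proto mf.
have p0 : 0 < access N by case: adm => _ _ _ /andP[].
split => //.
- by move=> u u0; exact: (success_distribution adm palm proto mf u0).
move=> f g ff mg g0 law.
move=> approx error; rewrite /approx /error age (integral_law_inv p0 mg g0 law).
have [h1 h2] := integral_approx_error p0 ff mg g0.
by split; rewrite [leRHS]addeAC leeD2r// -addeA leeD2l.
Qed.
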